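(* Let $M$ be a factor and let $\alpha$ and $\beta$ be cocycle conjugate $E_0$-semigroups on $M$. Suppose that $\alpha$ is modularly extendable. Then $\beta$ is modularly extendable, and moreover the modular extensions of $\alpha$ and $\beta$ are cocycle conjugate. Therefore, the type (EI, EII, EIII, or not modularly extendable) of an $E_0$-semigroup on $M$ is a cocycle conjugacy invariant.
   Context: All Hilbert spaces are separable, all von Neumann algebras have separable predual, and all endomorphisms are $*$-preserving. An $E_0$-semigroup on a von Neumann algebra $M$ is a family $\{\alpha_t\}_{t\ge0}$ of normal unital $*$-endomorphisms of $M$ with $\alpha_0=\mathrm{id}$, $\alpha_s\circ\alpha_t=\alpha_{s+t}$, and $t\mapsto\rho(\alpha_t(x))$ continuous for all $\rho\in M_*$, $x\in M$. An $\alpha$-cocycle is a strongly continuous family of unitaries $\{U_t\}_{t\ge0}$ in $M$ with $U_{s+t}=U_t\alpha_t(U_s)$ for all $s,t\ge0$. $\beta$ is conjugate to $\alpha$ if $\gamma\circ\beta_t\circ\gamma^{-1}=\alpha_t$ ($t\ge0$) for some automorphism $\gamma$ of $M$; $\beta$ is cocycle equivalent to $\alpha$ if $\beta_t(x)=U_t\alpha_t(x)U_t^*$ ($t\geq 0$, $x\in M$) for some $\alpha$-cocycle $U$; $\beta$ is cocycle conjugate to $\alpha$ if some $E_0$-semigroup $\beta'$ conjugate to $\beta$ is cocycle equivalent to $\alpha$. For a faithful normal semifinite weight $\phi$ on a factor $M$, let $\mathcal{H}_\phi$ be the GNS space and $J_\phi$ the modular conjugation; $M$ is identified with its image in $\mathcal{B}(\mathcal{H}_\phi)$.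 A normal unital endomorphism $\theta$ of $M$ is modularly extendable if, for some (equivalently, every) faithful normal semifinite weight $\phi$, there exists a normal endomorphism $\widetilde\theta_\phi$ of $\mathcal{B}(\mathcal{H}_\phi)$ with $\widetilde\theta_\phi(xy')=\theta(x)\,J_\phi\theta(J_\phi y'J_\phi)J_\phi$ for all $x\in M$, $y'\in M'$; then $\widetilde\theta_\phi$ is unique. An $E_0$-semigroup $\alpha$ on $M$ is modularly extendable if every $\alpha_t$ is; its modular extension (with respect to $\phi$) is the $E_0$-semigroup $\{(\widetilde{\alpha_t})_\phi\}_{t\ge0}$ on $\mathcal{B}(\mathcal{H}_\phi)$; for different weights these are conjugate. A unit of an $E_0$-semigroup $\sigma$ on $\mathcal{B}(\mathcal{H})$ is a strongly continuous semigroup $\{T_t\}_{t\ge0}$ of bounded operators with $T_0=I$ and $\sigma_t(x)T_t=T_tx$ for all $x\in\mathcal{B}(\mathcal{H})$. In the sense of Arveson and Powers, $\sigma$ has type I if it has units and for every $t>0$ the space $\{T:\sigma_t(x)T=Tx\ \forall x\in\mathcal{B}(\mathcal{H})\}$ is the closed linear span of products $T^{(1)}_{t_1}\cdots T^{(n)}_{t_n}$ with $T^{(i)}$ units and $t_1+\dots+t_n=t$; type II if it has units but is not of type I; type III if it has no units. A modularly extendable $E_0$-semigroup on a factor has type EI, EII or EIII if its modular extension has type I, II or III respectively; otherwise it is called not modularly extendable. *)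

(* Defs.v *)
From HB Require Import structures.
From mathcomp Require Import all_boot all_order all_algebra.
From mathcomp Require Import complex.
From mathcomp Require Import all_classical all_reals all_analysis.

Import Order.TTheory GRing.Theory Num.Theory.
Import numFieldNormedType.Exports.

Local Open Scope classical_set_scope.
Local Open Scope complex_scope.
Local Open Scope ring_scope.

(* Separable complex Hilbert spaces; [hdot] is linear in its first argument. *)
Record hilbert (R : realType) : Type := Hilbert {
  hcarrier :> completeNormedModType R[i];
  hdot : {dot hcarrier for (@Num.conj R[i])};
  hilbert_norm : forall u, `|u| ^+ 2 = hdot u u;
  hilbert_separable : exists2 D : set hcarrier, countable D & dense D
}.

Arguments hcarrier {R} h.
Arguments hdot {R} h.

Definition bounded_ops {R : realType} (H : hilbert R) : set (H -> H) :=
  [set T | linear T /\ continuous T].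

(* Every bounded operator has exactly one adjoint; the value of [adj] at other
   functions is irrelevant. *)
Definition adj {R : realType} {H : hilbert R} (T : H -> H) : H -> H :=
  xget T [set S | forall u v, hdot H (T u) v = hdot H u (S v)].

Definition positive_op {R : realType} {H : hilbert R} (T : H -> H) : Prop :=
  forall u, 0 <= hdot H (T u) u.

Definition op_le {R : realType} {H : hilbert R} (S T : H -> H) : Prop :=
  positive_op (T - S).

Definition unitary_op {R : realType} {H : hilbert R} (U : H -> H) : Prop :=
  [/\ bounded_ops H U, adj U \o U = idfun & U \o adj U = idfun].

Definition strongly_continuous {R : realType} {H : hilbert R}
    (T : R -> H -> H) : Prop :=
  forall u, {within `[0, +oo[, continuous (fun t => T t u)}.

Definition commutant {R : realType} {H : hilbert R} (A : set (H -> H)) :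
    set (H -> H) :=
  [set T | bounded_ops H T /\ forall x, A x -> T \o x = x \o T].

(* The predual is automatically separable, as H is; conversely every von
   Neumann algebra with separable predual acts on a separable space. *)
Definition von_neumann_algebra {R : realType} {H : hilbert R}
    (M : set (H -> H)) : Prop :=
  [/\ M `<=` bounded_ops H,
      forall x, M x -> M (adj x) &
      commutant (commutant M) = M].

Definition is_factor {R : realType} {H : hilbert R} (M : set (H -> H)) : Prop :=
  von_neumann_algebra M /\
  M `&` commutant M = [set T | exists c : R[i], T = c *: idfun].

(* The predual M_*: the sigma-weakly continuous functionals on M. *)
Definition predual {R : realType} {H : hilbert R} (M : set (H -> H)) :
    set ((H -> H) -> R[i]^o) :=
  [set rho | exists xi eta : nat -> H,
    [/\ cvgn (series (fun n => `|xi n| ^+ 2 : R[i]^o)),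
        cvgn (series (fun n => `|eta n| ^+ 2 : R[i]^o)) &
        forall x, M x ->
          series (fun n => hdot H (x (xi n)) (eta n) : R[i]^o) @ \oo
            --> rho x]].

(* Maps between operator algebras are total functions on all of [H -> H]; only
   their values on the algebra in question matter. *)

Definition star_hom {R : realType} {H K : hilbert R}
    (M : set (H -> H)) (N : set (K -> K)) (f : (H -> H) -> (K -> K)) : Prop :=
  [/\ forall x, M x -> N (f x),
      forall (c : R[i]) x y, M x -> M y -> f (c *: x + y) = c *: f x + f y,
      forall x y, M x -> M y -> f (x \o y) = f x \o f y &
      forall x, M x -> f (adj x) = adj (f x)].

Definition star_iso {R : realType} {H K : hilbert R}
    (M : set (H -> H)) (N : set (K -> K)) (f : (H -> H) -> (K -> K)) : Prop :=
  star_hom M N f /\ set_bij M N f.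

Definition normal_endomorphism {R : realType} {H : hilbert R}
    (M : set (H -> H)) (f : (H -> H) -> (H -> H)) : Prop :=
  star_hom M M f /\ forall rho, predual M rho -> predual M (rho \o f).

(* One-parameter families are indexed by R; only the parameters t >= 0 matter. *)

Definition E0_semigroup {R : realType} {H : hilbert R} (M : set (H -> H))
    (alpha : R -> (H -> H) -> (H -> H)) : Prop :=
  [/\ forall t, 0 <= t ->
        normal_endomorphism M (alpha t) /\ alpha t idfun = idfun,
      forall x, M x -> alpha 0 x = x,
      forall s t x, 0 <= s -> 0 <= t -> M x ->
        alpha s (alpha t x) = alpha (s + t) x &
      forall rho x, predual M rho -> M x ->
        {within `[0, +oo[, continuous (fun t => rho (alpha t x))}].

Definition cocycle {R : realType} {H : hilbert R} (M : set (H -> H))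
    (alpha : R -> (H -> H) -> (H -> H)) (U : R -> H -> H) : Prop :=
  [/\ forall t, 0 <= t -> M (U t) /\ unitary_op (U t),
      strongly_continuous U &
      forall s t, 0 <= s -> 0 <= t -> U (s + t) = U t \o alpha t (U s)].

Definition cocycle_equivalent {R : realType} {H : hilbert R}
    (M : set (H -> H)) (beta alpha : R -> (H -> H) -> (H -> H)) : Prop :=
  exists U, cocycle M alpha U /\
    forall t x, 0 <= t -> M x -> beta t x = U t \o alpha t x \o adj (U t).

(* The algebras are allowed to differ, so that modular extensions living on
   different GNS spaces can be compared. *)
Definition conjugate {R : realType} {H K : hilbert R}
    (N : set (K -> K)) (beta : R -> (K -> K) -> (K -> K))
    (M : set (H -> H)) (alpha : R -> (H -> H) -> (H -> H)) : Prop :=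
  exists gamma, star_iso N M gamma /\
    forall t x, 0 <= t -> N x -> gamma (beta t x) = alpha t (gamma x).

Definition cocycle_conjugate {R : realType} {H K : hilbert R}
    (N : set (K -> K)) (beta : R -> (K -> K) -> (K -> K))
    (M : set (H -> H)) (alpha : R -> (H -> H) -> (H -> H)) : Prop :=
  exists beta', [/\ E0_semigroup M beta', conjugate N beta M beta' &
                    cocycle_equivalent M beta' alpha].

Definition positive_cone {R : realType} {H : hilbert R} (M : set (H -> H)) :
    set (H -> H) :=
  [set x | M x /\ positive_op x].

(* [mule] satisfies 0 * +oo = 0, as is usual for weights. *)
Definition weight {R : realType} {H : hilbert R} (M : set (H -> H))
    (phi : (H -> H) -> \bar R) : Prop :=
  [/\ forall x, positive_cone M x -> (0 <= phi x)%E,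
      forall x y, positive_cone M x -> positive_cone M y ->
        phi (x + y) = (phi x + phi y)%E &
      forall (c : R) x, 0 <= c -> positive_cone M x ->
        phi (c%:C *: x) = (c%:E * phi x)%E].

Definition faithful_weight {R : realType} {H : hilbert R} (M : set (H -> H))
    (phi : (H -> H) -> \bar R) : Prop :=
  forall x, positive_cone M x -> phi x = 0%E -> x = 0.

Definition op_directed {R : realType} {H : hilbert R} (D : set (H -> H)) :
    Prop :=
  D !=set0 /\
  forall x y, D x -> D y -> exists z, [/\ D z, op_le x z & op_le y z].

Definition op_sup {R : realType} {H : hilbert R} (M D : set (H -> H))
    (x : H -> H) : Prop :=
  [/\ positive_cone M x, forall y, D y -> op_le y x &
      forall z, positive_cone M z -> (forall y, D y -> op_le y z) ->
        op_le x z].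

Definition normal_weight {R : realType} {H : hilbert R} (M : set (H -> H))
    (phi : (H -> H) -> \bar R) : Prop :=
  forall D x, D `<=` positive_cone M -> op_directed D -> op_sup M D x ->
    phi x = ereal_sup (phi @` D).

Definition weight_ideal {R : realType} {H : hilbert R} (M : set (H -> H))
    (phi : (H -> H) -> \bar R) : set (H -> H) :=
  [set x | M x /\ (phi (adj x \o x) < +oo)%E].

(* [{ptws H -> H}] induces the strong operator topology. *)
Definition semifinite_weight {R : realType} {H : hilbert R} (M : set (H -> H))
    (phi : (H -> H) -> \bar R) : Prop :=
  M `<=` closure (weight_ideal M phi : set {ptws H -> H}).

Definition fns_weight {R : realType} {H : hilbert R} (M : set (H -> H))
    (phi : (H -> H) -> \bar R) : Prop :=
  [/\ weight M phi, faithful_weight M phi, normal_weight M phi &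
      semifinite_weight M phi].

(* This determines (K, pi, Lambda) up to a unique unitary equivalence. The inner
   product <Lambda x, Lambda y> = phi (y^* x) is given by its quadratic form. *)
Definition gns_representation {R : realType} {H K : hilbert R}
    (M : set (H -> H)) (phi : (H -> H) -> \bar R)
    (pi : (H -> H) -> (K -> K)) (Lambda : (H -> H) -> K) : Prop :=
  let n_phi := weight_ideal M phi in
  [/\ star_hom M (bounded_ops K) pi,
      forall (c : R[i]) x y, n_phi x -> n_phi y ->
        Lambda (c *: x + y) = c *: Lambda x + Lambda y,
      forall x, n_phi x ->
        hdot K (Lambda x) (Lambda x) = (fine (phi (adj x \o x)))%:C,
      dense (Lambda @` n_phi) &
      forall x y, M x -> n_phi y -> pi x (Lambda y) = Lambda (x \o y)].

(* Unbounded operators are given by their graphs. As the domain is dense, the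
   adjoint relation is a graph, and equality with it forces A to be the graph
   of a (closed) linear operator. *)
Definition positive_selfadjoint {R : realType} {K : hilbert R}
    (A : set (K * K)) : Prop :=
  [/\ dense (fst @` A),
      A = [set p | forall q, A q -> hdot K q.2 p.1 = hdot K q.1 p.2] &
      forall p, A p -> 0 <= hdot K p.2 p.1].

Definition antiunitary {R : realType} {K : hilbert R} (J : K -> K) : Prop :=
  [/\ forall (c : R[i]) u v, J (c *: u + v) = Num.conj c *: J u + J v,
      forall u, `|J u| = `|u| &
      forall v, exists u, J u = v].

(* J is the antiunitary part of the polar decomposition S = J Delta^{1/2} of
   the closure S of Lambda x |-> Lambda x^*, x in n_phi and x^* in n_phi. *)
Definition modular_conjugation {R : realType} {H K : hilbert R}
    (M : set (H -> H)) (phi : (H -> H) -> \bar R) (Lambda : (H -> H) -> K)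
    (J : K -> K) : Prop :=
  let n_phi := weight_ideal M phi in
  let S := closure
    [set (Lambda x, Lambda (adj x)) | x in [set x | n_phi x /\ n_phi (adj x)]]
  in
  antiunitary J /\
  exists2 sqrtDelta : set (K * K), positive_selfadjoint sqrtDelta &
    S = [set (p.1, J p.2) | p in sqrtDelta].

Record gns {R : realType} {H : hilbert R} (M : set (H -> H))
    (phi : (H -> H) -> \bar R) : Type := Gns {
  gns_space : hilbert R;
  gns_pi : (H -> H) -> (gns_space -> gns_space);
  gns_Lambda : (H -> H) -> gns_space;
  gns_J : gns_space -> gns_space;
  gnsP : gns_representation M phi gns_pi gns_Lambda;
  gns_JP : modular_conjugation M phi gns_Lambda gns_J
}.

Arguments gns_space {R H M phi} g.
Arguments gns_pi {R H M phi} g.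
Arguments gns_Lambda {R H M phi} g.
Arguments gns_J {R H M phi} g.

(* [M] is identified with its image under [gns_pi G]; thus z below is the
   element J y' J of M. *)
Definition modular_extension {R : realType} {H : hilbert R}
    {M : set (H -> H)} {phi : (H -> H) -> \bar R} (G : gns M phi)
    (theta : (H -> H) -> (H -> H))
    (theta' : (gns_space G -> gns_space G) -> (gns_space G -> gns_space G)) :
    Prop :=
  let pi := gns_pi G in
  let J := gns_J G in
  normal_endomorphism (bounded_ops (gns_space G)) theta' /\
  forall x y' z, M x -> commutant (pi @` M) y' ->
    M z -> pi z = J \o y' \o J ->
    theta' (pi x \o y') = pi (theta x) \o (J \o pi (theta z) \o J).

(* By uniqueness of the standard form, "for some phi" here and in
   [modular_extension_has] is equivalent to "for every phi". *)
Definition modularly_extendable {R : realType} {H : hilbert R}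
    (M : set (H -> H)) (theta : (H -> H) -> (H -> H)) : Prop :=
  exists (phi : (H -> H) -> \bar R) (G : gns M phi),
    fns_weight M phi /\ exists theta', modular_extension G theta theta'.

Definition E0_modularly_extendable {R : realType} {H : hilbert R}
    (M : set (H -> H)) (alpha : R -> (H -> H) -> (H -> H)) : Prop :=
  forall t, 0 <= t -> modularly_extendable M (alpha t).

Definition E0_modular_extension {R : realType} {H : hilbert R}
    {M : set (H -> H)} {phi : (H -> H) -> \bar R} (G : gns M phi)
    (alpha : R -> (H -> H) -> (H -> H))
    (alpha' : R -> (gns_space G -> gns_space G) ->
              (gns_space G -> gns_space G)) : Prop :=
  forall t, 0 <= t -> modular_extension G (alpha t) (alpha' t).

Definition semigroup_unit {R : realType} {K : hilbert R}
    (sigma : R -> (K -> K) -> (K -> K)) (T : R -> K -> K) : Prop :=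
  [/\ forall t, 0 <= t -> bounded_ops K (T t),
      strongly_continuous T,
      T 0 = idfun,
      forall s t, 0 <= s -> 0 <= t -> T (s + t) = T s \o T t &
      forall t x, 0 <= t -> bounded_ops K x -> sigma t x \o T t = T t \o x].

Definition has_units {R : realType} {K : hilbert R}
    (sigma : R -> (K -> K) -> (K -> K)) : Prop :=
  exists T, semigroup_unit sigma T.

Definition intertwiners {R : realType} {K : hilbert R}
    (sigma : R -> (K -> K) -> (K -> K)) (t : R) : set (K -> K) :=
  [set T | bounded_ops K T /\
           forall x, bounded_ops K x -> sigma t x \o T = T \o x].

Definition unit_products {R : realType} {K : hilbert R}
    (sigma : R -> (K -> K) -> (K -> K)) (t : R) : set (K -> K) :=
  [set P | exists (n : nat) (T : 'I_n -> R -> K -> K) (s : 'I_n -> R),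
    [/\ forall i, semigroup_unit sigma (T i),
        forall i, 0 <= s i,
        \sum_(i < n) s i = t &
        P = \big[(fun f g => f \o g)/idfun]_(i < n) T i (s i)]].

Definition linear_span {R : realType} {K : hilbert R} (A : set (K -> K)) :
    set (K -> K) :=
  [set T | exists (n : nat) (c : 'I_n -> R[i]) (S : 'I_n -> K -> K),
    (forall i, A (S i)) /\ T = \sum_(i < n) c i *: S i].

Definition norm_closure {R : realType} {K : hilbert R} (A : set (K -> K)) :
    set (K -> K) :=
  [set T | bounded_ops K T /\ forall e : R, 0 < e ->
    exists2 S, A S & forall u, `|T u - S u| <= e%:C * `|u|].

Definition type_I {R : realType} {K : hilbert R}
    (sigma : R -> (K -> K) -> (K -> K)) : Prop :=
  has_units sigma /\
  forall t, 0 < t ->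
    intertwiners sigma t = norm_closure (linear_span (unit_products sigma t)).

Definition type_II {R : realType} {K : hilbert R}
    (sigma : R -> (K -> K) -> (K -> K)) : Prop :=
  has_units sigma /\ ~ type_I sigma.

Definition type_III {R : realType} {K : hilbert R}
    (sigma : R -> (K -> K) -> (K -> K)) : Prop :=
  ~ has_units sigma.

Inductive E0_type : Set := EI | EII | EIII | NotModularlyExtendable.

Definition modular_extension_has {R : realType} {H : hilbert R}
    (M : set (H -> H)) (alpha : R -> (H -> H) -> (H -> H))
    (P : forall K : hilbert R, (R -> (K -> K) -> (K -> K)) -> Prop) : Prop :=
  exists (phi : (H -> H) -> \bar R) (G : gns M phi) alpha',
    [/\ fns_weight M phi, E0_modular_extension G alpha alpha' & P _ alpha'].

Definition has_type {R : realType} {H : hilbert R} (M : set (H -> H))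
    (alpha : R -> (H -> H) -> (H -> H)) (tau : E0_type) : Prop :=
  match tau with
  | EI => modular_extension_has M alpha (@type_I R)
  | EII => modular_extension_has M alpha (@type_II R)
  | EIII => modular_extension_has M alpha (@type_III R)
  | NotModularlyExtendable => ~ E0_modularly_extendable M alpha
  end.

(* Main.v *)
Require Import Defs.
From HB Require Import structures.
From mathcomp Require Import all_boot all_order all_algebra.
From mathcomp Require Import complex.
From mathcomp Require Import all_classical all_reals all_analysis.
From mathcomp Require Import ring lra.
Set Implicit Arguments.
Unset Strict Implicit.
Unset Printing Implicit Defensive.
Import Order.TTheory GRing.Theory Num.Theory.
Import numFieldNormedType.Exports.
Local Open Scope classical_set_scope.
Local Open Scope ring_scope.

(** The standard form of [M] is unique: for faithful normal semifinite weights [phi]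
  and [psi] a unitary intertwines both the GNS representations and the modular
  conjugations. This is Tomita's commutation theorem for the weight [phi + psi] on the
  2 x 2 matrices over [M], applied to a matrix unit. Hence a modular extension on one
  GNS space is carried to every other one.
  If [beta_t = Ad U_t o alpha_t], then [W_t = pi(U_t) J pi(U_t) J] is a cocycle for the
  modular extension [alpha'] and [Ad W_t o alpha'_t] is the modular extension of
  [beta]. If [gamma] conjugates [beta] to [alpha], then [alpha'] itself is the modular
  extension of [beta] with respect to [phi o gamma]. As [M] is a factor, [M] and
  [J M J] generate an irreducible algebra; a normal representation of all bounded
  operators is determined by its values there, so that [alpha'] is a semigroup, and it
  is continuous by a Baire category argument. Finally [T_t |-> W_t T_t] matches the
  units and intertwiners of cocycle equivalent E_0-semigroups, so the type is
  invariant. *)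

(** * Real Hilbert spaces *)

(** The obstacle is Tomita's theorem, whose usual proofs rest on the modular flow and on the
    functional calculus of an unbounded operator. Here the closure S of the involution enters only
    through the contraction g = (1 + |S|)^-1 and a real-linear isometry J, and of the flow only its
    value D : Y |-> |S| Y |S|^-1 at one imaginary time is used. D is unbounded too, but it is the
    quotient of the commuting contractions Y |-> (1 - g) Y g and Y |-> g Y (1 - g), so identities in
    D are stated without denominators. The classical resolvent estimate puts D / (D^2 + r) applied
    to J Q^# J in the left algebra, for Q in the right one. Averaging over Chebyshev nodes, with
    bounds uniform in the node, yields elements V = D / (1 + D) X of the left algebra. Then J V J is
    right multiplication by a vector, and there are enough such V to carry commutants across.
    Operator identities are tested on narrow spectral windows of g, which replaces the spectral
    theorem. *)

(** Complex Hilbert spaces are handled through their underlying real Hilbert spaces,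
  with multiplication by the imaginary unit as a bounded operator: this makes the
  conjugate-linear modular conjugations ordinary bounded operators. *)
Record rhilb (R : realType) := RHilb {
 rsort :> lmodType R;
 ip : rsort -> rsort -> R;
 ipC : forall u v, ip u v = ip v u;
 ipDl : forall u v w, ip (u + v) w = ip u w + ip v w;
 ipZl : forall c u v, ip (c *: u) v = c * ip u v;
 ip_ge0 : forall u, 0 <= ip u u;
 ip_eq0 : forall u, ip u u = 0 -> u = 0;
 ip_complete : forall x : nat -> rsort,
  (forall e : R, 0 < e -> exists N : nat, forall m n, (N <= m)%N -> (N <= n)%N ->
    ip (x m - x n) (x m - x n) < e) ->
  exists l, forall e : R, 0 < e -> exists N : nat, forall n, (N <= n)%N ->
    ip (x n - l) (x n - l) < e
}.

Section Ip.
Context {R : realType} {U : rhilb R}.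
Implicit Types u v w : U.

Lemma ipDr u v w : ip u (v + w) = ip u v + ip u w.
Proof. by rewrite ipC ipDl !(ipC _ u). Qed.
Lemma ipZr c u v : ip u (c *: v) = c * ip u v.
Proof. by rewrite ipC ipZl ipC. Qed.
Lemma ipNl u v : ip (- u) v = - ip u v.
Proof. by rewrite -scaleN1r ipZl mulN1r. Qed.
Lemma ipNr u v : ip u (- v) = - ip u v.
Proof. by rewrite ipC ipNl ipC. Qed.
Lemma ip0l v : ip 0 v = 0.
Proof. by rewrite -(scale0r 0) ipZl mul0r. Qed.
Lemma ip0r v : ip v 0 = 0.
Proof. by rewrite ipC ip0l. Qed.

Definition ipE := (ipDl, ipDr, ipNl, ipNr, ipZl, ipZr, ip0l, ip0r).

Lemma ip_inj u v : (forall w, ip u w = ip v w) -> u = v.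
Proof.
move=> h; apply/subr0_eq/ip_eq0.
by rewrite ipDl ipNl h subrr.
Qed.

Lemma ip_suml (I : Type) (r : seq I) (P : pred I) (F : I -> U) v :
 ip (\sum_(i <- r | P i) F i) v = \sum_(i <- r | P i) ip (F i) v.
Proof.
by elim/big_rec2: _ => [|i y x _ <-]; rewrite ?ip0l ?ipDl.
Qed.

Lemma CS2 u v : ip u v ^+ 2 <= ip u u * ip v v.
Proof.
have [v0|v0] := eqVneq (ip v v) 0.
 by rewrite (ip_eq0 v0) !ipE mulr0 expr0n.
have vp : 0 < ip v v by rewrite lt_neqAle eq_sym v0 ip_ge0.
have := ip_ge0 (ip v v *: u - ip u v *: v).
rewrite !ipE (ipC v u) => h.
have : 0 <= ip v v * (ip u u * ip v v - ip u v ^+ 2) by apply: le_trans h _; lra.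
by rewrite pmulr_rge0// subr_ge0.
Qed.

Definition nrm u : R := Num.sqrt (ip u u).
Lemma nrm_ge0 u : 0 <= nrm u. Proof. exact: sqrtr_ge0. Qed.
Lemma nrm2 u : nrm u ^+ 2 = ip u u. Proof. by rewrite sqr_sqrtr ?ip_ge0. Qed.
Lemma nrm0 : nrm 0 = 0. Proof. by rewrite /nrm ip0l sqrtr0. Qed.
Lemma nrm_eq0 u : nrm u = 0 -> u = 0.
Proof. by move=> h; apply: ip_eq0; rewrite -nrm2 h expr0n. Qed.
Lemma nrmN u : nrm (- u) = nrm u. Proof. by rewrite /nrm !ipE opprK. Qed.
Lemma nrmZ c u : nrm (c *: u) = `|c| * nrm u.
Proof.
by rewrite /nrm !ipE mulrA -expr2 sqrtrM ?sqr_ge0// sqrtr_sqr.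
Qed.
Lemma nrmB u v : nrm (u - v) = nrm (v - u).
Proof. by rewrite -nrmN opprB. Qed.

Lemma sq_le (a b : R) : 0 <= b -> a ^+ 2 <= b ^+ 2 -> a <= b.
Proof.
move=> b0 h; have [//|ab] := leP a b.
have a0 : 0 < a by apply: le_lt_trans ab.
suff : b ^+ 2 < a ^+ 2 by lra.
by rewrite ltr_pXn2r ?nnegrE// ltW.
Qed.

Lemma CS u v : ip u v <= nrm u * nrm v.
Proof.
apply: sq_le; first by rewrite mulr_ge0 ?nrm_ge0.
by rewrite exprMn !nrm2 CS2.
Qed.
Lemma CSabs u v : `|ip u v| <= nrm u * nrm v.
Proof.
rewrite ler_norml CS andbT lerNl -ipNl.
by apply: le_trans (CS _ _) _; rewrite nrmN.
Qed.
Lemma nrmD u v : nrm (u + v) <= nrm u + nrm v.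
Proof.
apply: sq_le; first by rewrite addr_ge0 ?nrm_ge0.
rewrite nrm2 !ipE (ipC v u) sqrrD !nrm2; have := CS u v; lra.
Qed.
Lemma nrm_distD u v w : nrm (u - v) <= nrm (u - w) + nrm (w - v).
Proof. by apply: le_trans (nrmD _ _); rewrite addrA subrK. Qed.

Lemma nrm_le_ip u (C : R) : 0 <= C -> (forall v, ip u v <= C * nrm v) -> nrm u <= C.
Proof.
move=> C0 h; have := h u; rewrite -nrm2 expr2.
have [->|u0] := eqVneq (nrm u) 0; first by [].
by rewrite ler_pM2r// lt_neqAle eq_sym u0 nrm_ge0.
Qed.

Lemma parallelogram u v :
 nrm (u + v) ^+ 2 + nrm (u - v) ^+ 2 = 2 * nrm u ^+ 2 + 2 * nrm v ^+ 2.
Proof. by rewrite !nrm2 !ipE; ring. Qed.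

Definition conv (x : nat -> U) (l : U) := forall e : R, 0 < e ->
 exists N : nat, forall n, (N <= n)%N -> nrm (x n - l) < e.
Definition cau (x : nat -> U) := forall e : R, 0 < e ->
 exists N : nat, forall m n, (N <= m)%N -> (N <= n)%N -> nrm (x m - x n) < e.

Lemma nrm_lt u e : 0 < e -> (nrm u < e) = (ip u u < e ^+ 2).
Proof.
move=> e0; rewrite -nrm2 ltr_pXn2r ?nnegrE ?nrm_ge0//; exact: ltW.
Qed.

Lemma cau_conv x : cau x -> exists l, conv x l.
Proof.
move=> h; have [|l hl] := @ip_complete R U x.
 move=> e e0; have [|N hN] := h (Num.sqrt e); first by rewrite sqrtr_gt0.
 exists N => m n hm hn; have := hN m n hm hn.
 by rewrite nrm_lt ?sqrtr_gt0// sqr_sqrtr// ltW.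
exists l => e e0; have [|N hN] := hl (e ^+ 2); first by rewrite exprn_gt0.
by exists N => n hn; rewrite nrm_lt// hN.
Qed.

Lemma eps_le (a b : R) : (forall e : R, 0 < e -> a <= b + e) -> a <= b.
Proof. by move=> h; apply/ler_addgt0Pr => e e0; exact: h. Qed.
Lemma eps_eq0 (C : R) u : (forall e : R, 0 < e -> nrm u <= C * e) -> u = 0.
Proof.
move=> h; apply: nrm_eq0; apply/eqP; rewrite eq_le nrm_ge0 andbT.
apply: eps_le => e e0; rewrite add0r.
have C1 : 0 < `|C| + 1 by rewrite ltr_wpDl.
have := h (e / (`|C| + 1)); rewrite divr_gt0// => /(_ isT) /le_trans; apply.
rewrite mulrCA ler_piMr ?(ltW e0)// ler_pdivrMr// mul1r.
by apply: le_trans (ler_norm _) _; rewrite lerDl.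
Qed.

Lemma conv_uniq x k l : conv x k -> conv x l -> k = l.
Proof.
move=> hk hl; apply: subr0_eq.
apply: (@eps_eq0 2) => e e0.
have [N1 h1] := hk e e0; have [N2 h2] := hl e e0.
have := h1 (maxn N1 N2) (leq_maxl _ _); have := h2 (maxn N1 N2) (leq_maxr _ _).
have := nrm_distD k l (x (maxn N1 N2)); rewrite (nrmB k (x _)); lra.
Qed.

Lemma conv_cst u : conv (fun=> u) u.
Proof. by move=> e e0; exists 0%N => n _; rewrite subrr nrm0. Qed.

Lemma convD x y k l : conv x k -> conv y l -> conv (fun n => x n + y n) (k + l).
Proof.
move=> hx hy e e0; have e2 : 0 < e / 2 by rewrite divr_gt0.
have [N1 h1] := hx _ e2; have [N2 h2] := hy _ e2.
exists (maxn N1 N2) => n; rewrite geq_max => /andP[/h1 + /h2].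
have := nrmD (x n - k) (y n - l); rewrite addrACA -opprD; lra.
Qed.

Lemma conv_le x l (C : R) (b : nat -> R) :
 0 <= C -> (forall n, nrm (x n - l) <= C * b n) ->
 (forall e : R, 0 < e -> exists N : nat, forall n, (N <= n)%N -> b n < e) -> conv x l.
Proof.
move=> C0 h hb e e0; have C1 : 0 < C + 1 by lra.
have [|N hN] := hb (e / (C + 1)); first by rewrite divr_gt0.
exists N => n /hN h1; apply: le_lt_trans (h n) _.
apply: le_lt_trans (_ : C * (e / (C + 1)) < _).
 by rewrite ler_wpM2l// ltW.
by rewrite mulrCA gtr_pMr// ltr_pdivrMr// mul1r; lra.
Qed.

Lemma conv_ip x l v e : conv x l -> 0 < e -> exists N : nat, forall n, (N <= n)%N ->
 `|ip (x n) v - ip l v| < e.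
Proof.
move=> h e0; have v1 : 0 < nrm v + 1 by rewrite ltr_wpDl ?nrm_ge0.
have [|N hN] := h (e / (nrm v + 1)); first by rewrite divr_gt0.
exists N => n /hN h1; rewrite -ipNl -ipDl.
apply: le_lt_trans (CSabs _ _) _.
apply: le_lt_trans (_ : (e / (nrm v + 1)) * nrm v < _).
 by rewrite ler_wpM2r ?nrm_ge0// ltW.
by rewrite mulrAC -mulrA gtr_pMr// ltr_pdivrMr// mul1r ltrDl.
Qed.

Lemma conv_nrm_le x l C : conv x l -> (forall n, nrm (x n) <= C) -> nrm l <= C.
Proof.
move=> h hx; apply: eps_le => e e0; have [N hN] := h e e0.
have := hN N (leqnn _); have := hx N; have := nrmD (x N) (l - x N).
rewrite addrC subrK (nrmB l); lra.
Qed.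

Lemma conv_ip_le x l v C : conv x l -> (forall n, ip (x n) v <= C) -> ip l v <= C.
Proof.
move=> h hx; apply: eps_le => e e0; have [N hN] := conv_ip v h e0.
by have := hN N (leqnn _); have := hx N; rewrite ltr_norml; lra.
Qed.

Lemma conv_ip_eq x l v C : conv x l -> (forall n, ip (x n) v = C) -> ip l v = C.
Proof.
move=> h hx; apply/eqP; rewrite eq_le (conv_ip_le h) => [|n]; last by rewrite hx.
rewrite -lerN2 -ipNr; apply: (conv_ip_le h) => n; by rewrite ipNr hx.
Qed.

Definition dns (A : set U) := forall u e, 0 < e -> exists2 a, A a & nrm (u - a) < e.

Lemma dns_orth (A : set U) u : dns A -> (forall a, A a -> ip u a = 0) -> u = 0.
Proof.
move=> hA h; apply: (@eps_eq0 1) => e e0; rewrite mul1r.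
have [a Aa ha] := hA u e e0.
have := CS u (u - a); rewrite ipDr ipNr (h _ Aa) subr0 -nrm2 expr2.
have [->|u0] := eqVneq (nrm u) 0; first by move=> _; exact: ltW.
rewrite ler_pM2l ?lt_neqAle 1?eq_sym ?u0 ?nrm_ge0//; lra.
Qed.

End Ip.

Ltac vring := apply: ip_inj => ?; rewrite !ipE; ring.

(** * Orthogonal projections and the Riesz representation *)

Section Proj.
Context {R : realType} {U : rhilb R}.

Definition subsp (A : set U) :=
 A 0 /\ forall c u v, A u -> A v -> A (c *: u + v).
Definition sclosed (A : set U) := forall x l, (forall n, A (x n)) -> conv x l -> A l.
Definition scl (A : set U) : set U := [set u | forall e : R, 0 < e -> exists2 a, A a & nrm (u - a) < e].

Lemma inv_small (e : R) : 0 < e -> exists N : nat, forall n, (N <= n)%N -> n.+1%:R^-1 < e.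
Proof.
move=> e0; exists (Num.trunc e^-1) => n hn.
rewrite invf_plt ?posrE//.
apply: lt_le_trans (Num.Theory.truncnS_gt _) _.
by rewrite ler_nat ltnS.
Qed.

Lemma scl_seq (A : set U) u : scl A u -> exists2 x, (forall n, A (x n)) & conv x u.
Proof.
move=> h.
have hn (n : nat) : 0 < n.+1%:R^-1 :> R by [].
have hc n : {a | A a /\ nrm (u - a) < n.+1%:R^-1}.
 by apply: cid; have [a] := h _ (hn n); exists a.
exists (fun n => sval (hc n)) => [n|]; first by case: (svalP (hc n)).
move=> e e0; have [N hN] := inv_small e0; exists N => n /hN; apply: lt_trans.
by rewrite nrmB; case: (svalP (hc n)).
Qed.

Lemma sub_scl (A : set U) u : A u -> scl A u.
Proof. by move=> h e e0; exists u => //; rewrite subrr nrm0. Qed.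

Lemma scl_closed (A : set U) : sclosed (scl A).
Proof.
move=> x l hx hl e e0; have e2 : 0 < e / 2 by rewrite divr_gt0.
have [N hN] := hl _ e2; have := hN N (leqnn _); have [a Aa ha] := hx N _ e2.
move=> h1; exists a => //; move: ha; have := nrm_distD l a (x N); rewrite (nrmB l (x _)); lra.
Qed.

Lemma scl_subsp (A : set U) : subsp A -> subsp (scl A).
Proof.
move=> [A0 Al]; split; first exact: sub_scl.
move=> c u v hu hv e e0; have c1 : 0 < `|c| + 1 by rewrite ltr_wpDl.
have [a Aa ha] := hu (e / 2 / (`|c| + 1)) ltac:(by rewrite !divr_gt0).
have [b Ab hb] := hv (e / 2) ltac:(by rewrite divr_gt0).
exists (c *: a + b); first exact: Al.
rewrite (_ : _ - _ = c *: (u - a) + (v - b)); last by vring.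
apply: le_lt_trans (nrmD _ _) _; rewrite nrmZ.
have : `|c| * nrm (u - a) <= e / 2; last by lra.
apply: le_trans (_ : `|c| * (e / 2 / (`|c| + 1)) <= _).
 by rewrite ler_wpM2l// ltW.
rewrite mulrCA ler_piMr ?ler_pdivrMr ?mul1r ?lerDl//; lra.
Qed.

Lemma subspD (A : set U) u v : subsp A -> A u -> A v -> A (u + v).
Proof. by case=> _ h hu hv; rewrite -[u]scale1r; exact: h. Qed.
Lemma subspZ (A : set U) c u : subsp A -> A u -> A (c *: u).
Proof. by case=> h0 h hu; rewrite -[_ *: _]addr0; exact: h. Qed.
Lemma subspB (A : set U) u v : subsp A -> A u -> A v -> A (u - v).
Proof. by move=> hA hu hv; rewrite -scaleN1r; apply: subspD => //; exact: subspZ. Qed.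

(** A minimising sequence is Cauchy by the parallelogram law. Its limit [a] leaves a residue
    orthogonal to A because t |-> |u - a - t b|^2 is minimal at t = 0. *)
Lemma projection (A : set U) u : subsp A -> sclosed A ->
 exists2 a, A a & forall b, A b -> ip (u - a) b = 0.
Proof.
move=> sA cA; have A0 := sA.1.
pose D : set R := [set nrm (u - a) ^+ 2 | a in A].
have D0 : D !=set0 by exists (nrm (u - 0) ^+ 2), 0.
have Dlb : has_lbound D by exists 0 => _ [a _ <-]; rewrite exprn_ge0 ?nrm_ge0.
pose d := inf D.
have hd a : A a -> d <= nrm (u - a) ^+ 2.
 by move=> Aa; apply: ge_inf => //; exists a.
have hc (n : nat) : {a | A a /\ nrm (u - a) ^+ 2 < d + n.+1%:R^-1}.
 apply: cid; have [|_ [a Aa <-] ha] := @inf_adherent _ D n.+1%:R^-1 _ (conj D0 Dlb).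
  by [].
 by exists a.
pose x n := sval (hc n).
have Ax n : A (x n) by case: (svalP (hc n)).
have hx n : nrm (u - x n) ^+ 2 < d + n.+1%:R^-1 by case: (svalP (hc n)).
clearbody x d.
have par m n : nrm (x m - x n) ^+ 2 <= 2 * m.+1%:R^-1 + 2 * n.+1%:R^-1.
 have := parallelogram (u - x m) (u - x n).
 have -> : u - x m - (u - x n) = x n - x m by vring.
 have -> : u - x m + (u - x n) = 2 *: (u - 2^-1 *: (x m + x n)).
  by apply: ip_inj => w; rewrite !ipE; field.
 rewrite (nrmB (x n)) nrmZ exprMn.
 have := hd (2^-1 *: (x m + x n)) (subspZ _ sA (subspD sA (Ax m) (Ax n))).
 have := hx m; have := hx n; rewrite normr_nat; move: (m.+1%:R^-1) (n.+1%:R^-1) => i j.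
 move: (nrm (u - x n) ^+ 2) (nrm (u - x m) ^+ 2) (nrm _ ^+ 2) (nrm (x m - x n) ^+ 2) => w1 w2 w3 w4.
 move: (d) => d' *; lra.
have [|a ha] := @cau_conv R U x.
 move=> e e0; have [|N hN] := @inv_small (e ^+ 2 / 4).
  by rewrite divr_gt0 ?exprn_gt0.
 exists N => m n /hN h1 /hN h2.
 rewrite nrm_lt// -nrm2; move: (par m n) h1 h2.
 move: (m.+1%:R^-1) (n.+1%:R^-1) => i j *; lra.
have Aa : A a by apply: cA ha.
exists a => // b Ab.
have d0 : 0 <= d + 0.
 apply: eps_le => e e0; have [N hN] := inv_small e0.
 move: (hx N) (hN N (leqnn _)) (exprn_ge0 2 (nrm_ge0 (u - x N))).
 by move: (N.+1%:R^-1) => i; lra.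
have da : nrm (u - a) ^+ 2 <= d.
 apply: eps_le => e e0.
 suff : nrm (u - a) <= Num.sqrt (d + e).
  rewrite -(@ler_pXn2r _ 2)// ?nnegrE ?nrm_ge0 ?sqrtr_ge0// => /le_trans; apply.
  by rewrite sqr_sqrtr//; lra.
 have [N hN] := inv_small e0.
 apply: (@conv_nrm_le _ _ (fun n => u - x (N + n)%N)) => [e' e0'|n].
  have [N' hN'] := ha e' e0'; exists N' => n hn.
  rewrite (_ : u - x (N + n)%N - (u - a) = a - x (N + n)%N); last by vring.
  by rewrite nrmB; apply: hN'; rewrite (leq_trans hn) ?leq_addl.
 rewrite -[nrm _]ger0_norm ?nrm_ge0// -sqrtr_sqr ler_wsqrtr//.
 move: (hx (N + n)%N) (hN (N + n)%N (leq_addr _ _)).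
 move: ((N + n).+1%:R^-1) => i *; lra.
have key t : 0 <= - (2 * t * ip (u - a) b) + t ^+ 2 * ip b b.
 have := hd (t *: b + a) (sA.2 _ _ _ Ab Aa).
 rewrite (_ : u - _ = (u - a) - t *: b); last by vring.
 have : nrm (u - a) ^+ 2 <= d by [].
 rewrite !nrm2 !ipE (ipC b u) (ipC b a) => h1 h2; have := le_trans h1 h2.
 rewrite !(ipC a u) => h3; lra.
(* The test value t = p / (|b|^2 + 1) makes the quadratic negative unless p = 0; the + 1 keeps the
   denominator positive for every b. *)
set p := ip (u - a) b; have [//|p0] := eqVneq p 0.
have b1 : 0 < ip b b + 1 by rewrite ltr_wpDl ?ip_ge0.
have := key (p / (ip b b + 1)); rewrite -/p.
set q := (ip b b + 1)^-1; have q0 : 0 < q by rewrite invr_gt0.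
have qb : q * ip b b = 1 - q.
 by rewrite /q; apply: (mulfI (lt0r_neq0 b1)); field; exact: lt0r_neq0.
have -> : - (2 * (p * q) * p) + (p * q) ^+ 2 * ip b b =
  - (p ^+ 2 * q * (1 + q)).
 by rewrite exprMn (expr2 q) -!mulrA qb; ring.
rewrite oppr_ge0 leNgt; case/negP.
by rewrite mulr_gt0 ?addr_gt0// mulr_gt0// exprn_even_gt0.
Qed.

Lemma riesz (f : U -> R) (C : R) : (forall c u v, f (c *: u + v) = c * f u + f v) ->
 (forall u, `|f u| <= C * nrm u) -> exists w, forall u, f u = ip u w.
Proof.
move=> lin bd.
have f0 : f 0 = 0.
 apply/eqP; have := bd 0; rewrite nrm0 mulr0 normr_le0; exact.
have fZ c u : f (c *: u) = c * f u by rewrite -[c *: u]addr0 lin f0 addr0.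
have fD u v : f (u + v) = f u + f v by rewrite -[u]scale1r lin mul1r scale1r.
have fN u : f (- u) = - f u by rewrite -scaleN1r fZ mulN1r.
pose A : set U := [set u | f u = 0].
have sA : subsp A by split=> //= c u v hu hv; rewrite /A/= lin hu hv mulr0 addr0.
have cA : sclosed A.
 move=> x l hx hl; have : 1 *: f l = 0 :> R.
  apply/eqP; rewrite scale1r -normr_eq0 eq_le normr_ge0 andbT.
  apply: eps_le => e e0; rewrite add0r.
  have C1 : 0 < `|C| + 1 by rewrite ltr_wpDl.
  have [N hN] := hl (e / (`|C| + 1)) ltac:(by rewrite divr_gt0).
  have := hN N (leqnn _) => h1.
  have -> : f l = f (l - x N) by rewrite fD fN (hx N) subr0.
  apply: le_trans (bd _) _; rewrite nrmB.
  apply: le_trans (_ : (`|C| + 1) * nrm (x N - l) <= _).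
   rewrite ler_wpM2r ?nrm_ge0//.
   by apply: le_trans (ler_norm _) _; rewrite lerDl.
  by rewrite mulrC -ler_pdivlMr// ltW.
 by rewrite scale1r.
have [all0|/existsNP[u0 hu0]] := pselect (forall u, f u = 0).
 by exists 0 => u; rewrite all0 ip0r.
have [a Aa ha] := projection u0 sA cA.
have [z [{}ha fz z0]] : exists z,
  [/\ forall b, A b -> ip z b = 0, f z = f u0 & ip z z != 0].
 have fz : f (u0 - a) = f u0 by rewrite fD fN Aa subr0.
 exists (u0 - a); split=> //.
 apply: contra_notN hu0 => /eqP/ip_eq0 z0; rewrite -fz z0; exact: f0.
exists ((f z / ip z z) *: z) => u; rewrite ipZr.
have : ip z (u - (f u / f z) *: z) = 0.
 apply: ha; rewrite /A/= fD fN fZ divfK ?subrr//.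
 by rewrite fz; exact/eqP.
rewrite !ipE (ipC z u) => /subr0_eq ->.
by field; rewrite z0 fz andbT; apply/eqP.
Qed.

End Proj.

(** * Bounded operators *)

Section Bop.
Context {R : realType}.

Record bop (U V : rhilb R) := Bop {
 bfun :> U -> V;
 bop_lin : forall c u v, bfun (c *: u + v) = c *: bfun u + bfun v;
 bop_bd : exists2 C : R, 0 <= C & forall u, nrm (bfun u) <= C * nrm u
}.

Lemma bopP (U V : rhilb R) (f g : bop U V) : (forall u, f u = g u) -> f = g.
Proof.
case: f g => f lf bf [g lg bg] /= /funext fg; subst g.
by congr Bop; exact: Prop_irrelevance.
Qed.

Lemma bop_at (U V : rhilb R) (u : U) (f g : bop U V) : f = g -> f u = g u.
Proof. by move=> ->. Qed.

HB.instance Definition _ (U V : rhilb R) := gen_eqMixin (bop U V).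
HB.instance Definition _ (U V : rhilb R) := gen_choiceMixin (bop U V).

Section Lin.
Context {U V : rhilb R} (f : bop U V).
Lemma bD u v : f (u + v) = f u + f v.
Proof. by have := bop_lin f 1 u v; rewrite !scale1r. Qed.
Lemma b0 : f 0 = 0.
Proof. by apply: (@addrI _ (f 0)); rewrite -bD !addr0. Qed.
Lemma bZ c u : f (c *: u) = c *: f u.
Proof. by rewrite -[c *: u]addr0 bop_lin b0 addr0. Qed.
Lemma bN u : f (- u) = - f u.
Proof. by rewrite -scaleN1r bZ scaleN1r. Qed.
Lemma bB u v : f (u - v) = f u - f v.
Proof. by rewrite bD bN. Qed.
Lemma bsum (I : Type) (r : seq I) (P : pred I) (F : I -> U) :
 f (\sum_(i <- r | P i) F i) = \sum_(i <- r | P i) f (F i).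
Proof. by elim/big_rec2: _ => [|i y x _ <-]; rewrite ?b0 ?bD. Qed.
End Lin.

Definition bnd (U V : rhilb R) (f : U -> V) (C : R) :=
 0 <= C /\ forall u, nrm (f u) <= C * nrm u.
Lemma bop_bnd (U V : rhilb R) (f : bop U V) : exists C, bnd f C.
Proof. by have [C C0 h] := bop_bd f; exists C. Qed.

Lemma bop_conv (U V : rhilb R) (f : bop U V) x l :
 conv x l -> conv (fun n => f (x n)) (f l).
Proof.
move=> h; have [C [C0 hC]] := bop_bnd f.
apply: (@conv_le _ _ _ _ C (fun n => nrm (x n - l))) => // n.
by rewrite -bB.
Qed.

Lemma bop_eq_dns (U V : rhilb R) (f g : bop U V) (A : set U) :
 dns A -> (forall a, A a -> f a = g a) -> f = g.
Proof.
move=> hA h; apply: bopP => u; apply: subr0_eq.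
have [C [C0 hC]] := bop_bnd f; have [D [D0 hD]] := bop_bnd g.
apply: (@eps_eq0 _ _ (C + D)) => e e0; have [a Aa ha] := hA u e e0.
rewrite (_ : f u - g u = f (u - a) - g (u - a)); last first.
 by rewrite !bB (h _ Aa); vring.
apply: le_trans (nrmD _ _) _; rewrite nrmN.
have := hC (u - a); have := hD (u - a).
have : C * nrm (u - a) <= C * e by rewrite ler_wpM2l// ltW.
have : D * nrm (u - a) <= D * e by rewrite ler_wpM2l// ltW.
lra.
Qed.

Section Ops.
Context {U V : rhilb R}.

(* Opaque witnesses keep simplification from unfolding sums of operators. *)
Fact badd_ex (f g : bop U V) : {h : bop U V | forall u, h u = f u + g u}.
Proof.
have l c u v : f (c *: u + v) + g (c *: u + v) = c *: (f u + g u) + (f v + g v).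
 by rewrite !bop_lin; vring.
apply: cid; have [C [C0 hC]] := bop_bnd f; have [D [D0 hD]] := bop_bnd g.
have b : exists2 E : R, 0 <= E & forall u, nrm (f u + g u) <= E * nrm u.
 exists (C + D) => [|u]; first exact: addr_ge0.
 by apply: le_trans (nrmD _ _) _; rewrite mulrDl lerD.
by exists (Bop l b).
Qed.
Fact bscale_ex c (f : bop U V) : {h : bop U V | forall u, h u = c *: f u}.
Proof.
have l d u v : c *: f (d *: u + v) = d *: (c *: f u) + (c *: f v).
 by rewrite bop_lin; vring.
apply: cid; have [C [C0 hC]] := bop_bnd f.
have b : exists2 E : R, 0 <= E & forall u, nrm (c *: f u) <= E * nrm u.
 exists (`|c| * C) => [|u]; first exact: mulr_ge0.
 by rewrite nrmZ -mulrA ler_wpM2l.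
by exists (Bop l b).
Qed.
Fact bzero_ex : {h : bop U V | forall u, h u = 0}.
Proof.
have l (c : R) (u v : U) : 0 = c *: 0 + 0 :> V by vring.
have b : exists2 E : R, 0 <= E & forall u : U, nrm (0 : V) <= E * nrm u.
 by exists 0 => // u; rewrite nrm0 mul0r.
by exists (Bop l b).
Qed.
Definition badd f g := sval (badd_ex f g).
Definition bscale c f := sval (bscale_ex c f).
Definition bzero := sval bzero_ex.
Definition bopp f := bscale (-1) f.
Let baddE f g u : badd f g u = f u + g u. Proof. exact: (svalP (badd_ex f g)). Qed.
Let bscaleE c f u : bscale c f u = c *: f u. Proof. exact: (svalP (bscale_ex c f)). Qed.
Let bzeroE u : bzero u = 0. Proof. exact: (svalP bzero_ex). Qed.
Let opE := (baddE, bscaleE, bzeroE).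

Lemma baddA : associative badd. Proof. by move=> f g h; apply: bopP => u; rewrite ?/bopp !opE; vring. Qed.
Lemma baddC : commutative badd. Proof. by move=> f g; apply: bopP => u; rewrite ?/bopp !opE; vring. Qed.
Lemma badd0 : left_id bzero badd. Proof. by move=> f; apply: bopP => u; rewrite ?/bopp !opE; vring. Qed.
Lemma baddN : left_inverse bzero bopp badd.
Proof. by move=> f; apply: bopP => u; rewrite ?/bopp !opE; vring. Qed.
HB.instance Definition _ := GRing.isZmodule.Build (bop U V) baddA baddC badd0 baddN.

Lemma bscaleA a b f : bscale a (bscale b f) = bscale (a * b) f.
Proof. by apply: bopP => u; rewrite !opE; vring. Qed.
Lemma bscale1 : left_id 1 bscale.
Proof. by move=> f; apply: bopP => u; rewrite ?/bopp !opE; vring. Qed.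
Lemma bscaleDr : right_distributive bscale +%R.
Proof. by move=> a f g; apply: bopP => u; rewrite ?/bopp !opE; vring. Qed.
Lemma bscaleDl f : {morph bscale^~ f : a b / a + b}.
Proof. by move=> a b; apply: bopP => u; rewrite ?/bopp !opE; vring. Qed.
HB.instance Definition _ :=
 GRing.Zmodule_isLmodule.Build R (bop U V) bscaleA bscale1 bscaleDr bscaleDl.

Lemma bopDE (f g : bop U V) u : (f + g) u = f u + g u. Proof. exact: baddE. Qed.
Lemma bopZE c (f : bop U V) u : (c *: f) u = c *: f u. Proof. exact: bscaleE. Qed.
Lemma bopNE (f : bop U V) u : (- f) u = - f u.
Proof. by rewrite -[- f]scaleN1r bopZE scaleN1r. Qed.
Lemma bop0E u : (0 : bop U V) u = 0. Proof. exact: bzeroE. Qed.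
Lemma bopBE (f g : bop U V) u : (f - g) u = f u - g u.
Proof. by rewrite bopDE bopNE. Qed.
Lemma bopsumE (I : Type) (r : seq I) (P : pred I) (F : I -> bop U V) u :
 (\sum_(i <- r | P i) F i) u = \sum_(i <- r | P i) F i u.
Proof. by elim/big_rec2: _ => [|i y x _ <-]; rewrite ?bop0E ?bopDE. Qed.
End Ops.

Program Definition bcomp (U V W : rhilb R) (f : bop V W) (g : bop U V) :=
 @Bop U W (fun u => f (g u)) _ _.
Next Obligation. by move=> U V W f g c u v /=; rewrite !bop_lin. Qed.
Next Obligation.
move=> U V W f g; have [C [C0 hC]] := bop_bnd f; have [D [D0 hD]] := bop_bnd g.
exists (C * D); first exact: mulr_ge0.
by move=> u; apply: le_trans (hC _) _; rewrite -mulrA ler_wpM2l.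
Qed.

Program Definition bid (U : rhilb R) := @Bop U U (fun u => u) _ _.
Next Obligation. by []. Qed.
Next Obligation. by move=> U; exists 1 => // u; rewrite mul1r. Qed.

Definition mkbop (U V : rhilb R) (f : U -> V) (C : R)
  (l : forall c u v, f (c *: u + v) = c *: f u + f v) (C0 : 0 <= C)
  (h : forall u, nrm (f u) <= C * nrm u) : bop U V :=
 @Bop U V f l (ex_intro2 _ _ C C0 h).

End Bop.

Notation "f ** g" := (bcomp f g) (at level 40, left associativity).
Arguments bid {R U}.

(** * Adjoints and positive operators *)

Section Adj.
Context {R : realType}.

Lemma badj_exists (U V : rhilb R) (f : bop U V) :
 {g : bop V U | forall u v, ip (f u) v = ip u (g v)}.
Proof.
apply: cid; have [C [C0 hC]] := bop_bnd f.
have hv v : {w | forall u, ip (f u) v = ip u w}.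
 apply: cid; apply: (@riesz R U (fun u => ip (f u) v) (C * nrm v)) => [c u u'|u].
  by rewrite bop_lin !ipE.
 apply: le_trans (CSabs _ _) _.
 by rewrite mulrAC ler_wpM2r ?nrm_ge0.
pose g v := sval (hv v).
have gE u v : ip (f u) v = ip u (g v) by exact: (svalP (hv v)).
have gl c u v : g (c *: u + v) = c *: g u + g v.
 by apply: ip_inj => w; rewrite ipC -gE !ipE !(ipC _ w) -!gE.
have gb u : nrm (g u) <= C * nrm u.
 apply: nrm_le_ip => [|v]; first by rewrite mulr_ge0 ?nrm_ge0.
 rewrite ipC -gE; apply: le_trans (CS _ _) _.
 by rewrite mulrAC ler_wpM2r ?nrm_ge0.
by exists (mkbop gl C0 gb).
Qed.

Definition badj (U V : rhilb R) (f : bop U V) : bop V U := sval (badj_exists f).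
End Adj.
Notation "f ^#" := (badj f) (at level 2, format "f ^#").

Section AdjTh.
Context {R : realType}.
Implicit Types U V W : rhilb R.

Lemma badjE U V (f : bop U V) u v : ip (f u) v = ip u (f^# v).
Proof. exact: (svalP (badj_exists f)). Qed.
Lemma badjEr U V (f : bop U V) u v : ip v (f u) = ip (f^# v) u.
Proof. by rewrite ipC badjE ipC. Qed.
Lemma badj_uniq U V (f : bop U V) (g : bop V U) :
 (forall u v, ip (f u) v = ip u (g v)) -> f^# = g.
Proof.
move=> h; apply: bopP => v; apply: ip_inj => w; by rewrite ipC -badjE h ipC.
Qed.
Lemma badjK U V (f : bop U V) : (f^#)^# = f.
Proof. by apply: badj_uniq => u v; rewrite badjEr. Qed.
Lemma badjM U V W (f : bop V W) (g : bop U V) : (f ** g)^# = g^# ** f^#.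
Proof. by apply: badj_uniq => u v /=; rewrite !badjE. Qed.
Lemma badjD U V (f g : bop U V) : (f + g)^# = f^# + g^#.
Proof. by apply: badj_uniq => u v; rewrite !bopDE !ipE !badjE. Qed.
Lemma badjZ U V c (f : bop U V) : (c *: f)^# = c *: f^#.
Proof. by apply: badj_uniq => u v; rewrite !bopZE !ipE !badjE. Qed.
Lemma badjN U V (f : bop U V) : (- f)^# = - f^#.
Proof. by rewrite -scaleN1r badjZ scaleN1r. Qed.
Lemma badjB U V (f g : bop U V) : (f - g)^# = f^# - g^#.
Proof. by rewrite badjD badjN. Qed.
Lemma badj1 U : (@bid R U)^# = bid.
Proof. exact: badj_uniq. Qed.
Lemma badj0 U V : (0 : bop U V)^# = 0.
Proof. by apply: badj_uniq => u v; rewrite !bop0E !ipE. Qed.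

Lemma bcA U V W X (f : bop W X) (g : bop V W) (h : bop U V) :
 f ** (g ** h) = f ** g ** h.
Proof. exact: bopP. Qed.
Lemma bcDl U V W (f g : bop V W) (h : bop U V) : (f + g) ** h = f ** h + g ** h.
Proof. by apply: bopP => u; rewrite /= !bopDE. Qed.
Lemma bcDr U V W (f : bop V W) (g h : bop U V) : f ** (g + h) = f ** g + f ** h.
Proof. by apply: bopP => u; rewrite /= !bopDE bD. Qed.
Lemma bcZl U V W c (f : bop V W) (h : bop U V) : (c *: f) ** h = c *: (f ** h).
Proof. by apply: bopP => u; rewrite /= !bopZE. Qed.
Lemma bcZr U V W c (f : bop V W) (h : bop U V) : f ** (c *: h) = c *: (f ** h).
Proof. by apply: bopP => u; rewrite /= !bopZE /= bZ. Qed.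
Lemma bcNl U V W (f : bop V W) (h : bop U V) : (- f) ** h = - (f ** h).
Proof. by apply: bopP => u; rewrite /= !bopNE. Qed.
Lemma bcNr U V W (f : bop V W) (h : bop U V) : f ** (- h) = - (f ** h).
Proof. by apply: bopP => u; rewrite /= !bopNE /= bN. Qed.
Lemma bcBl U V W (f g : bop V W) (h : bop U V) : (f - g) ** h = f ** h - g ** h.
Proof. by rewrite bcDl bcNl. Qed.
Lemma bcBr U V W (f : bop V W) (g h : bop U V) : f ** (g - h) = f ** g - f ** h.
Proof. by rewrite bcDr bcNr. Qed.
Lemma bc1l U V (f : bop U V) : bid ** f = f. Proof. exact: bopP. Qed.
Lemma bc1r U V (f : bop U V) : f ** bid = f. Proof. exact: bopP. Qed.
Lemma bc0l U V W (h : bop U V) : (0 : bop V W) ** h = 0.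
Proof. by apply: bopP => u; rewrite /= !bop0E. Qed.
Lemma bc0r U V W (h : bop V W) : h ** (0 : bop U V) = 0.
Proof. by apply: bopP => u; rewrite /= !bop0E b0. Qed.

Lemma bnd_comp U V W (f : bop V W) (g : bop U V) C D :
 bnd f C -> bnd g D -> bnd (f ** g) (C * D).
Proof.
move=> [C0 hC] [D0 hD]; split; first exact: mulr_ge0.
by move=> u /=; apply: le_trans (hC _) _; rewrite -mulrA ler_wpM2l.
Qed.
Lemma bnd_le U V (f : U -> V) (C D : R) : C <= D -> bnd f C -> bnd f D.
Proof.
move=> CD [C0 hC]; split; first exact: le_trans CD.
by move=> u; apply: le_trans (hC _) _; rewrite ler_wpM2r ?nrm_ge0.
Qed.
Lemma bnd_add U V (f g : bop U V) C D : bnd f C -> bnd g D -> bnd (f + g) (C + D).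
Proof.
move=> [C0 hC] [D0 hD]; split; first exact: addr_ge0.
by move=> u; rewrite bopDE; apply: le_trans (nrmD _ _) _; rewrite mulrDl lerD.
Qed.
Lemma bnd_scale U V c (f : bop U V) C : bnd f C -> bnd (c *: f) (`|c| * C).
Proof.
move=> [C0 hC]; split; first exact: mulr_ge0.
by move=> u; rewrite bopZE nrmZ -mulrA ler_wpM2l.
Qed.
Lemma bnd_adj U V (f : bop U V) C : bnd f C -> bnd f^# C.
Proof.
move=> [C0 hC]; split=> // u.
apply: nrm_le_ip => [|v]; first by rewrite mulr_ge0 ?nrm_ge0.
by rewrite ipC -badjE; apply: le_trans (CS _ _) _; rewrite mulrAC ler_wpM2r ?nrm_ge0.
Qed.

Definition bsa U (a : bop U U) := a^# = a.
Definition bpos U (a : bop U U) := bsa a /\ forall u, 0 <= ip (a u) u.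

Lemma bsaE U (a : bop U U) u v : bsa a -> ip (a u) v = ip u (a v).
Proof. by move=> h; rewrite badjE h. Qed.
Lemma bpos1 U : bpos (@bid R U).
Proof. by split; [exact: badj1|move=> u /=; exact: ip_ge0]. Qed.
Lemma bposD U (a b : bop U U) : bpos a -> bpos b -> bpos (a + b).
Proof.
move=> [sa ha] [sb hb]; split; first by rewrite /bsa badjD sa sb.
by move=> u; rewrite bopDE ipDl addr_ge0.
Qed.
Lemma bposZ U c (a : bop U U) : 0 <= c -> bpos a -> bpos (c *: a).
Proof.
move=> c0 [sa ha]; split; first by rewrite /bsa badjZ sa.
by move=> u; rewrite bopZE ipZl mulr_ge0.
Qed.
Lemma bpos0 U : bpos (0 : bop U U).
Proof. by split; [exact: badj0|move=> u; rewrite bop0E ip0l]. Qed.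
Lemma bpos_adjl U V (f : bop U V) : bpos (f^# ** f).
Proof.
split; first by rewrite /bsa badjM badjK.
by move=> u /=; rewrite -badjEr ip_ge0.
Qed.
Lemma bpos_conj U V (f : bop U V) (a : bop V V) : bpos a -> bpos (f^# ** a ** f).
Proof.
move=> [sa ha]; split; first by rewrite /bsa !badjM badjK sa bcA.
by move=> u /=; rewrite -badjEr ha.
Qed.

Lemma bpos_CS U (a : bop U U) u v : bpos a ->
 ip (a u) v ^+ 2 <= ip (a u) u * ip (a v) v.
Proof.
move=> [sa ha].
have key t : 0 <= ip (a u) u - 2 * t * ip (a u) v + t ^+ 2 * ip (a v) v.
 have := ha (u - t *: v); rewrite bB bZ !ipE (bsaE v u sa) (ipC v (a u)).
 by move=> h; lra.
have [v0|v0] := eqVneq (ip (a v) v) 0.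
 rewrite v0 mulr0; have [->|p0] := eqVneq (ip (a u) v) 0; first by rewrite expr0n.
 (* When <a v, v> = 0 the quadratic is affine in t, and this t gives it the value -1. *)
 have := key ((ip (a u) u + 1) / (2 * ip (a u) v)); rewrite v0 mulr0 addr0.
 have -> : 2 * ((ip (a u) u + 1) / (2 * ip (a u) v)) * ip (a u) v = ip (a u) u + 1.
  by field.
 lra.
have vp : 0 < ip (a v) v by rewrite lt_neqAle eq_sym v0 ha.
have := key (ip (a u) v / ip (a v) v).
have -> : ip (a u) u - 2 * (ip (a u) v / ip (a v) v) * ip (a u) v +
 (ip (a u) v / ip (a v) v) ^+ 2 * ip (a v) v =
 ip (a u) u - ip (a u) v ^+ 2 / ip (a v) v by field.
by rewrite subr_ge0 ler_pdivrMr.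
Qed.

Lemma bpos_eq0 U (a : bop U U) u : bpos a -> ip (a u) u = 0 -> a u = 0.
Proof.
move=> pa h; apply: ip_eq0; apply/eqP; rewrite -sqrf_eq0 eq_le sqr_ge0 andbT.
by have := bpos_CS u (a u) pa; rewrite h mul0r.
Qed.

(** This is a^2 <= C a for 0 <= a <= C. It follows from Cauchy-Schwarz for the form of [a], applied
    to u and a u. *)
Lemma bpos_sq U (a : bop U U) (C : R) u : bpos a -> (forall v, ip (a v) v <= C * ip v v) ->
 ip (a u) (a u) <= C * ip (a u) u.
Proof.
move=> pa h; have [sa ha] := pa.
have [z|z] := eqVneq (ip (a u) (a u)) 0.
 by rewrite (ip_eq0 z) !ip0l mulr0.
have zp : 0 < ip (a u) (a u) by rewrite lt_neqAle eq_sym z ip_ge0.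
rewrite -(ler_pM2l zp).
have := bpos_CS u (a u) pa; rewrite expr2 => /le_trans; apply.
rewrite mulrC [leRHS]mulrA; apply: ler_wpM2r => //.
by rewrite mulrC; apply: le_trans (h _) _.
Qed.

(** Polarisation turns a bound on the quadratic form into one on <a v, w>. The choice w = a u,
    rescaled to the length of u, then bounds the norm. *)
Lemma bsa_bnd U (a : bop U U) (C : R) : bsa a -> 0 <= C ->
 (forall u, `|ip (a u) u| <= C * ip u u) -> bnd a C.
Proof.
move=> sa C0 h; split=> // u.
have key v w : 2 * ip (a v) w <= C * (ip v v + ip w w).
 have := h (v + w); have := h (v - w).
 rewrite !bD !bN !ipE (bsaE w v sa) (ipC w (a v)) (ipC w v) !ler_norml.
 by move=> /andP[h1 h2] /andP[h3 h4]; lra.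
have [z|z] := eqVneq (nrm u) 0.
 by rewrite (nrm_eq0 z) b0 nrm0 mulr0.
have [w|w] := eqVneq (nrm (a u)) 0; first by rewrite w mulr_ge0 ?nrm_ge0.
have up : 0 < nrm u by rewrite lt_neqAle eq_sym z nrm_ge0.
have wp : 0 < nrm (a u) by rewrite lt_neqAle eq_sym w nrm_ge0.
have := key u ((nrm u / nrm (a u)) *: a u).
rewrite !ipZr ipZl -!nrm2.
have -> : nrm u / nrm (a u) * (nrm u / nrm (a u) * nrm (a u) ^+ 2) = nrm u ^+ 2 by field.
have -> : nrm u / nrm (a u) * nrm (a u) ^+ 2 = nrm u * nrm (a u) by field.
have -> : C * (nrm u ^+ 2 + nrm u ^+ 2) = 2 * (nrm u * (C * nrm u)) by ring.
by rewrite ler_pM2l// ler_pM2l.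
Qed.

Lemma bpos_bnd U (a : bop U U) (C : R) : bpos a -> (forall v, ip (a v) v <= C * ip v v) ->
 0 <= C -> bnd a C.
Proof.
move=> [sa ha] h C0; apply: bsa_bnd => // u; by rewrite ger0_norm.
Qed.

(** The lower bound makes [a] injective with closed range, and self-adjointness makes that range
    dense. *)
Lemma binv_exists U (a : bop U U) (c : R) : bsa a -> 0 < c ->
 (forall u, c * ip u u <= ip (a u) u) ->
 exists b : bop U U, [/\ a ** b = bid, b ** a = bid, bsa b & bnd b c^-1].
Proof.
move=> sa c0 h.
have hn u : c * nrm u <= nrm (a u).
 have [z|z] := eqVneq (nrm u) 0; first by rewrite z mulr0 nrm_ge0.
 have up : 0 < nrm u by rewrite lt_neqAle eq_sym z nrm_ge0.
 rewrite -(ler_pM2r up) -mulrA -expr2 nrm2.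
 by apply: le_trans (h u) _; exact: CS.
pose A : set U := range a.
have sA : subsp A.
 split; first by exists 0; rewrite ?b0.
 by move=> d _ _ [u _ <-] [v _ <-]; exists (d *: u + v); rewrite // bop_lin.
have cA : sclosed A.
 move=> x l Ax hl.
 have hy n : {y | a y = x n} by apply: cid; have [y _ <-] := Ax n; exists y.
 pose y n := sval (hy n); have yE n : a (y n) = x n by exact: (svalP (hy n)).
 have [|m hm] := @cau_conv _ _ y.
  move=> e e0; have ce : 0 < c * e / 2 by rewrite divr_gt0 ?mulr_gt0.
  have [N hN] := hl _ ce; exists N => i j hi hj.
  rewrite -(ltr_pM2l c0); apply: le_lt_trans (hn _) _; rewrite bB !yE.
  have := hN i hi; have := hN j hj; have := nrm_distD (x i) (x j) l.
  rewrite (nrmB l); lra.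
 exists m => //; apply: conv_uniq (bop_conv a hm) _.
 by move=> e e0; have [N hN] := hl e e0; exists N => n hnn; rewrite yE hN.
have surj u : {v | a v = u}.
 apply: cid; have [_ [v _ <-] hv] := projection u sA cA; exists v.
 apply/eqP; rewrite eq_sym -subr_eq0; apply/eqP/nrm_eq0/eqP.
 have w0 : a (u - a v) = 0.
  by apply: ip_inj => w; rewrite ip0l bsaE// hv//; exists w.
 have := hn (u - a v); rewrite w0 nrm0 => h0.
 rewrite eq_le nrm_ge0 andbT -(ler_pM2l c0) mulr0; exact: h0.
have inj u v : a u = a v -> u = v.
 move=> E; apply/subr0_eq/nrm_eq0/eqP.
 by rewrite eq_le nrm_ge0 andbT -(ler_pM2l c0) mulr0 (le_trans (hn _))// bB E subrr nrm0.
pose b u := sval (surj u); have bE u : a (b u) = u by exact: (svalP (surj u)).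
have bl d u v : b (d *: u + v) = d *: b u + b v.
 by apply: inj; rewrite bop_lin !bE.
have bb u : nrm (b u) <= c^-1 * nrm u.
 by rewrite -(ler_pM2l c0) mulrA mulfV ?mul1r ?lt0r_neq0// -[X in _ <= nrm X]bE.
have ci : 0 <= c^-1 by rewrite invr_ge0 ltW.
exists (mkbop bl ci bb); split=> //.
- by apply: bopP => u /=; exact: bE.
- by apply: bopP => u /=; apply: inj; exact: bE.
- apply: badj_uniq => u v /=; by rewrite -{1}[v]bE -bsaE// bE.
Qed.

End AdjTh.

Definition bopE := (@bopDE, @bopNE, @bopZE, @bop0E, @bD, @bN, @bZ).
Ltac oring := apply: bopP => ?; rewrite /= ?bopE /= ?bopE /= ?bopE; vring.

(** * Strong limits of bounded sequences *)

Section StrongLimits.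
Context {R : realType}.
Implicit Types U V W : rhilb R.

Definition scv U V (x : nat -> bop U V) (l : U -> V) := forall u, conv (fun n => x n u) (l u).

Lemma scv_exists U V (x : nat -> bop U V) (C : R) (A : set U) :
 (forall n, bnd (x n) C) -> dns A ->
 (forall a, A a -> exists l, conv (fun n => x n a) l) ->
 exists2 l : bop U V, bnd l C & scv x l.
Proof.
move=> hb hA hl; have C0 : 0 <= C by case: (hb 0%N).
have hc u : {l | conv (fun n => x n u) l}.
 apply: cid; apply: cau_conv => e e0.
 have C1 : 0 < 4 * (C + 1) by rewrite mulr_gt0// ltr_wpDl.
 have [a Aa ha] := hA u (e / (4 * (C + 1))) ltac:(by rewrite divr_gt0).
 have [l la] := hl a Aa.
 have [N hN] := la (e / 4) ltac:(by rewrite divr_gt0).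
 exists N => m n /hN h1 /hN h2.
 have hs k : nrm (x k u - x k a) <= e / 4.
  rewrite -bB; apply: le_trans ((hb k).2 _) _.
  apply: le_trans (_ : (C + 1) * (e / (4 * (C + 1))) <= _).
   by apply: ler_pM; rewrite ?nrm_ge0// ?lerDl// ltW.
  rewrite le_eqVlt; apply/orP; left; apply/eqP; field; lra.
 have := nrm_distD (x m u) (x n u) (x m a).
 have := nrm_distD (x m a) (x n u) (x n a).
 have := nrm_distD (x m a) (x n a) l.
 have := hs m; have := hs n; rewrite (nrmB (x n u)) (nrmB l); lra.
pose l u := sval (hc u).
have lE u : conv (fun n => x n u) (l u) by exact: (svalP (hc u)).
clearbody l.
have ll c u v : l (c *: u + v) = c *: l u + l v.
 apply: conv_uniq (lE _) _ => e e0; have c1 : 0 < `|c| + 1 by rewrite ltr_wpDl.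
 have [N1 h1] := lE u (e / 2 / (`|c| + 1)) ltac:(by rewrite !divr_gt0).
 have [N2 h2] := lE v (e / 2) ltac:(by rewrite divr_gt0).
 exists (maxn N1 N2) => n; rewrite geq_max => /andP[/h1 + /h2].
 move=> h3 h4.
 rewrite bop_lin [X in nrm X](_ : _ = c *: (x n u - l u) + (x n v - l v)); last by vring.
 apply: le_lt_trans (nrmD _ _) _; rewrite nrmZ.
 have : `|c| * nrm (x n u - l u) <= e / 2; last by lra.
 apply: le_trans (_ : `|c| * (e / 2 / (`|c| + 1)) <= _).
  by rewrite ler_wpM2l// ltW.
 by rewrite mulrCA ler_piMr ?divr_ge0 ?ltW// ltr_pdivrMr// mul1r ltrDl.
have lb u : nrm (l u) <= C * nrm u.
 by apply: conv_nrm_le (lE u) _ => n; exact: (hb n).2.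
by exists (mkbop ll C0 lb).
Qed.

Lemma scv_uniq U V (x : nat -> bop U V) (k l : bop U V) : scv x k -> scv x l -> k = l.
Proof. by move=> hk hl; apply: bopP => u; exact: conv_uniq (hk u) (hl u). Qed.

Lemma scv_comp U V W (x : nat -> bop V W) (y : nat -> bop U V) (C : R) (k : bop V W) (l : bop U V) :
 (forall n, bnd (x n) C) -> scv x k -> scv y l -> scv (fun n => x n ** y n) (k ** l).
Proof.
move=> hb hx hy u /= e e0; have C1 : 0 < C + 1 by rewrite ltr_wpDl//; case: (hb 0%N).
have [N1 h1] := hx (l u) (e / 2) ltac:(by rewrite divr_gt0).
have [N2 h2] := hy u (e / 2 / (C + 1)) ltac:(by rewrite !divr_gt0).
exists (maxn N1 N2) => n; rewrite geq_max => /andP[/h1 h3 /h2 h4].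
have := nrm_distD (x n (y n u)) (k (l u)) (x n (l u)); rewrite -bB.
have : nrm (x n (y n u - l u)) < e / 2; last by lra.
apply: le_lt_trans ((hb n).2 _) _.
apply: le_lt_trans (_ : (C + 1) * nrm (y n u - l u) < _).
 by rewrite ler_wpM2r ?nrm_ge0// lerDl.
by rewrite mulrC -ltr_pdivlMr.
Qed.

Lemma scv_bsa U (x : nat -> bop U U) (l : bop U U) :
 (forall n, bsa (x n)) -> scv x l -> bsa l.
Proof.
move=> hx hl; apply: badj_uniq => u v; apply: subr0_eq.
have : 1 *: (ip (l u) v - ip u (l v)) = 0 :> R; last by rewrite scale1r.
apply/eqP; rewrite scale1r -normr_eq0 eq_le normr_ge0 andbT; apply: eps_le => e e0.
have [N1 h1] := conv_ip v (hl u) (divr_gt0 e0 (ltr0n _ 2)).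
have [N2 h2] := conv_ip u (hl v) (divr_gt0 e0 (ltr0n _ 2)).
have := h1 (maxn N1 N2) (leq_maxl _ _); have := h2 (maxn N1 N2) (leq_maxr _ _).
rewrite (ipC u (l v)) (bsaE u v (hx _)) (ipC u).
rewrite !ltr_norml ler_norml; lra.
Qed.

Lemma bnd_form U (a : bop U U) (C : R) u : bnd a C -> ip (a u) u <= C * ip u u.
Proof.
move=> [C0 h]; apply: le_trans (CS _ _) _.
by rewrite -nrm2 expr2 mulrA ler_wpM2r ?nrm_ge0.
Qed.

(** The forms <x n u, u> converge as bounded increasing sequences. [bpos_sq] for the increments x n
    - x m, which lie between 0 and 1, turns this into norm convergence of x n u. *)
Lemma monotone_scv U (x : nat -> bop U U) : (forall n, bpos (x n)) ->
 (forall n, bnd (x n) 1) -> (forall n, bpos (x n.+1 - x n)) ->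
 exists l : bop U U, [/\ scv x l, bpos l, bnd l 1 & forall n, bpos (l - x n)].
Proof.
move=> hp hb hi.
have him m n : (m <= n)%N -> bpos (x n - x m).
 move=> /subnK <-; elim: (n - m)%N => [|k IH]; first by rewrite subrr; exact: bpos0.
 rewrite addSn (_ : _ - _ = (x (k + m).+1 - x (k + m)%N) + (x (k + m)%N - x m)).
  exact: bposD.
 by rewrite addrA subrK.
have hmon u m n : (m <= n)%N -> ip (x m u) u <= ip (x n u) u.
 by move=> /him [_ /(_ u)]; rewrite bopBE ipDl ipNl subr_ge0.
have key u m n : (m <= n)%N ->
  nrm (x n u - x m u) ^+ 2 <= ip (x n u) u - ip (x m u) u.
 move=> mn; rewrite nrm2 -bopBE; apply: le_trans (@bpos_sq _ _ _ 1 u (him _ _ mn) _) _ => [v|].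
  rewrite mul1r bopBE ipDl ipNl.
  have := bnd_form v (hb n); rewrite mul1r; have := (hp m).2 v; lra.
 by rewrite mul1r bopBE ipDl ipNl.
have hc u : exists l, conv (fun n => x n u) l.
 apply: cau_conv => e e0.
 pose S : set R := range (fun n => ip (x n u) u).
 have hS : has_sup S.
  split; first by exists (ip (x 0%N u) u), 0%N.
  by exists (1 * ip u u) => _ [n _ <-]; exact: bnd_form.
 have [_ [N _ <-] hN] := @sup_adherent _ S (e ^+ 2) (exprn_gt0 _ e0) hS.
 have hle n : ip (x n u) u <= sup S by apply: sup_ubound; [exact: hS.2|exists n].
 have hd n : (N <= n)%N -> nrm (x n u - x N u) < e.
  move=> Nn; rewrite nrm_lt// -nrm2.
  apply: le_lt_trans (key _ _ _ Nn) _; have := hle n; lra.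
 have hd2 m n : (N <= m)%N -> (m <= n)%N -> nrm (x n u - x m u) < e.
  move=> Nm mn; rewrite nrm_lt// -nrm2.
  apply: le_lt_trans (key _ _ _ mn) _; have := hle n; have := hmon u _ _ Nm; lra.
 exists N => m n Nm Nn; have [mn|/ltnW nm] := leqP m n.
  by rewrite nrmB; exact: hd2.
 exact: hd2.
have dT : dns [set: U] by move=> u e e0; exists u => //; rewrite subrr nrm0.
have [l lb hl] := scv_exists hb dT (fun u _ => hc u).
have ls : bsa l by apply: scv_bsa hl => n; case: (hp n).
have lx n : bpos (l - x n).
 split; first by rewrite /bsa badjB ls (hp n).1.
 move=> u; rewrite bopBE ipDl ipNl subr_ge0; rewrite -lerN2 -ipNl.
 apply: (@conv_ip_le _ _ (fun k => - x (n + k)%N u)) => [e e0|k].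
  have [N hN] := hl u e e0; exists N => k hk.
  rewrite -opprD nrmN.
  by apply: hN; rewrite (leq_trans hk) ?leq_addl.
 by rewrite ipNl lerN2 hmon ?leq_addr.
exists l; split=> //; rewrite -(subrK (x 0%N) l); exact: bposD.
Qed.

End StrongLimits.

(** * Square roots, absolute values and sign projections *)

Section Sqrt.
Context {R : realType}.
Implicit Types U V W : rhilb R.

Fixpoint bpow U (d : bop U U) n : bop U U := if n is k.+1 then d ** bpow d k else bid.
Lemma bpowD U (d : bop U U) m n : bpow d (m + n) = bpow d m ** bpow d n.
Proof. by elim: m => [|m IH]; rewrite ?bc1l// addSn /= IH bcA. Qed.
Lemma bpowSr U (d : bop U U) n : bpow d n.+1 = bpow d n ** d.
Proof. by rewrite -addn1 bpowD /= bc1r. Qed.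
Lemma bsa_pow U (d : bop U U) n : bsa d -> bsa (bpow d n).
Proof.
move=> sd; elim: n => [|n IH]; first exact: badj1.
by rewrite /bsa [in LHS]/= badjM IH sd -bpowSr.
Qed.
Lemma bpos_pow U (d : bop U U) n : bpos d -> bpos (bpow d n).
Proof.
move=> [sd pd]; rewrite -(odd_double_half n) -addnn addnCA bpowD bpowD.
rewrite bcA -{1}(bsa_pow n./2 sd); apply: bpos_conj.
by case: (odd n); rewrite /= ?bc1r//; exact: bpos1.
Qed.

(** Polynomials in d with nonnegative coefficients. They are positive when d is and are closed under
    products, which makes the iteration below positive and monotone without any functional
    calculus. *)
Inductive npol U (d : bop U U) : bop U U -> Prop :=
| npol0 : npol d 0
| npolS (c : R) k x : 0 <= c -> npol d x -> npol d (c *: bpow d k + x).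

Lemma npol_pos U (d x : bop U U) : bpos d -> npol d x -> bpos x.
Proof.
move=> pd; elim=> [|c k y c0 _ py]; first exact: bpos0.
by apply: bposD => //; apply: bposZ => //; exact: bpos_pow.
Qed.
Lemma npolD U (d x y : bop U U) : npol d x -> npol d y -> npol d (x + y).
Proof.
move=> hx hy; elim: hx => [|c k z c0 _ IH]; rewrite ?add0r// -addrA; exact: npolS.
Qed.
Lemma npolZ U (d x : bop U U) (c : R) : 0 <= c -> npol d x -> npol d (c *: x).
Proof.
move=> c0; elim=> [|e k z e0 _ IH]; first by rewrite scaler0; exact: npol0.
by rewrite scalerDr scalerA; apply: npolS => //; exact: mulr_ge0.
Qed.
Lemma npolM U (d x y : bop U U) : npol d x -> npol d y -> npol d (x ** y).
Proof.
move=> hx hy; elim: hx => [|c k z c0 _ IH]; first by rewrite bc0l; exact: npol0.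
rewrite bcDl; apply: npolD => //; elim: hy => [|e j w e0 _ IH2].
 by rewrite bc0r; exact: npol0.
rewrite bcDr; apply: npolD => //.
rewrite bcZl bcZr -bpowD scalerA -[_ *: _]addr0; apply: npolS; last exact: npol0.
exact: mulr_ge0.
Qed.
Lemma npol_d U (d : bop U U) : npol d d.
Proof. rewrite -{2}[d]bc1r -[_ ** _]scale1r -[_ *: _]addr0 -/(bpow d 1). exact: npolS (npol0 _). Qed.

(* Newton-type iteration for [1 - sqrt (1 - d)]. *)
Fixpoint sqs U (d : bop U U) n : bop U U :=
 if n is k.+1 then 2^-1 *: (d + sqs d k ** sqs d k) else 0.

Lemma sqs_npol U (d : bop U U) n : npol d (sqs d n).
Proof.
elim: n => [|n IH]; first exact: npol0.
by apply: npolZ => //; apply: npolD; [exact: npol_d|exact: npolM].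
Qed.
Lemma sqs_comm U (d : bop U U) m n : sqs d m ** sqs d n = sqs d n ** sqs d m.
Proof.
have hd k x : npol d x -> x ** bpow d k = bpow d k ** x.
 elim=> [|c j z _ _ IH]; first by rewrite bc0l bc0r.
 by rewrite bcDl bcDr IH bcZl bcZr -!bpowD addnC.
elim: (sqs_npol d n) => [|c j z _ _ IH]; first by rewrite bc0l bc0r.
by rewrite bcDl bcDr IH bcZl bcZr hd//; exact: sqs_npol.
Qed.
(** Each increment is 1/2 (p - q)(p + q) for the two preceding iterates. The induction hypothesis
    says that p - q is a polynomial with nonnegative coefficients; mere positivity would not pass to
    the product so easily. *)
Lemma sqs_incr U (d : bop U U) n : npol d (sqs d n.+1 - sqs d n).
Proof.
elim: n => [|n IH]; first by rewrite /= subr0; exact: (sqs_npol d 1).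
have key (p q r : bop U U) : p = 2^-1 *: (d + q ** q) -> r = 2^-1 *: (d + p ** p) ->
  p ** q = q ** p -> r - p = 2^-1 *: ((p - q) ** (p + q)).
 move=> e1 e2 e3; rewrite e2 [X in _ - X]e1 -scalerBr; congr (_ *: _); rewrite bcDr !bcBl e3.
 by rewrite opprD addrACA subrr add0r addrA subrK.
rewrite (key _ (sqs d n) _ _ _ (sqs_comm d _ _))//.
by apply: npolZ => //; apply: npolM => //; apply: npolD; exact: sqs_npol.
Qed.

Definition bsqrt U (a : bop U U) : bop U U :=
 xget (0 : bop U U) [set b : bop U U | scv (fun n => bid - sqs (bid - a) n) b].

Definition ble1 U (a : bop U U) := bpos a /\ forall u, ip (a u) u <= ip u u.

Lemma ble1_compl U (a : bop U U) : ble1 a -> ble1 (bid - a).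
Proof.
move=> [[sa pa] h]; split; first split; first by rewrite /bsa badjB badj1 sa.
 by move=> u; rewrite bopBE ipDl ipNl subr_ge0 h.
by move=> u; rewrite bopBE ipDl ipNl gerBl pa.
Qed.
Lemma ble1_bnd U (a : bop U U) : ble1 a -> bnd a 1.
Proof. by move=> [pa h]; apply: bpos_bnd => // v; rewrite mul1r. Qed.
Lemma bnd_ble1 U (a : bop U U) : bpos a -> bnd a 1 -> ble1 a.
Proof. by move=> pa h; split=> // u; rewrite -[leRHS]mul1r; exact: bnd_form. Qed.

Lemma bsqrt_spec U (a : bop U U) : ble1 a ->
 [/\ scv (fun n => bid - sqs (bid - a) n) (bsqrt a), ble1 (bsqrt a) &
   bsqrt a ** bsqrt a = a].
Proof.
move=> ha; have [hd hd1] := ble1_compl ha; set d := bid - a in hd hd1 *.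
have db : bnd d 1 by exact/ble1_bnd/ble1_compl.
have sb n : bnd (sqs d n) 1.
 elim: n => [|n IH]; first by split=> // u; rewrite bop0E nrm0 mulr_ge0 ?nrm_ge0.
 rewrite /=; apply: bnd_le (bnd_scale 2^-1 (bnd_add db (bnd_comp IH IH))).
 by rewrite ger0_norm//; lra.
have [c [hc pc cb _]] := monotone_scv (fun n => npol_pos hd (sqs_npol d n)) sb
  (fun n => npol_pos hd (sqs_incr d n)).
have cE : c = 2^-1 *: (d + c ** c).
 apply: (@scv_uniq _ _ _ (fun n => sqs d n.+1)) => u.
  by move=> e e0; have [N hN] := hc u e e0; exists N => n Nn; apply: hN; exact: leqW.
 have h := scv_comp sb hc hc u.
 move=> e e0; have [N hN] := h _ e0; exists N => n Nn /=.
 rewrite !bopZE !bopDE -scalerBr nrmZ ger0_norm//.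
 rewrite (_ : _ - _ = sqs d n (sqs d n u) - c (c u)); last by vring.
 have := hN n Nn; rewrite /=; have := nrm_ge0 (sqs d n (sqs d n u) - c (c u)); lra.
have h1 : scv (fun n => bid - sqs d n) (bid - c).
 move=> u e e0; have [N hN] := hc u e e0; exists N => n Nn.
 rewrite !bopBE (_ : _ - _ = - (sqs d n u - c u)); last by vring.
 by rewrite nrmN hN.
have -> : bsqrt a = bid - c.
 apply: xget_unique => // b hb; exact: scv_uniq hb h1.
split=> //; first exact/ble1_compl/bnd_ble1.
have : 2 *: c = d + c ** c by rewrite {1}cE scalerA mulfV// scale1r.
rewrite bcBl !bcBr !bc1l bc1r opprB addrA => h.
apply: subr0_eq; rewrite /d in h.
transitivity (((bid - a) + c ** c) - 2 *: c); last by rewrite h subrr.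
by oring.
Qed.

(** The iteration is polynomial, so W carries each iterate for [a] to the one for [a']. Two
    operators are needed because this is applied to bounded transforms, which intertwine C and C',
    and to J, which exchanges an operator C with 1 - C. *)
Lemma bsqrt_comm U V (a : bop U U) (a' : bop V V) (W : bop U V) :
 ble1 a -> ble1 a' -> W ** a = a' ** W -> W ** bsqrt a = bsqrt a' ** W.
Proof.
move=> ha ha' h; have [h1 _ _] := bsqrt_spec ha; have [h2 _ _] := bsqrt_spec ha'.
have hn n : W ** sqs (bid - a) n = sqs (bid - a') n ** W.
 elim: n => [|n IH]; first by rewrite bc0l bc0r.
 rewrite /= bcZl bcZr bcDl bcDr bcBr bcBl h bc1l bc1r.
 by rewrite bcA IH -bcA IH bcA.
apply: bopP => u /=; apply: conv_uniq (bop_conv W (h1 u)) _.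
move=> e e0; have [N hN] := h2 (W u) e e0; exists N => n Nn.
have := hN n Nn; congr (nrm (_ - _) < e).
by rewrite !bopBE /= bB -[W (sqs _ _ _)]/((W ** sqs _ _) u) hn.
Qed.

Lemma bpos_comm_mul U (a b : bop U U) : ble1 a -> bpos b -> a ** b = b ** a -> bpos (a ** b).
Proof.
move=> ha hb h; have [_ [[sq _] _] q2] := bsqrt_spec ha.
rewrite -q2 -bcA -(bsqrt_comm ha ha (esym h)) bcA -{1}sq.
exact: bpos_conj.
Qed.

Definition babs U (s : bop U U) := bsqrt (s ** s).
Lemma bsa_sq_ble1 U (s : bop U U) : bsa s -> bnd s 1 -> ble1 (s ** s).
Proof.
move=> ss sb; apply: bnd_ble1; first by rewrite -{1}ss; exact: bpos_adjl.
by rewrite -[1]mulr1; exact: bnd_comp.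
Qed.

Definition invariant U V (W : bop U V) (A : set U) (B : set V) := forall u, A u -> B (W u).

Lemma bproj_exists U (A : set U) : subsp A -> sclosed A ->
 exists p : bop U U, [/\ bsa p, p ** p = p, forall u, A (p u), forall u, A u -> p u = u &
  forall u v, A v -> ip (u - p u) v = 0].
Proof.
move=> sA cA.
have hp u : {a | A a /\ forall b, A b -> ip (u - a) b = 0}.
 by apply: cid; have [a] := projection u sA cA; exists a.
pose p u := sval (hp u).
have Ap u : A (p u) by case: (svalP (hp u)).
have op u b : A b -> ip (u - p u) b = 0 by case: (svalP (hp u)) => _; apply.
clearbody p.
have uniq u a : A a -> (forall b, A b -> ip (u - a) b = 0) -> p u = a.
 move=> Aa h; apply/subr0_eq/ip_eq0.
 have Ab := subspB sA (Ap u) Aa; have := op u _ Ab; have := h _ Ab.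
 by rewrite !ipE; lra.
have pl c u v : p (c *: u + v) = c *: p u + p v.
 apply: uniq => [|b Ab]; first exact: sA.2.
 by have := op u b Ab; have := op v b Ab; rewrite !ipE => h1 h2; nra.
have pb u : nrm (p u) <= 1 * nrm u.
 rewrite mul1r; apply: sq_le; first exact: nrm_ge0.
 rewrite !nrm2; have := op u _ (Ap u); have := ip_ge0 (u - p u).
 by rewrite !ipE (ipC (p u) u); lra.
exists (mkbop pl ler01 pb); split=> //=.
- apply: badj_uniq => u v /=.
 have := op u _ (Ap v); have := op v _ (Ap u); rewrite !ipE (ipC v) (ipC (p v)); lra.
- by apply: bopP => u /=; apply: uniq => // b _; rewrite subrr ip0l.
- by move=> u Au; apply: uniq => // b _; rewrite subrr ip0l.
Qed.

Lemma bproj_comm U (A : set U) (p W : bop U U) : bsa p -> (forall u, A (p u)) ->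
 (forall u, A u -> p u = u) -> invariant W A A -> invariant W^# A A -> W ** p = p ** W.
Proof.
move=> sp h1 h2 h3 h4.
have h5 : p ** (W ** p) = W ** p by apply: bopP => u /=; apply: h2; apply: h3.
have h6 : p ** (W^# ** p) = W^# ** p by apply: bopP => u /=; apply: h2; apply: h4.
by rewrite -h5; have := congr1 (@badj _ _ _) h6; rewrite !badjM !badjK sp bcA.
Qed.

(** e projects onto the kernel of |s| - s, where s = |s|. As (|s| - s)(|s| + s) = 0, the range of
    |s| + s lies in this kernel, so s = -|s| on the complement. The kernel is invariant under
    whatever commutes with s, hence the commutation clause. *)
Lemma sign_proj U (s : bop U U) : bsa s -> bnd s 1 ->
 exists e : bop U U, [/\ bsa e, e ** e = e,
  (forall W : bop U U, W ** s = s ** W -> W^# ** s = s ** W^# -> W ** e = e ** W),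
  s ** e = babs s ** e & s ** (bid - e) = - (babs s ** (bid - e))].
Proof.
move=> ss sb; have h1 := bsa_sq_ble1 ss sb.
have [_ [[aa _] _] a2] := bsqrt_spec h1; rewrite -/(babs s) in aa a2.
have cm : s ** babs s = babs s ** s by apply: bsqrt_comm => //; rewrite bcA.
pose A : set U := [set u | babs s u - s u = 0].
have sA : subsp A.
 split; rewrite /A/= ?b0 ?subr0// => c u v hu hv; rewrite !bop_lin.
 rewrite (_ : _ - _ = c *: (babs s u - s u) + (babs s v - s v)); last by vring.
 by rewrite hu hv; vring.
have cA : sclosed A.
 move=> x l hx hl.
 have h := bop_conv (babs s - s) hl.
 suff : (babs s - s) l = 0 by rewrite bopBE.
 apply: conv_uniq h _ => e e0; exists 0%N => n _.
 by rewrite bopBE hx subrr nrm0.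
have [e [se ee h2 h3 h4]] := bproj_exists sA cA; exists e.
have eA : s ** e = babs s ** e.
 by apply: bopP => u /=; have := h2 u; rewrite /A/= => /subr0_eq ->.
split=> //.
 move=> W W1 W2.
 have inv (X : bop U U) : X ** s = s ** X -> invariant X A A.
  move=> Xs u; rewrite /A/= => hu.
  have : (babs s ** X - s ** X) u = 0; last by rewrite bopBE.
  rewrite -(bsqrt_comm h1 h1) -?Xs -?bcBr /=; first by rewrite bopBE hu b0.
  by rewrite bcA Xs -bcA Xs bcA.
 by apply: (bproj_comm se h2 h3); exact: inv.
have k : (babs s + s) ** (bid - e) = 0.
 have : e ** (babs s + s) = babs s + s.
  apply: bopP => u /=; apply: h3; rewrite /A/= bopDE !bD -!/((_ ** _) u) .
  rewrite -[babs s (babs s u)]/((babs s ** babs s) u) a2 /=.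
  by rewrite -[s (babs s u)]/((s ** babs s) u) cm /=; vring.
 move=> /(congr1 (@badj _ _ _)); rewrite badjM badjD aa ss se bcBr bc1r => ->.
 by rewrite subrr.
by apply/eqP; rewrite -subr_eq0 opprK -bcDl addrC k.
Qed.

End Sqrt.

Section PosPart.
Context {R : realType}.
Implicit Types U V W : rhilb R.

Definition bpp U (s : bop U U) := 2^-1 *: (babs s + s).

(** The positive part is also |s| e with the projection e of [sign_proj], and this form shows its
    positivity. *)
Lemma bpp_spec U (s : bop U U) : bsa s -> bnd s 1 ->
 [/\ ble1 (bpp s), s ** bpp s = bpp s ** bpp s & bpp s = 0 -> bpos (- s)].
Proof.
move=> ss sb; have h1 := bsa_sq_ble1 ss sb.
have [_ [[aa pa] a1] a2] := bsqrt_spec h1; rewrite -/(babs s) in aa a1 a2 pa.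
have cm : s ** babs s = babs s ** s by apply: bsqrt_comm => //; rewrite bcA.
have [e [se ee ce h2 h3]] := sign_proj ss sb.
have ea : babs s ** e = e ** babs s.
 by apply: ce; rewrite ?aa.
have ppE : bpp s = babs s ** e.
 have : (babs s + s) ** (bid - e) = 0 by rewrite bcDl h3 subrr.
 rewrite bcBr bc1r /bpp => /subr0_eq ->.
 rewrite bcDl h2; move: (babs s ** e) => w.
 by apply: bopP => u; rewrite bopZE bopDE -[X in X + X]scale1r -scalerDl scalerA mulVf// scale1r.
split.
- apply: bnd_ble1.
  rewrite ppE -ee bcA ea -{1}se; exact: bpos_conj.
 have ab : bnd (babs s) 1 by exact: ble1_bnd.
 apply: bnd_le (bnd_scale 2^-1 (bnd_add ab sb)); rewrite ger0_norm//; lra.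
- rewrite /bpp !bcZr !bcZl !bcDr !bcDl a2 cm.
 by move: (s ** s) (babs s ** s) => x y; apply: bopP => u; rewrite !bopZE !bopDE; apply: ip_inj => w; rewrite !ipE; field.
- move=> h; suff -> : - s = babs s by [].
 move: h => /(congr1 (fun x => 2 *: x)); rewrite /bpp scalerA mulfV// scale1r scaler0.
 by move=> /eqP; rewrite addr_eq0 => /eqP ->.
Qed.

Lemma bpp_comm U V (s : bop U U) (s' : bop V V) (W : bop U V) :
 bsa s -> bnd s 1 -> bsa s' -> bnd s' 1 -> W ** s = s' ** W -> W ** bpp s = bpp s' ** W.
Proof.
move=> ss sb ss' sb' h; rewrite /bpp bcZl bcZr bcDl bcDr h.
congr (_ *: (_ + _)); apply: bsqrt_comm; try exact: bsa_sq_ble1.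
by rewrite bcA h -bcA h bcA.
Qed.

End PosPart.

(** * Spectral windows of a positive contraction *)

Section Windows.
Context {R : realType} {U : rhilb R} (g : bop U U).
Hypothesis g1 : ble1 g.

Let sg : bsa g. Proof. by case: g1 => [[]]. Qed.

(** e is the spectral projection of g for the half-line from l on, obtained as the sign projection
    of g - l. *)
Lemma windows_cut (l : R) : 0 <= l <= 1 -> exists e : bop U U,
 [/\ bsa e, e ** e = e,
  (forall W : bop U U, W ** g = g ** W -> W^# ** g = g ** W^# -> W ** e = e ** W),
  forall u, l * ip (e u) (e u) <= ip (g (e u)) (e u) &
  forall u, ip (g (u - e u)) (u - e u) <= l * ip (u - e u) (u - e u)].
Proof.
move=> /andP[l0 l1]; pose s : bop U U := g - l *: bid.
have ss : bsa s by rewrite /bsa badjB badjZ badj1 sg.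
have sb : bnd s 1.
 apply: bsa_bnd => // u; rewrite bopBE bopZE /= !ipE mul1r.
 have := g1.1.2 u; have := g1.2 u; have := ip_ge0 u; rewrite ler_norml; nra.
have [_ [[aa pa] _] _] := bsqrt_spec (bsa_sq_ble1 ss sb).
have [e [se ee ce h2 h3]] := sign_proj ss sb.
have cs W : W ** g = g ** W -> W ** s = s ** W.
 by move=> h; rewrite bcBl bcBr h bcZl bcZr bc1l bc1r.
exists e; split=> // [W h h'|u|u]; first by apply: ce; exact: cs.
- have : (s ** e) u = (babs s ** e) u by rewrite h2.
 rewrite /= bopBE bopZE /= => h; have := pa (e u); rewrite -/(babs s) -h !ipE; lra.
- have : (s ** (bid - e)) u = (- (babs s ** (bid - e))) u by rewrite h3.
 rewrite bopNE /= !bopBE bopZE /= => h.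
 have := pa (u - e u); rewrite -/(babs s) -[babs s _]opprK -h !ipE; lra.
Qed.

Definition narrow (p : bop U U) (c t : R) :=
 [/\ bsa p, p ** p = p, g ** p = p ** g & forall u, nrm (g (p u) - c *: p u) <= t * nrm (p u)].

(** A finite substitute for the spectral theorem: consecutive cuts at k/N are subtracted. The cut at
    0 is set to 1 and the cut at N to 0, so that the sum telescopes to the identity. *)
Lemma windows (N : nat) : (0 < N)%N -> exists p : nat -> bop U U,
 (forall k, (k < N)%N -> narrow (p k) (k%:R / N%:R) N%:R^-1) /\
 \sum_(k < N) p k = bid.
Proof.
move=> N0; have NR : 0 < N%:R :> R by rewrite ltr0n.
have hl k : (k < N)%N -> 0 <= (k%:R / N%:R : R) <= 1.
 by move=> kN; rewrite divr_ge0//= ler_pdivrMr// mul1r ler_nat ltnW.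
have he k : {e : bop U U | [/\ bsa e, e ** e = e,
  (forall W : bop U U, W ** g = g ** W -> W^# ** g = g ** W^# -> W ** e = e ** W),
  ((k < N)%N -> forall u, k%:R / N%:R * ip (e u) (e u) <= ip (g (e u)) (e u)) &
  ((0 < k)%N -> forall u, ip (g (u - e u)) (u - e u) <= k%:R / N%:R * ip (u - e u) (u - e u))]
  /\ (k = 0%N -> e = bid) /\ ((N <= k)%N -> e = 0)}.
 apply: cid; case: k => [|k].
  exists bid; split; last by split=> //; rewrite leqn0 => /eqP N00; rewrite N00 in N0.
  split=> //; [exact: badj1|by rewrite bc1l|by move=> W _ _; rewrite bc1l bc1r|].
  by move=> _ u; rewrite /= mul0r mul0r; exact: g1.1.2.
 have [kN|Nk] := ltnP k.+1 N.
  by have [e [h1 h2 h3 h4 h5]] := windows_cut (hl _ kN); exists e; split; [split|].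
 exists 0; split; last by split.
 split.
 - exact: badj0.
 - by rewrite bc0l.
 - by move=> W _ _; rewrite bc0l bc0r.
 - by [].
 - move=> _ u; rewrite bop0E subr0; apply: le_trans (g1.2 u) _.
  by rewrite ler_peMl ?ip_ge0// ler_pdivlMr// mul1r ler_nat.
pose e k := sval (he k).
have [sa [idem [com [lo [hi [e0 eN]]]]]] : (forall k, bsa (e k)) /\ (forall k, e k ** e k = e k) /\
 (forall k (W : bop U U), W ** g = g ** W -> W^# ** g = g ** W^# -> W ** e k = e k ** W) /\
 (forall k, (k < N)%N -> forall u, k%:R / N%:R * ip (e k u) (e k u) <= ip (g (e k u)) (e k u)) /\
 (forall k, (0 < k)%N -> forall u, ip (g (u - e k u)) (u - e k u) <= k%:R / N%:R * ip (u - e k u) (u - e k u))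
 /\ e 0%N = bid /\ e N = 0.
 have hE k := svalP (he k); rewrite /e.
 split; first by move=> k; case: (hE k) => -[].
 split; first by move=> k; case: (hE k) => -[].
 split; first by move=> k; case: (hE k) => -[].
 split; first by move=> k; case: (hE k) => -[].
 split; first by move=> k; case: (hE k) => -[].
 by split; [case: (hE 0%N) => _ [->]|case: (hE N) => _ [_ ->]].
clearbody e.
have cg k : g ** e k = e k ** g by apply: com; rewrite ?sg.
have ce j k : e j ** e k = e k ** e j.
 by apply: com; rewrite ?sa cg.
have iE k w : e k (e k w) = e k w by rewrite -[LHS]/((e k ** e k) w) idem.
have cE j k w : e j (e k w) = e k (e j w) by rewrite -[LHS]/((e j ** e k) w) ce.
(* A vector under the cut at (k + 2)/N but orthogonal to the one at (k + 1)/N would have its form of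
   g both above the larger and below the smaller bound, so it vanishes. *)
have mono k : (k < N)%N -> e k ** e k.+1 = e k.+1.
 case: k => [|k] kN; first by rewrite e0 bc1l.
 have [kN2|] := ltnP k.+2 N; last first.
  move=> h; have -> : k.+2 = N by apply/eqP; rewrite eqn_leq kN h.
  by rewrite eN bc0r.
 apply: subr0_eq; apply: bopP => u; rewrite bop0E bopBE /=.
 apply/eqP; rewrite -oppr_eq0 opprB; apply/eqP.
 set v := e k.+2 u - _.
 have v1 : e k.+2 v = v by rewrite /v bB iE (cE k.+2) iE.
 have v2 : v - e k.+1 v = v by rewrite {2}/v bB iE subrr subr0.
 have h1 := lo k.+2 kN2 v; have h2 := hi k.+1 isT v; rewrite v1 in h1; rewrite v2 in h2.
 apply: ip_eq0; apply/eqP; rewrite eq_le ip_ge0 andbT leNgt; apply/negP => vp.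
 have := le_trans h1 h2; rewrite ler_pM2r// ler_pM2r ?invr_gt0//.
 by rewrite ler_nat ltnn.
pose p k := e k ** (bid - e k.+1).
have pE k : (k < N)%N -> p k = e k - e k.+1.
 by move=> kN; rewrite /p bcBr bc1r mono.
exists p; split; last first.
 rewrite (eq_bigr (fun k : 'I_N => - (e k.+1 - e k))); last by move=> k _; rewrite pE// opprB.
 rewrite sumrN -(big_mkord xpredT (fun k => e k.+1 - e k)) telescope_sumr//.
 by rewrite e0 eN sub0r opprK.
move=> k kN; have sp : bsa (p k) by rewrite /bsa pE// badjB !sa.
have pp : p k ** p k = p k.
 rewrite {1 2}pE// bcBl !bcBr !idem mono// ce mono// subrr subr0 pE//.
have gp : g ** p k = p k ** g by rewrite pE// bcBl bcBr !cg.
split=> // u.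
have epk w : e k (p k w) = p k w by rewrite /p /= iE.
have ep1 w : e k.+1 (p k w) = 0 by rewrite pE// bopBE bB iE -[e k.+1 (e k w)]cE -[X in X - _]/((e k ** e k.+1) w) mono// subrr.
have gpw w : g (p k w) = p k (g w) by rewrite -[LHS]/((g ** p k) w) gp.
have h1 := lo k kN; have h2 := hi k.+1 isT.
(* On the range of p k one has 0 <= g - k/N <= 1/N; the norm estimate is the one for the positive
   operator h. *)
pose h := (g - (k%:R / N%:R) *: bid) ** p k.
have hE w : h w = g (p k w) - (k%:R / N%:R) *: p k w by rewrite /h /= bopBE bopZE.
have ppw w : p k (p k w) = p k w by rewrite -[LHS]/((p k ** p k) w) pp.
have hip w : ip (h w) w = ip (g (p k w)) (p k w) - k%:R / N%:R * ip (p k w) (p k w).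
 rewrite hE ipDl ipNl ipZl; congr (_ - _ * _).
  by rewrite -{1}[p k w]ppw gpw bsaE.
 by rewrite -{1}[p k w]ppw bsaE.
clearbody p.
have hpos : bpos h.
 split; last by move=> w; rewrite hip subr_ge0; have := h1 (p k w); rewrite epk.
 by rewrite /bsa /h badjM badjB badjZ badj1 sg sp bcBl bcBr bcZl bcZr bc1l bc1r gp.
have hb : bnd h N%:R^-1.
 apply: bpos_bnd => // v.
 rewrite hip; have := h2 (p k v); rewrite ep1 subr0 -natr1 mulrDl mul1r mulrDl.
 have : ip (p k v) (p k v) <= ip v v.
  have := ip_ge0 (v - p k v); rewrite !ipE.
  have -> : ip (p k v) v = ip (p k v) (p k v) by rewrite -{1}ppw bsaE.
  by rewrite (ipC v (p k v)) -{1}ppw bsaE//; lra.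
 rewrite -(@ler_pM2l _ N%:R^-1) ?invr_gt0//.
 move: (N%:R^-1) => x; lra.
have -> : g (p k u) - (k%:R / N%:R) *: p k u = h (p k u) by rewrite hE ppw.
exact: hb.2.
Qed.

End Windows.

(** * Direct sums and bounded transforms of closed operators *)

Section Prod.
Context {R : realType}.
Implicit Types U V W : rhilb R.

Section Rprod.
Variables U V : rhilb R.
Definition pip (p q : U * V) : R := ip p.1 q.1 + ip p.2 q.2.
Fact pipC p q : pip p q = pip q p.
Proof. by rewrite /pip (ipC p.1) (ipC p.2). Qed.
Fact pipDl p q r : pip (p + q) r = pip p r + pip q r.
Proof. by rewrite /pip /= !ipE; ring. Qed.
Fact pipZl c p q : pip (c *: p) q = c * pip p q.
Proof. by rewrite /pip /= !ipE; ring. Qed.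
Fact pip_ge0 p : 0 <= pip p p.
Proof. by rewrite addr_ge0 ?ip_ge0. Qed.
Fact pip_eq0 p : pip p p = 0 -> p = 0.
Proof.
move=> /eqP; rewrite paddr_eq0 ?ip_ge0// => /andP[/eqP/ip_eq0 h1 /eqP/ip_eq0 h2].
by case: p h1 h2 => a b /= -> ->.
Qed.
Fact pip_complete (x : nat -> U * V) :
 (forall e : R, 0 < e -> exists N : nat, forall m n, (N <= m)%N -> (N <= n)%N ->
   pip (x m - x n) (x m - x n) < e) ->
 exists l, forall e : R, 0 < e -> exists N : nat, forall n, (N <= n)%N ->
   pip (x n - l) (x n - l) < e.
Proof.
move=> h.
have [l1 h1] : exists l, conv (fun n => (x n).1) l.
 apply: cau_conv => e e0; have [|N hN] := h (e ^+ 2); first by rewrite exprn_gt0.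
 exists N => m n hm hn; rewrite nrm_lt//; have := hN m n hm hn.
 rewrite /pip /=; have := ip_ge0 ((x m).2 - (x n).2); lra.
have [l2 h2] : exists l, conv (fun n => (x n).2) l.
 apply: cau_conv => e e0; have [|N hN] := h (e ^+ 2); first by rewrite exprn_gt0.
 exists N => m n hm hn; rewrite nrm_lt//; have := hN m n hm hn.
 rewrite /pip /=; have := ip_ge0 ((x m).1 - (x n).1); lra.
exists (l1, l2) => e e0; have s0 : 0 < Num.sqrt (e / 2) by rewrite sqrtr_gt0 divr_gt0.
have [N1 g1] := h1 _ s0; have [N2 g2] := h2 _ s0.
exists (maxn N1 N2) => n; rewrite geq_max => /andP[/g1 + /g2].
by rewrite !nrm_lt// sqr_sqrtr ?divr_ge0 ?ltW// /pip /=; lra.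
Qed.
Definition rprod := RHilb pipC pipDl pipZl pip_ge0 pip_eq0 pip_complete.
End Rprod.

Lemma nrm_fst U V (p : rprod U V) : nrm p.1 <= nrm p.
Proof. by rewrite /nrm ler_wsqrtr// /ip /= /pip lerDl ip_ge0. Qed.
Lemma nrm_snd U V (p : rprod U V) : nrm p.2 <= nrm p.
Proof. by rewrite /nrm ler_wsqrtr// /ip /= /pip lerDr ip_ge0. Qed.
Lemma ip_prod U V (p q : rprod U V) : ip p q = ip p.1 q.1 + ip p.2 q.2.
Proof. by []. Qed.
Lemma nrm_prod_le U V (p : rprod U V) : nrm p <= nrm p.1 + nrm p.2.
Proof.
apply: sq_le; first by rewrite addr_ge0 ?nrm_ge0.
rewrite nrm2 ip_prod sqrrD !nrm2.
by have := mulr_ge0 (nrm_ge0 p.1) (nrm_ge0 p.2); lra.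
Qed.
Lemma prod_eq U V (p q : rprod U V) : p.1 = q.1 -> p.2 = q.2 -> p = q.
Proof. by case: p q => [a b] [c d] /= -> ->. Qed.

Section Inj.
Variables U V : rhilb R.
Fact pfst_lin (c : R) (u v : rprod U V) : (c *: u + v).1 = c *: u.1 + v.1. Proof. by []. Qed.
Fact pfst_bd (u : rprod U V) : nrm u.1 <= 1 * nrm u. Proof. by rewrite mul1r nrm_fst. Qed.
Definition pfst : bop (rprod U V) U := mkbop pfst_lin ler01 pfst_bd.
Fact psnd_lin (c : R) (u v : rprod U V) : (c *: u + v).2 = c *: u.2 + v.2. Proof. by []. Qed.
Fact psnd_bd (u : rprod U V) : nrm u.2 <= 1 * nrm u. Proof. by rewrite mul1r nrm_snd. Qed.
Definition psnd : bop (rprod U V) V := mkbop psnd_lin ler01 psnd_bd.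
Definition pinl : bop U (rprod U V) := pfst^#.
Definition pinr : bop V (rprod U V) := psnd^#.
Lemma pinlE u : pinl u = (u, 0).
Proof. by apply: ip_inj => w; rewrite /pinl -badjEr ip_prod /= ip0l addr0. Qed.
Lemma pinrE u : pinr u = (0, u).
Proof. by apply: ip_inj => w; rewrite /pinr -badjEr ip_prod /= ip0l add0r. Qed.
End Inj.

(** For the graph of [T] one has [C = (1 + T* T)^-1], [C' = (1 + T T* )^-1] and [B = T C = C' T]. *)
Lemma graph_ops U V (G : set (rprod U V)) : subsp G -> sclosed G ->
 exists (C : bop U U) (B : bop U V) (C' : bop V V),
 [/\ [/\ ble1 C, ble1 C', B^# ** B = C - C ** C, B ** B^# = C' - C' ** C' & B ** C = C' ** B],
   [/\ forall u v, G (u, v) -> B u = C' v /\ C u + B^# v = u,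
   forall u v, (forall p, G p -> ip p.1 u + ip p.2 v = 0) ->
     C u + B^# v = 0 /\ B u + v = C' v,
   forall u, C u = 0 -> forall p, G p -> ip u p.1 = 0 &
   forall v, C' v = 0 -> G (0, v)] &
   forall (X : bop U U) (Y : bop V V), (forall p, G p -> G (X p.1, Y p.2)) ->
    (forall p, G p -> G (X^# p.1, Y^# p.2)) ->
    [/\ X ** C = C ** X, Y ** B = B ** X & Y ** C' = C' ** Y]].
Proof.
move=> sG cG; have [P [sP PP GP PG oP]] := bproj_exists sG cG.
pose i1 := pinl U V; pose i2 := pinr U V; pose p1 := pfst U V; pose p2 := psnd U V.
have dec q : q = i1 (p1 q) + i2 (p2 q).
 by rewrite /i1 /i2 pinlE pinrE; apply: prod_eq => /=; rewrite ?addr0 ?add0r.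
have i1p u v : i1 u + i2 v = (u, v).
 by rewrite /i1 /i2 pinlE pinrE; apply: prod_eq => /=; rewrite ?addr0 ?add0r.
have p1i2 v : p1 (i2 v) = 0 by rewrite /i2 pinrE.
have p2i1 v : p2 (i1 v) = 0 by rewrite /i1 pinlE.
have p1i1 v : p1 (i1 v) = v by rewrite /i1 pinlE.
have p2i2 v : p2 (i2 v) = v by rewrite /i2 pinrE.
have i1a : i1^# = p1 by rewrite badjK.
have i2a : i2^# = p2 by rewrite badjK.
pose C : bop U U := p1 ** P ** i1; pose B : bop U V := p2 ** P ** i1.
pose D : bop V V := p2 ** P ** i2; pose C' : bop V V := bid - D.
have Ba : B^# = p1 ** P ** i2 by rewrite /B !badjM i1a sP bcA.
have sC : bsa C by rewrite /bsa /C !badjM i1a sP bcA.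
have sD : bsa D by rewrite /bsa /D !badjM i2a sP bcA.
have PE q : P q = i1 (C (p1 q) + B^# (p2 q)) + i2 (B (p1 q) + D (p2 q)).
 have E : P q = P (i1 (p1 q)) + P (i2 (p2 q)) by rewrite -bD -dec.
 by rewrite [LHS]dec; congr (i1 _ + i2 _); rewrite E bD ?Ba.
have PPE q : P (P q) = P q by rewrite -[LHS]/((P ** P) q) PP.
have CE u : ip (C u) u = ip (P (i1 u)) (P (i1 u)).
 by rewrite -[C u]/(p1 (P (i1 u))) badjE -i1a badjK -{1}PPE (bsaE _ _ sP).
have DE v : ip (D v) v = ip (P (i2 v)) (P (i2 v)).
 by rewrite -[D v]/(p2 (P (i2 v))) badjE -i2a badjK -{1}PPE (bsaE _ _ sP).
have i1n u : ip (i1 u) (i1 u) = ip u u by rewrite badjEr -/i1 i1a p1i1.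
have i2n u : ip (i2 u) (i2 u) = ip u u by rewrite badjEr -/i2 i2a p2i2.
have hC u : C u = p1 (P (i1 u)) by [].
have hB u : B u = p2 (P (i1 u)) by [].
have hD u : D u = p2 (P (i2 u)) by [].
have hC' v : C' v = v - D v by rewrite /C' bopBE.
have C'E : C' = bid - D by [].
have p1E q : p1 q = q.1 by [].
have p2E q : p2 q = q.2 by [].
have i2E v : i2 v = (0, v) by exact: pinrE.
clearbody C B D C' p1 p2 i1 i2.
have E1 u : P (i1 u) = i1 (C u) + i2 (B u) by rewrite PE p1i1 p2i1 !b0 !addr0.
have E2 v : P (i2 v) = i1 (B^# v) + i2 (D v) by rewrite PE p1i2 p2i2 !b0 !add0r.
have e1 : B^# ** B = C - C ** C.
 apply: bopP => u; have := PPE (i1 u); rewrite [P (i1 u) in LHS]E1 bD E1 E2.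
 rewrite E1 => /(congr1 p1); rewrite !bD !p1i1 !p1i2 !addr0 bopBE /= => h.
 by rewrite -{1}h addrAC subrr add0r.
have e2 : B ** C = C' ** B.
 apply: bopP => u; have := PPE (i1 u); rewrite [P (i1 u) in LHS]E1 bD E1 E2.
 rewrite E1 => /(congr1 p2); rewrite !bD !p2i1 !p2i2 !add0r /= hC' => h.
 by rewrite -{1}h addrK.
have e3 : B ** B^# = C' - C' ** C'.
 apply: bopP => v; have := PPE (i2 v); rewrite [P (i2 v) in LHS]E2 bD E1 E2.
 rewrite E2 => /(congr1 p2); rewrite !bD !p2i1 !p2i2 !add0r /= => h.
 by rewrite !bopBE /= !hC' bB -{2}h; vring.
have le q : ip (P q) (P q) <= ip q q.
 have h : ip (P q) q = ip (P q) (P q) by rewrite -{1}PPE (bsaE _ _ sP).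
 by have := ip_ge0 (q - P q); rewrite !ipE (ipC q) h; lra.
have C1 : ble1 C.
 split; first by split=> // u; rewrite CE ip_ge0.
 by move=> u; rewrite CE -(i1n u).
have D1 : ble1 D.
 split; first by split=> // u; rewrite DE ip_ge0.
 by move=> u; rewrite DE -(i2n u).
exists C, B, C'; split.
- by split=> //; rewrite C'E; exact: ble1_compl.
- split.
 + move=> u v /PG h0; split.
   move: h0; rewrite PE => /(congr1 p2); rewrite (bD p2) p2i1 p2i2 add0r.
   by rewrite !p1E !p2E hC' /= => h; rewrite -{1}h addrK.
  by move: h0; rewrite PE => /(congr1 p1); rewrite (bD p1) p1i1 p1i2 addr0 !p1E p2E.
 + move=> u v h; have : P (u, v) = 0.
   apply: ip_eq0; rewrite (bsaE _ _ sP) PPE ipC ip_prod /=; exact: h.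
  rewrite PE p1E p2E /= => h0; split; have := h0.
   by move=> /(congr1 p1); rewrite (bD p1) p1i1 p1i2 addr0 b0.
  move=> /(congr1 p2); rewrite (bD p2) p2i1 p2i2 add0r hC' b0 => h1.
  by rewrite -[LHS]subr0 -h1; vring.
 + move=> u Cu p Gp; have : P (i1 u) = 0 by apply: ip_eq0; rewrite -CE Cu ip0l.
  move=> h; have : ip (P (i1 u)) p = 0 by rewrite h ip0l.
  by rewrite (bsaE _ _ sP) (PG _ Gp) badjE i1a p1E.
 + move=> v C'v; suff -> : (0, v) = P (i2 v) by exact: GP.
  have h : ip (P (i2 v)) (P (i2 v)) = ip v v.
   have : ip (C' v) v = 0 by rewrite C'v ip0l.
   rewrite hC' !ipE DE; lra.
  have h2 : i2 v - P (i2 v) = 0.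
   apply: ip_eq0; have h3 : ip (P (i2 v)) (i2 v) = ip (P (i2 v)) (P (i2 v)).
    by rewrite -{1}PPE (bsaE _ _ sP).
   by rewrite !ipE (ipC (i2 v)) h3 h i2n; ring.
  by rewrite -i2E; apply/eqP; rewrite -subr_eq0 h2.
- move=> X Y h1 h2; pose Z : bop (rprod U V) (rprod U V) := i1 ** X ** p1 + i2 ** Y ** p2.
 have ZE q : Z q = (X q.1, Y q.2) by rewrite bopDE /= p1E p2E i1p.
 have i1a' : p1^# = i1 by rewrite -i1a badjK.
 have i2a' : p2^# = i2 by rewrite -i2a badjK.
 have ZaE q : Z^# q = (X^# q.1, Y^# q.2).
  by rewrite badjD !badjM i1a i2a i1a' i2a' bopDE /= p1E p2E i1p.
 have ZP : Z ** P = P ** Z.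
  apply: (bproj_comm sP GP PG) => u /=; first by rewrite ZE; exact: h1.
  by rewrite ZaE; exact: h2.
 have hZ q : Z (P q) = P (Z q) by rewrite -[LHS]/((Z ** P) q) ZP.
 have Z1 u : Z (i1 u) = i1 (X u) by rewrite bopDE /= p1i1 p2i1 !b0 addr0.
 have Z2 u : Z (i2 u) = i2 (Y u) by rewrite bopDE /= p1i2 p2i2 !b0 add0r.
 have p1Z q : p1 (Z q) = X (p1 q) by rewrite ZE !p1E.
 have p2Z q : p2 (Z q) = Y (p2 q) by rewrite ZE !p2E.
 split; apply: bopP => u.
 + by rewrite /= !hC -p1Z hZ Z1.
 + by rewrite /= !hB -p2Z hZ Z1.
 + by rewrite /= !hC' bB !hD -p2Z hZ Z2.
Qed.

End Prod.

(** * Tomita's commutation theorem *)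

Section Triples.
Context {R : realType} {K : rhilb R}.
Implicit Types (A B : bop K K -> K -> K -> Prop).

(** A triple [(X, x, x')] stands for left multiplication X by x in a left Hilbert algebra, with x'
    the image of x under the involution. [perp A] then collects the right multiplications Q by h
    whose adjoint is the one by h'. Carrying the operator with both vectors keeps unbounded
    operators out of the axioms. *)
Definition perp A : bop K K -> K -> K -> Prop := fun Q h h' =>
 forall X x x', A X x x' -> [/\ X h = Q x, X^# h = Q x', X h' = Q^# x & X^# h' = Q^# x'].

Definition tstar A := forall X x x', A X x x' -> A X^# x' x.
Definition tlin A := A 0 0 0 /\ forall c X x x' Y y y', A X x x' -> A Y y y' ->
 A (c *: X + Y) (c *: x + y) (c *: x' + y').
Definition tmul A := forall X x x' Y y y', A X x x' -> A Y y y' ->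
 A (X ** Y) (X y) (Y^# x').
Definition tvec A : set K := [set x | exists X x', A X x x'].
Definition tnd A := forall k, (forall X x x', A X x x' -> X k = 0) -> k = 0.

Lemma perp_star A : tstar (perp A).
Proof. by move=> Q h h' hQ X x x' /hQ [h1 h2 h3 h4]; split; rewrite ?badjK. Qed.

Lemma perp_lin A : tlin (perp A).
Proof.
split=> [X x x' _|c Q q q' P p p' hQ hP X x x' hX]; first by rewrite badj0 !b0 !bop0E.
have [h1 h2 h3 h4] := hQ _ _ _ hX; have [h5 h6 h7 h8] := hP _ _ _ hX.
by rewrite badjD badjZ !bopDE !bopZE !bop_lin h1 h2 h3 h4 h5 h6 h7 h8.
Qed.

Lemma perp_sub A : tstar A -> forall X x x', A X x x' -> perp (perp A) X x x'.
Proof. by move=> sA X x x' hX Q q q' hQ; have [h1 h2 h3 h4] := hQ _ _ _ hX. Qed.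

(** On the dense set of vectors y one has X (Q y) = X (Y q) = (X Y) q = Q (X y). *)
Lemma perp_comm A : tstar A -> tmul A -> dns (tvec A) ->
 forall X x x' Q q q', A X x x' -> perp A Q q q' -> X ** Q = Q ** X.
Proof.
move=> sA mA dA X x x' Q q q' hX hQ; apply: (bop_eq_dns dA) => y [Y [y' hY]] /=.
have [h1 _ _ _] := hQ _ _ _ (mA _ _ _ _ _ _ hX hY).
by have [<- _ _ _] := hQ _ _ _ hY; rewrite -h1.
Qed.

Lemma perp_mul A : tstar A -> tmul A -> dns (tvec A) -> tmul (perp A).
Proof.
move=> sA mA dA Q q q' P p p' hQ hP X x x' hX.
have c Y y y' Z z z' (hY : A Y y y') (hZ : perp A Z z z') u : Y (Z u) = Z (Y u).
 by rewrite -[LHS]/((Y ** Z) u) (perp_comm sA mA dA hY hZ).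
have [h1 h2 h3 h4] := hQ _ _ _ hX; have [h5 h6 h7 h8] := hP _ _ _ hX.
have sX := sA _ _ _ hX; have sQ := perp_star hQ; have sP := perp_star hP.
rewrite badjM /=; split.
- by rewrite (c _ _ _ _ _ _ hX hQ) h5.
- by rewrite (c _ _ _ _ _ _ sX hQ) h6.
- by rewrite (c _ _ _ _ _ _ hX sP) h3.
- by rewrite (c _ _ _ _ _ _ sX sP) h4.
Qed.

(** The closure of [x |-> X z] is an operator affiliated with the commutant of
  [A]; its bounded transforms give elements of [perp A]. *)
Lemma cut A z z' : tlin A -> tstar A -> tmul A -> dns (tvec A) ->
 (forall X x x' Y y y', A X x x' -> A Y y y' -> ip (X z) y = ip x (Y z')) ->
 exists (C B C' : bop K K),
 [/\ [/\ ble1 C, ble1 C', B^# ** B = C - C ** C, B ** B^# = C' - C' ** C' & B ** C = C' ** B],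
   forall X x x', A X x x' -> [/\ B x = C' (X z), C x + B^# (X z) = x, B^# x = C (X z') &
    C' x + B (X z') = x],
   forall X x x', A X x x' -> [/\ X ** C = C ** X, X ** B = B ** X & X ** C' = C' ** X],
   (forall u, C u = 0 -> u = 0) /\ (forall u, C' u = 0 -> u = 0) &
   perp A B (C' z) (C z')].
Proof.
move=> lA sA mA dA fa.
pose G0 : set (rprod K K) := [set p | exists X x', A X p.1 x' /\ p.2 = X z].
have sG0 : subsp G0.
 split; first by exists 0, 0; split; [exact: lA.1|rewrite bop0E].
 move=> c [x1 x2] [y1 y2] [X [x' /= [hX ->]]] [Y [y' /= [hY ->]]].
 exists (c *: X + Y), (c *: x' + y'); split; first exact: lA.2.
 by rewrite bopDE bopZE.
pose G := scl G0.
have [C [B [C' [h1 [h2 h3 h4 h5] h6]]]] := graph_ops (scl_subsp sG0) (@scl_closed _ _ G0).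
have G0G X x x' : A X x x' -> G (x, X z) by move=> hX; apply: sub_scl; exists X, x'.
have ext (p q : rprod K K) : (forall r, G0 r -> ip r q = 0) -> G p -> ip p q = 0.
 move=> h /scl_seq[x hx cx]; apply: (conv_ip_eq cx) => n; exact: h.
have cm X x x' : A X x x' -> [/\ X ** C = C ** X, X ** B = B ** X & X ** C' = C' ** X].
 have inv Y y y' p : A Y y y' -> G p -> G (Y p.1, Y p.2).
  move=> hY /scl_seq[w hw cw].
  apply: (@scl_closed _ _ G0 (fun n => (Y (w n).1, Y (w n).2))) => [n|].
   apply: sub_scl; have [W [w' [hW ->]]] := hw n.
   by exists (Y ** W), (W^# y'); split=> //=; exact: mA hY hW.
  have [D [D0 hD]] := bop_bnd Y.
  apply: (@conv_le _ _ _ _ (D + D) (fun n => nrm (w n - p))) => [|n|//].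
   exact: addr_ge0.
  apply: le_trans (nrm_prod_le _) _; rewrite /= -!bB mulrDl; apply: lerD.
   by apply: le_trans (hD _) _; rewrite ler_wpM2l// -[(w n).1 - p.1]/((w n - p).1) nrm_fst.
  by apply: le_trans (hD _) _; rewrite ler_wpM2l// -[(w n).2 - p.2]/((w n - p).2) nrm_snd.
 move=> hX; apply: h6 => p Gp; first exact: inv hX Gp.
 exact: inv (sA _ _ _ hX) Gp.
(* The pair (x, X z) lies in G, and (- X z', x) is orthogonal to G by [fa]. The clauses of
   [graph_ops] for these two cases give the four relations. *)
have rel X x x' : A X x x' -> [/\ B x = C' (X z), C x + B^# (X z) = x, B^# x = C (X z') &
    C' x + B (X z') = x].
 move=> hX; have [e1 e2] := h2 _ _ (G0G _ _ _ hX); split=> //.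
  have [|e3 e4] := h3 (- X z') x.
   move=> p Gp; apply: (@ext p (- X z', x)) => // r [Y [y' [hY E]]].
   by rewrite ip_prod E ipNr (fa _ _ _ _ _ _ hY hX) addrC subrr.
  by move: e3; rewrite bN => /eqP; rewrite addrC subr_eq0 => /eqP.
 have [|e3 e4] := h3 (- X z') x.
  move=> p Gp; apply: (@ext p (- X z', x)) => // r [Y [y' [hY E]]].
  by rewrite ip_prod E ipNr (fa _ _ _ _ _ _ hY hX) addrC subrr.
 by rewrite -e4 bN addrAC addNr add0r.
exists C, B, C'; split=> //.
- split=> u hu.
  apply: (dns_orth dA) => x [X [x' hX]].
  exact: (h4 _ hu _ (G0G _ _ _ hX)).
 apply: (dns_orth dA) => x [X [x' hX]].
 have : ip ((0, u) : rprod K K) (- X z', x) = 0.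
  apply: ext (h5 _ hu) => r [Y [y' [hY E]]].
  by rewrite ip_prod E ipNr (fa _ _ _ _ _ _ hY hX) addrC subrr.
 by rewrite ip_prod ip0l add0r.
- move=> X x x' hX; have sX := sA _ _ _ hX.
 have [c1 c2 c3] := cm _ _ _ hX; have [c4 c5 c6] := cm _ _ _ sX.
 have [r1 _ r3 _] := rel _ _ _ hX; have [q1 _ q3 _] := rel _ _ _ sX.
 rewrite r1 r3 q1 q3; split.
 + by rewrite -[LHS]/((X ** C') z) c3.
 + by rewrite -[LHS]/((X^# ** C') z) c6.
 + by rewrite -[LHS]/((X ** C) z') c1.
 + by rewrite -[LHS]/((X^# ** C) z') c4.
Qed.

(** The closure of the set of all Q x is invariant under A, so every Q kills the component of x
    orthogonal to it, and nondegeneracy removes that component. *)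
Lemma nd_approx A x : tlin A -> tstar A -> tmul A -> tnd A ->
 scl [set u | exists Q q q', A Q q q' /\ u = Q x] x.
Proof.
move=> lA sA mA nA; set L := [set u | _].
have sL : subsp L.
 split; first by exists 0, 0, 0; rewrite bop0E; split=> //; exact: lA.1.
 move=> c _ _ [Q [q [q' [hQ ->]]]] [P [p [p' [hP ->]]]].
 exists (c *: Q + P), (c *: q + p), (c *: q' + p'); split; first exact: lA.2.
 by rewrite bopDE bopZE.
have inv Q q q' : A Q q q' -> forall u, scl L u -> scl L (Q u).
 move=> hQ u /scl_seq[w hw cw].
 apply: (scl_closed _ (bop_conv Q cw)) => n; apply: sub_scl.
 have [P [p [p' [hP ->]]]] := hw n.
 by exists (Q ** P), (Q p), (P^# q'); split=> //; exact: (mA _ _ _ _ _ _ hQ hP).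
have [a La ha] := projection x (scl_subsp sL) (@scl_closed _ _ L).
suff -> : x = a by [].
apply: subr0_eq; apply: nA => Q q q' hQ.
have LQ : scl L (Q (x - a)).
 rewrite bB; apply: (@subspB _ _ (scl L)); first exact: scl_subsp.
  by apply: sub_scl; exists Q, q, q'.
 exact: inv hQ _ La.
by apply: ip_eq0; rewrite badjE ha//; apply: inv (sA _ _ _ hQ) _ LQ.
Qed.

Lemma binv_comm (a b W : bop K K) : a ** b = bid -> b ** a = bid -> W ** a = a ** W ->
 W ** b = b ** W.
Proof.
move=> h1 h2 h; rewrite -[W ** b]bc1l -h2 -bcA (bcA a) -h -bcA h1.
by rewrite bc1r.
Qed.

Lemma eps_inv (x : bop K K) (e : R) : 0 < e -> exists m : bop K K,
 [/\ (x^# ** x + e *: bid) ** m = bid, m ** (x^# ** x + e *: bid) = bid,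
   bsa m & bnd m e^-1].
Proof.
move=> e0; have [|//|u|m [h1 h2 h3 h4]] := @binv_exists _ _ (x^# ** x + e *: bid) e.
- by rewrite /bsa badjD badjM badjK badjZ badj1.
- by rewrite bopDE bopZE /= !ipE -badjEr lerDr ip_ge0.
- by exists m.
Qed.

(** The conclusion makes the involutions of the two algebras formally adjoint. With X regularised by
    X X^# (X X^# + e)^-1 it follows from the relations of [perp] alone ([id1]). The error e (X X^# +
    e)^-1 x tends to 0, because x is close to some P x = X p and e X (X^# X + e)^-1 has norm of the
    order of the square root of e. *)
Lemma perp_pair A B : (forall X x x', A X x x' <-> perp B X x x') ->
 (forall X x x', B X x x' <-> perp A X x x') ->
 tmul A -> tmul B -> dns (tvec A) -> dns (tvec B) -> tnd B ->
 forall X x x' Q q q', A X x x' -> B Q q q' -> ip q x = ip q' x'.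
Proof.
move=> hA hB mA mB dA dB nB X x x' Q q q' hX hQ.
have sA : tstar A by move=> Y y y' /hA/perp_star/hA.
have sB : tstar B by move=> Y y y' /hB/perp_star/hB.
have lB : tlin B by split; [exact/hB/(perp_lin A).1|move=> *; apply/hB/(perp_lin A).2; exact/hB].
have cm Y y y' P p p' : A Y y y' -> B P p p' -> P ** Y = Y ** P.
 by move=> hY hP; have := perp_comm sA mA dA hY (iffLR (hB _ _ _) hP).
have key (e : R) : 0 < e -> exists m m' : bop K K,
  [/\ [/\ bnd m e^-1, bnd m' e^-1, bsa m & bsa m'], X ** m = m' ** X,
   forall P p p', B P p p' -> P ** m = m ** P /\ P ** m' = m' ** P,
   (forall u, X (X^# (m' u)) = u - e *: m' u) /\
   (forall u, m (X^# (X u)) = u - e *: m u) &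
   bnd (X ** m) (Num.sqrt e^-1) /\ bnd (X^# ** m') (Num.sqrt e^-1)].
 move=> e0; have [m [m1 m2 m3 m4]] := eps_inv X e0.
 have [m' [n1 n2 n3 n4]] := eps_inv X^# e0; rewrite badjK in n1 n2.
 have bd (Y w : bop K K) : (Y^# ** Y + e *: bid) ** w = bid -> bnd w e^-1 ->
   bnd (Y ** w) (Num.sqrt e^-1).
  move=> h1 h2; split; first exact: sqrtr_ge0.
  move=> u /=; apply: sq_le; first by rewrite mulr_ge0 ?sqrtr_ge0 ?nrm_ge0.
  rewrite exprMn !nrm2 sqr_sqrtr ?invr_ge0; last exact: ltW.
  rewrite badjEr ipC.
  have E : Y^# (Y (w u)) = u - e *: w u.
   by have := bop_at u h1; rewrite /= bopDE bopZE /= => /(canRL (addrK _)).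
  rewrite E !ipE mulrC; apply: le_trans (_ : ip (w u) u <= _).
   by rewrite gerBl mulr_ge0 ?ip_ge0// ltW.
  exact: bnd_form.
 exists m, m'; split=> //.
 - apply: bopP => u; have : ((m' ** (X ** X^# + e *: bid)) ** (X ** m)) u =
   ((m' ** X) ** ((X^# ** X + e *: bid) ** m)) u.
   by rewrite /= !bopDE !bopZE /= !bD !bZ.
  by rewrite n2 m1 bc1l bc1r.
 - move=> P p p' hP; have h1 := cm _ _ _ _ _ _ hX hP; have h2 := cm _ _ _ _ _ _ (sA _ _ _ hX) hP.
  split.
   apply: (binv_comm m1 m2); rewrite bcDl bcDr bcZl bcZr bc1l bc1r.
   by rewrite bcA h2 -bcA h1 bcA.
  apply: (binv_comm n1 n2); rewrite bcDl bcDr bcZl bcZr bc1l bc1r.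
  by rewrite bcA h1 -bcA h2 bcA.
 - split=> u.
   by have := bop_at u n1; rewrite /= bopDE bopZE /= => /(canRL (addrK _)).
  by have := bop_at u m2; rewrite /= bopDE bopZE /= bD bZ => /(canRL (addrK _)).
 - by split; apply: bd => //; rewrite badjK.
have id1 (e : R) (e0 : 0 < e) m m' : X ** m = m' ** X ->
   (forall P p p', B P p p' -> P ** m = m ** P /\ P ** m' = m' ** P) ->
   bsa m -> ip q (X (X^# (m' x))) = ip (m (X^# (X x'))) q'.
 move=> h1 h2 sm.
 have hm : perp B (X ** m) (m' x) (m x').
  move=> P p p' hP; have [c1 c2] := h2 _ _ _ hP; have [c3 c4] := h2 _ _ _ (sB _ _ _ hP).
  have [r1 r2 r3 r4] := (iffLR (hB _ _ _) hP) _ _ _ hX.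
  have s3 : X^# ** m'^# = m ** X^# by have := congr1 (@badj _ _ _) h1; rewrite !badjM sm.
  rewrite badjM sm; split.
  + by rewrite -[LHS]/((P ** m') x) c2 /= -r1 -[RHS]/((X ** m) p) h1.
  + by rewrite -[LHS]/((P^# ** m') x) c4 /= -r3 -[RHS]/((X ** m) p') h1.
  + by rewrite -[LHS]/((P ** m) x') c1 /= -r2.
  + by rewrite -[LHS]/((P^# ** m) x') c3 /= -r4.
 have hm' := iffRL (hA _ _ _) hm.
 have hY := mA _ _ _ _ _ _ hX (sA _ _ _ hX).
 rewrite badjK in hY.
 have [r1 _ _ _] := (iffLR (hB _ _ _) hQ) _ _ _ hY.
 have [_ _ r3 _] := (iffLR (hB _ _ _) hQ) _ _ _ hm'.
 rewrite badjEr -badjE -[X (X^# q)]/((X ** X^#) q) r1 badjE -r3 /= badjEr.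
 by rewrite -(bsaE _ _ sm).
have bound (d : R) : 0 < d -> `|ip q x - ip q' x'| <= (2 * (nrm q + nrm q')) * d.
 move=> d0.
 have [_ [P [p [p' [hP ->]]]] hx] := nd_approx x lB sB mB nB d0.
 have [_ [P' [r [r' [hP' ->]]]] hx'] := nd_approx x' lB sB mB nB d0.
 have [p1 _ _ _] := (iffLR (hB _ _ _) hP) _ _ _ hX.
 have [_ p2 _ _] := (iffLR (hB _ _ _) hP') _ _ _ hX.
 rewrite -p1 in hx; rewrite -p2 in hx'.
 have np : 0 < nrm p + nrm r + 1 by have := nrm_ge0 p; have := nrm_ge0 r; lra.
 (* The regularisation parameter is e = t^2; p and r depend on d, and t is taken so small that t |p|
    and t |r| are at most d. *)
 pose t := d / (nrm p + nrm r + 1); have t0 : 0 < t by rewrite divr_gt0.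
 have e0 : 0 < t ^+ 2 by rewrite exprn_gt0.
 have tE : t * (nrm p + nrm r + 1) = d by rewrite divfK// lt0r_neq0.
 have tp : t * nrm p <= d.
  by rewrite -[leRHS]tE; apply: ler_wpM2l; [exact: ltW|have := nrm_ge0 r; lra].
 have tr : t * nrm r <= d.
  by rewrite -[leRHS]tE; apply: ler_wpM2l; [exact: ltW|have := nrm_ge0 p; lra].
 have [m [m' [[bm bm' sm sm'] h1 h2 [h3 h4] [h5 h6]]]] := key _ e0.
 have := id1 _ e0 _ _ h1 h2 sm; rewrite h3 h4 => E.
 have sq : Num.sqrt (t ^+ 2)^-1 = t^-1.
  by rewrite -exprVn sqrtr_sqr ger0_norm// invr_ge0 ltW.
 have small (Y w w' : bop K K) v y : bnd w' (t ^+ 2)^-1 -> bnd (Y ** w) (Num.sqrt (t ^+ 2)^-1) ->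
   Y ** w = w' ** Y -> t * nrm v <= d -> nrm (y - Y v) < d -> nrm (t ^+ 2 *: w' y) <= 2 * d.
  move=> b1 b2 c tv yd; rewrite -[y](subrK (Y v)) bD scalerDr.
  apply: le_trans (nrmD _ _) _; rewrite !nrmZ ger0_norm; last exact: ltW.
  have : t ^+ 2 * nrm (w' (y - Y v)) <= d.
   rewrite mulrC -ler_pdivlMr// mulrC; apply: le_trans (b1.2 _) _.
   by apply: ler_wpM2l; rewrite ?invr_ge0; exact: ltW.
  have : t ^+ 2 * nrm (w' (Y v)) <= d; last by lra.
  rewrite -[w' (Y v)]/((w' ** Y) v) -c; apply: le_trans _ tv.
  rewrite expr2 -mulrA; apply: ler_wpM2l; first exact: ltW.
  rewrite mulrC -ler_pdivlMr// mulrC.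
  by have := b2.2 v; rewrite sq.
 have s1 := small X m m' p x bm' h5 h1 tp hx.
 have c2 : X^# ** m' = m ** X^#.
  by have := congr1 (@badj _ _ _) h1; rewrite !badjM sm sm'.
 have s2 := small X^# m' m r x' bm h6 c2 tr hx'.
 have -> : ip q x - ip q' x' = ip q (t ^+ 2 *: m' x) - ip (t ^+ 2 *: m x') q'.
  by move: E; rewrite (ipC q' x') ipDr ipDl ipNl ipNr; lra.
 apply: le_trans (ler_normB _ _) _; rewrite mulrDr mulrDl; apply: lerD.
  apply: le_trans (CSabs _ _) _; rewrite mulrAC mulrC [leRHS]mulrC.
  by rewrite mulrC [leRHS]mulrC [2 * d * _]mulrC ler_wpM2l ?nrm_ge0.
 apply: le_trans (CSabs _ _) _; rewrite mulrAC.
 by rewrite ler_wpM2r ?nrm_ge0.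
apply/eqP; rewrite -subr_eq0 -normr_eq0 eq_le normr_ge0 andbT.
apply: eps_le => e e0; rewrite add0r.
have c0 : 0 < 2 * (nrm q + nrm q') + 1 by have := nrm_ge0 q; have := nrm_ge0 q'; lra.
apply: le_trans (bound (e / (2 * (nrm q + nrm q') + 1)) _) _; first by rewrite divr_gt0.
by rewrite mulrCA ler_piMr ?ltW// ltr_pdivrMr// mul1r ltrDl.
Qed.

End Triples.

Section Tomita.
Context {R : realType} {K : rhilb R}.
Implicit Types (A B N : bop K K -> K -> K -> Prop) (g J : bop K K).

(** [S] is the closed operator [g k |-> J (k - g k)], so that [g = (1 + |S|)^-1]. *)
Record polar g J : Prop := Polar {
 pl_g : ble1 g; pl_inj : forall u, g u = 0 -> u = 0;
 pl_J : bsa J; pl_JJ : J ** J = bid; pl_Jg : J ** g = (bid - g) ** J }.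

(** Exchanging g and 1 - g replaces |S| by |S|^-1, that is S by its adjoint involution. *)
Lemma polar_swap g J : polar g J -> polar (bid - g) J.
Proof.
case=> h1 h2 h3 h4 h5; split=> //; first exact: ble1_compl.
 move=> u h; have h6 : g (J u) = 0.
  have -> : g (J u) = J ((bid - g) u).
   rewrite -[RHS]/((J ** (bid - g)) u) bcBr h5 bc1r bcBl bc1l opprB addrC subrK.
   by [].
  by rewrite h b0.
 have /h2 h7 := h6; by rewrite -[u]/(bid u) -h4 /= h7 b0.
by rewrite bcBr h5 bc1r; oring.
Qed.

(** A full left algebra B and its right algebra N. Vectors of B are written (g k, J (k - g k)) = (x,
    S x), those of N likewise for the adjoint of S. Since k is recovered from such a pair
    isometrically in each coordinate, density of the indices k means density in the graph norm: the
    last two clauses say that B and N give cores. *)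
Record tsys g J B N : Prop := Tsys {
 ts_pol : polar g J;
 ts_B : forall X x x', B X x x' <-> perp N X x x';
 ts_N : forall X x x', N X x x' <-> perp B X x x';
 ts_mB : tmul B; ts_mN : tmul N; ts_ndB : tnd B; ts_ndN : tnd N;
 ts_vB : forall X x x', B X x x' -> exists k, x = g k /\ x' = J (k - g k);
 ts_vN : forall X x x', N X x x' -> exists k, x = k - g k /\ x' = J (g k);
 ts_dB : dns [set k | exists X, B X (g k) (J (k - g k))];
 ts_dN : dns [set k | exists X, N X (k - g k) (J (g k))] }.

Lemma tsys_swap g J B N : tsys g J B N -> tsys (bid - g) J N B.
Proof.
move=> [pl hB hN mB mN nB nN vB vN dB dN].
have e k : (bid - g) k = k - g k by rewrite bopBE.
have e' k : k - (bid - g) k = g k by rewrite e opprB addrC subrK.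
split=> //; first exact: polar_swap.
- by move=> X x x' /vN [k [-> ->]]; exists k; rewrite e' e.
- by move=> X x x' /vB [k [-> ->]]; exists k; rewrite e' e.
- move=> u d d0; have [a [X hX] ha] := dN u d d0; exists a => //.
 by exists X; rewrite e' e.
- move=> u d d0; have [a [X hX] ha] := dB u d d0; exists a => //.
 by exists X; rewrite e' e.
Qed.

Section PolarTh.
Variables (g J : bop K K).
Hypothesis pl : polar g J.
Let sg : bsa g := (pl_g pl).1.1.
Let sJ : bsa J := pl_J pl.

Lemma JJE u : J (J u) = u.
Proof. by rewrite -[LHS]/((J ** J) u) (pl_JJ pl). Qed.
Lemma JgE u : J (g u) = J u - g (J u).
Proof. by rewrite -[LHS]/((J ** g) u) (pl_Jg pl) /= bopBE. Qed.
Lemma gJE u : g (J u) = J u - J (g u).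
Proof. by rewrite JgE opprB addrC subrK. Qed.

Lemma dns_image (f : bop K K) (D : set K) : bsa f -> (forall u, f u = 0 -> u = 0) ->
 dns D -> dns (f @` D).
Proof.
move=> sf fi dD u e e0.
pose L : set K := range f.
have sL : subsp L.
 split; first by exists 0; rewrite ?b0.
 by move=> c _ _ [x _ <-] [y _ <-]; exists (c *: x + y); rewrite // bop_lin.
have Lu : scl L u.
 have [a La ha] := projection u (scl_subsp sL) (@scl_closed _ _ L).
 suff -> : u = a by [].
 apply/subr0_eq/fi/ip_inj => w; rewrite ip0l (bsaE _ _ sf).
 by apply: ha; apply: sub_scl; exists w.
have [_ [v _ <-] hv] := Lu (e / 2) ltac:(by rewrite divr_gt0).
have [C [C0 hC]] := bop_bnd f; have C1 : 0 < C + 1 by rewrite ltr_wpDl.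
have [a Da ha] := dD v (e / 2 / (C + 1)) ltac:(by rewrite !divr_gt0).
exists (f a); first by exists a.
apply: le_lt_trans (nrm_distD _ _ (f v)) _; rewrite -bB.
have : nrm (f (v - a)) <= e / 2; last by lra.
apply: le_trans (hC _) _; apply: le_trans (_ : (C + 1) * (e / 2 / (C + 1)) <= _).
 by apply: ler_pM; rewrite ?nrm_ge0 ?lerDl//; exact: ltW.
by rewrite mulrC divfK// lt0r_neq0.
Qed.

Lemma dns_sub (D E : set K) : D `<=` E -> dns D -> dns E.
Proof. by move=> h hD u e e0; have [a /h ha Da] := hD u e e0; exists a. Qed.

End PolarTh.

Section Build.
Variables (g J : bop K K) (A : bop K K -> K -> K -> Prop).
Hypotheses (pl : polar g J) (lA : tlin A) (sA : tstar A) (mA : tmul A) (nA : tnd A).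
Hypothesis vA : forall X x x', A X x x' -> exists k, x = g k /\ x' = J (k - g k).
Hypothesis dA : dns [set k | exists X, A X (g k) (J (k - g k))].

Let B := perp (perp A).
Let N := perp A.
Let sg : bsa g := (pl_g pl).1.1.
Let sJ : bsa J := pl_J pl.

Let dvA : dns (tvec A).
Proof.
apply: dns_sub (dns_image sg (pl_inj pl) dA) => _ [k [X hX] <-].
by exists X, (J (k - g k)).
Qed.

(** [cut] at t z gives the transform of a small operator, and 1/t times it is a right element with
    vector C' z. As t -> 0, C' tends strongly to 1; this is visible on vectors a of A, where a - C'
    a = B0 (t X z'). *)
Let approx k (e : R) : 0 < e -> exists Q q q', [/\ N Q q q', nrm (k - g k - q) < e & nrm (J (g k) - q') < e].
Proof.
move=> e0; pose z := k - g k; pose z' := J (g k).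
have fa t : forall X x x' Y y y', A X x x' -> A Y y y' ->
  ip (X (t *: z)) y = ip x (Y (t *: z')).
 move=> X x x' Y y y' hX hY.
 have [l [h1 h2]] := vA (mA (sA hX) hY).
 rewrite badjE [RHS]badjEr h1 h2 !ipZr !ipZl (bsaE _ _ sJ) /z /z' (JJE pl) !ipE (ipC l (g k)).
 by rewrite (bsaE k l sg) (ipC (g l)).
have key d : 0 < d -> exists t : R, 0 < t /\
  forall C B0 C' : bop K K, ble1 C -> ble1 C' -> bnd B0 1 ->
   (forall X x x', A X x x' -> C x + B0^# (X (t *: z)) = x /\ C' x + B0 (X (t *: z')) = x) ->
   nrm (z - C' z) <= d /\ nrm (z' - C z') <= d.
 move=> d0; have d4 : 0 < d / 4 by rewrite divr_gt0.
 have [a [X [a' hX]] ha] := dvA z d4; have [b [Y [b' hY]] hb] := dvA z' d4.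
 pose t := d / 4 / (nrm (X z') + nrm (Y z) + 1).
 have p0 : 0 < nrm (X z') + nrm (Y z) + 1 by have := nrm_ge0 (X z'); have := nrm_ge0 (Y z); lra.
 have t0 : 0 < t by rewrite divr_gt0.
 have tE : t * (nrm (X z') + nrm (Y z) + 1) = d / 4 by rewrite divfK// lt0r_neq0.
 exists t; split=> // C B0 C' C1 C1' Bb h.
 have [_ h1] := h _ _ _ hX; have [h2 _] := h _ _ _ hY.
 have gen (E E' : bop K K) u v w : ble1 E -> bnd E' 1 -> nrm (u - v) < d / 4 ->
   E v + E' (t *: w) = v -> t * nrm w <= d / 4 -> nrm (u - E u) <= d.
  move=> E1 E1' uv hv tw.
  have -> : u - E u = (u - v) - E (u - v) + E' (t *: w).
   rewrite (_ : E' (t *: w) = v - E v); first by rewrite bB; vring.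
    by rewrite -{1}hv addrAC subrr add0r.
  apply: le_trans (nrmD _ _) _.
  have := nrmD (u - v) (- E (u - v)); rewrite nrmN.
  have := (ble1_bnd E1).2 (u - v); have := E1'.2 (t *: w).
  by rewrite nrmZ ger0_norm; [lra|exact: ltW].
 split.
  apply: (gen C' B0 z a (X z')) => //; first by rewrite -bZ.
  by rewrite -tE; apply: ler_wpM2l; [exact: ltW|have := nrm_ge0 (Y z); lra].
 apply: (gen C B0^# z' b (Y z)) => //; first exact: bnd_adj.
  by rewrite -bZ.
 by rewrite -tE; apply: ler_wpM2l; [exact: ltW|have := nrm_ge0 (X z'); lra].
have [|t [t0 ht]] := key (e / 4); first by rewrite divr_gt0.
have [C [B0 [C' [[c1 c2 c3 c4 c5] rel cm inj tr]]]] := cut lA sA mA dvA (fa t).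
have Bb : bnd B0 1.
 split=> // u; rewrite mul1r; apply: sq_le; first exact: nrm_ge0.
 rewrite !nrm2 badjEr ipC -[B0^# _]/((B0^# ** B0) u) c3 bopBE /= !ipE (ipC u (C u)).
 by rewrite -(bsaE u (C u) c1.1.1); have := c1.2 u; have := ip_ge0 (C u); lra.
have [|h1 h2] := ht C B0 C' c1 c2 Bb.
 by move=> X x x' /rel [].
have tu : t * t^-1 = 1 by rewrite mulfV// lt0r_neq0.
exists (t^-1 *: B0), (C' z), (C z'); split.
 have [p0 pl0] := perp_lin A.
 have := pl0 t^-1 _ _ _ _ _ _ tr p0.
 by rewrite !addr0 !bZ !scalerA (mulrC t^-1) tu !scale1r.
- by move: h1; rewrite /z => h1; lra.
- by move: h2; rewrite /z' => h2; lra.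
Qed.

Let lN : tlin N. Proof. exact: perp_lin. Qed.
Let sN : tstar N. Proof. exact: perp_star. Qed.
Let mN : tmul N. Proof. exact: perp_mul. Qed.

Let pl' := polar_swap pl.

Let dvN : dns (tvec N).
Proof.
have dT : dns (@setT K) by move=> u e e0; exists u; rewrite ?subrr ?nrm0.
have d1 := dns_image (pl_g pl').1.1 (pl_inj pl') dT.
move=> u e e0; have e2 : 0 < e / 2 by rewrite divr_gt0.
have [_ [k _ <-]] := d1 u _ e2; rewrite bopBE /= => hk.
have [Q [q [q' [hQ h1 _]]]] := approx k e2.
exists q; first by exists Q, q'.
by apply: le_lt_trans (nrm_distD _ _ (k - g k)) _; lra.
Qed.

Let AB X x x' : A X x x' -> B X x x'. Proof. exact: perp_sub. Qed.

Let hN X x x' : N X x x' <-> perp B X x x'.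
Proof.
split=> [|h Y y y' /AB hY]; first exact: (perp_sub sN).
by have [h1 h2 h3 h4] := h _ _ _ hY.
Qed.

Let mB : tmul B. Proof. exact: (perp_mul sN mN dvN). Qed.

Let nB : tnd B.
Proof. by move=> k h; apply: nA => X x x' /AB hX; exact: h hX. Qed.

Let nN : tnd N.
Proof.
move=> k h; apply: nA => X x x' hX; apply: (dns_orth dvN) => q [Q [q' hQ]].
have [_ h2 _ _] := hQ _ _ _ hX.
by rewrite badjE h2 badjEr (h _ _ _ (sN hQ)) ip0l.
Qed.

Let dvB : dns (tvec B).
Proof. by apply: dns_sub dvA => x [X [x' /AB hX]]; exists X, x'. Qed.

(** Pairing with the core of A by [perp_pair] puts q in the domain of the adjoint of S. The index k
    = q + J q' inverts the map k |-> (k - g k, J (g k)). *)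
Let vN Q q q' : N Q q q' -> exists k, q = k - g k /\ q' = J (g k).
Proof.
move=> hQ; exists (q + J q').
have E : g q = J q' - g (J q').
 apply/subr0_eq/(dns_orth dA) => k [X /AB hX].
 have := perp_pair (fun X x x' => iff_refl (B X x x')) hN mB mN dvB dvN nN hX hQ.
 rewrite !ipE -!(bsaE _ _ sg) -!(bsaE _ _ sJ) !ipE !bsaE//; lra.
have E2 : g (q + J q') = J q' by rewrite bD E subrK.
by rewrite E2 (JJE pl) addrK.
Qed.

Let vB X x x' : B X x x' -> exists k, x = g k /\ x' = J (k - g k).
Proof.
move=> hX; exists (x + J x').
have E : x - g x = g (J x').
 apply/subr0_eq/(@dns_orth _ _ [set k | exists Q q q', N Q q q' /\ k = q + J q']).
  move=> k e e0; have [Q [q [q' [hQ h1 h2]]]] := approx k (e:= e / 2) ltac:(by rewrite divr_gt0).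
  exists (q + J q'); first by exists Q, q, q'.
  have -> : k - (q + J q') = (k - g k - q) + J (J (g k) - q') by rewrite bB (JJE pl); vring.
  apply: le_lt_trans (nrmD _ _) _.
  have -> : nrm (J (J (g k) - q')) = nrm (J (g k) - q') by rewrite /nrm (bsaE _ _ sJ) (JJE pl).
  lra.
 move=> _ [Q [q [q' [hQ ->]]]]; have [k [h1 h2]] := vN hQ.
 have := perp_pair (fun X x x' => iff_refl (B X x x')) hN mB mN dvB dvN nN hX hQ.
 rewrite h1 h2 (JJE pl) subrK !ipE (bsaE x k sg) (bsaE (J x') k sg) (bsaE x' (g k) sJ).
 by rewrite (ipC k) (ipC (g k) x) (ipC (J _)); lra.
have -> : g (x + J x') = x by rewrite bD -E addrC subrK.
by rewrite (addrC x) addrK (JJE pl).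
Qed.

(** The entry point for weights: A is the algebra of GNS triples, of which only a core,
    nondegeneracy and the algebraic axioms are known; B is its completion. *)
Lemma tsys_build : tsys g J B N.
Proof.
split; [exact: pl|by []|exact: hN|exact: mB|exact: mN|exact: nB|exact: nN|exact: vB|exact: vN| |].
- by apply: dns_sub dA => k [X /AB hX]; exists X.
- move=> k e e0; have [Q [q [q' [hQ h1 h2]]]] := approx k (e:= e / 2) ltac:(by rewrite divr_gt0).
 have [k' [E1 E2]] := vN hQ; exists k'; first by exists Q; rewrite -E1 -E2.
 have -> : k - k' = (k - g k - q) + J (J (g k) - q') by rewrite E1 E2 bB !(JJE pl); vring.
 apply: le_lt_trans (nrmD _ _) _.
 have -> : nrm (J (J (g k) - q')) = nrm (J (g k) - q') by rewrite /nrm (bsaE _ _ sJ) (JJE pl).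
 lra.
Qed.

End Build.
End Tomita.

(** * The resolvent estimate *)

Section Resolvent.
Context {R : realType} {K : rhilb R}.
Variables (g J : bop K K) (B N : bop K K -> K -> K -> Prop).
Hypothesis ts : tsys g J B N.
Let pl := ts_pol ts.
Let sg : bsa g := (pl_g pl).1.1.
Let sJ : bsa J := pl_J pl.
Let lN : tlin N. Proof. by have h := ts_N ts; split; [exact/h/(perp_lin B).1|move=> *; apply/h/(perp_lin B).2; exact/h]. Qed.
Let lB : tlin B. Proof. by have h := ts_B ts; split; [exact/h/(perp_lin N).1|move=> *; apply/h/(perp_lin N).2; exact/h]. Qed.
Let sN : tstar N. Proof. by have h := ts_N ts; move=> Y y y' /h/perp_star/h. Qed.
Let sB : tstar B. Proof. by have h := ts_B ts; move=> Y y y' /h/perp_star/h. Qed.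

Lemma ts_lB : tlin B. Proof. exact: lB. Qed.
Lemma ts_sB : tstar B. Proof. exact: sB. Qed.
Lemma ts_sN : tstar N. Proof. exact: sN. Qed.

Lemma ts_dvB : dns (tvec B).
Proof.
apply: dns_sub (dns_image sg (pl_inj pl) (ts_dB ts)) => _ [k [X hX] <-].
by exists X, (J (k - g k)).
Qed.

Lemma ts_dvN : dns (tvec N).
Proof.
have pl' := polar_swap pl.
apply: dns_sub (dns_image (pl_g pl').1.1 (pl_inj pl') (ts_dN ts)) => _ [k [X hX] <-].
by exists X, (J (g k)); rewrite bopBE.
Qed.

Lemma ts_comm X x x' Q q q' : B X x x' -> N Q q q' -> X ** Q = Q ** X.
Proof. by move=> hX hQ; exact: (perp_comm sB (ts_mB ts) ts_dvB hX (iffLR (ts_N ts _ _ _) hQ)). Qed.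

Lemma ts_rel X x x' Q q q' : B X x x' -> N Q q q' ->
 [/\ X q = Q x, X^# q = Q x', X q' = Q^# x & X^# q' = Q^# x'].
Proof. by move=> hX /(ts_N ts) h; have := h _ _ _ hX. Qed.

Lemma ts_mem (X : bop K K) x x' : (forall Q q q', N Q q q' -> X q = Q x /\ X^# q = Q x') -> B X x x'.
Proof.
move=> h; apply/(ts_B ts) => Q q q' hQ; have [h1 h2] := h _ _ _ hQ.
by have [h3 h4] := h _ _ _ (sN hQ); split.
Qed.

(** The weak form of (|S|^2 + r) x = q with x = g k. *)
Lemma resE q (r : R) k l : k - 2 *: g k + g (g k) + r *: g (g k) = g q ->
 ip (g l) q = ip (J (k - g k)) (J (l - g l)) + r * ip (g l) (g k).
Proof.
move=> hk; rewrite (bsaE l q sg) -hk (bsaE _ _ sJ) (JJE pl).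
rewrite !ipE (bsaE k l sg) (bsaE k (g l) sg) (bsaE l (g k) sg) (ipC k l) (ipC k (g l)).
by rewrite (ipC k (g (g l))) (bsaE l k sg) (bsaE (g l) k sg) (bsaE l (g k) sg); lra.
Qed.

(** [k = g ((1 - g)^2 + r g^2)^-1 q] makes [g k] the image of [q] under the
  resolvent at [-r] of [|S|^2]; it is the vector of a bounded element. *)
Lemma resolvent Q q q' (c r : R) k : N Q q q' -> bnd Q c -> 0 < r ->
 k - 2 *: g k + g (g k) + r *: g (g k) = g q ->
 exists2 Z, B Z (g k) (J (k - g k)) & bnd Z (c / (2 * Num.sqrt r)).
Proof.
move=> hQ bQ r0 hk; pose x := g k; pose x' := J (k - g k).
have fa X y y' Y w w' : N X y y' -> N Y w w' -> ip (X x) w = ip y (Y x').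
 move=> hX hY; have [l []] := ts_vN ts (ts_mN ts (sN hX) hY).
 move=> h1 h2; rewrite badjE [RHS]badjEr h1 h2 /x /x' (bsaE _ _ sJ) (JJE pl).
 by rewrite !ipE (bsaE k l sg) (ipC (g l) k) (ipC (g l) (g k)).
have E X y y' : B X y y' -> ip y q = ip x' y' + r * ip y x.
 by move=> /(ts_vB ts) [l [-> ->]]; exact: resE.
have [C [D [C' [[C1 C'1 DD DD' DC] rel cm [iC iC'] /(ts_B ts) hD]]]] :=
 cut lN sN (ts_mN ts) ts_dvN fa.
have sC : bsa C := C1.1.1; have sC' : bsa C' := C'1.1.1.
have CD : D^# ** C' = C ** D^# by have := congr1 (@badj _ _ _) DC; rewrite !badjM sC sC'.
(* D is the bounded transform of the multiplication Z by x, and C' = (1 + Z Z^#)^-1. A lower bound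
   on C' bounds Z: the spectral part e' of C' below each admissible c2 is shown to vanish. *)
have low (c2 : R) : 0 < c2 -> c2 < 1 -> c2 * c ^+ 2 < 4 * r * (1 - c2) ->
  forall u, c2 * ip u u <= ip (C' u) u.
 move=> c20 c21 cc.
 have spec (V : bop K K) : ble1 V -> [/\ bsa (c2 *: bid - V) & bnd (c2 *: bid - V) 1].
  move=> V1; have sV : bsa (c2 *: bid - V) by rewrite /bsa badjB badjZ badj1 V1.1.1.
  split=> //; apply: bsa_bnd => // u; rewrite bopBE bopZE !ipE /=.
  by have := V1.1.2 u; have := V1.2 u; have := ip_ge0 u; rewrite ler_norml; nra.
 have [se be] := spec _ C1; have [se' be'] := spec _ C'1.
 have [E1 EE Ez] := bpp_spec se be; have [E'1 E'E' E'z] := bpp_spec se' be'.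
 have DE : D ** bpp (c2 *: bid - C) = bpp (c2 *: bid - C') ** D.
  by apply: bpp_comm => //; rewrite bcBr bcBl DC bcZl bcZr bc1l bc1r.
 have EC : C ** bpp (c2 *: bid - C) = bpp (c2 *: bid - C) ** C.
  by apply: bpp_comm => //; rewrite bcBr bcBl bcZl bcZr bc1l bc1r.
 have EC' : C' ** bpp (c2 *: bid - C') = bpp (c2 *: bid - C') ** C'.
  by apply: bpp_comm => //; rewrite bcBr bcBl bcZl bcZr bc1l bc1r.
 have NE P p p' : N P p p' -> P ** bpp (c2 *: bid - C') = bpp (c2 *: bid - C') ** P.
  move=> /cm [_ _ h]; apply: bpp_comm => //.
  by rewrite bcBr bcBl bcZl bcZr bc1l bc1r h.
 have ND P p p' : N P p p' -> P ** D^# = D^# ** P.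
  by move=> /sN/cm [_ h _]; have := congr1 (@badj _ _ _) h; rewrite !badjM badjK.
 set e := bpp _ in E1 EE Ez DE EC; set e' := bpp _ in E'1 E'E' E'z DE EC' NE.
 have {}EE u : C (e u) = c2 *: e u - e (e u).
  have := bop_at u EE; rewrite /= bopBE bopZE /= => <-.
  by rewrite opprB addrC subrK.
 have {}E'E' u : C' (e' u) = c2 *: e' u - e' (e' u).
  have := bop_at u E'E'; rewrite /= bopBE bopZE /= => <-.
  by rewrite opprB addrC subrK.
 have se1 : bsa e := E1.1.1; have se1' : bsa e' := E'1.1.1.
 clearbody e e'.
 have DEu u : D (e u) = e' (D u) by rewrite -[LHS]/((D ** e) u) DE.
 have DEu' u : D^# (e' u) = e (D^# u).
  by have := congr1 (@badj _ _ _) DE; rewrite !badjM se1 se1' => h; rewrite -[LHS]/((D^# ** e') u) -h.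
 have ECu u : e (C u) = C (e u) by rewrite -[RHS]/((C ** e) u) EC.
 have ECu' u : e' (C' u) = C' (e' u) by rewrite -[RHS]/((C' ** e') u) EC'.
 have DDu u : D (D^# u) = C' u - C' (C' u) by rewrite -[LHS]/((D ** D^#) u) DD' bopBE.
 have DDu' u : D^# (D u) = C u - C (C u) by rewrite -[LHS]/((D^# ** D) u) DD bopBE.
 (* s and D s^2 are elements of B cut down to that spectral part. The weak equation [E] for D s^2
    compares |C v|^2 and r |sv|^2 with the bound c on Q. *)
 pose s := D^# ** e' ** D; pose u' := e' (C' x); pose sv := D^# u'.
 have ss : bsa s by rewrite /bsa /s !badjM badjK se1' bcA.
 have hs : B s sv sv.
  apply: ts_mem => P p p' hP; rewrite ss.
  suff -> : s p = P sv by [].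
  have [h1 _ _ _] := rel _ _ _ hP; rewrite /s /sv /u' /= h1.
  rewrite -[RHS]/((P ** D^#) _) (ND _ _ _ hP) /= -[P (e' _)]/((P ** e') _) (NE _ _ _ hP) /=.
  have [_ _ h2] := cm _ _ _ hP.
  by rewrite -[P (C' x)]/((P ** C') x) h2.
 pose v := s x'.
 have sE u : s u = e (D^# (D u)) by rewrite /s /= DEu'.
 have Cs u : C (s u) = s (C u).
  by rewrite !sE -ECu !DDu' bB.
 have hDs : B (D ** s) (D sv) (C v).
  by have := ts_mB ts hD hs; rewrite ss Cs.
 have hy : B (D ** (s ** s)) (D (s sv)) (C (s v)).
  have := ts_mB ts hD (ts_mB ts hs hs); rewrite badjM ss.
  by rewrite /v !Cs.
 have b1 : ip (C v) (C v) <= c2 * ip x' (C (s v)).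
  have <- : ip (C v) v = ip x' (C (s v)) by rewrite {2}/v -(bsaE _ x' ss) -Cs ipC.
  have vE : v = e (D^# (D x')) by rewrite /v sE.
  have Cv : C v = c2 *: v - e v by rewrite vE EE.
  rewrite {2}Cv !ipE.
  have : 0 <= ip (e (C v)) v.
   by have := (bpos_comm_mul E1 C1.1 (esym EC)).2 v.
  by rewrite (bsaE _ _ se1); lra.
 have a1 : (1 - c2) * ip sv sv <= ip (D (s sv)) x.
  have sx : ip (D (s sv)) x = ip (D (D^# u')) (u' - C' u').
   rewrite /s /sv /= DDu.
   have -> : ip (C' (e' (D (D^# u'))) - C' (C' (e' (D (D^# u'))))) x =
    ip (D (D^# u')) (e' (C' x) - C' (e' (C' x))).
    by rewrite !ipE !(bsaE _ _ sC') !(bsaE _ _ se1') ECu' !ECu'.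
   by [].
  have Cu : C' u' = c2 *: u' - e' u' by rewrite /u' E'E'.
  rewrite sx Cu !ipE !(badjE D) -/sv.
  have -> : ip sv (D^# (e' u')) = ip (e sv) sv by rewrite DEu' ipC.
  by have := E1.1.2 sv; lra.
 have b2 : ip (D (s sv)) q <= nrm sv * (c * nrm (C v)).
  have -> : D (s sv) = (D ** s) sv by [].
  rewrite badjE; have [_ -> _ _] := ts_rel hDs hQ.
  apply: le_trans (CS _ _) _; apply: ler_wpM2l; first exact: nrm_ge0.
  exact: bQ.2.
 have E3 := E _ _ _ hy.
 move: b1 a1; rewrite -!nrm2 => b1 a1.
 have sv0 : sv = 0.
  apply: nrm_eq0; move: b2; rewrite E3.
  move: (nrm_ge0 sv) (nrm_ge0 (C v)) a1 b1; move: (nrm sv) (nrm (C v)) => a b a0 b0 a1 b1 b2.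
  (* A quadratic form in (a, b) whose discriminant is negative exactly by the condition on c2; hence
     a = 0. *)
  have h1 : b ^+ 2 + r * c2 * (1 - c2) * a ^+ 2 <= c2 * c * (a * b).
   have : r * c2 * ((1 - c2) * a ^+ 2) <= r * c2 * ip (D (s sv)) x.
    by apply: ler_wpM2l => //; apply: mulr_ge0; exact: ltW.
   have : c2 * (ip x' (C (s v)) + r * ip (D (s sv)) x) <= c2 * (a * (c * b)).
    by apply: ler_wpM2l => //; exact: ltW.
   by nra.
  have h2 : (r * c2 * (1 - c2) - (c2 * c / 2) ^+ 2) * a ^+ 2 <= 0.
   by have := sqr_ge0 (b - c2 * c / 2 * a); nra.
  have h3 : 0 < r * c2 * (1 - c2) - (c2 * c / 2) ^+ 2.
   have : 0 < c2 * (4 * r * (1 - c2) - c2 * c ^+ 2) by rewrite mulr_gt0// subr_gt0.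
   by nra.
  apply/eqP; rewrite -(@sqrf_eq0 R) eq_le sqr_ge0 andbT.
  by rewrite -(pmulr_rle0 _ h3).
 have s0 u : s u = 0.
  suff -> : s = (0 : bop K K) by rewrite bop0E.
  apply: (@bop_eq_dns _ _ _ _ _ _ ts_dvN) => p [P [p' hP]].
  by have [-> _ _ _] := ts_rel hs hP; rewrite sv0 b0 bop0E.
 have e'0 : e' = 0.
  apply: bopP => u; rewrite bop0E.
  have h1 : C' (e' (D (D^# u)) - C' (e' (D (D^# u)))) = 0.
   by rewrite bB -DDu -[D^# _]/(s (D^# u)) s0 b0.
  have /iC' {}h1 := h1.
  have h2 : C' (e' (u - C' u - (C' (u - C' u)))) = 0.
   by move: h1; rewrite DDu -!ECu' -!bB => <-; congr (e' _); rewrite !bB.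
  have /iC' {}h2 := h2.
  have inj1 w : e' w - C' (e' w) = 0 -> e' w = 0.
   move=> h; apply: ip_eq0; have : ip (e' w - C' (e' w)) (e' w) = 0 by rewrite h ip0l.
   rewrite E'E' !ipE; have := E'1.1.2 (e' w); have := ip_ge0 (e' w); nra.
  apply: (inj1); rewrite -ECu' -bB; apply: (inj1); rewrite -ECu' -bB.
  by rewrite -[RHS]h2; congr (e' _); rewrite !bB.
 move=> u; have := (E'z e'0).2 u; rewrite bopNE bopBE bopZE /= !ipE; lra.
(* The supremum of the admissible c2, reached as a limit. *)
pose l := 4 * r / (4 * r + c ^+ 2).
have r4 : 0 < 4 * r + c ^+ 2 by have := sqr_ge0 c; lra.
have l0 : 0 < l by rewrite divr_gt0// mulr_gt0.
have lE : l * (4 * r + c ^+ 2) = 4 * r by rewrite divfK// lt0r_neq0.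
have lowl u : l * ip u u <= ip (C' u) u.
 apply: eps_le => d d0.
 have i1 : 0 < ip u u + 1 by rewrite ltr_wpDl ?ip_ge0.
 pose t := Num.min (l / 2) (d / (ip u u + 1)).
 have t0 : 0 < t by rewrite lt_min; apply/andP; split; exact: divr_gt0.
 have tl : t <= l / 2 by rewrite ge_min lexx.
 have td : t * (ip u u + 1) <= d by rewrite -ler_pdivlMr// ge_min lexx orbT.
 have := low (l - t) _ _ _ u.
 have := ip_ge0 u; have := sqr_ge0 c; clearbody l t => c0 u0 h.
 have : (l - t) * ip u u <= ip (C' u) u by apply: h; nra.
 by nra.
have [D' [D'1 D'2 sD' bD']] := binv_exists sC' l0 lowl.
have C'D' u : C' (D' u) = u by rewrite -[LHS]/((C' ** D') u) D'1.
have D'C' u : D' (C' u) = u by rewrite -[LHS]/((D' ** C') u) D'2.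
have DDu u : D (D^# u) = C' u - C' (C' u) by rewrite -[LHS]/((D ** D^#) u) DD' bopBE.
exists (D' ** D).
 apply: ts_mem => P p p' hP; have [h1 _ h3 _] := rel _ _ _ hP; have [_ _ h4] := cm _ _ _ hP.
 split.
  by rewrite /= h1 -/x D'C'.
 rewrite badjM sD' /=; apply/subr0_eq/iC; rewrite bB.
 by rewrite -[C (D^# _)]/((C ** D^#) (D' p)) -CD /= C'D' h3 -/x' subrr.
have c0 := bQ.1; pose w := c / (2 * Num.sqrt r).
have w0 : 0 <= w by rewrite divr_ge0// mulr_ge0// sqrtr_ge0.
rewrite -[D' ** D]badjK; apply: bnd_adj; split=> // u; apply: sq_le.
 by rewrite mulr_ge0 ?nrm_ge0.
rewrite exprMn nrm2 nrm2 badjM sD' /= badjE badjK DDu C'D' ipDr ipNr (bsaE _ (C' u) sD') D'C'.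
(* The adjoint of D' D has squared form C'^-1 - 1, which is at most 1/l - 1 = c^2 / (4 r). *)
have -> : w ^+ 2 = l^-1 - 1.
 rewrite /w /l invf_div exprMn exprVn exprMn sqr_sqrtr ?ltW//.
 by field; rewrite lt0r_neq0.
by have := bnd_form u bD'; rewrite mulrBl mul1r; lra.
Qed.

End Resolvent.

(** * The operator norm, and corners between spectral windows *)

Section Opn.
Context {R : realType}.
Implicit Types U V W : rhilb R.

Definition opn U V (f : bop U V) : R := inf [set C | bnd f C].

Lemma opn_ge0 U V (f : bop U V) : 0 <= opn f.
Proof. by apply: lb_le_inf; [have [C] := bop_bnd f; exists C|move=> C []]. Qed.

Lemma opn_le U V (f : bop U V) C : bnd f C -> opn f <= C.
Proof. by move=> h; apply: ge_inf => //; exists 0 => D []. Qed.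

Lemma opn_bnd U V (f : bop U V) : bnd f (opn f).
Proof.
split=> [|u]; first exact: opn_ge0.
apply: eps_le => e e0; have u1 : 0 < nrm u + 1 by rewrite ltr_wpDl ?nrm_ge0.
have hi : has_inf [set C | bnd f C].
 by split; [have [C] := bop_bnd f; exists C|exists 0 => D []].
have [C [C0 hC] hlt] := inf_adherent (divr_gt0 e0 u1) hi.
apply: le_trans (hC u) _; rewrite -/(opn f) in hlt.
apply: le_trans (_ : (opn f + e / (nrm u + 1)) * nrm u <= _).
 by apply: ler_wpM2r; [exact: nrm_ge0|exact: ltW].
rewrite mulrDl lerD2l mulrAC ler_pdivrMr// ler_wpM2l; [by []|exact: ltW|lra].
Qed.

Lemma opn_eq0 U V (f : bop U V) : opn f = 0 -> f = 0.
Proof.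
move=> h; apply: bopP => u; rewrite bop0E; apply: nrm_eq0; apply/eqP.
by rewrite eq_le nrm_ge0 andbT; have := (opn_bnd f).2 u; rewrite h mul0r.
Qed.

Lemma bnd_opp U V (f : bop U V) C : bnd f C -> bnd (- f) C.
Proof. by move=> [C0 h]; split=> // u; rewrite bopNE nrmN. Qed.

Lemma opnD U V (f g : bop U V) : opn (f + g) <= opn f + opn g.
Proof. by apply: opn_le; apply: bnd_add; exact: opn_bnd. Qed.

Lemma opnN U V (f : bop U V) : opn (- f) = opn f.
Proof.
by apply/eqP; rewrite eq_le -{3}[f]opprK; apply/andP; split; apply/opn_le/bnd_opp/opn_bnd.
Qed.

Lemma opnM U V W (f : bop V W) (g : bop U V) : opn (f ** g) <= opn f * opn g.
Proof. by apply: opn_le; apply: bnd_comp; exact: opn_bnd. Qed.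

Lemma opnZ U V c (f : bop U V) : opn (c *: f) <= `|c| * opn f.
Proof. by apply: opn_le; apply: bnd_scale; exact: opn_bnd. Qed.

Lemma opn_ble1 U (a : bop U U) : ble1 a -> opn a <= 1.
Proof. by move=> /ble1_bnd /opn_le. Qed.

End Opn.

Section Corners.
Context {R : realType} {U : rhilb R} (g : bop U U).
Hypothesis g1 : ble1 g.
Hypotheses (gi : forall u, g u = 0 -> u = 0) (hi : forall u, g u = u -> u = 0).
Let sg : bsa g := g1.1.1.
Let h := bid - g.
Let h1 : ble1 h := ble1_compl g1.

(** On such Y, left and right multiplication by g differ from the scalars c and d by at most t. *)
Record corner (P Q : bop U U) (c d t : R) (Y : bop U U) : Prop := Corner {
 cn_P : narrow g P c t; cn_Q : narrow g Q d t; cn_l : P ** Y = Y; cn_r : Y ** Q = Y }.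

Lemma narrow_proj P c t u : narrow g P c t -> nrm (P u) <= nrm u.
Proof.
move=> [sP PP _ _]; apply: sq_le; first exact: nrm_ge0.
have e : ip (P u) (P u) = ip (P u) u by rewrite (bsaE _ _ sP) -[P (P u)]/((P ** P) u) PP ipC.
rewrite !nrm2; have := ip_ge0 (P u - u); rewrite !ipE (ipC u (P u)) e; lra.
Qed.

Lemma corner_gl P Q c d t Y : 0 <= t -> corner P Q c d t Y -> opn (g ** Y - c *: Y) <= t * opn Y.
Proof.
move=> t0 [[sP PP gP nP] _ PY _]; apply: opn_le; split; first by rewrite mulr_ge0 ?opn_ge0.
move=> u; rewrite bopBE bopZE /= -PY /=; apply: le_trans (nP _) _.
by rewrite -[P (Y u)]/((P ** Y) u) PY -mulrA; apply: ler_wpM2l => //; exact: (opn_bnd Y).2.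
Qed.

Lemma corner_gr P Q c d t Y : 0 <= t -> corner P Q c d t Y -> opn (Y ** g - d *: Y) <= t * opn Y.
Proof.
move=> t0 [_ nQ _ YQ]; have [sQ QQ gQ hQ] := nQ; apply: opn_le; split; first by rewrite mulr_ge0 ?opn_ge0.
move=> u; rewrite bopBE bopZE /=.
have -> : Y (g u) - d *: Y u = Y (g (Q u) - d *: Q u).
 rewrite bB bZ -{1 2}YQ /= -[Q (g u)]/((Q ** g) u) -gQ.
 by [].
apply: le_trans ((opn_bnd Y).2 _) _; rewrite (mulrC t) -mulrA; apply: ler_wpM2l; first exact: opn_ge0.
by apply: le_trans (hQ u) _; apply: ler_wpM2l => //; exact: narrow_proj nQ.
Qed.

Lemma opn_lr (l r Y : bop U U) : opn l <= 1 -> opn r <= 1 -> opn (l ** Y ** r) <= opn Y.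
Proof.
move=> hl hr; apply: le_trans (opnM _ _) _; apply: le_trans (_ : opn (l ** Y) * 1 <= _).
 by apply: ler_wpM2l => //; exact: opn_ge0.
rewrite mulr1; apply: le_trans (opnM _ _) _; rewrite -[leRHS]mul1r.
by apply: ler_wpM2r => //; exact: opn_ge0.
Qed.

Lemma corner_lr P Q c d t Y (l r : bop U U) (x y : R) : 0 <= t -> `|x| <= 1 -> opn r <= 1 ->
 opn (l ** Y - x *: Y) <= t * opn Y -> opn (Y ** r - y *: Y) <= t * opn Y ->
 corner P Q c d t Y -> opn (l ** Y ** r - (x * y) *: Y) <= 2 * t * opn Y.
Proof.
move=> t0 x1 r1 hl hr _.
have -> : l ** Y ** r - (x * y) *: Y = (l ** Y - x *: Y) ** r + x *: (Y ** r - y *: Y) by oring.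
apply: le_trans (opnD _ _) _; rewrite -mulrA mulrDl mul1r; apply: lerD.
 apply: le_trans (opnM _ _) _; apply: le_trans (_ : (t * opn Y) * 1 <= _); last by rewrite mulr1.
 by apply: ler_pM; rewrite ?opn_ge0.
apply: le_trans (opnZ _ _) _; apply: le_trans (_ : 1 * (t * opn Y) <= _); last by rewrite mul1r.
by apply: ler_pM; rewrite ?normr_ge0 ?opn_ge0.
Qed.

Lemma opn_h (Y : bop U U) c : opn (h ** Y - (1 - c) *: Y) = opn (g ** Y - c *: Y).
Proof. by rewrite -opnN; congr opn; rewrite /h; oring. Qed.

Lemma opn_hr (Y : bop U U) c : opn (Y ** h - (1 - c) *: Y) = opn (Y ** g - c *: Y).
Proof. by rewrite -opnN; congr opn; rewrite /h; oring. Qed.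

(** As (1 - g) / g = |S|, the formal quotient of [aa] by [bb] is Y |-> |S| Y |S|^-1. *)
Definition aa (Y : bop U U) := h ** Y ** g.
Definition bb (Y : bop U U) := g ** Y ** h.

Lemma gP_corner P Q c d t Y (l r : bop U U) : corner P Q c d t Y -> P ** l = l ** P -> Q ** r = r ** Q ->
 corner P Q c d t (l ** Y ** r).
Proof.
move=> [nP nQ PY YQ] lP rQ; split=> //; first by rewrite 2!bcA lP -(bcA l) PY.
by rewrite -2!bcA -rQ bcA (bcA (l ** Y)) -(bcA l Y Q) YQ.
Qed.

Lemma narrow_h P c t : narrow g P c t -> P ** h = h ** P.
Proof. by move=> [_ _ e _]; rewrite /h bcBl bcBr e bc1l bc1r. Qed.
Lemma narrow_g P c t : narrow g P c t -> P ** g = g ** P.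
Proof. by case. Qed.

Lemma corner_aa P Q c d t Y : 0 <= t -> 0 <= c <= 1 -> corner P Q c d t Y ->
 opn (aa Y - ((1 - c) * d) *: Y) <= 2 * t * opn Y /\ corner P Q c d t (aa Y).
Proof.
move=> t0 /andP[c0 c1] hc; split.
 apply: (corner_lr t0 _ _ _ _ hc).
 - by rewrite ger0_norm; lra.
 - exact: opn_ble1.
 - by rewrite opn_h; exact: corner_gl hc.
 - exact: corner_gr hc.
have [nP nQ _ _] := hc; apply: (gP_corner hc); [exact: narrow_h nP|exact: narrow_g nQ].
Qed.

Lemma corner_bb P Q c d t Y : 0 <= t -> 0 <= c <= 1 -> corner P Q c d t Y ->
 opn (bb Y - (c * (1 - d)) *: Y) <= 2 * t * opn Y /\ corner P Q c d t (bb Y).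
Proof.
move=> t0 /andP[c0 c1] hc; split.
 apply: (corner_lr t0 _ _ _ _ hc).
 - by rewrite ger0_norm; lra.
 - exact: opn_ble1.
 - exact: corner_gl hc.
 - by rewrite opn_hr; exact: corner_gr hc.
have [nP nQ _ _] := hc; apply: (gP_corner hc); [exact: narrow_g nP|exact: narrow_h nQ].
Qed.

Lemma opn_aa Y : opn (aa Y) <= opn Y.
Proof. by apply: opn_lr; exact: opn_ble1. Qed.
Lemma opn_bb Y : opn (bb Y) <= opn Y.
Proof. by apply: opn_lr; exact: opn_ble1. Qed.

(** W = g (1 - g) is injective and small on the windows near 0 and 1, so <T W u, W v> sees only
    windows inside [e, 1 - e] up to an error of order e. Hence W T W = 0, and W cancels on both
    sides. *)
Lemma corners_eq0 (T : bop U U) :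
 (forall e : R, 0 < e -> e < 2^-1 -> exists2 t0 : R, 0 < t0 & forall P Q c d t,
   0 < t -> t < t0 -> narrow g P c t -> narrow g Q d t ->
   e <= c <= 1 - e -> e <= d <= 1 - e -> P ** T ** Q = 0) -> T = 0.
Proof.
move=> H; have [W WE] : exists W, W = g ** h by exists (g ** h).
have gh : g ** h = h ** g by rewrite /h; oring.
have pW : bpos W by rewrite WE; apply: bpos_comm_mul => //; exact: h1.1.
have sW : bsa W := pW.1.
have Wi u : W u = 0 -> u = 0.
 by rewrite WE => /gi; rewrite /h bopBE /= => /subr0_eq/esym/hi.
have W1 u : nrm (W u) <= nrm u.
 by have := (bnd_comp (ble1_bnd g1) (ble1_bnd h1)).2 u; rewrite mulr1 mul1r WE.
pose C := opn T; have C0 : 0 <= C := opn_ge0 T.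
have small e u v : 0 < e -> e < 2^-1 -> `|ip (T (W u)) (W v)| <= (5 * C * nrm u * nrm v) * (2 * e).
 move=> e0 e2; have [t0 t00 Ht] := H e e0 e2.
 have tm : 0 < Num.min t0 e by rewrite lt_min t00.
 have [N hN] := inv_small tm; have {}hN := hN N (leqnn N).
 move: hN; rewrite lt_min => /andP[N1 N2].
 have [p [hp sp]] := windows g1 (ltn0Sn N).
 have i0 : 0 < N.+1%:R^-1 :> R by rewrite invr_gt0 ltr0n.
 pose gd (k : 'I_N.+1) := e <= (k%:R / N.+1%:R : R) <= 1 - e.
 pose S := \sum_(k < N.+1 | gd k) p k; pose S' := \sum_(k < N.+1 | ~~ gd k) p k.
 have SS : S + S' = bid by rewrite -sp /S /S' [RHS](bigID gd).
 have sS : bsa S.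
  apply: (big_ind (fun x : bop U U => bsa x)); first exact: badj0.
   by move=> x y hx hy; rewrite /bsa badjD hx hy.
  by move=> k _; have [] := hp k (ltn_ord k).
 have STS : S ** T ** S = 0.
  apply: bopP => w; rewrite bop0E /= /S bopsumE; apply: big1 => j gj.
  rewrite bopsumE bsum bsum; apply: big1 => k gk.
  rewrite -[LHS]/((p j ** T ** p k) w).
  by rewrite (Ht _ _ _ _ _ i0 N1 (hp j (ltn_ord j)) (hp k (ltn_ord k)) gj gk) bop0E.
 have pp k w : (k < N.+1)%N -> ip (p k w) w = ip (p k w) (p k w).
  move=> /hp [sp1 pp1 _ _]; rewrite (bsaE _ (p k w) sp1) -[p k (p k w)]/((p k ** p k) w) pp1.
  exact: ipC.
 have WS k w : (k < N.+1)%N -> ip (W (p k w)) w = ip (W (p k w)) (p k w).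
  move=> kN; have nk := hp _ kN; have [sp1 pp1 pg _] := nk.
  have pWk : p k ** W = W ** p k.
   by rewrite WE bcA -pg -bcA (narrow_h nk) bcA.
  rewrite -(bsaE _ w sp1) -[p k (W _)]/((p k ** W) (p k w)) pWk /=.
  by rewrite -[p k (p k w)]/((p k ** p k) w) pp1.
 (* At a window outside [e, 1 - e] of width below e, either g or 1 - g is at most 2 e, and W lies
    below both. *)
 have bad k w : (k < N.+1)%N -> ~~ (e <= (k%:R / N.+1%:R : R) <= 1 - e) ->
   ip (W (p k w)) w <= 2 * e * ip (p k w) w.
  move=> kN; rewrite WS// pp// => nb; have [_ _ _ nk] := hp _ kN.
  have := nk w; set c : R := _ / _ => nw; have {}nb : ~~ (e <= c <= 1 - e) := nb; set z := p k w.
  have c0 : 0 <= c by rewrite divr_ge0.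
  have c1 : c <= 1 by rewrite ler_pdivrMr ?ltr0n// mul1r ler_nat ltnW.
  clearbody c; move: (N.+1%:R^-1) nw N1 N2 i0 nb => i nw N1 N2 i0 nb; rewrite -/z in nw.
  have gz : ip (g z) z <= (c + i) * ip z z.
   have cs : ip (g z - c *: z) z <= i * ip z z.
    apply: le_trans (CS _ _) _; rewrite -nrm2 expr2 mulrA.
    by apply: ler_wpM2r => //; exact: nrm_ge0.
   by move: cs; rewrite !ipE; lra.
  have hz : ip (z - g z) z <= (1 - c + i) * ip z z.
   have cs : ip (c *: z - g z) z <= i * ip z z.
    apply: le_trans (CS _ _) _; rewrite nrmB -nrm2 expr2 mulrA.
    by apply: ler_wpM2r => //; exact: nrm_ge0.
   by move: cs; rewrite !ipE; lra.
  have z0 := ip_ge0 z.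
  have Wz : ip (W z) z = ip (g z) z - ip (g z) (g z).
   by rewrite WE /= /h bopBE /= bB ipDl ipNl (bsaE (g z) _ sg).
  have Wle1 : ip (W z) z <= ip (g z) z by rewrite Wz; have := ip_ge0 (g z); lra.
  have Wle2 : ip (W z) z <= ip (z - g z) z.
   rewrite Wz !ipE; have := ip_ge0 (z - g z); rewrite !ipE (ipC z (g z)); lra.
  move: nb; rewrite negb_and -!ltNge => /orP[cb|cb]; nra.
 have S'1 w : ip (W (S' w)) w <= 2 * e * ip w w.
  rewrite /S' bopsumE bsum ip_suml; apply: le_trans (_ : \sum_(k < N.+1 | ~~ gd k) 2 * e * ip (p k w) w <= _).
   by apply: ler_sum => k; exact: bad.
  rewrite -mulr_sumr ler_wpM2l//; first by rewrite mulr_ge0// ltW.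
  rewrite -[w in leRHS]/(bid w) -[X in ip (_ w) X]/w -sp bopsumE ip_suml [leRHS](bigID gd)/= lerDr.
  by apply: sumr_ge0 => k _; rewrite pp// ip_ge0.
 have WS' : S' ** W = W ** S'.
  apply: bopP => w; rewrite /= /S' !bopsumE bsum; apply: eq_bigr => k _.
  have nk := hp _ (ltn_ord k); have [_ _ pg _] := nk.
  by rewrite WE -[LHS]/((p k ** (g ** h)) w) bcA -pg -bcA (narrow_h nk).
 have sS' : bsa S'.
  by have -> : S' = bid - S; [rewrite -SS addrAC subrr add0r|rewrite /bsa badjB badj1 sS].
 have pWS : bpos (W ** S').
  split; first by rewrite /bsa badjM sW sS' WS'.
  move=> w; rewrite /= /S' bopsumE bsum ip_suml; apply: sumr_ge0 => k _.
  by rewrite WS//; exact: pW.2.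
 have WSb : bnd (W ** S') (2 * e) by apply: bpos_bnd => // ; rewrite ?mulr_ge0 ?ltW.
 have b1 w : nrm (S' (W w)) <= 2 * e * nrm w.
  by rewrite -[S' _]/((S' ** W) w) WS'; exact: WSb.2.
 have dec w : W w = S (W w) + S' (W w) by rewrite -bopDE SS.
 have b2 w : nrm (S (W w)) <= 2 * nrm w.
  have -> : S (W w) = W w - S' (W w) by rewrite {2}dec addrK.
  apply: le_trans (nrmD _ _) _; rewrite nrmN; have := b1 w; have := W1 w; have := nrm_ge0 w; nra.
 rewrite {1}(dec u) bD ipDl {1}(dec v) ipDr.
 have -> : ip (T (S (W u))) (S (W v)) = 0.
  rewrite -(bsaE _ _ sS) -[S (T _)]/((S ** T ** S) (W u)) STS bop0E ip0l.
  by [].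
 rewrite add0r; apply: le_trans (ler_normD _ _) _.
 have TC w : nrm (T w) <= C * nrm w := (opn_bnd T).2 w.
 have e1 : `|ip (T (S (W u))) (S' (W v))| <= C * (2 * nrm u) * (2 * e * nrm v).
  apply: le_trans (CSabs _ _) _; apply: ler_pM; rewrite ?nrm_ge0//.
  by apply: le_trans (TC _) _; exact: ler_wpM2l.
 have e3 : `|ip (T (S' (W u))) (W v)| <= C * (2 * e * nrm u) * nrm v.
  apply: le_trans (CSabs _ _) _; apply: ler_pM; rewrite ?nrm_ge0//.
  by apply: le_trans (TC _) _; exact: ler_wpM2l.
 have : 0 <= C * nrm u * nrm v * e by rewrite !mulr_ge0 ?nrm_ge0// ltW.
 by move: e1 e3; set x := `|_|; set y := `|_|; nra.
have z u v : ip (T (W u)) (W v) = 0.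
 apply/eqP; rewrite -normr_eq0 eq_le normr_ge0 andbT; apply: eps_le => d d0; rewrite add0r.
 pose D := 5 * C * nrm u * nrm v; have D0 : 0 <= D by rewrite !mulr_ge0 ?nrm_ge0.
 have D1 : 0 < 2 * D + 4 by rewrite ltr_wpDl// mulr_ge0.
 have m0 : 0 < Num.min d 1 by rewrite lt_min d0 ltr01.
 have := small (Num.min d 1 / (2 * D + 4)) u v (divr_gt0 m0 D1); rewrite -/D.
 have mE : Num.min d 1 / (2 * D + 4) * (2 * D + 4) = Num.min d 1 by rewrite divfK// lt0r_neq0.
 have md : Num.min d 1 <= d by rewrite ge_min lexx.
 have m1 : Num.min d 1 <= 1 by rewrite ge_min lexx orbT.
 have x0 : 0 < Num.min d 1 / (2 * D + 4) by rewrite divr_gt0.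
 clearbody D; move: (Num.min d 1 / _) mE x0 => x mE x0 hx.
 apply: le_trans (hx _) _; nra.
apply: bopP => u; rewrite bop0E; apply: ip_inj => v; rewrite ip0l.
have WT w : W (T (W w)) = 0 by apply: ip_inj => v'; rewrite ip0l (bsaE _ _ sW) z.
have TW w : T (W w) = 0 by apply: Wi; exact: WT.
rewrite badjE; suff -> : T^# v = 0 by rewrite ip0r.
by apply: Wi; apply: ip_inj => w; rewrite ip0l (bsaE _ _ sW) -badjEr TW ip0r.
Qed.

End Corners.

(** * Partial fractions and Chebyshev averages of commuting maps *)

Section Modules.
Context {R : realType} {V : lmodType R}.
Variables (T : Type) (f : T -> V -> R).
Hypotheses (fl : forall t c u v, f t (c *: u + v) = c * f t u + f t v)
 (fI : forall u v, (forall t, f t u = f t v) -> u = v).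
Definition lin (P : V -> V) := forall c u v, P (c *: u + v) = c *: P u + P v.

Lemma linD P u v : lin P -> P (u + v) = P u + P v.
Proof. by move=> h; rewrite -[u]scale1r h !scale1r. Qed.
Lemma lin0 P : lin P -> P 0 = 0.
Proof. by move=> h; have := h (-1) 0 0; rewrite scaler0 addr0 scaleN1r addNr. Qed.
Lemma linZ P c u : lin P -> P (c *: u) = c *: P u.
Proof. by move=> h; rewrite -[c *: u]addr0 h lin0// addr0. Qed.
Lemma linN P u : lin P -> P (- u) = - P u.
Proof. by move=> h; rewrite -scaleN1r linZ// scaleN1r. Qed.
Lemma lin_iter P n : lin P -> lin (iter n P).
Proof. by move=> h; elim: n => [//|n IH] c u v; rewrite !iterS IH h. Qed.

Let fD t u v : f t (u + v) = f t u + f t v.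
Proof. by rewrite -[u]scale1r fl mul1r scale1r. Qed.
Let f0 t : f t 0 = 0.
Proof. by have := fl t (-1) 0 0; rewrite scaler0 addr0 mulN1r addNr. Qed.
Let fZ t c u : f t (c *: u) = c * f t u.
Proof. by rewrite -[c *: u]addr0 fl f0 addr0. Qed.
Let fN t u : f t (- u) = - f t u.
Proof. by rewrite -scaleN1r fZ mulN1r. Qed.
Let fE := (fD, fZ, fN, f0).

Section Fractions.
Variables (a b : V -> V) (la : lin a) (lb : lin b) (ab : forall v, a (b v) = b (a v)).
Let aD u v : a (u + v) = a u + a v. Proof. exact: linD. Qed.
Let aZ c u : a (c *: u) = c *: a u. Proof. exact: linZ. Qed.
Let aN u : a (- u) = - a u. Proof. exact: linN. Qed.
Let bD u v : b (u + v) = b u + b v. Proof. exact: linD. Qed.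
Let bZ c u : b (c *: u) = c *: b u. Proof. exact: linZ. Qed.
Let bN u : b (- u) = - b u. Proof. exact: linN. Qed.
Let abE := (aD, aZ, aN, bD, bZ, bN, ab).

(** Formally z1 = e / (a^2 + b^2) and z2 = e / (a^2 + 2 b^2), so the equation for y means b y = 2 a
    (z1 - z2), and z3 / 2 is a^2 / (a^2 + s b^2) applied to z1 - z2. The separating functionals
    [f t] reduce such identities to linear arithmetic in R, for vectors and operators alike. *)
Lemma frac_comp e z1 z2 y z3 s : (forall v, a (a v) + 2 *: b (b v) = 0 -> v = 0) ->
 a (a z1) + b (b z1) = e -> a (a z2) + 2 *: b (b z2) = e ->
 b (b y) + 2^-1 *: a (a y) = a (b z1) -> a (a z3) + s *: b (b z3) = a (b y) ->
 a (a (2^-1 *: z3)) + s *: b (b (2^-1 *: z3)) = a (a (z1 - z2)).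
Proof.
move=> inj E1 E2 Ey E3.
have E : b y - 2 *: a (z1 - z2) = 0.
 apply: inj; apply: fI => t.
 have h1 := congr1 (fun v => f t (b v)) Ey.
 have h2 := congr1 (fun v => f t (a v)) (etrans E1 (esym E2)).
 by move: h1 h2; rewrite /= !abE !fE; lra.
apply: fI => t; have h1 := congr1 (fun v => f t (a v)) E; have h2 := congr1 (f t) E3.
by move: h1 h2; rewrite /= lin0// !abE !fE; lra.
Qed.

(** The same element a^2 / (a^2 + s b^2) (z1 - z2), by partial fractions with parameters s, 1 and 2.
    It serves for small s, where the factor s in front absorbs the growth of the resolvent at s. *)
Lemma frac_split e z1 z2 zs s al be ga : al + be + ga = 0 -> be * (1 - s) = -1 -> ga * (2 - s) = 1 ->
 a (a z1) + b (b z1) = e -> a (a z2) + 2 *: b (b z2) = e -> a (a zs) + s *: b (b zs) = e ->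
 let G := z1 - z2 - s *: (al *: zs + be *: z1 + ga *: z2) in
 a (a G) + s *: b (b G) = a (a (z1 - z2)).
Proof.
move=> h1 h2 h3 E1 E2 Es /=; apply: fI => t.
move: (congr1 (f t) E1) (congr1 (f t) E2) (congr1 (f t) Es); rewrite !abE !fE.
move: (f t (a (a z1))) (f t (a (a z2))) (f t (a (a zs))) (f t e) => x1 x2 xs w.
move: (f t (b (b z1))) (f t (b (b z2))) (f t (b (b zs))) => y1 y2 ys k1 k2 k3.
have -> : x1 = w - y1 by lra.
have -> : x2 = w - 2 * y2 by lra.
have -> : xs = w - s * ys by lra.
apply: subr0_eq.
transitivity (- s * (al + be + ga) * w + s * (1 + be * (1 - s)) * y1 + s * (ga * (2 - s) - 1) * y2).
 by ring.
by rewrite h1 h2 h3; ring.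
Qed.

(** With P = a + b and Q = a - b one has P^2 + Q^2 + 2 c P Q = 2 (1 + c) (a^2 + s b^2) for s = (1 -
    c) / (1 + c): the half-line of resolvent parameters becomes the interval of the nodes. *)
Lemma node_eq G x c : -1 < c -> a (a G) + ((1 - c) / (1 + c)) *: b (b G) = a (a x) ->
 let P v := a v + b v in let Q v := a v - b v in
 P (P G) + Q (Q G) + (2 * c) *: P (Q G) = P (a x) + Q (a x) + c *: (Q (a x) + P (a x)).
Proof.
move=> c0 E /=; apply: fI => t; have := congr1 (f t) E; rewrite !abE !fE.
move: (f t (a (a G))) (f t (b (b G))) (f t (a (a x))) (f t (b (a x))) (f t (b (a G))).
move=> x1 y1 x2 z w h1.
have hi : (1 - c) / (1 + c) * (1 + c) = 1 - c by rewrite divfK// lt0r_neq0//; lra.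
have h2 : x1 * (1 + c) + (1 - c) * y1 = x2 * (1 + c).
 by move: ((1 - c) / (1 + c)) hi h1 => i hi <-; rewrite -hi; ring.
lra.
Qed.

End Fractions.

(** The average of [G] over the [2^k] zeros of a Chebyshev polynomial, which is
  an exact quadrature for the resolvent integral of a square root. *)
Fixpoint avg (W : lmodType R) k (G : R -> W) : W :=
 if k is k'.+1 then
  avg k' (fun c2 => 2^-1 *: (G (Num.sqrt ((1 + c2) / 2)) + G (- Num.sqrt ((1 + c2) / 2))))
 else G 0.

(** The half-angle formula: for c2 = cos 2x the two nodes are cos x and -cos x. *)
Lemma node_bound (c2 : R) : -1 < c2 < 1 ->
 [/\ -1 < Num.sqrt ((1 + c2) / 2) < 1, -1 < - Num.sqrt ((1 + c2) / 2) < 1 &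
   c2 = 2 * Num.sqrt ((1 + c2) / 2) ^+ 2 - 1].
Proof.
move=> /andP[h1 h2]; have h3 : 0 < (1 + c2) / 2 by lra.
have h4 : 0 < Num.sqrt ((1 + c2) / 2) by rewrite sqrtr_gt0.
have h5 : Num.sqrt ((1 + c2) / 2) < 1.
 by rewrite -[ltRHS]sqrtr1 ltr_sqrt ?ltr01//; lra.
rewrite sqr_sqrtr; last exact: ltW.
by split; [apply/andP; split; lra|apply/andP; split; lra|lra].
Qed.

Lemma avg_ind2 (W W' : lmodType R) (Q : W -> W' -> Prop) k G G' :
 (forall u v u' v', Q u u' -> Q v v' -> Q (2^-1 *: (u + v)) (2^-1 *: (u' + v'))) ->
 (forall c, -1 < c < 1 -> Q (G c) (G' c)) -> Q (avg k G) (avg k G').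
Proof.
move=> hQ; elim: k G G' => [|k IH] G G' h /=; first by apply: h; rewrite ltr01 andbT oppr_lt0 ltr01.
by apply: IH => c2 /node_bound [h1 h2 _]; apply: hQ; exact: h.
Qed.

Lemma iter_sq (P : V -> V) n v : iter n (fun v => P (P v)) v = iter n.*2 P v.
Proof. by elim: n => [//|n IH]; rewrite iterS IH doubleS. Qed.

Lemma iter_sqN (P : V -> V) n v : lin P ->
 iter n (fun v => - P (P v)) v = (-1) ^+ n *: iter n.*2 P v.
Proof.
move=> lP; elim: n => [|n IH]; first by rewrite expr0 scale1r.
by rewrite iterS IH doubleS !(linZ _ _ lP) exprS -scalerA scaleN1r.
Qed.

(** The factors P^2 + Q^2 + 2 c P Q for c and -c multiply to the one for c2 = 2 c^2 - 1 and the pair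
    (P^2, -Q^2), so averaging over both nodes doubles the degree. Where Q is smaller than P, the
    resulting equation says that the average tends to P^-1 u. *)
Lemma dyadic k P Q u v (G : R -> V) : lin P -> lin Q -> (forall w, Q (P w) = P (Q w)) ->
 (forall c, -1 < c < 1 ->
   P (P (G c)) + Q (Q (G c)) + (2 * c) *: P (Q (G c)) = P u + Q v + c *: (Q u + P v)) ->
 iter (2 ^ k.+1) P (avg k G) + iter (2 ^ k.+1) Q (avg k G) =
 iter (2 ^ k.+1).-1 P u + iter (2 ^ k.+1).-1 Q v.
Proof.
elim: k P Q u v G => [|k IH] P Q u v G lP lQ PQ h.
 by have := h 0; rewrite mulr0 !scale0r !addr0 => -> //; rewrite ltr01 andbT oppr_lt0 ltr01.
pose G' c2 := 2^-1 *: (G (Num.sqrt ((1 + c2) / 2)) + G (- Num.sqrt ((1 + c2) / 2))).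
have PE := (fun u v => linD u v lP, fun c u => linZ c u lP, fun u => linN u lP).
have QE := (fun u v => linD u v lQ, fun c u => linZ c u lQ, fun u => linN u lQ).
have := IH (fun w => P (P w)) (fun w => - Q (Q w)) (P u) (- Q v) G' _ _ _ _.
rewrite -/(avg k.+1 G) (expnS 2 k.+1) mul2n.
have ev : (2 ^ k.+1 = (2 ^ k).*2)%N by rewrite expnS mul2n.
have pr : ((2 ^ k.+1).*2.-1 = (2 ^ k.+1).-1.*2.+1)%N.
 by rewrite -[in LHS](prednK (expn_gt0 2 k.+1 : 0 < 2 ^ k.+1)%N) doubleS.
(* Even powers forget the sign of - Q^2; the odd power 2^(k+1) - 1 keeps it, and there it cancels
   against the sign of - Q v. *)
have s1 : (-1) ^+ (2 ^ k.+1) = 1 :> R by rewrite ev -mul2n exprM sqrrN expr1n expr1n.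
have s2 : (-1) ^+ (2 ^ k.+1).-1 = -1 :> R.
 by have := s1; rewrite -(prednK (expn_gt0 2 k.+1 : 0 < 2 ^ k.+1)%N) exprS mulN1r => /(canRL (@opprK _)).
rewrite pr !iter_sq !iter_sqN// s1 s2 scale1r.
have it (X : V -> V) n w : iter n X (X w) = iter n.+1 X w by rewrite -iterSr.
rewrite (linN _ (lin_iter _ lQ)) scaleN1r opprK !it; apply.
- by move=> c w w'; rewrite !lP.
- by move=> c w w'; rewrite !lQ opprD scalerN.
- by move=> w; rewrite !PE !PQ.
- move=> c2 /node_bound [h1 h2 h3]; move: (h _ h1) (h _ h2) h3; rewrite /G'.
 move: (Num.sqrt ((1 + c2) / 2)) => c Ep Em ->.
 apply: fI => t.
 have n1 := congr1 (fun v => f t (P (P v))) Ep.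
 have n2 := congr1 (fun v => f t (P (P v))) Em.
 have n3 := congr1 (fun v => f t (Q (Q v))) Ep.
 have n4 := congr1 (fun v => f t (Q (Q v))) Em.
 have n5 := congr1 (fun v => c * f t (P (Q v))) Ep.
 have n6 := congr1 (fun v => c * f t (P (Q v))) Em.
 move: n1 n2 n3 n4 n5 n6; rewrite /= !(PE, QE, PQ) !fE; lra.
Qed.

End Modules.

Lemma zsub4 (V : zmodType) (a b c d : V) : a + b = c + d -> a - c = - (b - d).
Proof.
by move=> /(canRL (addrK _)) ->; rewrite opprB addrC !addrA addNr add0r.
Qed.

(** 1 - r^n is 1 - r times a sum of n powers of r, each at least r^n. It serves as an explicit rate
    r^n = O(1/n). *)
Lemma geo_bound (R : realType) (r : R) n : 0 <= r -> r <= 1 -> n%:R * (1 - r) * r ^+ n <= 1 - r ^+ n.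
Proof.
move=> r0 r1; elim: n => [|n IH]; first by rewrite !mul0r expr0 subrr.
rewrite exprS -natr1; have : 0 <= r ^+ n by exact: exprn_ge0.
have : 0 <= n%:R :> R by [].
move: IH; move: (r ^+ n) (n%:R) => x m IH m0 x0.
have : 0 <= (m + 1) * (1 - r) * x * (1 - r) by rewrite !mulr_ge0//; lra.
by nra.
Qed.

Section Decay.
Context {R : realType} {K : rhilb R} (g : bop K K).
Hypothesis g1 : ble1 g.
Let sg : bsa g := g1.1.1.
Let h := bid - g.
Let q := h - g.

Lemma q_contr u : nrm (q u) <= nrm u.
Proof.
apply: sq_le; first exact: nrm_ge0; rewrite !nrm2 /q /h !bopBE /= !ipE.
have := g1.1.2 u; have := bpos_sq (C := 1) u g1.1; rewrite (ipC u (g u)).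
have h2 v : ip (g v) v <= 1 * ip v v by rewrite mul1r; exact: g1.2.
by move=> /(_ h2); rewrite mul1r; lra.
Qed.

(** With s_j = |q^j u|^2 - |q^(j+1) u|^2 one has d_j = |q^j (1 - q^2) u|^2 = s_j - s_(j+1), and d_j
    decreases; so j d_j <= s_0 <= |u|^2. The factor g (1 - g) = (1 - q^2) / 4 makes up for q^j not
    decaying at the ends of the spectrum. *)
Lemma q_decay n u : n%:R * nrm (iter n q (g (h u))) ^+ 2 <= nrm u ^+ 2.
Proof.
have qs v w : ip (q v) w = ip v (q w).
 by rewrite /q /h !bopBE /= !ipE !(bsaE _ w sg).
have W v : 4 *: g (h v) = v - q (q v).
 rewrite /q /h !(bopBE, bB) /=; move: (g v) (g (g v)) => x y; vring.
pose d j := nrm (iter j q (u - q (q u))) ^+ 2.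
have it j : iter j q (u - q (q u)) = iter j q u - q (q (iter j q u)).
 by elim: j => [//|j IH]; rewrite iterS IH bB.
pose s j := nrm (iter j q u) ^+ 2 - nrm (iter j.+1 q u) ^+ 2.
have dE j : d j = s j - s j.+1.
 rewrite /d /s it !iterS; move: (iter j q u) => v; rewrite !nrm2 !ipE -!qs.
 lra.
have dd j : d j.+1 <= d j.
 by rewrite /d iterS ler_sqr ?nnegrE ?nrm_ge0//; exact: q_contr.
have s0 j : 0 <= s j.
 by rewrite /s subr_ge0 iterS ler_sqr ?nnegrE ?nrm_ge0//; exact: q_contr.
have key j : j%:R * d j <= s 0%N - s j.
 elim: j => [|j IH]; first by rewrite mul0r subrr.
 have := dd j; have := ler0n R j; rewrite -natr1; move: IH; rewrite (dE j).
 move: (s j) (s j.+1) (s 0%N) (d j.+1) (j%:R) => a b c x m h1 m0 h2.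
 have : 0 <= m * (a - b - x) by rewrite mulr_ge0// subr_ge0.
 lra.
have : iter n q (g (h u)) = 4^-1 *: iter n q (u - q (q u)).
 rewrite -W; elim: n => [|j IH]; first by rewrite scalerA mulVf// scale1r.
 by rewrite !iterS IH bZ.
move=> ->; rewrite nrmZ exprMn -/(d n).
have := key n; have := s0 n; rewrite {2}/s /=; have := sqr_ge0 (nrm (q u)).
have d0 : 0 <= d n by exact: sqr_ge0.
have n0 := ler0n R n.
have : 0 <= n%:R * d n by exact: mulr_ge0.
rewrite normfV normr_nat; move: (n%:R) (d n) => x y *.
have -> : x * (4^-1 ^+ 2 * y) = 16^-1 * (x * y) by field.
lra.
Qed.

End Decay.

Section Separation.
Context {R : realType} {K : rhilb R}.
Definition fO (t : K * K) (Y : bop K K) : R := ip (Y t.1) t.2.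
Lemma fOl t c Y Z : fO t (c *: Y + Z) = c * fO t Y + fO t Z.
Proof. by rewrite /fO bopDE bopZE !ipE. Qed.
Lemma fOI Y Z : (forall t, fO t Y = fO t Z) -> Y = Z.
Proof. by move=> h; apply: bopP => u; apply: ip_inj => v; exact: (h (u, v)). Qed.
Definition fV (w v : K) : R := ip v w.
Lemma fVl t c Y Z : fV t (c *: Y + Z) = c * fV t Y + fV t Z.
Proof. by rewrite /fV !ipE. Qed.
Lemma fVI Y Z : (forall t, fV t Y = fV t Z) -> Y = Z.
Proof. exact: ip_inj. Qed.

Lemma opnZE c (f : bop K K) : opn (c *: f) = `|c| * opn f.
Proof.
apply/eqP; rewrite eq_le opnZ/=; have [->|c0] := eqVneq c 0.
 by rewrite normr0 mul0r opn_ge0.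
have := opnZ c^-1 (c *: f); rewrite scalerA mulVf// scale1r normfV.
by rewrite mulrC ler_pdivlMr ?normr_gt0// mulrC.
Qed.

Lemma prod_lo (e c d : R) : 0 < e -> e <= c -> e <= d -> e ^+ 2 <= c * d.
Proof. by move=> e0 ec ed; rewrite expr2; apply: ler_pM => //; exact: ltW. Qed.
Lemma prod_le1 (e c d : R) : 0 < e -> e <= c -> e <= d -> c <= 1 - e -> d <= 1 - e -> c * d <= 1.
Proof. by move=> e0 ec ed c1 d1; rewrite -[leRHS]mulr1; apply: ler_pM; lra. Qed.

Lemma minv_gen (g h : bop K K) (r : R) : bsa g -> bsa h -> g ** h = h ** g -> (forall u, h u = u - g u) ->
 0 < r -> exists m : bop K K,
 [/\ forall u, m (h (h u) + r *: g (g u)) = u, forall u, h (h (m u)) + r *: g (g (m u)) = u,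
   bsa m, forall u, m (g u) = g (m u) & forall u, m (h u) = h (m u)].
Proof.
move=> sg sh gh hE r0; pose M := h ** h + r *: (g ** g).
have sM : bsa M by rewrite /bsa badjD badjZ !badjM sh sg.
have r1 : 0 < 1 + r by lra.
(* The polynomial (1 - x)^2 + r x^2 has minimum r / (1 + r), at x = 1 / (1 + r). *)
have lo u : r / (1 + r) * ip u u <= ip (M u) u.
 rewrite mulrAC ler_pdivrMr// bopDE bopZE /= !hE bB !ipE.
 have := ip_ge0 ((1 + r) *: g u - u); rewrite !ipE !(bsaE _ u sg) (ipC u (g u)) (bsaE u u sg); nra.
have [m [m1 m2 sm _]] := binv_exists sM (divr_gt0 r0 r1) lo.
have cm (x : bop K K) : x ** g = g ** x -> x ** h = h ** x -> x ** m = m ** x.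
 move=> e e'; apply: (binv_comm m1 m2); rewrite /M bcDl bcDr bcZl bcZr.
 by rewrite bcA e' -bcA e' bcA (bcA x g) e -(bcA g x) e (bcA g g).
exists m; split=> // u.
- by rewrite -[RHS]/(bid u) -m2 /= bopDE bopZE.
- by rewrite -[RHS]/(bid u) -m1 /= bopDE bopZE.
- by rewrite -[LHS]/((m ** g) u) -(cm g).
- by rewrite -[LHS]/((m ** h) u) -(cm h).
Qed.

Lemma bidBB (g : bop K K) : bid - (bid - g) = g.
Proof. by rewrite opprB addrC subrK. Qed.

End Separation.

Lemma node_gt0 (R : realType) (c : R) : -1 < c -> c < 1 -> 0 < (1 - c) / (1 + c).
Proof. by move=> h1 h2; apply: divr_gt0; lra. Qed.

(** Both x = (1 - c) d and y = c (1 - d) are at least e^2, so the gap x + y - |x - y| = 2 min(x, y)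
    exceeds the total error 8 t. Thus aa + bb strictly dominates aa - bb on such corners. *)
Lemma window_box (R : realType) (e c d t : R) : 0 < e -> e <= c -> c <= 1 - e -> e <= d -> d <= 1 - e ->
 0 < t -> t < e ^+ 2 / 8 ->
 [/\ 0 <= c <= 1, 0 <= (1 - c) * d + c * (1 - d), 0 <= `|(1 - c) * d - c * (1 - d)| + 4 * t &
  `|(1 - c) * d - c * (1 - d)| + 4 * t < (1 - c) * d + c * (1 - d) - 4 * t].
Proof.
move=> e0 c0 c1 d0 d1 t0 te.
have x0 : e ^+ 2 <= (1 - c) * d by apply: prod_lo => //; lra.
have y0 : e ^+ 2 <= c * (1 - d) by apply: prod_lo => //; lra.
have e20 := sqr_ge0 e; split; [apply/andP; split; lra|lra|by rewrite addr_ge0// mulr_ge0// ltW|].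
by rewrite -ltrBrDr ltr_norml; apply/andP; split; lra.
Qed.

Section AB.
Context {R : realType} {K : rhilb R} (g : bop K K).
Lemma aa_lin : lin (aa g). Proof. by move=> c Y Z; rewrite /aa bcDr bcDl bcZr bcZl. Qed.
Lemma bb_lin : lin (bb g). Proof. by move=> c Y Z; rewrite /bb (bcDr g) bcDl bcZr bcZl. Qed.
Lemma gh_comm : g ** (bid - g) = (bid - g) ** g. Proof. by oring. Qed.
Lemma aabb Y : aa g (bb g Y) = bb g (aa g Y).
Proof. by rewrite /aa /bb !bcA -gh_comm -!bcA gh_comm. Qed.

Hypothesis g1 : ble1 g.
Hypotheses (gi : forall u, g u = 0 -> u = 0) (hi : forall u, g u = u -> u = 0).

Lemma cut_aa P Q c d t Y : narrow g P c t -> narrow g Q d t -> aa g (P ** Y ** Q) = P ** aa g Y ** Q.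
Proof.
move=> nP nQ; rewrite /aa !bcA -(narrow_h nP) -!bcA.
by rewrite (narrow_g nQ).
Qed.
Lemma cut_bb P Q c d t Y : narrow g P c t -> narrow g Q d t -> bb g (P ** Y ** Q) = P ** bb g Y ** Q.
Proof.
move=> nP nQ; rewrite /bb !bcA -(narrow_g nP) -!bcA.
by rewrite (narrow_h nQ).
Qed.

Lemma cut_corner P Q c d t Y : narrow g P c t -> narrow g Q d t -> corner g P Q c d t (P ** Y ** Q).
Proof.
move=> nP nQ; have [_ PP _ _] := nP; have [_ QQ _ _] := nQ.
by split=> //; rewrite ?bcA ?PP// -!bcA QQ.
Qed.

Lemma corner_PQ P Q c d t Y : 0 <= t -> 0 <= c <= 1 ->
 0 <= (1 - c) * d + c * (1 - d) -> corner g P Q c d t Y ->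
 [/\ ((1 - c) * d + c * (1 - d) - 4 * t) * opn Y <= opn (aa g Y + bb g Y),
   opn (aa g Y - bb g Y) <= (`|(1 - c) * d - c * (1 - d)| + 4 * t) * opn Y,
   corner g P Q c d t (aa g Y + bb g Y) & corner g P Q c d t (aa g Y - bb g Y)].
Proof.
move=> t0 c01 xy hc; have [a1 ha] := corner_aa g1 t0 c01 hc; have [b1 hb] := corner_bb g1 t0 c01 hc.
have cl r Z Z' : corner g P Q c d t Z -> corner g P Q c d t Z' -> corner g P Q c d t (Z + r *: Z').
 move=> [z3 z4 z1 z2] [_ _ w1 w2]; split=> //.
  by rewrite bcDr bcZr z1 w1.
 by rewrite bcDl bcZl z2 w2.
move: (aa g Y) (bb g Y) a1 ha b1 hb => y1 y2; move: ((1 - c) * d) (c * (1 - d)) xy => x y xy a1 ha b1 hb.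
split.
- have : opn ((x + y) *: Y) <= opn (y1 + y2) + opn (y1 - x *: Y) + opn (y2 - y *: Y).
  have -> : (x + y) *: Y = y1 + y2 - (y1 - x *: Y) - (y2 - y *: Y) by oring.
  apply: le_trans (opnD _ _) _; rewrite opnN lerD2r.
  by apply: le_trans (opnD _ _) _; rewrite opnN.
 by rewrite opnZE ger0_norm//; lra.
- have : opn (y1 - y2) <= opn ((x - y) *: Y) + opn (y1 - x *: Y) + opn (y2 - y *: Y).
  have -> : y1 - y2 = (x - y) *: Y + (y1 - x *: Y) - (y2 - y *: Y) by oring.
  apply: le_trans (opnD _ _) _; rewrite opnN lerD2r.
  exact: opnD.
 by rewrite opnZE; lra.
- by rewrite -[y2]scale1r; exact: cl.
- by rewrite -scaleN1r; exact: cl.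
Qed.

(** On a corner the operator is nearly the scalar x^2 + r y^2 >= (1 + r) e^4, with an error of 4 t
    (1 + r); hence the choice t < e^4 / 4. *)
Lemma aabb_inj r Y : 0 < r -> aa g (aa g Y) + r *: bb g (bb g Y) = 0 -> Y = 0.
Proof.
move=> r0 hY; apply: (corners_eq0 g1 gi hi) => e e0 e2.
have e4 : 0 < e ^+ 4 / 4 by rewrite divr_gt0// exprn_gt0.
exists (e ^+ 4 / 4) => // P Q c d t t0 te nP nQ /andP[c0 c1] /andP[d0 d1].
apply: opn_eq0; have hc := cut_corner Y nP nQ.
have c01 : 0 <= c <= 1 by apply/andP; split; lra.
have t0' := ltW t0.
have [a1 ha] := corner_aa g1 t0' c01 hc; have [a2 _] := corner_aa g1 t0' c01 ha.
have [b1 hb] := corner_bb g1 t0' c01 hc; have [b2 _] := corner_bb g1 t0' c01 hb.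
have E : aa g (aa g (P ** Y ** Q)) + r *: bb g (bb g (P ** Y ** Q)) = 0.
 rewrite !(cut_aa _ nP nQ) !(cut_bb _ nP nQ) -bcZl -bcZr -bcDl -bcDr hY.
 by rewrite bc0r bc0l.
move: (P ** Y ** Q) a1 ha a2 b1 hb b2 E {hc} => Z a1 ha a2 b1 hb b2 E.
have Z0 := opn_ge0 Z; have aZ := opn_aa g1 Z; have bZ := opn_bb g1 Z.
have two (f : bop K K -> bop K K) x : 0 <= x -> x <= 1 -> opn (f Z) <= opn Z ->
  opn (f Z - x *: Z) <= 2 * t * opn Z -> opn (f (f Z) - x *: f Z) <= 2 * t * opn (f Z) ->
  opn (f (f Z) - (x ^+ 2) *: Z) <= 4 * t * opn Z.
 move=> x0 x1 h0 h1 h2.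
 have -> : f (f Z) - (x ^+ 2) *: Z = (f (f Z) - x *: f Z) + x *: (f Z - x *: Z).
  by move: (f (f Z)) (f Z) => y w; oring.
 apply: le_trans (opnD _ _) _; rewrite opnZE ger0_norm//.
 have : 2 * t * opn (f Z) <= 2 * t * opn Z by apply: ler_wpM2l => //; rewrite mulr_ge0.
 have : x * opn (f Z - x *: Z) <= 1 * (2 * t * opn Z) by apply: ler_pM; rewrite ?opn_ge0.
 lra.
have [c2 d2 c3 d3] : [/\ e <= 1 - c, e <= 1 - d, 1 - c <= 1 - e & 1 - d <= 1 - e] by clear -c0 c1 d0 d1; split; lra.
have x0 : e ^+ 2 <= (1 - c) * d by exact: prod_lo.
have y0 : e ^+ 2 <= c * (1 - d) by exact: prod_lo.
have e20 : 0 <= e ^+ 2 by exact: sqr_ge0.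
have x1 : (1 - c) * d <= 1 by exact: (prod_le1 e0).
have y1 : c * (1 - d) <= 1 by exact: (prod_le1 e0).
have {}a2 := two (aa g) _ (le_trans e20 x0) x1 aZ a1 a2.
have {}b2 := two (bb g) _ (le_trans e20 y0) y1 bZ b1 b2.
move: ((1 - c) * d) (c * (1 - d)) x0 y0 x1 y1 a2 b2 => x y x0 y0 x1 y1 a2 b2 {two a1 b1 ha hb}.
have s : opn ((x ^+ 2 + r * y ^+ 2) *: Z) <= 4 * t * (1 + r) * opn Z.
 have -> : (x ^+ 2 + r * y ^+ 2) *: Z =
   - ((aa g (aa g Z) - (x ^+ 2) *: Z) + r *: (bb g (bb g Z) - (y ^+ 2) *: Z)).
  have -> : (aa g (aa g Z) - (x ^+ 2) *: Z) + r *: (bb g (bb g Z) - (y ^+ 2) *: Z) =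
   (aa g (aa g Z) + r *: bb g (bb g Z)) - (x ^+ 2 + r * y ^+ 2) *: Z.
   by move: (aa g (aa g Z)) (bb g (bb g Z)) => y' w; oring.
  by rewrite E sub0r opprK.
 rewrite opnN; apply: le_trans (opnD _ _) _; rewrite opnZE ger0_norm; last exact: ltW.
 have : r * opn (bb g (bb g Z) - (y ^+ 2) *: Z) <= r * (4 * t * opn Z).
  by apply: ler_wpM2l => //; exact: ltW.
 lra.
have xx : e ^+ 4 <= x ^+ 2 by rewrite (exprM e 2 2) ler_sqr ?nnegrE//; lra.
have yy : e ^+ 4 <= y ^+ 2 by rewrite (exprM e 2 2) ler_sqr ?nnegrE//; lra.
move: s; rewrite opnZE ger0_norm; last by apply: addr_ge0; [exact: sqr_ge0|apply: mulr_ge0; [exact: ltW|exact: sqr_ge0]].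
have : (e ^+ 4 * (1 + r)) * opn Z <= (x ^+ 2 + r * y ^+ 2) * opn Z.
 apply: ler_wpM2r => //.
 have : r * e ^+ 4 <= r * y ^+ 2 by apply: ler_wpM2l => //; exact: ltW.
 lra.
move=> h1 h2; apply/eqP; rewrite eq_le Z0 andbT.
have h3 : 0 < (e ^+ 4 - 4 * t) * (1 + r) by rewrite mulr_gt0//; lra.
rewrite -(pmulr_rle0 _ h3); lra.
Qed.

End AB.

Section Res.
Context {R : realType} {K : rhilb R}.
Variables (g J : bop K K) (B N : bop K K -> K -> K -> Prop).
Hypothesis ts : tsys g J B N.
Local Notation h := (bid - g).
Let pl := ts_pol ts.
Let sg : bsa g := (pl_g pl).1.1.
Let sJ : bsa J := pl_J pl.

Lemma hE u : h u = u - g u. Proof. by rewrite bopBE. Qed.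
Lemma ghE u : g (h u) = h (g u).
Proof. by rewrite -[LHS]/((g ** h) u) gh_comm. Qed.
Lemma gJ u : g (J u) = J (h u). Proof. by rewrite hE bB (gJE pl). Qed.
Lemma hJ u : h (J u) = J (g u). Proof. by rewrite hE gJ hE bB opprB addrC subrK. Qed.
Lemma sh : bsa h. Proof. exact: (pl_g (polar_swap pl)).1.1. Qed.
Lemma hinj u : h u = 0 -> u = 0. Proof. exact: (pl_inj (polar_swap pl)). Qed.

Lemma vB X x x' : B X x x' -> exists k, x = g k /\ x' = J (h k).
Proof. by move=> /(ts_vB ts) [k [-> ->]]; exists k; rewrite hE. Qed.
Lemma vN X x x' : N X x x' -> exists k, x = h k /\ x' = J (g k).
Proof. by move=> /(ts_vN ts) [k [-> ->]]; exists k; rewrite hE. Qed.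
Lemma dB : dns [set k | exists X, B X (g k) (J (h k))].
Proof. by apply: dns_sub (ts_dB ts) => k [X hX]; exists X; rewrite hE. Qed.
Lemma dN : dns [set k | exists X, N X (h k) (J (g k))].
Proof. by apply: dns_sub (ts_dN ts) => k [X hX]; exists X; rewrite hE. Qed.

Lemma minv (r : R) : 0 < r -> exists m : bop K K,
 [/\ forall u, m (h (h u) + r *: g (g u)) = u, forall u, h (h (m u)) + r *: g (g (m u)) = u,
   bsa m, forall u, m (g u) = g (m u) & forall u, m (h u) = h (m u)].
Proof.
exact: (minv_gen sg sh (gh_comm g) hE).
Qed.

Lemma res Q q q' r : N Q q q' -> 0 < r -> exists k Z,
 [/\ B Z (g k) (J (h k)), h (h k) + r *: g (g k) = g q & opn Z <= opn Q / (2 * Num.sqrt r)].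
Proof.
move=> hQ r0; have [m [m1 m2 sm mg mh]] := minv r0.
have E : h (h (m (g q))) + r *: g (g (m (g q))) = g q by exact: m2.
have [|Z hZ bZ] := resolvent ts hQ (opn_bnd Q) r0 (k := m (g q)).
 by rewrite -[RHS]E !hE bB; vring.
by exists (m (g q)), Z; split=> //; [rewrite hE|exact: opn_le].
Qed.

Lemma res_inj r v : 0 < r -> h (h v) + r *: g (g v) = 0 -> v = 0.
Proof. by move=> r0 e; have [m [m1 _ _ _ _]] := minv r0; rewrite -(m1 v) e b0. Qed.

End Res.

Section Tau.
Context {R : realType} {K : rhilb R}.
Variables (g J : bop K K) (B N : bop K K -> K -> K -> Prop).
Hypothesis ts : tsys g J B N.
Local Notation h := (bid - g).
Let pl := ts_pol ts.
Let sg : bsa g := (pl_g pl).1.1.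
Let sJ : bsa J := pl_J pl.
Let sh : bsa h := sh ts.
Let JJ u : J (J u) = u := JJE pl u.
Let gJ := gJ ts.
Let hJ := hJ ts.

Lemma res_swap Q q q' r : B Q q q' -> 0 < r -> exists k Z,
 [/\ N Z (h k) (J (g k)), g (g k) + r *: h (h k) = h q & opn Z <= opn Q / (2 * Num.sqrt r)].
Proof. by move=> hQ r0; have := res (tsys_swap ts) hQ r0; rewrite bidBB. Qed.

(** Passing from B to N and back by resolvents at 1 multiplies the index l by 1 - g and an injective
    function f of g. *)
Lemma smooth : dns [set l | exists U, B U (g (h l)) (J (h (h l)))].
Proof.
have [m [m1 m2 sm mg mh]] := minv ts ltr01.
pose f := g ** g ** h ** m ** m.
have gh u : g (h u) = h (g u) by exact: ghE.
have sf : bsa f.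
 rewrite /bsa /f !badjM sg sh sm; apply: bopP => u /=.
 by rewrite -!gh !mg !mh -?gh.
have mi u : m u = 0 -> u = 0 by move=> e; rewrite -(m2 u) e !b0 scaler0 addr0.
have fi u : f u = 0 -> u = 0.
 by move=> /(pl_inj pl)/(pl_inj pl)/(hinj ts)/mi/mi.
apply: dns_sub (dns_image sf fi (dB ts)) => _ [l [U hU] <-].
have [kW [W [hW eW _]]] := res_swap hU ltr01.
have [k [Z [hZ eZ _]]] := res ts hW ltr01.
have kE : k = h (f l).
 have kWE : kW = m (h (g l)).
  by rewrite -eW -{1}(m1 kW); congr (m _); rewrite !scale1r addrC.
 by rewrite -{1}(m1 k) eZ kWE /f /= !(mg, mh) !gh.
by exists Z; rewrite -kE.
Qed.

(** The operator form of the resolvent equation, (D + r D^-1) Z = J Q^# J for D the quotient of [aa]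
    by [bb], cleared of denominators. It is tested on vectors J l with l as in [smooth], where the
    powers of g and 1 - g can be moved onto vectors of B. *)
Lemma opE Q q q' Z k r : N Q q q' -> B Z (g k) (J (h k)) -> h (h k) + r *: g (g k) = g q ->
 aa g (aa g Z) + r *: bb g (bb g Z) = aa g (bb g (J ** Q^# ** J)).
Proof.
move=> hQ hZ hk.
have gh u : g (h u) = h (g u) by exact: ghE.
have Ji u : J u = 0 -> u = 0 by move=> e; rewrite -(JJ u) e b0.
have dJ := dns_image sJ Ji smooth.
apply: (bop_eq_dns dJ) => _ [l [U hU] <-].
apply/subr0_eq/(dns_orth dJ) => _ [m [V hV] <-].
rewrite ipDl ipNl bopDE bopZE ipDl ipZl /aa /bb.
have t1 : ip ((h ** (h ** Z ** g) ** g) (J l)) (J m) = ip (Z (J (h (h l)))) (J (g (g m))).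
 by rewrite -[LHS]/(ip (h (h (Z (g (g (J l)))))) (J m)) !(bsaE _ _ sh) !gJ !hJ.
have t2 : ip ((g ** (g ** Z ** h) ** h) (J l)) (J m) = ip (Z (J (g (g l)))) (J (h (h m))).
 by rewrite -[LHS]/(ip (g (g (Z (h (h (J l)))))) (J m)) !(bsaE _ _ sg) !gJ !hJ.
have t3 : ip ((h ** (g ** (J ** Q^# ** J) ** h) ** g) (J l)) (J m) = ip (g (h l)) (Q (g (h m))).
 rewrite -[LHS]/(ip (h (g (J (Q^# (J (h (g (J l)))))))) (J m)) (bsaE _ _ sh) (bsaE _ _ sg).
 by rewrite gJ hJ JJ hJ gJ (bsaE _ _ sJ) JJ badjE badjK -gh.
rewrite t1 t2 t3.
have sV := ts_sB ts hV; have sU := ts_sB ts hU.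
have [l1 [e1 e2]] := ts_vB ts (ts_mB ts sV hU).
have := resE ts (q := q) (r := r) (k := k) l1 _.
rewrite -e2 -e1.
have -> : ip (V^# (g (h l))) q = ip (g (h l)) (Q (g (h m))).
 by have [<- _ _ _] := ts_rel ts hV hQ; rewrite badjEr.
have -> : ip (J (k - g k)) (U^# (g (h m))) = ip (Z (J (h (h l)))) (J (g (g m))).
 rewrite -badjE -(hE g).
 have [n [n1 n2]] := vB ts (ts_mB ts hZ sU); rewrite badjK in n2.
 rewrite n1 n2 (bsaE _ _ sJ) (bsaE _ _ sh) (bsaE _ _ sg); congr (ip n _).
 by rewrite hJ gJ !gh.
have -> : ip (V^# (g (h l))) (g k) = ip (Z (J (g (g l)))) (J (h (h m))).
 have [n [n1 n2]] := vB ts (ts_mB ts hV hZ).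
 rewrite -badjEr n1 (badjE Z) n2 (bsaE _ _ sJ) JJ !(bsaE _ _ sg) (bsaE _ _ sh).
 by rewrite !gh.
move=> ->; first by rewrite subrr.
by rewrite -hk !(hE g) bB; vring.
Qed.

Definition tau (Y : bop K K) := J ** Y^# ** J.
Lemma tauK Y : tau (tau Y) = Y.
Proof.
rewrite /tau !badjM badjK sJ; apply: bopP => u /=; by rewrite !JJ.
Qed.
Lemma tau_aa Y : tau (aa g Y) = aa g (tau Y).
Proof. by rewrite /tau /aa !badjM sg sh; apply: bopP => u /=; rewrite !hJ. Qed.
Lemma tau_bb Y : tau (bb g Y) = bb g (tau Y).
Proof. by rewrite /tau /bb !badjM sg sh; apply: bopP => u /=; rewrite !gJ. Qed.
Lemma tau_lin : lin tau.
Proof. by move=> c Y Z; rewrite /tau badjD badjZ bcDr bcDl bcZr bcZl. Qed.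

End Tau.

(** * The half power of the modular flow on the left algebra *)

Section HalfPower.
Context {R : realType} {K : rhilb R}.
Variables (g J : bop K K) (B N : bop K K -> K -> K -> Prop).
Hypothesis ts : tsys g J B N.
Local Notation h := (bid - g).
Let pl := ts_pol ts.
Let sg : bsa g := (pl_g pl).1.1.
Let sJ : bsa J := pl_J pl.
Let sh : bsa h := sh ts.
Let JJ u : J (J u) = u := JJE pl u.
Let gJ := gJ ts.
Let hJ := hJ ts.
Let gh u : g (h u) = h (g u). Proof. exact: ghE. Qed.
Let gi := pl_inj pl.
Let hi u : g u = u -> u = 0.
Proof. by move=> e; apply: (hinj ts); rewrite hE e subrr. Qed.
Let g1 := pl_g pl.
Let lh : lin h. Proof. by move=> c u v; rewrite bop_lin. Qed.
Let lg : lin g. Proof. by move=> c u v; rewrite bop_lin. Qed.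

(** X is the difference of the resolvents at 1 and 2, so that a^2 / (a^2 + s b^2) X, with a = [aa g]
    and b = [bb g], stays bounded both as s -> 0 and as s -> infinity. For s >= 1/2 it is half the
    resolvent at s of one element W of N; for smaller s it is a combination of resolvents. *)
Lemma uniform_resolvents Q q q' : N Q q q' -> exists X kX (A : R),
 [/\ B X (g kX) (J (h kX)), exists k1 k2, [/\ h (h k1) + g (g k1) = g q,
   h (h k2) + 2 *: g (g k2) = g q & kX = k1 - k2] &
  forall s : R, 0 < s -> exists G k, [/\ B G (g k) (J (h k)), opn G <= A,
   aa g (aa g G) + s *: bb g (bb g G) = aa g (aa g X) &
   h (h k) + s *: g (g k) = h (h kX)]].
Proof.
move=> hQ.
have [k1 [Z1 [hZ1 e1 _]]] := res ts hQ ltr01.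
have o1 := opE ts hQ hZ1 e1; rewrite scale1r in e1; rewrite scale1r in o1.
have [k2 [Z2 [hZ2 e2 _]]] := res ts hQ (ltr0n R 2).
have o2 := opE ts hQ hZ2 e2.
have B_lin c X x x' Y y y' (hX : B X x x') (hY : B Y y y') := (ts_lB ts).2 c _ _ _ _ _ _ hX hY.
have Bk c X k Y l : B X (g k) (J (h k)) -> B Y (g l) (J (h l)) ->
  B (c *: X + Y) (g (c *: k + l)) (J (h (c *: k + l))).
 by move=> hX hY; rewrite !bop_lin; exact: B_lin.
have Bk0 : B 0 (g 0) (J (h 0)) by rewrite !b0; exact: (ts_lB ts).1.
have hX : B (Z1 - Z2) (g (k1 - k2)) (J (h (k1 - k2))).
 by have := Bk (-1) _ _ _ _ hZ2 hZ1; rewrite !scaleN1r addrC (addrC _ k1).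
have r2 : 0 < 2^-1 :> R by rewrite invr_gt0.
have [kW [W [hW eW bW]]] := res_swap ts hZ1 r2.
(* The swapped [opE] expresses W through [tau J Z1]. Applying the involution [tau], which commutes
   with [aa] and [bb], gives the equation for [tau J W] that [frac_comp] needs. *)
have oW : bb g (bb g (tau J W)) + 2^-1 *: aa g (aa g (tau J W)) = aa g (bb g Z1).
 have E : bb g (bb g W) + 2^-1 *: aa g (aa g W) = bb g (aa g (tau J Z1)).
  have := opE (tsys_swap ts) hZ1 _ _ (Z := W) (k := kW) (r := 2^-1).
  by rewrite /aa /bb bidBB; apply.
 have := congr1 (tau J) E; rewrite (linD _ _ (tau_lin J)) (linZ _ _ (tau_lin J)).
 by rewrite !(tau_aa ts, tau_bb ts) (tauK ts) aabb => ->.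
pose c := opn Q; have c0 : 0 <= c := opn_ge0 Q.
pose A := opn W + (opn (Z1 - Z2) + 2 * c + opn Z1 + opn Z2).
have A1 : opn W <= A by rewrite lerDl !addr_ge0 ?mulr_ge0 ?opn_ge0.
have A2 : opn (Z1 - Z2) + 2 * c + opn Z1 + opn Z2 <= A by rewrite lerDr opn_ge0.
exists (Z1 - Z2), (k1 - k2), A; split=> //; first by exists k1, k2.
move=> s s0; case: (leP 2^-1 s) => hs.
 have [k3 [Z3 [hZ3 e3 b3]]] := res ts hW s0.
 have o3 := opE ts hW hZ3 e3; rewrite -/(tau J W) in o3.
 exists (2^-1 *: Z3), (2^-1 *: k3); split.
 - by have := Bk 2^-1 _ _ _ _ hZ3 Bk0; rewrite !addr0.
 - apply: le_trans A1; rewrite opnZE ger0_norm; last exact: ltW.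
  have q0 : 0 < Num.sqrt s by rewrite sqrtr_gt0.
  have q1 : 2^-1 <= Num.sqrt s.
   apply: sq_le; first exact: ltW.
   by rewrite sqr_sqrtr ?expr2; [lra|exact: ltW].
  have : opn W / (2 * Num.sqrt s) <= opn W.
   rewrite ler_pdivrMr ?mulr_gt0// ler_peMr ?opn_ge0//; lra.
  have := opn_ge0 Z3; have := opn_ge0 W; lra.
 - exact: (frac_comp fOl fOI (aa_lin g) (bb_lin g) (@aabb _ _ g) (fun v => aabb_inj g1 gi hi (ltr0n R 2)) o1 o2 oW o3).
 - have hgc v : h (g v) = g (h v) by rewrite gh.
  apply: (@frac_comp R K K _ (@fVl _ _) (@fVI _ _) h g lh lg hgc (g q) k1 k2 kW k3 s) => //.
  + by move=> v; exact: (res_inj ts (ltr0n R 2)).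
  + by rewrite e3 gh.
have [ks [Zs [hZs es bs]]] := res ts hQ s0.
have os := opE ts hQ hZs es.
have n1 : 1 - s != 0 by rewrite lt0r_neq0//; lra.
have n2 : 2 - s != 0 by rewrite lt0r_neq0//; lra.
pose al := (1 - s)^-1 * (2 - s)^-1; pose be := - (1 - s)^-1; pose ga := (2 - s)^-1.
have f1 : al + be + ga = 0 by rewrite /al /be /ga; field; rewrite n1 n2.
have f2 : be * (1 - s) = -1 by rewrite /be mulNr mulVf.
have f3 : ga * (2 - s) = 1 by rewrite /ga mulVf.
exists (Z1 - Z2 - s *: (al *: Zs + be *: Z1 + ga *: Z2)),
 (k1 - k2 - s *: (al *: ks + be *: k1 + ga *: k2)); split.
- have s1 := Bk al _ _ _ _ hZs Bk0; have s2 := Bk be _ _ _ _ hZ1 s1.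
 have s3 := Bk ga _ _ _ _ hZ2 s2; have := Bk (- s) _ _ _ _ s3 hX.
 have re (V : lmodType R) (x y z w : V) : - s *: (x + (y + (z + 0))) + w = w - s *: (z + y + x).
  by rewrite addr0 scaleNr addrC (addrC x) (addrC y).
 by rewrite !re.
- apply: le_trans A2.
 have i1 : (1 - s)^-1 <= 2 by rewrite invf_ple ?posrE//; lra.
 have i1' : 0 <= (1 - s)^-1 by rewrite invr_ge0; lra.
 have i2 : (2 - s)^-1 <= 1 by rewrite invf_ple ?posrE ?invr1//; lra.
 have i2' : 0 <= (2 - s)^-1 by rewrite invr_ge0; lra.
 have q0 : 0 < Num.sqrt s by rewrite sqrtr_gt0.
 have q1 : Num.sqrt s <= 1 by apply: sq_le => //; rewrite sqr_sqrtr ?expr1n; [lra|exact: ltW].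
 have qq : Num.sqrt s ^+ 2 = s by rewrite sqr_sqrtr// ltW.
 (* The resolvent bound is of order s^(-1/2), so the factor s makes it harmless. *)
 have zs : s * opn Zs <= c / 2.
  have h1 := ler_wpM2l (ltW s0) bs; apply: le_trans h1 _.
  have -> : s * (opn Q / (2 * Num.sqrt s)) = Num.sqrt s * (c / 2).
   by rewrite -{1}qq /c; field; exact: lt0r_neq0.
  by rewrite ler_piMl// divr_ge0.
 apply: le_trans (opnD _ _) _; rewrite opnN opnZE ger0_norm; last exact: ltW.
 have t1 : opn (al *: Zs + be *: Z1 + ga *: Z2) <= 2 * opn Zs + 2 * opn Z1 + opn Z2.
  apply: le_trans (opnD _ _) _; apply: lerD.
   apply: le_trans (opnD _ _) _; rewrite !opnZE; apply: lerD; apply: ler_wpM2r; rewrite ?opn_ge0//.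
    rewrite ger0_norm ?mulr_ge0// -[leRHS]mulr1; exact: ler_pM.
   by rewrite normrN ger0_norm.
  by rewrite opnZE ger0_norm// ler_piMl ?opn_ge0.
 have h1 := ler_wpM2l (ltW s0) t1; have z1 := opn_ge0 Z1; have z2 := opn_ge0 Z2.
 have : s * opn Z1 <= 2^-1 * opn Z1 by apply: ler_wpM2r => //; exact: ltW.
 have : s * opn Z2 <= 1 * opn Z2 by apply: ler_wpM2r => //; lra.
 lra.
- exact: (frac_split fOl fOI (aa_lin g) (bb_lin g) f1 f2 f3 o1 o2 os).
- exact: (frac_split (@fVl _ _) (@fVI _ _) lh lg f1 f2 f3 e1 e2 es).
Qed.

Lemma conv_sq (x : nat -> K) l (C : R) : 0 <= C ->
 (forall n, nrm (x n - l) ^+ 2 <= C * n.+1%:R^-1) -> conv x l.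
Proof.
move=> C0 H e e0; have C1 : 0 < C + 1 by lra.
have [|M HM] := inv_small (e := e ^+ 2 / (C + 1)); first by rewrite divr_gt0// exprn_gt0.
exists M => n /HM hn; rewrite nrm_lt// -nrm2; apply: le_lt_trans (H n) _.
have i0 : 0 <= n.+1%:R^-1 :> R by rewrite invr_ge0.
apply: le_lt_trans (_ : (C + 1) * n.+1%:R^-1 < _); first by apply: ler_wpM2r => //; lra.
by rewrite mulrC -ltr_pdivlMr.
Qed.

Lemma scv_adj (x : nat -> bop K K) (l m : bop K K) : scv x l -> scv (fun n => (x n)^#) m -> l^# = m.
Proof.
move=> hl hm; apply: badj_uniq => u v; apply/eqP; rewrite -subr_eq0.
rewrite -normr_eq0 eq_le normr_ge0 andbT; apply: eps_le => e e0.
have [N1 h1] := conv_ip v (hl u) (divr_gt0 e0 (ltr0n _ 2)).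
have [N2 h2] := conv_ip u (hm v) (divr_gt0 e0 (ltr0n _ 2)).
have := h1 (maxn N1 N2) (leq_maxl _ _); have := h2 (maxn N1 N2) (leq_maxr _ _).
rewrite (ipC u (m v)) (badjE (x _)^#) badjK (ipC v).
rewrite !ltr_norml ler_norml; lra.
Qed.

(** [V] is the image of [X] under [D / (1 + D)], where [D] is the half power
  [Y |-> |S| Y |S|^-1] of the modular flow. *)
Lemma halfpower Q q q' : N Q q q' -> exists X V k1 k2,
 [/\ h (h k1) + g (g k1) = g q, h (h k2) + 2 *: g (g k2) = g q,
   B X (g (k1 - k2)) (J (h (k1 - k2))),
   B V (g (h (k1 - k2))) (J (h (h (k1 - k2)))) &
   aa g V + bb g V = aa g X].
Proof.
move=> hQ; have [X [kX [A [hX [k1 [k2 [ek1 ek2 kXE]]] HG]]]] := uniform_resolvents hQ.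
have /choice[GK hGK] : forall c : R, exists p : bop K K * K, -1 < c < 1 ->
  [/\ B p.1 (g p.2) (J (h p.2)), opn p.1 <= A,
   aa g (aa g p.1) + ((1 - c) / (1 + c)) *: bb g (bb g p.1) = aa g (aa g X) &
   h (h p.2) + ((1 - c) / (1 + c)) *: g (g p.2) = h (h kX)].
 move=> c; have [/andP[c1 c2]|] := boolP (-1 < c < 1); last by exists (0, 0).
 have [G [k hG]] := HG _ (node_gt0 c1 c2).
 by exists (G, k).
(* The index of V k is averaged with the same nodes, so that V k stays in B with a known vector. *)
pose V k := avg k (fun c => (GK c).1); pose kv k := avg k (fun c => (GK c).2).
have VB k : B (V k) (g (kv k)) (J (h (kv k))) /\ opn (V k) <= A.
 apply: (@avg_ind2 _ (bop K K) K (fun Y l => B Y (g l) (J (h l)) /\ opn Y <= A)); last first.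
  by move=> c /hGK [].
 move=> Y Z l m [hY oY] [hZ oZ]; split.
  rewrite !scalerDr !bop_lin !bZ; apply: (ts_lB ts).2 => //.
  by have := (ts_lB ts).2 2^-1 _ _ _ _ _ _ hZ (ts_lB ts).1; rewrite !addr0.
 rewrite opnZE ger0_norm//; have := opnD Y Z; lra.
pose P Y := aa g Y + bb g Y; pose Q' Y := aa g Y - bb g Y.
have lP : lin P.
 by move=> c Y Z; rewrite /P aa_lin bb_lin scalerDr addrACA.
have lQ : lin Q'.
 by move=> c Y Z; rewrite /Q' aa_lin bb_lin scalerBr opprD addrACA.
have PQ Y : Q' (P Y) = P (Q' Y).
 rewrite /P /Q' (linD _ _ (aa_lin g)) (linD _ _ (bb_lin g)) (linD _ (- _) (aa_lin g)) (linD _ (- _) (bb_lin g)).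
 by rewrite (linN _ (aa_lin g)) (linN _ (bb_lin g)) aabb; move: (aa g _) (bb g (aa g Y)) (bb g _) => x y z; oring.
have DV k : iter (2 ^ k.+1) P (V k) + iter (2 ^ k.+1) Q' (V k) =
  iter (2 ^ k.+1).-1 P (aa g X) + iter (2 ^ k.+1).-1 Q' (aa g X).
 apply: (@dyadic R (bop K K) (K * K) (@fO R K) (@fOl R K) (@fOI R K) k P Q' (aa g X) (aa g X) (fun c => (GK c).1) lP lQ PQ) => c c1; have [_ _ E _] := hGK _ c1.
 by apply: (node_eq fOl fOI (aa_lin g) (bb_lin g) (@aabb _ _ g) _ E); case/andP: c1.
pose p v := h v + g v; pose q0 v := h v - g v.
have pE v : p v = v by rewrite /p hE subrK.
have lp : lin p by move=> c u v; rewrite !pE.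
have lq : lin q0 by move=> c u v; rewrite /q0 lh lg scalerBr opprD addrACA.
have Dv k : kv k + iter (2 ^ k.+1) q0 (kv k) = h kX + iter (2 ^ k.+1).-1 q0 (h kX).
 have pq v : q0 (p v) = p (q0 v) by rewrite !pE.
 have := @dyadic R K K (@fV R K) (@fVl R K) (@fVI R K) k p q0 (h kX) (h kX) (fun c => (GK c).2) lp lq pq.
 have itp n v : iter n p v = v by elim: n => // n IH; rewrite iterS IH pE.
 rewrite !itp; apply => c c1; have [_ _ _ E] := hGK _ c1.
 have hgc v : h (g v) = g (h v) by rewrite gh.
 by apply: (node_eq (@fVl _ _) (@fVI _ _) lh lg hgc _ E); case/andP: c1.
have pos k : (0 < 2 ^ k.+1)%N by rewrite expn_gt0.
have big k : (k < (2 ^ k.+1).-1)%N.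
 by rewrite -ltnS prednK//; apply: ltn_expl.
have q0s v w : ip (q0 v) w = ip v (q0 w) by rewrite /q0 !ipE (bsaE _ _ sh) (bsaE _ _ sg).
have q0i n v w : ip (iter n q0 v) w = ip v (iter n q0 w).
 by elim: n v => [//|n IH] v; rewrite [in LHS]iterSr IH q0s.
have q0E n v : iter n q0 v = iter n (h - g) v by apply: eq_iter => u; rewrite bopBE.
(* With N = 2^(k+1) the difference e solves e + q0^N e = 2 q0^(N-1) g h kX. As N / 2 is an integer,
   q0^N is positive and 1 + q0^N >= 1; [q_decay] bounds the right side. *)
have ckv : conv kv (h kX).
 apply: (@conv_sq _ _ (4 * nrm kX ^+ 2)) => [|k]; first by rewrite mulr_ge0 ?sqr_ge0.
 set e := kv k - h kX.
 have E : e + iter (2 ^ k.+1) q0 e = 2 *: iter (2 ^ k.+1).-1 q0 (g (h kX)).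
  rewrite -(linZ 2 _ (lin_iter _ lq)).
  have -> : 2 *: g (h kX) = h kX - q0 (h kX) by rewrite /q0 [h (h kX)]hE; vring.
  rewrite (linD _ (- _) (lin_iter _ lq)) (linN _ (lin_iter _ lq)) -iterSr prednK//.
  rewrite /e (linD _ (- _) (lin_iter _ lq)) (linN _ (lin_iter _ lq)) addrACA Dv.
  by vring.
 have le : nrm e <= nrm (e + iter (2 ^ k.+1) q0 e).
  have : nrm e ^+ 2 <= nrm e * nrm (e + iter (2 ^ k.+1) q0 e).
   apply: le_trans (CS _ _); rewrite nrm2 ipDr lerDl.
   have -> : (2 ^ k.+1 = 2 ^ k + 2 ^ k)%N by rewrite expnS mul2n addnn.
   by rewrite iterD -q0i ip_ge0.
  rewrite expr2; have [->|e0] := eqVneq (nrm e) 0; first by rewrite nrm_ge0.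
  by rewrite ler_pM2l// lt0r e0 nrm_ge0.
 apply: le_trans (_ : nrm (e + iter (2 ^ k.+1) q0 e) ^+ 2 <= _).
  by rewrite ler_sqr ?nnegrE ?nrm_ge0.
 rewrite E nrmZ exprMn q0E ger0_norm// (_ : 2 ^+ 2 = 4); last by rewrite expr2; lra.
 rewrite -mulrA; apply: ler_wpM2l => //; rewrite ler_pdivlMr ?ltr0n// mulrC.
 apply: le_trans (q_decay g1 (2 ^ k.+1).-1 kX).
 by apply: ler_wpM2r; [exact: sqr_ge0|rewrite ler_nat].
have Vb k : bnd (V k) A by apply: bnd_le (opn_bnd (V k)); have [] := VB k.
(* On a vector u of N, V k u = Q0 (g (kv k)) converges; with the uniform bound A this gives a strong
   limit, and likewise for the adjoints. *)
have [V0 bV0 cV] : exists2 l : bop K K, bnd l A & scv V l.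
 apply: (scv_exists Vb (ts_dvN ts)) => u [Q0 [u' hQ0]]; exists (Q0 (g (h kX))).
 have E k : V k u = Q0 (g (kv k)) by have [VBk _] := VB k; have [] := ts_rel ts VBk hQ0.
 have := bop_conv (Q0 ** g) ckv; move=> H e /H[M HM]; exists M => k /HM; by rewrite E.
have [V1 _ cV1] : exists2 l : bop K K, bnd l A & scv (fun k => (V k)^#) l.
 apply: (scv_exists (fun k => bnd_adj (Vb k)) (ts_dvN ts)) => u [Q0 [u' hQ0]].
 exists (Q0 (J (h (h kX)))).
 have E k : (V k)^# u = Q0 (J (h (kv k))) by have [VBk _] := VB k; have [] := ts_rel ts VBk hQ0.
 have := bop_conv (Q0 ** J ** h) ckv; move=> H e /H[M HM]; exists M => k /HM; by rewrite E.
have V1E := scv_adj cV cV1.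
have hV0 : B V0 (g (h kX)) (J (h (h kX))).
 apply: (ts_mem ts) => Q0 u u' hQ0; rewrite V1E; split.
  apply: conv_uniq (cV u) _.
  have E k : V k u = Q0 (g (kv k)) by have [VBk _] := VB k; have [] := ts_rel ts VBk hQ0.
  have := bop_conv (Q0 ** g) ckv; move=> H e /H[M HM]; exists M => k /HM; by rewrite E.
 apply: conv_uniq (cV1 u) _.
 have E k : (V k)^# u = Q0 (J (h (kv k))) by have [VBk _] := VB k; have [] := ts_rel ts VBk hQ0.
 have := bop_conv (Q0 ** J ** h) ckv; move=> H e /H[M HM]; exists M => k /HM; by rewrite E.
exists X, V0, k1, k2; rewrite -kXE; split=> //.
apply: subr0_eq.
apply: (corners_eq0 g1 gi hi) => e e0 e2.
exists (e ^+ 2 / 8); first by rewrite divr_gt0// exprn_gt0.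
move=> Pc Qc c d t t0 te nP nQ /andP[c0 c1] /andP[d0 d1].
pose nu Y := Pc ** Y ** Qc.
have lnu : lin nu by move=> r Y Z; rewrite /nu bcDr bcDl bcZr bcZl.
have nuP Y : P (nu Y) = nu (P Y).
 by rewrite /P /nu (cut_aa _ nP nQ) (cut_bb _ nP nQ) (bcDr Pc) bcDl.
have nuQ Y : Q' (nu Y) = nu (Q' Y).
 by rewrite /Q' /nu (cut_aa _ nP nQ) (cut_bb _ nP nQ) (bcBr Pc) bcBl.
have [c01 xy u20 u12] := window_box e0 c0 c1 d0 d1 t0 te.
have est Y : corner g Pc Qc c d t Y -> [/\ _, _, _ & _] := corner_PQ g1 (ltW t0) c01 xy.
move: (_ - 4 * t) (_ + 4 * t) u20 u12 est => u1 u2 u20 u12 est.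
have estP n Y : corner g Pc Qc c d t Y -> u1 ^+ n * opn Y <= opn (iter n P Y).
 elim: n Y => [|n IH] Y hc; first by rewrite mul1r.
 have [h1 _ h2 _] := est _ hc; rewrite iterSr exprSr -mulrA.
 apply: le_trans (IH _ h2); apply: ler_wpM2l => //; apply: exprn_ge0.
 by apply: le_trans u20 _; exact: ltW.
have estQ n Y : corner g Pc Qc c d t Y -> opn (iter n Q' Y) <= u2 ^+ n * opn Y.
 elim: n Y => [|n IH] Y hc; first by rewrite mul1r.
 have [_ h1 _ h2] := est _ hc; rewrite iterSr exprSr -mulrA.
 by apply: le_trans (IH _ h2) _; apply: ler_wpM2l => //; exact: exprn_ge0.
(* The defects of P V = aa X and Q' V = aa X. [DV] equates the power N - 1 of P on T with minus that
   of Q' on F; on a corner Q' is smaller than P by a factor r < 1, so T tends to 0 there. *)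
pose T k := P (V k) - aa g X; pose F k := Q' (V k) - aa g X.
have TF k : iter (2 ^ k.+1).-1 P (T k) = - iter (2 ^ k.+1).-1 Q' (F k).
 rewrite /T /F (linD _ (- _) (lin_iter _ lP)) (linD _ (- _) (lin_iter _ lQ)).
 by rewrite (linN _ (lin_iter _ lP)) (linN _ (lin_iter _ lQ)) -!iterSr prednK//; apply: zsub4.
have nuT k : iter (2 ^ k.+1).-1 P (nu (T k)) = - iter (2 ^ k.+1).-1 Q' (nu (F k)).
 have itP n Y : iter n P (nu Y) = nu (iter n P Y) by elim: n => // n IH; rewrite !iterS IH nuP.
 have itQ n Y : iter n Q' (nu Y) = nu (iter n Q' Y) by elim: n => // n IH; rewrite !iterS IH nuQ.
 by rewrite itP TF linN// itQ.
have onu Y : opn (nu Y) <= opn Y.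
 by apply: opn_lr; apply: opn_le; split=> // w; rewrite mul1r; [exact: narrow_proj nP|exact: narrow_proj nQ].
pose C1 := 2 * A + opn X.
have A0 : 0 <= A by apply: le_trans (opn_ge0 (V 0%N)) _; have [] := VB 0%N.
have C10 : 0 <= C1 by rewrite addr_ge0 ?mulr_ge0 ?opn_ge0.
have oF k : opn (nu (F k)) <= C1.
 apply: le_trans (onu _) _; rewrite /F /Q'.
 apply: le_trans (opnD _ _) _; rewrite opnN.
 have := opnD (aa g (V k)) (- bb g (V k)); rewrite opnN.
 have := opn_aa g1 (V k); have := opn_bb g1 (V k); have := opn_aa g1 X.
 have [_ ] := VB k; rewrite /C1; lra.
have u10 : 0 < u1 by exact: le_lt_trans u12.
pose r := u2 / u1; have r0 : 0 <= r by rewrite divr_ge0// ltW.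
have r1 : r < 1 by rewrite ltr_pdivrMr// mul1r.
have oT k : opn (nu (T k)) <= C1 / (1 - r) * k.+1%:R^-1.
 set n := (2 ^ k.+1).-1.
 have h1 := estP n _ (cut_corner (T k) nP nQ).
 have h2 := estQ n _ (cut_corner (F k) nP nQ).
 have h3 : u1 ^+ n * opn (nu (T k)) <= u2 ^+ n * C1.
  apply: le_trans h1 _; rewrite -/(nu (T k)) nuT opnN; apply: le_trans h2 _.
  by apply: ler_wpM2l (oF k); exact: exprn_ge0.
 have h4 : opn (nu (T k)) <= r ^+ n * C1.
  have un : 0 < u1 ^+ n by exact: exprn_gt0.
  by rewrite /r expr_div_n mulrAC ler_pdivlMr// mulrC.
 apply: le_trans h4 _; rewrite mulrAC mulrC -mulrA; apply: ler_wpM2l => //.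
 have h5 := geo_bound n r0 (ltW r1); have rn : 0 <= r ^+ n by exact: exprn_ge0.
 have r10 : 0 < 1 - r by rewrite subr_gt0.
 rewrite ler_pdivlMr// -[leRHS]div1r ler_pdivlMr ?ltr0n//.
 have h6 : r ^+ n * (1 - r) * k.+1%:R <= r ^+ n * (1 - r) * n%:R.
  by apply: ler_wpM2l; [apply: mulr_ge0 => //; exact: ltW|rewrite ler_nat].
 move: h5 h6 rn; move: (r ^+ n) (n%:R) => z m; lra.
apply: bopP => u; rewrite bop0E.
apply: (@conv_uniq _ _ (fun k => nu (T k) u)).
 have -> : (Pc ** (aa g V0 + bb g V0 - aa g X) ** Qc) u =
   Pc (aa g V0 (Qc u)) + Pc (bb g V0 (Qc u)) + Pc (- (aa g X (Qc u))).
  by rewrite -[LHS]/(Pc ((aa g V0 + bb g V0 - aa g X) (Qc u))) !bopDE bopNE !bD.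
 have E k : nu (T k) u = Pc (aa g (V k) (Qc u)) + Pc (bb g (V k) (Qc u)) + Pc (- (aa g X (Qc u))).
  by rewrite -[LHS]/(Pc ((aa g (V k) + bb g (V k) - aa g X) (Qc u))) !bopDE bopNE !bD.
 have c1' := convD (convD (bop_conv (Pc ** h) (cV (g (Qc u)))) (bop_conv (Pc ** g) (cV (h (Qc u)))))
  (conv_cst (Pc (- (aa g X (Qc u))))).
 by move=> e' /c1'[M HM]; exists M => k /HM; rewrite E.
apply: (@conv_le _ _ _ _ (C1 / (1 - r) * nrm u) (fun k => k.+1%:R^-1)).
- by rewrite !mulr_ge0 ?nrm_ge0// invr_ge0 subr_ge0 ltW.
- move=> k; rewrite subr0; apply: le_trans ((opn_bnd _).2 u) _.
 rewrite mulrAC; apply: ler_wpM2r => //; exact: nrm_ge0.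
- exact: inv_small.
Qed.

End HalfPower.

(** * Passing from left to right multiplication by J *)

Section Flip.
Context {R : realType} {K : rhilb R}.
Variables (g J : bop K K) (B N : bop K K -> K -> K -> Prop).
Hypothesis ts : tsys g J B N.
Local Notation h := (bid - g).
Let pl := ts_pol ts.
Let sg : bsa g := (pl_g pl).1.1.
Let sJ : bsa J := pl_J pl.
Let sh : bsa h := sh ts.
Let JJ u : J (J u) = u := JJE pl u.
Let gJ := gJ ts.
Let hJ := hJ ts.
Let gh u : g (h u) = h (g u). Proof. exact: ghE. Qed.
Let gi := pl_inj pl.
Let hi := hinj ts.
Let dT : dns (@setT K). Proof. by move=> u e e0; exists u; rewrite ?subrr ?nrm0. Qed.

(** For V' = X - V the hypothesis says V = |S| V' |S|^-1, so formally J V J = S V' S. That is right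
    multiplication by S v', where v' = g (g k) is the vector of V'. *)
Lemma halfpower_flip X V k : B X (g k) (J (h k)) -> B V (g (h k)) (J (h (h k))) ->
 aa g V + bb g V = aa g X -> N (J ** V ** J) (J (g (h k))) (h (h k)).
Proof.
move=> hX hV E; pose V' := X - V.
have hV' : B V' (g (g k)) (J (h (g k))).
 have -> : g k = k - h k by rewrite hE opprB addrC subrK.
 have := (ts_lB ts).2 (-1) _ _ _ _ _ _ hV hX; rewrite !scaleN1r /V' addrC.
 by rewrite !bB (addrC (- g _)) (addrC (- J _)).
have E' : bb g V = aa g V'.
 have -> : aa g V' = aa g X - aa g V by rewrite /aa /V' (bcBr h) bcBl.
 by rewrite -E addrAC subrr add0r.
have cl Y y y' : B Y y y' -> V (J y) = J (Y (J (g (h k)))).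
 move=> hY; have [l [y1 y2]] := vB ts hY.
 have [n [n1 n2]] := vB ts (ts_mB ts hV' (ts_sB ts hY)); rewrite badjK in n2.
 apply/subr0_eq/(dns_orth (dns_image sg gi dT)) => _ [m _ <-].
 rewrite ipDl ipNl; apply/eqP; rewrite subr_eq0; apply/eqP.
 rewrite y1 -hJ -(bsaE _ _ sg) -[g (V _)]/(bb g V (J l)) E'.
 rewrite -[aa g V' (J l)]/(h (V' (g (J l)))) (bsaE _ _ sh) gJ -y2 n1 gh n2 JJ.
 by rewrite (bsaE _ _ sg) (bsaE n _ sh) gh.
apply: (ts_mem (tsys_swap ts)) => Y y y' hY; split; first by rewrite /= (cl _ _ _ hY) JJ.
apply/subr0_eq/(dns_orth (ts_dvB ts)) => y2 [Y2 [y2' hY2]].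
rewrite ipDl ipNl; apply/eqP; rewrite subr_eq0; apply/eqP.
rewrite badjE badjK -[(J ** V ** J) y2]/(J (V (J y2))) (cl _ _ _ hY2) JJ badjEr (badjE Y).
have [n [n1 n2]] := vB ts (ts_mB ts (ts_sB ts hY2) hY); rewrite n1 n2.
by rewrite (bsaE _ _ sg) gJ -(bsaE _ (h n) sJ) -(bsaE _ n sh) hJ ipC !gh.
Qed.

Definition flippable V k := B V (g k) (J (h k)) /\ exists q q', N (J ** V ** J) q q'.

(** The indices produced by [halfpower] are the images of a core of N under a product of injective
    functions of g. *)
Lemma flippable_dns : dns [set k | exists V, flippable V k].
Proof.
have [m1 [a1 b1 s1 _ _]] := minv ts ltr01.
have [m2 [a2 b2 s2 _ _]] := minv ts (ltr0n R 2).
have i1 u : m1 u = 0 -> u = 0 by move=> e; rewrite -(b1 u) e !b0 scaler0 addr0.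
have i2 u : m2 u = 0 -> u = 0 by move=> e; rewrite -(b2 u) e !b0 scaler0 addr0.
have d := dns_image sh hi (dns_image s1 i1 (dns_image sg gi (dns_image sg gi
 (dns_image s2 i2 (dns_image sg gi (dns_image sh hi (dN ts))))))).
apply: dns_sub d => _ [_ [_ [_ [_ [_ [_ [k [Q hQ] <-] <-] <-] <-] <-] <-] <-].
have [X [V [k1 [k2 [e1 e2 hX hV E]]]]] := halfpower ts hQ.
(* The resolvent identity m1 - m2 = m1 g^2 m2. *)
have -> : m1 (g (g (m2 (g (h k))))) = k1 - k2.
 have -> : m2 (g (h k)) = k2 by rewrite -e2 a2.
 rewrite -[RHS]a1; congr (m1 _); rewrite scale1r !bB.
 have -> : h (h k1) - h (h k2) + (g (g k1) - g (g k2)) =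
  (h (h k1) + g (g k1)) - (h (h k2) + 2 *: g (g k2)) + g (g k2) by vring.
 by rewrite e1 e2 subrr add0r.
by exists V; split=> //; exists (J (g (h (k1 - k2)))), (h (h (k1 - k2))); exact: halfpower_flip E.
Qed.

(** Paired with a vector q of N, Y r depends on Y only through y' = S y, so both sides are
    continuous in the graph norm and a core suffices. *)
Lemma flippable_ext (T : bop K K) r : (forall V k, flippable V k -> V r = T (g k)) ->
 forall Y y y', B Y y y' -> T y = Y r.
Proof.
move=> H Y y y' hY; apply/esym/eqP; rewrite -subr_eq0; apply/eqP/(dns_orth (ts_dvN ts)) => q [Q [q' hQ]].
have z : h (J (Q^# r)) - g (T^# q) = 0.
 apply: (dns_orth flippable_dns) => k [V hk]; have [hV _] := hk.
 rewrite ipDl ipNl (bsaE _ _ sh) (bsaE _ _ sJ) (bsaE _ _ sg) badjE badjK.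
 have [_ e _ _] := ts_rel ts hV hQ; rewrite -e (badjE T^#) badjK -(H _ _ hk).
 by rewrite -badjE ipC subrr.
have [k [-> y2]] := vB ts hY; rewrite ipDl ipNl.
have : ip (h (J (Q^# r)) - g (T^# q)) k = 0 by rewrite z ip0l.
rewrite ipDl ipNl (bsaE _ _ sh) (bsaE _ _ sJ) -y2 badjE badjK (bsaE _ _ sg) (badjE T^#) badjK.
have [_ <- _ _] := ts_rel ts hY hQ.
by rewrite -(badjE Y) (ipC q).
Qed.

(** S = J T J commutes with flippable V, because J V J lies in N. To reach all of B, the products Q1
    S Q2 are shown to lie in N: their defining relations concern the values of Y at fixed vectors,
    so [flippable_ext] applies. Nondegeneracy of N then cancels Q1 and Q2. *)
Theorem tomita (T : bop K K) : (forall Q q q', N Q q q' -> T ** Q = Q ** T) ->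
 forall X x x', B X x x' -> (J ** T ** J) ** X = X ** (J ** T ** J).
Proof.
move=> hT X x x' hX; pose S := J ** T ** J; rewrite -/S.
have SV V k : flippable V k -> S ** V = V ** S /\ S^# ** V = V ** S^#.
 move=> [hV [q [q' hN]]]; have e1 := hT _ _ _ hN; have e2 := hT _ _ _ (ts_sN ts hN).
 split; apply: bopP => u.
  have := congr1 (fun f : bop K K => J (f (J u))) e1.
  by rewrite /S /= !JJ.
 have := congr1 (fun f : bop K K => J (f^# (J u))) e2.
 by rewrite /S !badjM !badjK sJ /= !JJ.
clearbody S; have main Q1 q1 q1' Q2 q2 q2' : N Q1 q1 q1' -> N Q2 q2 q2' ->
  N (Q1 ** S ** Q2) (Q1 (S q2)) (Q2^# (S^# q1')).
 move=> h1 h2; apply: (ts_mem (tsys_swap ts)) => Y y y' hY; split.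
  apply: (flippable_ext _ hY) => V k hk; have [hV _] := hk; have [e _] := SV _ _ hk.
  have c1 := ts_comm ts hV h1; have [r1 _ _ _] := ts_rel ts hV h2.
  rewrite -[LHS]/((V ** Q1) (S q2)) c1 /= -[V (S q2)]/((V ** S) q2) -e /=.
  by rewrite r1.
 rewrite !badjM; apply: (flippable_ext _ hY) => V k hk; have [hV _] := hk; have [_ e] := SV _ _ hk.
 have c1 := ts_comm ts hV (ts_sN ts h2); have [_ _ r1 _] := ts_rel ts hV h1.
 rewrite -[LHS]/((V ** Q2^#) (S^# q1')) c1 /= -[V (S^# q1')]/((V ** S^#) q1') -e /=.
 by rewrite r1.
have z Q2 q2 q2' u : N Q2 q2 q2' -> (S ** X - X ** S) (Q2 u) = 0.
 move=> h2; apply: (ts_ndN ts) => Q1 q1 q1' h1.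
 have c := ts_comm ts hX (main _ _ _ _ _ _ h1 h2).
 have c1 := ts_comm ts hX h1; have c2 := ts_comm ts hX h2.
 rewrite bopBE bB; apply/eqP; rewrite subr_eq0; apply/eqP => /=.
 rewrite -[X (Q2 u)]/((X ** Q2) u) c2 -[Q1 (X _)]/((Q1 ** X) (S (Q2 u))) -c1.
 by have := bop_at u c.
apply: subr0_eq; rewrite -[LHS]badjK -[RHS]badj0; congr badj.
apply: bopP => u; rewrite bop0E; apply: (ts_ndN ts) => Q q q' /(ts_sN ts) hQ.
apply: ip_inj => w; rewrite ip0l -[Q]badjK badjE badjK badjE badjK.
by rewrite (z _ _ _ _ hQ) ip0r.
Qed.

End Flip.

(** * Von Neumann algebras and normal representations *)

Section Extend.
Context {R : realType} {U V : rhilb R}.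

(** Extension by continuity, and by 0 on the orthogonal complement. Indexing both families by I
    spares a separate proof that a i determines b i. *)
Lemma extend (I : Type) (D : I -> Prop) (a : I -> U) (b : I -> V) (C : R) : 0 <= C ->
 (exists2 i, D i & a i = 0) ->
 (forall c i j, D i -> D j -> exists k, [/\ D k, a k = c *: a i + a j & b k = c *: b i + b j]) ->
 (forall i, D i -> nrm (b i) <= C * nrm (a i)) ->
 exists T : bop U V, [/\ bnd T C, forall i, D i -> T (a i) = b i &
  forall u, (forall i, D i -> ip u (a i) = 0) -> T u = 0].
Proof.
move=> C0 [i0 D0 a0] lab hab.
pose L : set U := [set u | exists2 i, D i & u = a i].
have sL : subsp L.
 split; first by exists i0; rewrite ?a0.
 by move=> c _ _ [i Di ->] [j Dj ->]; have [k [Dk <- _]] := lab c i j Di Dj; exists k.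
have [p [sp pp Lp pL op]] := bproj_exists (scl_subsp sL) (@scl_closed _ _ L).
pose G u v := forall e : R, 0 < e -> exists i, [/\ D i, nrm (p u - a i) < e & nrm (v - b i) < e].
have Gex u : {v | G u v}.
 apply: cid; have [x hx cx] := scl_seq (Lp u).
 have /choice[s hs] : forall n, exists i, D i /\ x n = a i by move=> n; case: (hx n) => i; exists i.
 have hb m n : nrm (b (s m) - b (s n)) <= C * nrm (x m - x n).
  have [Dm em] := hs m; have [Dn en] := hs n.
  have [k [Dk ak bk]] := lab (-1) _ _ Dn Dm; rewrite !scaleN1r in ak bk.
  by rewrite em en addrC -bk (addrC (a _)) -ak; exact: hab.
 have [v hv] : exists v, conv (fun n => b (s n)) v.
  apply: cau_conv => e e0; have C1 : 0 < C + 1 by lra.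
  have [M hM] := cx (e / (2 * (C + 1))) ltac:(by rewrite divr_gt0// mulr_gt0).
  exists M => m n /hM h1 /hM h2; apply: le_lt_trans (hb m n) _.
  have h3 : nrm (x m - x n) < e / (C + 1).
   have := nrm_distD (x m) (x n) (p u); rewrite (nrmB (p u)).
   have : e / (C + 1) = 2 * (e / (2 * (C + 1))) by field; exact: lt0r_neq0.
   lra.
  apply: le_lt_trans (_ : C * (e / (C + 1)) < _); first by apply: ler_wpM2l => //; exact: ltW.
  by rewrite mulrCA gtr_pMr// ltr_pdivrMr// mul1r; lra.
 exists v => e e0; have [N1 h1] := cx e e0; have [N2 h2] := hv e e0.
 have [Dn en] := hs (maxn N1 N2); exists (s (maxn N1 N2)); split=> //.
  by rewrite -en nrmB h1// leq_maxl.
 by rewrite nrmB h2// leq_maxr.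
have Gbd u v : G u v -> nrm v <= C * nrm (p u).
 move=> hG; apply: eps_le => e e0; have C1 : 0 < C + 1 by lra.
 have [i [Di h1 h2]] := hG (e / (C + 1)) ltac:(by rewrite divr_gt0).
 have h3 := hab i Di; have h4 := nrmD (v - b i) (b i); rewrite subrK in h4.
 have h5 := nrmD (a i - p u) (p u); rewrite subrK nrmB in h5.
 have h6 : C * nrm (a i) <= C * (e / (C + 1)) + C * nrm (p u).
  by rewrite -mulrDr; apply: ler_wpM2l => //; lra.
 have h7 : C * (e / (C + 1)) + e / (C + 1) = e by field; exact: lt0r_neq0.
 lra.
have Glin c u v u' v' : G u v -> G u' v' -> G (c *: u + u') (c *: v + v').
 move=> h h' e e0; have c1 : 0 < `|c| + 1 by rewrite ltr_wpDl.
 have [i [Di h1 h2]] := h (e / 2 / (`|c| + 1)) ltac:(by rewrite !divr_gt0).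
 have [j [Dj h3 h4]] := h' (e / 2) ltac:(by rewrite divr_gt0).
 have [k [Dk ak bk]] := lab c i j Di Dj.
 have small (W : rhilb R) (w w' x x' : W) : nrm (w - x) < e / 2 / (`|c| + 1) -> nrm (w' - x') < e / 2 ->
   nrm (c *: w + w' - (c *: x + x')) < e.
  move=> k1 k2; have -> : c *: w + w' - (c *: x + x') = c *: (w - x) + (w' - x') by vring.
  apply: le_lt_trans (nrmD _ _) _; rewrite nrmZ.
  have : `|c| * nrm (w - x) <= e / 2; last by lra.
  apply: le_trans (_ : `|c| * (e / 2 / (`|c| + 1)) <= _); first by rewrite ler_wpM2l// ltW.
  by rewrite mulrCA ler_piMr ?divr_ge0 ?ltW// ltr_pdivrMr// mul1r ltrDl.
 by exists k; split=> //; rewrite ?ak ?bk ?bop_lin; exact: small.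
have Guniq u v w : G u v -> G u w -> v = w.
 move=> h1 h2; apply/eqP; rewrite -subr_eq0 -scaleN1r addrC; apply/eqP/nrm_eq0/eqP.
 rewrite eq_le nrm_ge0 andbT; apply: le_trans (Gbd _ _ (Glin (-1) _ _ _ _ h2 h1)) _.
 by rewrite scaleN1r addNr b0 nrm0 mulr0.
pose T u := sval (Gex u); have GT u : G u (T u) := svalP (Gex u).
have Tl c u v : T (c *: u + v) = c *: T u + T v by apply: (Guniq _ _ _ (GT _)); exact: Glin.
have np u : nrm (p u) <= nrm u.
 apply: sq_le; first exact: nrm_ge0.
 have e : ip (p u) (p u) = ip (p u) u by rewrite (bsaE _ _ sp) -[p (p u)]/((p ** p) u) pp ipC.
 rewrite !nrm2; have := ip_ge0 (p u - u); rewrite !ipE (ipC u (p u)) e; lra.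
have Tb u : nrm (T u) <= C * nrm u.
 by apply: le_trans (Gbd _ _ (GT u)) _; apply: ler_wpM2l.
exists (mkbop Tl C0 Tb); split=> //.
 move=> i Di /=; apply: (Guniq _ _ _ (GT _)) => e e0; exists i.
 by rewrite pL ?subrr ?nrm0//; apply: sub_scl; exists i.
move=> u hu /=; apply: nrm_eq0; apply/eqP; rewrite eq_le nrm_ge0 andbT.
apply: le_trans (Gbd _ _ (GT u)) _; suff -> : p u = 0 by rewrite nrm0 mulr0.
apply: ip_inj => w; rewrite ip0l (bsaE _ _ sp).
have [x hx cx] := scl_seq (Lp w); rewrite ipC; apply: (conv_ip_eq cx) => n.
by have [i Di ->] := hx n; rewrite ipC hu.
Qed.

End Extend.

Section Maximal.
Context {R : realType} {H : rhilb R}.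
Variable e : nat -> H.
Hypothesis de : dns (range e).

(** A greedy sequence takes the place of Zorn's lemma: step n, decoded as (i, m), comes within 1/(m
    + 1) of the largest possible <b e_i, e_i>. The limit cannot be increased at any e_i, and these
    are dense. *)
Lemma maximal (P : bop H H -> Prop) (a0 : bop H H) : (forall a, P a -> ble1 a) ->
 (forall x (l : bop H H), (forall n, P (x n)) -> (forall n, bpos (x n.+1 - x n)) -> scv x l -> P l) ->
 P a0 -> exists a, [/\ P a, bpos (a - a0) & forall b, P b -> bpos (b - a) -> b = a].
Proof.
move=> P1 Pl P0.
have step (n : nat) (a : bop H H) : exists b, P a -> [/\ P b, bpos (b - a) & forall i m, unpickle n = Some (i, m) ->
  forall b', P b' -> bpos (b' - a) -> ip (b' (e i)) (e i) <= ip (b (e i)) (e i) + m.+1%:R^-1].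
 have [Pa|] := pselect (P a); last by exists 0.
 case En : (unpickle n : option (nat * nat)) => [[i m]|]; last first.
  by exists a => _; split=> //; rewrite subrr; exact: bpos0.
 pose A := [set r : R | exists b, [/\ P b, bpos (b - a) & r = ip (b (e i)) (e i)]].
 have hA : has_sup A.
  split; first by exists (ip (a (e i)) (e i)), a; split=> //; rewrite subrr; exact: bpos0.
  by exists (ip (e i) (e i)) => _ [b [/P1 [_ h] _ ->]]; exact: h.
 have m0 : 0 < m.+1%:R^-1 :> R by rewrite invr_gt0.
 have [_ [b [Pb ba ->]] hb] := sup_adherent m0 hA.
 exists b => _; split=> // j k [<- <-] b' Pb' ba'.
 have : ip (b' (e i)) (e i) <= sup A by apply: ub_le_sup; [exact: hA.2|exists b'].
 by move: (m.+1%:R^-1) hb => r hb; lra.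
have /choice[F hF] : forall p : nat * bop H H, exists b, P p.2 -> [/\ P b, bpos (b - p.2) &
  forall i m, unpickle p.1 = Some (i, m) -> forall b', P b' -> bpos (b' - p.2) ->
   ip (b' (e i)) (e i) <= ip (b (e i)) (e i) + m.+1%:R^-1] by move=> [n a]; exact: step.
pose x := fix x n := if n is k.+1 then F (k, x k) else a0.
have Px n : P (x n) by elim: n => [//|n IH] /=; have [] := hF (n, x n) IH.
have inc n : bpos (x n.+1 - x n) by have [] := hF (n, x n) (Px n).
have [l [cl _ _ hl]] := monotone_scv (fun n => (P1 _ (Px n)).1) (fun n => ble1_bnd (P1 _ (Px n))) inc.
have Pl' := Pl x l Px inc cl.
exists l; split=> //; first exact: (hl 0%N).
move=> b Pb hb.
have ht (c d f : bop H H) : bpos (c - d) -> bpos (d - f) -> bpos (c - f).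
 by move=> h1 h2; have := bposD h1 h2; rewrite addrA subrK.
have z i : (b - l) (e i) = 0.
 apply: (bpos_eq0 hb); rewrite bopBE ipDl ipNl.
 apply/eqP; rewrite eq_le; apply/andP; split; last first.
  by have := hb.2 (e i); rewrite bopBE ipDl ipNl.
 rewrite subr_le0; apply: eps_le => d d0.
 have [m hm] := inv_small d0; have {}hm := hm m (leqnn m).
 have := hF (pickle (i, m), x (pickle (i, m))) (Px _) => /= -[_ _].
 move=> /(_ i m (pickleK _) b Pb (ht _ _ _ hb (hl _))).
 rewrite -[F _]/(x (pickle (i, m)).+1).
 have := (hl (pickle (i, m)).+1).2 (e i); rewrite bopBE ipDl ipNl.
 by move: (m.+1%:R^-1) hm => r hm; lra.
apply: subr0_eq.
by apply: (bop_eq_dns de) => _ [i _ <-]; rewrite z bop0E.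
Qed.

End Maximal.

Section VN.
Context {R : realType} {H : rhilb R}.

(** A complex von Neumann algebra is a real one containing the
  multiplication by the imaginary unit. *)
Record vnalg (M : bop H H -> Prop) : Prop := Vnalg {
 vn_adj : forall a, M a -> M a^#;
 vn_bic : forall a, (forall T, (forall b, M b -> T ** b = b ** T) -> T ** a = a ** T) -> M a }.

Variable M : bop H H -> Prop.
Hypothesis vM : vnalg M.

Lemma vn1 : M bid. Proof. by apply: (vn_bic vM) => T _; rewrite bc1l bc1r. Qed.
Lemma vn0 : M 0. Proof. by apply: (vn_bic vM) => T _; rewrite bc0l bc0r. Qed.
Lemma vn_lin c a b : M a -> M b -> M (c *: a + b).
Proof.
by move=> ha hb; apply: (vn_bic vM) => T hT; rewrite bcDl bcDr bcZl bcZr !hT.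
Qed.
Lemma vnD a b : M a -> M b -> M (a + b).
Proof. by move=> ha hb; have := vn_lin 1 ha hb; rewrite scale1r. Qed.
Lemma vnZ c a : M a -> M (c *: a).
Proof. by move=> ha; have := vn_lin c ha vn0; rewrite addr0. Qed.
Lemma vnB a b : M a -> M b -> M (a - b).
Proof. by move=> ha hb; rewrite -scaleN1r addrC; exact: vn_lin. Qed.
Lemma vnM a b : M a -> M b -> M (a ** b).
Proof. by move=> ha hb; apply: (vn_bic vM) => T hT; rewrite bcA hT// -bcA hT// bcA. Qed.
Lemma vn_sqrt a : ble1 a -> M a -> M (bsqrt a).
Proof. by move=> h ha; apply: (vn_bic vM) => T hT; apply: bsqrt_comm => //; exact: hT. Qed.
Lemma vn_inv a b : a ** b = bid -> b ** a = bid -> M a -> M b.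
Proof. by move=> h1 h2 ha; apply: (vn_bic vM) => T hT; apply: (binv_comm h1 h2); exact: hT. Qed.
Lemma vn_scv x (l : bop H H) : (forall n, M (x n)) -> scv x l -> M l.
Proof.
move=> hx cx; apply: (vn_bic vM) => T hT; apply: bopP => u /=.
apply: conv_uniq (bop_conv T (cx u)) _ => e e0; have [n hn] := cx (T u) e e0; exists n => m /hn.
by rewrite -[T (x m u)]/((T ** x m) u) hT.
Qed.

Context {K : rhilb R}.

(** The last clause is a weak form of normality that both the predual and a normal weight deliver: a
    vector state vanishing along an increasing sequence vanishes at its limit. [rp_scv] recovers
    strong continuity on bounded sequences from it. *)
Record repn (P : bop H H -> bop K K) : Prop := Repn {
 rp_lin : forall c a b, M a -> M b -> P (c *: a + b) = c *: P a + P b;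
 rp_mul : forall a b, M a -> M b -> P (a ** b) = P a ** P b;
 rp_adj : forall a, M a -> P a^# = (P a)^#;
 rp_1 : P bid = bid;
 rp_norm : forall k x (l : bop H H), (forall n, M (x n)) -> (forall n, ble1 (x n)) ->
  (forall n, bpos (x n.+1 - x n)) -> scv x l -> (forall n, ip (P (x n) k) k = 0) -> ip (P l k) k = 0 }.

Variable P : bop H H -> bop K K.
Hypothesis rP : repn P.
Lemma rpD a b : M a -> M b -> P (a + b) = P a + P b.
Proof. by move=> ha hb; rewrite -[a]scale1r (rp_lin rP)// !scale1r. Qed.
Lemma rp0 : P 0 = 0.
Proof. by have := rp_lin rP (-1) vn0 vn0; rewrite scaler0 addr0 scaleN1r addNr. Qed.
Lemma rpZ c a : M a -> P (c *: a) = c *: P a.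
Proof. by move=> ha; rewrite -[c *: a]addr0 (rp_lin rP)// ?rp0 ?addr0//; exact: vn0. Qed.
Lemma rpB a b : M a -> M b -> P (a - b) = P a - P b.
Proof. by move=> ha hb; rewrite -scaleN1r addrC (rp_lin rP)// scaleN1r addrC. Qed.

Lemma rp_ge0 a k : M a -> ble1 a -> 0 <= ip (P a k) k.
Proof.
move=> ha a1; have [_ [[sb _] _] bb] := bsqrt_spec a1; have hb := vn_sqrt a1 ha.
by rewrite -bb (rp_mul rP)//= -{1}sb (rp_adj rP)// -badjEr ip_ge0.
Qed.

Variable e : nat -> H.
Hypothesis de : dns (range e).

Definition intertw (T : bop H K) := forall a, M a -> P a ** T = T ** a.

(** Otherwise the functional of a vector orthogonal to the ranges of the intertwiners
  would, on some corner of [M], be dominated by a vector functional on [H], which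
  gives a nonzero intertwiner. *)
Lemma intertw_total k : (forall T, intertw T -> T^# k = 0) -> k = 0.
Proof.
move=> hk; apply: contrapT => k0; pose w a := ip (P a k) k.
have w1 : 0 < w bid.
 rewrite /w (rp_1 rP) /= lt_neqAle ip_ge0 andbT eq_sym; apply/eqP => /ip_eq0; exact: k0.
have M1 := vn1.
(* a0 is maximal among the contractions on which w vanishes; it plays the complement of the support
   of w. *)
have [|x l hx ix cx||a0 [[Ma0 a01 wa0] _ max0]] := @maximal _ _ e de (fun a => [/\ M a, ble1 a & w a = 0]) 0.
- by move=> a [].
- have [Mx x1 wx] : [/\ forall n, M (x n), forall n, ble1 (x n) & forall n, w (x n) = 0].
  by split=> n; have [] := hx n.
 have [l' [cl' pl' bl' _]] := monotone_scv (fun n => (x1 n).1) (fun n => ble1_bnd (x1 n)) ix.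
 have ll : l = l' by exact: scv_uniq cl'.
 split; [exact: vn_scv cx|by rewrite ll; exact: bnd_ble1|exact: (rp_norm rP Mx x1 ix cx)].
- split; [exact: vn0|split; [exact: bpos0|by move=> u; rewrite bop0E ip0l ip_ge0]|].
 by rewrite /w rp0 bop0E ip0l.
(* z is scaled up so that the maximal [a] chosen next cannot be 1. *)
have [z hz] : exists z, w bid < ip ((bid - a0) z) z.
 have p0 := (ble1_compl a01).1.
 have [u hu] : exists u, 0 < ip ((bid - a0) u) u.
  apply: contrapT => hn; have e0 : bid - a0 = 0.
   apply: bopP => u; rewrite bop0E; apply: (bpos_eq0 p0); apply/eqP.
   by rewrite eq_le p0.2 andbT leNgt; apply/negP => h; apply: hn; exists u.
  by move: w1; move/subr0_eq: e0 => ->; rewrite wa0 ltxx.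
 pose s := w bid / ip ((bid - a0) u) u + 1.
 have s1 : 1 <= s by rewrite lerDr divr_ge0//; exact: ltW.
 exists (s *: u); rewrite bZ ipZl ipZr mulrA.
 have e1 : s * ip ((bid - a0) u) u = w bid + ip ((bid - a0) u) u.
  by rewrite /s mulrDl mul1r divfK// lt0r_neq0.
 have : s * ip ((bid - a0) u) u <= s * (s * ip ((bid - a0) u) u).
  by rewrite ler_peMl// e1 addr_ge0//; exact: ltW.
 by rewrite mulrA e1; lra.
have pB a b : bpos (a - b) -> M a -> M b -> ble1 a -> bpos b -> w b <= w a.
 move=> h ha hb a1 b1; rewrite -subr_ge0 /w -ipNl -ipDl -bopBE -rpB//.
 apply: rp_ge0; first exact: vnB.
 split=> // u; rewrite bopBE ipDl ipNl; have := a1.2 u; have := b1.2 u; lra.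
(* For a maximal [a] in this set and c = 1 - a, the opposite inequality w (c y c) <= <y (c z), c z>
   must hold, otherwise c y c could be added to [a]. It makes y (c z) |-> P y (P c k)
   contractive. *)
pose A1 a := [/\ M a, ble1 a, bpos (a - a0) & ip ((a - a0) z) z <= w a].
have [|x l hx ix cx||a [[Ma a1 aa0 wa] _ maxa]] := @maximal _ _ e de A1 a0.
- by move=> a [].
- have x1 n : ble1 (x n) by have [] := hx n.
 have [l' [cl' pl' bl' hl']] := monotone_scv (fun n => (x1 n).1) (fun n => ble1_bnd (x1 n)) ix.
 have ll : l = l' by exact: scv_uniq cl'.
 have Ml : M l by apply: vn_scv cx => n; have [] := hx n.
 have l1 : ble1 l by rewrite ll; exact: bnd_ble1.
 split=> //.
  have := bposD (hl' 0%N) (let: And4 _ _ h _ := hx 0%N in h); by rewrite -ll addrA subrK.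
 rewrite bopBE ipDl; have : ip (l z) z <= w l - ip (- a0 z) z.
  apply: (conv_ip_le (cx z)) => n; have [Mx _ _] := hx n; rewrite bopBE ipDl.
  have := pB l (x n); rewrite ll => /(_ (hl' n)); rewrite -ll => /(_ Ml Mx l1 (x1 n).1); lra.
 by lra.
- by split=> //; rewrite subrr ?bop0E ?ip0l; [exact: bpos0|rewrite wa0].
pose c := bid - a; have c1 : ble1 c := ble1_compl a1; have Mc : M c := vnB M1 Ma.
have sc : bsa c := c1.1.1.
have c0 : c <> 0.
 move=> /subr0_eq ca; move: wa; rewrite -ca => /(lt_le_trans hz).
 by rewrite ltxx.
have wc : w c <> 0.
 move=> wc; apply: c0; have : a0 + c = a0; last by move=> /(canRL (addKr _)); rewrite addNr.
 apply: max0.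
  split; first exact: vnD.
   split; first exact: bposD a01.1 c1.1.
   by move=> u; rewrite /c bopDE bopBE !ipE /=; have := aa0.2 u; rewrite bopBE !ipE; lra.
  by rewrite /w rpD// bopDE ipDl -/(w a0) -/(w c) wa0 wc addr0.
 by rewrite addrC addrA addNr add0r; exact: c1.1.
have dom y : M y -> ble1 y -> w (c ** y ** c) <= ip (y (c z)) (c z).
 move=> My y1; rewrite leNgt; apply/negP => hlt.
 have Mcy : M (c ** y ** c) by apply: vnM => //; exact: vnM.
 have pcy : bpos (c ** y ** c) by rewrite -{1}sc; apply: bpos_conj; exact: y1.1.
 have E : a + c ** y ** c = a.
  apply: maxa; last by rewrite addrC addrA addNr add0r.
  split; first exact: vnD.
  - split; first exact: bposD a1.1 pcy.
   move=> u; have : ip ((c ** y ** c) u) u <= ip (c u) u.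
    rewrite /= (bsaE _ _ sc); apply: le_trans (y1.2 _) _.
    have := @bpos_sq _ _ c 1 u c1.1; rewrite mul1r; apply => v; rewrite mul1r; exact: c1.2.
   rewrite bopDE ipDl; move: (ip ((c ** y ** c) u) u) => t; rewrite /c bopBE !ipE /=; lra.
  - by rewrite addrAC; exact: bposD aa0 pcy.
  - rewrite addrAC bopDE ipDl /w rpD// bopDE ipDl; apply: lerD => //.
   by rewrite /= (bsaE _ z sc); exact: ltW.
 have E0 : c ** y ** c = 0 by move: E => /(canRL (addKr _)); rewrite addNr.
 move: hlt; rewrite -(bsaE _ z sc) -[c (y (c z))]/((c ** y ** c) z) E0 /w rp0 !bop0E !ip0l.
 by rewrite ltxx.
have [|c' i j Mi Mj|y My|T [bT Ta T0]] := @extend _ H K _ M (fun y => y (c z)) (fun y => P y (P c k)) 1 ler01.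
- by exists 0; rewrite ?bop0E//; exact: vn0.
- by exists (c' *: i + j); rewrite (rp_lin rP)// !bopDE !bopZE; split=> //; exact: vn_lin.
- rewrite mul1r; apply: sq_le; first exact: nrm_ge0; rewrite !nrm2.
 have [D [D0 bD]] := bop_bnd y; pose s := ((D + 1) ^+ 2)^-1.
 have D1 : 0 < (D + 1) ^+ 2 by rewrite exprn_gt0//; lra.
 have s0 : 0 < s by rewrite invr_gt0.
 have My2 : M (y^# ** y) by apply: vnM => //; exact: (vn_adj vM).
 have b1 : ble1 (s *: (y^# ** y)).
  split; first by apply: bposZ; [exact: ltW|exact: bpos_adjl].
  move=> u; rewrite bopZE ipZl /= -badjEr -nrm2 -(nrm2 u) mulrC ler_pdivrMr// mulrC -exprMn.
  rewrite ler_sqr ?nnegrE ?nrm_ge0 ?mulr_ge0 ?nrm_ge0//; last by lra.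
  by apply: le_trans (bD u) _; apply: ler_wpM2r; [exact: nrm_ge0|lra].
 have := dom _ (vnZ s My2) b1; rewrite /w.
 have Ms := vnZ s My2.
 rewrite (rp_mul rP)//; last exact: vnM.
 rewrite (rp_mul rP)// rpZ// (rp_mul rP)//; last exact: (vn_adj vM).
 rewrite (rp_adj rP)// -{1}sc (rp_adj rP)//.
 rewrite -[((P c)^# ** _ ** _) k]/((P c)^# ((s *: ((P y)^# ** P y)) (P c k))) -badjEr.
 by rewrite !bopZE !ipZl /= -!badjEr ler_pM2l.
have hT : intertw T.
 move=> y My; apply: bopP => u /=.
 have sL : subsp [set v | exists2 x, M x & v = x (c z)].
  split; first by exists 0; rewrite ?bop0E//; exact: vn0.
  by move=> c' _ _ [i Mi ->] [j Mj ->]; exists (c' *: i + j); rewrite ?bopDE ?bopZE//; exact: vn_lin.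
 have [v Lv hv] := projection u (scl_subsp sL) (@scl_closed _ _ _).
 have [t tE] : exists t, t = u - v by exists (u - v).
 rewrite -tE in hv; have -> : u = t + v by rewrite tE subrK.
 have t0 : T t = 0 by apply: T0 => i Mi; apply: hv; apply: sub_scl; exists i.
 have t1 : T (y t) = 0.
  apply: T0 => i Mi; rewrite badjE; apply: hv; apply: sub_scl; exists (y^# ** i) => //.
  by apply: vnM => //; exact: (vn_adj vM).
 rewrite !bD t0 t1 b0 !add0r.
 have [x hx cx] := scl_seq Lv; apply: conv_uniq (bop_conv (P y ** T) cx) _.
 have E n : (P y ** T) (x n) = (T ** y) (x n).
  have [i Mi ->] := hx n; rewrite /= Ta// -[y (i _)]/((y ** i) (c z)) Ta ?(rp_mul rP)//.
  exact: vnM.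
 by have := bop_conv (T ** y) cx; move=> h d /h [n hn]; exists n => m /hn; rewrite E.
apply: wc; have := hk T hT => h0.
rewrite /w; have -> : P c k = T (c z).
 by have := Ta _ M1; rewrite (rp_1 rP).
by rewrite badjE h0 ip0r.
Qed.

(** On the range of an intertwiner T the claim is that of x, as P (x n) T = T (x n). These ranges
    are total, and the bound C does the rest. *)
Lemma rp_scv (x : nat -> bop H H) (l : bop H H) (C : R) : (forall n, M (x n)) -> M l ->
 (forall n, bnd (P (x n)) C) -> scv x l -> scv (fun n => P (x n)) (P l).
Proof.
move=> Mx Ml bx cx.
pose L : set K := [set k | conv (fun n => P (x n) k) (P l k)].
suff : forall k, scl L k.
 move=> hL k d d0; have [D [D0 bD]] := bop_bnd (P l); have C0 : 0 <= C := (bx 0%N).1.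
 have CD : 0 < 2 * (C + D + 1) by lra.
 have [k' Lk' hk'] := hL k (d / (2 * (C + D + 1))) ltac:(by rewrite divr_gt0).
 have [n hn] := Lk' (d / 2) ltac:(by rewrite divr_gt0).
 exists n => m /hn h1.
 have -> : P (x m) k - P l k = P (x m) (k - k') + (P (x m) k' - P l k') - P l (k - k').
  by rewrite !bB; vring.
 apply: le_lt_trans (nrmD _ _) _; rewrite nrmN.
 have := nrmD (P (x m) (k - k')) (P (x m) k' - P l k').
 have h2 := (bx m).2 (k - k'); have h3 := bD (k - k').
 have h4 : (C + D + 1) * nrm (k - k') < d / 2.
  rewrite mulrC -ltr_pdivlMr; last by lra.
  by rewrite -mulrA -invfM.
 have := nrm_ge0 (k - k'); lra.
have sL : subsp L.
 split; first by move=> d d0; exists 0%N => n _; rewrite !b0 subrr nrm0.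
 move=> c u v hu hv.
 have h1 := convD (bop_conv (c *: bid) hu) hv.
 move=> d /h1 [n hn]; exists n => m /hn; by rewrite !bopZE /= !bop_lin.
move=> k; have [a La ha] := projection k (scl_subsp sL) (@scl_closed _ _ L).
suff -> : k = a by [].
apply/subr0_eq/intertw_total => T hT.
apply: ip_inj => u; rewrite ip0l -badjEr ha//.
apply: sub_scl => d; have := bop_conv T (cx u) => h /h [n hn]; exists n => m /hn.
by rewrite -[T (x m u)]/((T ** x m) u) -hT// -[T (l u)]/((T ** l) u) -hT.
Qed.

End VN.

(** * Standard forms *)

Section SelfAdjointGraph.
Context {R : realType} {K : rhilb R}.

(** On the graph |u|^2 + |v|^2 <= |u + v|^2, so the range of 1 + D is closed; self-adjointness makes
    it the whole space, and g is the inverse. *)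
Lemma resolvent_of_graph (D : K -> K -> Prop) :
 dns [set u | exists v, D u v] ->
 (forall u v, D u v <-> forall x y, D x y -> ip y u = ip x v) ->
 (forall u v, D u v -> 0 <= ip v u) ->
 exists g : bop K K, [/\ ble1 g, forall u, g u = 0 -> u = 0 &
  forall u v, D u v <-> exists k, u = g k /\ v = k - g k].
Proof.
move=> dD sD pD.
have Dl c u v u' v' : D u v -> D u' v' -> D (c *: u + u') (c *: v + v').
 move=> /sD h /sD h'; apply/sD => x y hx; by rewrite !ipE (h _ _ hx) (h' _ _ hx).
have D0 : D 0 0 by apply/sD => x y _; rewrite !ip0r.
have lo u v : D u v -> ip u u + ip v v <= ip (u + v) (u + v).
 by move=> /pD h; rewrite !ipE (ipC u v); lra.
pose L : set K := [set k | exists u v, D u v /\ k = u + v].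
have sL : subsp L.
 split; first by exists 0, 0; rewrite addr0.
 move=> c _ _ [u [v [h ->]]] [u' [v' [h' ->]]]; exists (c *: u + u'), (c *: v + v').
 by split; [exact: Dl|rewrite scalerDr addrACA].
have cL : sclosed L.
 move=> x l hx cx.
 have /choice[p hp] : forall n, exists p : K * K, D p.1 p.2 /\ x n = p.1 + p.2.
  by move=> n; have [u [v [h ->]]] := hx n; exists (u, v).
 have dp m n : D ((p m).1 - (p n).1) ((p m).2 - (p n).2).
  have := Dl (-1) _ _ _ _ (hp n).1 (hp m).1.
  by rewrite !scaleN1r addrC (addrC _ (p m).2).
 have est m n : nrm ((p m).1 - (p n).1) <= nrm (x m - x n) /\ nrm ((p m).2 - (p n).2) <= nrm (x m - x n).
  have := lo _ _ (dp m n).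
  have -> : (p m).1 - (p n).1 + ((p m).2 - (p n).2) = x m - x n.
   by rewrite (hp m).2 (hp n).2; vring.
  have := ip_ge0 ((p m).1 - (p n).1); have := ip_ge0 ((p m).2 - (p n).2) => a b c.
  by split; apply: sq_le; rewrite ?nrm_ge0// !nrm2; lra.
 have cx2 : cau x.
  move=> d d0; have [n hn] := cx (d / 2) ltac:(by rewrite divr_gt0); exists n => i j /hn h1 /hn h2.
  by have := nrm_distD (x i) (x j) l; rewrite (nrmB l); lra.
 have [u hu] : exists u, conv (fun n => (p n).1) u.
  apply: cau_conv => d /cx2 [n hn]; exists n => i j hi hj.
  by apply: le_lt_trans (est i j).1 _; exact: hn.
 have [v hv] : exists v, conv (fun n => (p n).2) v.
  apply: cau_conv => d /cx2 [n hn]; exists n => i j hi hj.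
  by apply: le_lt_trans (est i j).2 _; exact: hn.
 exists u, v; split.
  apply/sD => y z hy; apply: subr0_eq.
  have c1 : conv (fun n => (((p n).1, (p n).2) : rprod K K)) (u, v).
   apply: (@conv_le _ _ _ _ 1 (fun n => nrm ((p n).1 - u) + nrm ((p n).2 - v))) => // [n|d d0].
    by rewrite mul1r; exact: nrm_prod_le.
   have [n1 h1] := hu (d / 2) ltac:(by rewrite divr_gt0).
   have [n2 h2] := hv (d / 2) ltac:(by rewrite divr_gt0).
   by exists (maxn n1 n2) => n; rewrite geq_max => /andP[/h1 + /h2]; lra.
  have := @conv_ip_eq _ _ _ _ ((z, - y) : rprod K K) 0 c1.
  rewrite !ip_prod ipNr (ipC u) (ipC v) => -> // n.
  by rewrite ip_prod ipNr (ipC _ z) (ipC _ y) (iffLR (sD _ _) (hp n).1 _ _ hy) subrr.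
 apply: conv_uniq cx _ => d /(convD hu hv) [n hn]; exists n => m /hn.
 by rewrite (hp m).2.
have full k : L k.
 have [a La ha] := projection k sL cL.
 suff e : k - a = 0 by move/subr0_eq: e => ->.
 have Dk : D (k - a) (- (k - a)).
  apply/sD => x y hxy; have := ha (x + y); rewrite ipDr => h.
  by rewrite ipNr (ipC y) (ipC x); have := h ltac:(by exists x, y); lra.
 by have := pD _ _ Dk; have := ip_ge0 (k - a); rewrite ipNl => h1 h2; apply: ip_eq0; lra.
have /choice[q hq] : forall k, exists p : K * K, D p.1 p.2 /\ k = p.1 + p.2.
 by move=> k; have [u [v [h ->]]] := full k; exists (u, v).
have uq k u v : D u v -> k = u + v -> u = (q k).1.
 move=> huv kE; have := Dl (-1) _ _ _ _ huv (hq k).1; move=> /lo.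
 have -> : -1 *: u + (q k).1 + (-1 *: v + (q k).2) = 0.
  by rewrite addrACA -scalerDr -kE -(hq k).2 scaleN1r addNr.
 rewrite ip0l scaleN1r; have := ip_ge0 (- u + (q k).1); have := ip_ge0 (-1 *: v + (q k).2) => a b c.
 have /eqP : - u + (q k).1 = 0 by apply: ip_eq0; lra.
 by rewrite addrC subr_eq0 => /eqP ->.
have gl c u v : (q (c *: u + v)).1 = c *: (q u).1 + (q v).1.
 apply/esym; apply: (uq _ _ (c *: (q u).2 + (q v).2)); first exact: Dl (hq u).1 (hq v).1.
 by rewrite addrACA -scalerDr -(hq u).2 -(hq v).2.
have gb u : nrm (q u).1 <= 1 * nrm u.
 rewrite mul1r; apply: sq_le; first exact: nrm_ge0.
 by rewrite !nrm2; have := lo _ _ (hq u).1; rewrite -(hq u).2; have := ip_ge0 (q u).2; lra.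
pose g := mkbop gl ler01 gb.
have qE k : (q k).2 = k - g k by rewrite /= {2}(hq k).2 addrC addKr.
exists g; split.
- split; first split.
 + apply: badj_uniq => u v /=; rewrite [in LHS](hq v).2 [in RHS](hq u).2 ipDr ipDl; congr (_ + _).
  by rewrite -(iffLR (sD _ _) (hq v).1 _ _ (hq u).1).
 + move=> u /=; have -> : ip (q u).1 u = ip (q u).1 ((q u).1 + (q u).2) by rewrite -(hq u).2.
  rewrite ipDr addr_ge0 ?ip_ge0// ipC.
  exact: pD (hq u).1.
 + move=> u /=; have -> : ip (q u).1 u = ip (q u).1 ((q u).1 + (q u).2) by rewrite -(hq u).2.
  have -> : ip u u = ip ((q u).1 + (q u).2) ((q u).1 + (q u).2) by rewrite -(hq u).2.
  rewrite !ipE (ipC (q u).2 (q u).1).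
  by have := pD _ _ (hq u).1; have := ip_ge0 (q u).2; rewrite (ipC _ (q u).1); lra.
- move=> u /= u0; have := hq u; rewrite u0 => -[h e]; rewrite add0r in e.
 rewrite e; apply: (dns_orth dD) => x [y hxy].
 by rewrite ipC -(iffLR (sD _ _) h _ _ hxy) ip0r.
- move=> u v; split=> [h|[k [-> ->]]]; last by rewrite -qE; exact: (hq k).1.
 exists (u + v); have e := uq _ _ _ h erefl.
 by rewrite /= -e addrC addKr.
Qed.

(** On a corner the left side is nearly c d + (1 - c)(1 - d) times X, and this scalar is at least 2
    e^2. *)
Lemma diag_corner (g : bop K K) X : ble1 g -> (forall u, g u = 0 -> u = 0) -> (forall u, g u = u -> u = 0) ->
 g ** X ** g + (bid - g) ** X ** (bid - g) = 0 -> X = 0.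
Proof.
move=> g1 gi hi hX; apply: (corners_eq0 g1 gi hi) => e e0 e2.
have e4 : 0 < e ^+ 2 / 4 by rewrite divr_gt0// exprn_gt0.
exists (e ^+ 2 / 4) => // P Q c d t t0 te nP nQ /andP[c0 c1] /andP[d0 d1].
apply: opn_eq0; have hc := cut_corner X nP nQ; set Y := P ** X ** Q in hc *.
have t0' := ltW t0.
have h1 := ble1_compl g1.
have a1 : opn (g ** Y ** g - (c * d) *: Y) <= 2 * t * opn Y.
 apply: (corner_lr t0' _ (opn_ble1 g1) (corner_gl t0' hc) (corner_gr t0' hc) hc).
 by rewrite ger0_norm; lra.
have a2 : opn ((bid - g) ** Y ** (bid - g) - ((1 - c) * (1 - d)) *: Y) <= 2 * t * opn Y.
 apply: (corner_lr t0' _ (opn_ble1 h1) _ _ hc).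
 - by rewrite ger0_norm; lra.
 - by rewrite opn_h; exact: corner_gl hc.
 - by rewrite opn_hr; exact: corner_gr hc.
have E : g ** Y ** g + (bid - g) ** Y ** (bid - g) = 0.
 transitivity (P ** (g ** X ** g + (bid - g) ** X ** (bid - g)) ** Q); last by rewrite hX bc0r bc0l.
 have := narrow_g nP; have := narrow_h nP; have := narrow_g nQ; have := narrow_h nQ.
 rewrite /Y; move: (bid - g) => h q1 q2 p1 p2.
 rewrite (bcDr P) bcDl !bcA -p1 -p2 -!bcA.
 by rewrite q1 q2.
have x0 : e ^+ 2 <= c * d by exact: prod_lo.
have y0 : e ^+ 2 <= (1 - c) * (1 - d) by apply: prod_lo => //; lra.
move: (c * d) ((1 - c) * (1 - d)) x0 y0 a1 a2 => x y x0 y0 a1 a2.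
have s : opn ((x + y) *: Y) <= 4 * t * opn Y.
 have -> : (x + y) *: Y = - ((g ** Y ** g - x *: Y) + ((bid - g) ** Y ** (bid - g) - y *: Y)).
  move: E; move: (g ** Y ** g) ((bid - g) ** Y ** (bid - g)) => z1 z2 /eqP; rewrite addr_eq0 => /eqP ->.
  oring.
 by rewrite opnN; apply: le_trans (opnD _ _) _; lra.
have e20 := sqr_ge0 e; have Y0 := opn_ge0 Y.
move: s; rewrite opnZE ger0_norm; last by lra.
move=> s; apply/eqP; rewrite eq_le Y0 andbT.
have e21 : 0 < e ^+ 2 by exact: exprn_gt0.
have h3 : 0 < x + y - 4 * t by lra.
by rewrite -(pmulr_rle0 _ h3); lra.
Qed.

(** The symmetry gives (1 - g) J (1 - g) = g J^# g and the same with J and J^# exchanged, so J - J^#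
    solves the equation of [diag_corner] and vanishes. *)
Lemma polar_of_involution (g J : bop K K) : ble1 g -> (forall u, g u = 0 -> u = 0) ->
 J^# ** J = bid -> J ** J^# = bid ->
 (forall k, exists l, J (k - g k) = g l /\ g k = J (l - g l)) -> polar g J.
Proof.
move=> g1 gi J1 J2 sym; have sg : bsa g := g1.1.1.
have JJ' u : J^# (J u) = u by rewrite -[LHS]/((J^# ** J) u) J1.
have J'J u : J (J^# u) = u by rewrite -[LHS]/((J ** J^#) u) J2.
have hi u : g u = u -> u = 0.
 move=> e; have [l [h1 h2]] := sym u; move: h1; rewrite e subrr b0 => /esym/gi l0.
 by move: h2; rewrite l0 !b0 subrr b0 e.
have E1 u : J u - g (J u) - (J (g u) - g (J (g u))) = g (J^# (g u)).
 have [l [h1 h2]] := sym u.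
 have -> : J^# (g u) = l - g l by rewrite h2 JJ'.
 by rewrite bB -h1 !bB; vring.
have E2 u : J^# u - g (J^# u) - (J^# (g u) - g (J^# (g u))) = g (J (g u)).
 have E1o : J - g ** J - (J ** g - g ** J ** g) = g ** J^# ** g.
  by apply: bopP => v; rewrite !bopBE; exact: E1.
 have := congr1 (fun f : bop K K => (badj f) u) E1o.
 rewrite !badjB !badjM !badjK sg !bopBE /= => <-.
 by move: (J^# u) (g (J^# u)) (J^# (g u)) (g (J^# (g u))) => x y z t; vring.
have JE : J = J^#.
 apply: subr0_eq; apply: (diag_corner g1 gi hi).
 apply: bopP => u; rewrite bop0E bopDE.
 rewrite -[(g ** _ ** g) u]/(g ((J - J^#) (g u))).
 rewrite -[(_ ** _ ** (bid - g)) u]/((bid - g) ((J - J^#) ((bid - g) u))) !bopBE !bB /=.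
 apply: ip_inj => w; move/(congr1 (fun x => ip x w)): (E1 u); move/(congr1 (fun x => ip x w)): (E2 u).
 by rewrite !ipE; lra.
split=> //; first by rewrite {1}JE.
apply: bopP => u /=; rewrite bopBE /=.
have := E1 u; rewrite -JE => h; apply: subr0_eq.
apply/eqP; rewrite -oppr_eq0 opprB; apply/eqP.
have -> : J u - g (J u) - J (g u) = (J u - g (J u) - (J (g u) - g (J (g u)))) - g (J (g u)) by vring.
by rewrite h subrr.
Qed.

End SelfAdjointGraph.

Section Diag.
Context {R : realType} {U V : rhilb R}.

Definition bdiag (f : bop U U) (g : bop V V) : bop (rprod U V) (rprod U V) :=
 pinl U V ** f ** pfst U V + pinr U V ** g ** psnd U V.

Lemma bdiagE f g p : bdiag f g p = (f p.1, g p.2).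
Proof. by rewrite /bdiag bopDE /= pinlE pinrE; apply: prod_eq => /=; rewrite ?addr0 ?add0r. Qed.

Lemma bdiag_adj f g : (bdiag f g)^# = bdiag f^# g^#.
Proof. by apply: badj_uniq => p q; rewrite !bdiagE !ip_prod /= !badjE. Qed.

Lemma bdiag_comp f g f' g' : bdiag f g ** bdiag f' g' = bdiag (f ** f') (g ** g').
Proof. by apply: bopP => p; rewrite /= !bdiagE. Qed.

Lemma bdiag_polar (g J : bop U U) (g' J' : bop V V) : polar g J -> polar g' J' ->
 polar (bdiag g g') (bdiag J J').
Proof.
move=> [[[sg g0] g1] gi sJ JJ Jg] [[[sg' g0'] g1'] gi' sJ' JJ' Jg']; split.
- split; first split.
 + by rewrite /bsa bdiag_adj sg sg'.
 + by move=> p; rewrite bdiagE ip_prod /= addr_ge0.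
 + by move=> p; rewrite bdiagE !ip_prod /= lerD.
- by move=> p; rewrite bdiagE => -[/gi h /gi' h']; apply: prod_eq.
- by rewrite /bsa bdiag_adj sJ sJ'.
- by rewrite bdiag_comp JJ JJ'; apply: bopP => p; rewrite bdiagE; apply: prod_eq.
- rewrite bdiag_comp Jg Jg'; apply: bopP => p; rewrite bdiagE /= !bopBE !bdiagE /=.
 by apply: prod_eq.
Qed.

End Diag.

Section PolarOfGraph.
Context {R : realType} {K : rhilb R}.

(** A closed densely defined involution [S]: the projection onto its graph has
  the form [[C, B], [B, C]] with [B = S C], and [J] is the sign of [B]. *)
Lemma polar_of_graph (S : K -> K -> Prop) : S 0 0 ->
 (forall c u v u' v', S u v -> S u' v' -> S (c *: u + u') (c *: v + v')) ->
 (forall (x y : nat -> K) u v, (forall n, S (x n) (y n)) -> conv x u -> conv y v -> S u v) ->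
 (forall u v, S u v -> S v u) -> dns [set u | exists v, S u v] -> (forall v, S 0 v -> v = 0) ->
 exists g J, [/\ polar g J, forall u v, S u v <-> exists k, u = g k /\ v = J (k - g k) &
  forall l, bsa l -> (forall u v, S u v -> S (l u) (- l v)) -> J ** l = - (l ** J)].
Proof.
move=> S0 lS cS sS dS iS.
pose G : set (rprod K K) := [set p | S p.1 p.2].
have sG : subsp G by split=> // c u v /= hu hv; exact: lS.
have cG : sclosed G.
 move=> x l hx cx; apply: (cS (fun n => (x n).1) (fun n => (x n).2)) => //.
  by move=> e /cx [N hN]; exists N => n /hN; apply: le_lt_trans; exact: (nrm_fst (x n - l)).
 by move=> e /cx [N hN]; exists N => n /hN; apply: le_lt_trans; exact: (nrm_snd (x n - l)).
have [p [sp pp Gp pG op]] := bproj_exists sG cG.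
(* The swap w preserves the graph because S is an involution; hence the four blocks of p are C, B, B
   and C. *)
pose w : bop (rprod K K) (rprod K K) := pinl K K ** psnd K K + pinr K K ** pfst K K.
have wE q : w q = (q.2, q.1).
 by rewrite /w bopDE /= pinlE pinrE; apply: prod_eq => /=; rewrite ?addr0 ?add0r.
have sw : w^# = w.
 by apply: badj_uniq => a b; rewrite !wE !ip_prod /= addrC.
have wp : w ** p = p ** w.
 by apply: (bproj_comm sp Gp pG); rewrite ?sw => q hq; rewrite wE; exact: sS.
pose C := pfst K K ** p ** pinl K K; pose B := psnd K K ** p ** pinl K K.
have pE a b : p (a, b) = (C a + B b, B a + C b).
 have -> : ((a, b) : rprod K K) = pinl K K a + w (pinl K K b).
  by rewrite wE !pinlE; apply: prod_eq => /=; rewrite ?addr0 ?add0r.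
 rewrite bD -[p (w _)]/((p ** w) _) -wp /= wE; apply: prod_eq => /=; exact: erefl.
clearbody C B; have {wp wE sw w} sC : bsa C.
 apply: badj_uniq => u v; have := bsaE ((u, 0) : rprod K K) ((v, 0) : rprod K K) sp.
 by rewrite !pE !ip_prod /= !b0 !addr0 !ipE !addr0.
have sB : bsa B.
 apply: badj_uniq => u v; have := bsaE ((u, 0) : rprod K K) ((0, v) : rprod K K) sp.
 by rewrite !pE !ip_prod /= !b0 !addr0 !add0r !ipE !add0r addr0.
have [CE BE] : (forall u, C u = C (C u) + B (B u)) /\ (forall u, B u = B (C u) + C (B u)).
 have h u : p (p (u, 0)) = p (u, 0) by rewrite -[LHS]/((p ** p) _) pp.
 by split=> u; have := h u; rewrite !pE !b0 !addr0 => -[].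
have C1 : ble1 C.
 split; first split=> // u.
  by rewrite CE !ipE (bsaE _ _ sC) (bsaE _ _ sB) addr_ge0 ?ip_ge0.
 move=> u; have := op (u, 0) (p (u, 0)) (Gp _); rewrite pE ip_prod /= !b0 !addr0 add0r.
 have := ip_ge0 (u - C u); have := ip_ge0 (B u); rewrite !ipE (ipC u (C u)); lra.
have Ci u : C u = 0 -> u = 0.
 move=> h; apply: (dns_orth dS) => x [y hxy].
 have Bu : B u = 0 by apply: ip_eq0; rewrite -(bsaE _ _ sB) ipC; have := CE u; rewrite h b0 add0r => <-; rewrite ip0r.
 by have := op (u, 0) (x, y) hxy; rewrite pE h Bu !b0 !addr0 ip_prod /= subr0 subr0 ip0l addr0.
have Ci' u : C u = u -> u = 0.
 move=> h; have := CE u; rewrite !h => /eqP; rewrite addrC -subr_eq subrr eq_sym => /eqP e.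
 have Bu : B u = 0 by apply: ip_eq0; rewrite -(bsaE _ _ sB) e ip0l.
 by have := Gp (u, 0); rewrite pE h Bu !b0 !addr0 => /sS /iS.
have B1 : bnd B 1.
 split=> // u; rewrite mul1r; apply: sq_le; first exact: nrm_ge0.
 rewrite !nrm2 -(bsaE _ _ sB) (_ : B (B u) = C u - C (C u)); last by rewrite {1}CE addrAC subrr add0r.
 by rewrite ipDl ipNl (bsaE (C u) u sC); have := C1.2 u; have := ip_ge0 (C u); lra.
have Bi u : B u = 0 -> u = 0.
 move=> h; have := CE u; rewrite h b0 addr0 => /esym /Ci'; exact: Ci.
have [e [se ee We Be Be']] := sign_proj sB B1.
pose J := 2 *: e - bid; pose x := babs B.
have B2 : ble1 (B ** B) := bsa_sq_ble1 sB B1.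
have [_ x1 xx] := bsqrt_spec B2; rewrite -/(babs B) -/x in x1 xx.
have xE u : x (x u) = B (B u) by rewrite -[LHS]/((x ** x) u) xx.
have xi u : x u = 0 -> u = 0 by move=> h; apply/Bi/Bi; rewrite -xE h b0.
have BJ u : B u = x (J u).
 have h1 : B (e u) = x (e u) by rewrite -[LHS]/((B ** e) u) Be.
 have h2 : B (u - e u) = - x (u - e u).
  by have := bop_at u Be'; rewrite bopNE /= bopBE.
 have -> : u = e u + (u - e u) by rewrite addrC subrK.
 rewrite bD h1 h2 /J bopBE bopZE /= -bN -bD; congr (x _).
 have -> : e u + (u - e u) = u by vring.
 by vring.
have sJ : bsa J by rewrite /bsa /J badjB badjZ badj1 se.
have JJ u : J (J u) = u.
 have eeu : e (e u) = e u by rewrite -[LHS]/((e ** e) u) ee.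
 by rewrite /J !bopBE !bopZE /= !bB !bZ eeu; vring.
have BBE v : B (B v) = C v - C (C v) by rewrite {1}(CE v) addrAC subrr add0r.
have xcomm W : W ** (B ** B) = (B ** B) ** W -> W ** x = x ** W by exact: bsqrt_comm.
clearbody x J.
have anti l : bsa l -> (forall u v, S u v -> S (l u) (- l v)) -> J ** l = - (l ** J).
 move=> sl hl; pose W := bdiag l (- l).
 have sW : W^# = W by rewrite bdiag_adj badjN sl.
 have Wp : W ** p = p ** W.
  by apply: (bproj_comm sp Gp pG); rewrite ?sW => q hq; rewrite /W bdiagE bopNE; exact: hl.
 have hB u : B (l u) = - l (B u).
  have := congr1 (fun f : bop (rprod K K) (rprod K K) => (f ((u, 0) : rprod K K)).2) Wp.
  rewrite -[(W ** p) _]/(W (p _)) -[(p ** W) _]/(p (W _)) /W !bdiagE pE /= !bopNE b0 oppr0 pE /=.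
  by rewrite !b0 !addr0.
 have hx : l ** x = x ** l.
  by apply: xcomm; apply: bopP => u /=; rewrite hB bN hB opprK.
 apply: bopP => u; rewrite bopNE /=; apply/subr0_eq/xi.
 rewrite bB bN -BJ hB opprK BJ -[l (x _)]/((l ** x) _) hx /=; exact: addNr.
have JC u : J (C u) = J u - C (J u).
 apply/subr0_eq/xi; rewrite !bB -!BJ.
 have xC : C ** x = x ** C.
  by apply: xcomm; apply: bopP => v /=; rewrite !BBE !bB.
 have -> : x (C (J u)) = C (B u) by rewrite -[LHS]/((x ** C) _) -xC /= -BJ.
 by rewrite {1}(BE u); vring.
have C1' := ble1_compl C1.
(* Cosine and sine: C = (1 + |S|^2)^-1 = c^2 and |S| = s / c, so the required (1 + |S|)^-1 is c (c +
   s)^-1. The sum c + s is invertible because c + s >= c^2 + s^2 = 1. *)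
have [_ c1 cc] := bsqrt_spec C1; have [_ s1 ss] := bsqrt_spec C1'.
set c := bsqrt C in c1 cc; set s := bsqrt (bid - C) in s1 ss.
have cW W : W ** C = C ** W -> W ** c = c ** W by exact: bsqrt_comm.
have sW W : W ** (bid - C) = (bid - C) ** W -> W ** s = s ** W by exact: bsqrt_comm.
have JcW : J ** C = (bid - C) ** J -> J ** c = s ** J by exact: bsqrt_comm.
clearbody c s.
have ccE u : c (c u) = C u by rewrite -[LHS]/((c ** c) u) cc.
have ssE u : s (s u) = u - C u by rewrite -[LHS]/((s ** s) u) ss bopBE.
have [sc ssa] : bsa c /\ bsa s by split; [exact: c1.1.1|exact: s1.1.1].
have Cc : C ** c = c ** C by rewrite -cc bcA.
have sCo : s ** C = C ** s.
 by apply/esym/sW; rewrite bcBr bcBl bc1l bc1r.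
have scc : s ** c = c ** s by exact: cW.
have scE u : s (c u) = c (s u) by rewrite -[LHS]/((s ** c) u) scc.
have JC' : J ** C = (bid - C) ** J by apply: bopP => u; rewrite /= bopBE JC.
have Jc : J ** c = s ** J by exact: JcW.
have JcE u : J (c u) = s (J u) by rewrite -[LHS]/((J ** c) u) Jc.
have JsE u : J (s u) = c (J u) by rewrite -{1}[u]JJ -JcE JJ.
have sq_ge (a : bop K K) u : ble1 a -> ip (a (a u)) u <= ip (a u) u.
 move=> ha; rewrite (bsaE _ _ ha.1.1) -[leLHS]mul1r; have := bpos_sq u ha.1 (C := 1).
 by rewrite !mul1r; apply=> v; rewrite mul1r; exact: ha.2.
have csb u : 1 * ip u u <= ip ((c + s) u) u.
 rewrite bopDE ipDl; have := sq_ge c u c1; have := sq_ge s u s1.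
 by rewrite ccE ssE ipDl ipNl; lra.
have scs : bsa (c + s) by rewrite /bsa badjD sc ssa.
have [m [m1 m2 sm _]] := binv_exists scs ltr01 csb.
have m1E u : c (m u) + s (m u) = u by rewrite -[LHS]bopDE -[LHS]/(((c + s) ** m) u) m1.
have mc : c ** m = m ** c.
 by apply: (binv_comm m1 m2); rewrite bcDr bcDl scc.
have ms : s ** m = m ** s.
 by apply: (binv_comm m1 m2); rewrite bcDr bcDl scc.
have Jm : J ** m = m ** J.
 by apply: (binv_comm m1 m2); apply: bopP => u; rewrite /= !bopDE bD /= JcE JsE addrC.
have pm : bpos m.
 split=> // u; have -> : ip (m u) u = ip ((m^# ** (c + s) ** m) u) u.
  by rewrite sm -bcA m1 bc1r.
 by apply: (bpos_conj m _).2; exact: bposD c1.1 s1.1.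
have hE : bid - c ** m = s ** m.
 by apply: bopP => u; rewrite bopBE /= -{1}[u]m1E addrAC subrr add0r.
have g1 : ble1 (c ** m).
 have h := bpos_comm_mul s1 pm ms; split; first exact: bpos_comm_mul.
 by move=> u; have := h.2 u; rewrite -hE bopBE ipDl ipNl /=; lra.
exists (c ** m), J; split=> //.
- split=> //.
 + move=> u /= h; apply: Ci.
  have -> : C u = c (c (c (m u)) + s (c (m u))) by rewrite scE -bD m1E ccE.
  by rewrite h !b0 addr0 b0.
 + by apply: bopP => u; rewrite /= JJ.
 + by rewrite hE; apply: bopP => u; rewrite /= JcE -[J (m u)]/((J ** m) u) Jm.
(* Both are positive with square C - C^2, and they commute, so (x + c s) annihilates their
   difference d. *)
have xcs : x = c ** s.
 apply: bopP => u; apply: subr0_eq; set d := _ - _.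
 have pcs : bpos (c ** s) by apply: bpos_comm_mul => //; exact: s1.1.
 have xy : (c ** s) ** x = x ** (c ** s).
  by apply: xcomm; apply: bopP => v /=; rewrite !BBE !bB -!ccE !scE.
 have xcv v : x (c (s v)) = c (s (x v)) by rewrite -[RHS]/((c ** s ** x) v) xy.
 have z : x d + c (s d) = 0.
  rewrite /d /= !bB xE xcv scE ssE !bB !ccE BBE; move: (c (s _)) => a.
  by vring.
 have /(bpos_eq0 x1.1)/xi // : ip (x d) d = 0.
 have := congr1 (fun v => ip v d) z; rewrite ip0l ipDl.
 by have := x1.1.2 d; have := pcs.2 d => /=; lra.
have BEcs u : B u = c (s (J u)) by rewrite BJ xcs.
move=> u v; split=> [h|[k [-> ->]]].
 have /(congr1 (fun q : rprod K K => q)) := pG (u, v) h; rewrite pE => -[h1 h2]; rewrite !BEcs in h1 h2.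
 exists (c (c u + s (J v)) + s (c u + s (J v))).
 have mcs z : m (c z + s z) = z by rewrite -bopDE -[LHS]/((m ** (c + s)) z) m2.
 have hE' z : z - (c ** m) z = s (m z) by have := bop_at z hE; rewrite bopBE.
 rewrite hE' /= mcs; split.
  by rewrite bD ccE.
 by rewrite JsE bD JcE JsE JJ bD ccE.
have hE' : k - (c ** m) k = s (m k) by have := bop_at k hE; rewrite bopBE.
rewrite hE' /=; have := Gp (c (m k), J (s (m k))); rewrite pE /G /=.
have -> : C (c (m k)) + B (J (s (m k))) = c (m k).
 by rewrite BEcs JJ ssE bB -!ccE addrC subrK.
suff -> : B (c (m k)) + C (J (s (m k))) = J (s (m k)) by [].
by rewrite BEcs JcE ssE JsE bB -ccE ccE subrK.
Qed.

End PolarOfGraph.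

Section Commutants.
Context {R : realType} {K : rhilb R}.
Variables (g J : bop K K) (A : bop K K -> K -> K -> Prop).
Hypotheses (sA : tstar A) (ts : tsys g J (perp (perp A)) (perp A)).

Local Notation N := (perp A).

(** As T commutes with A, the product Q1 T Q2 is again a right element for right elements Q1 and Q2.
    W commutes with all three, and nondegeneracy cancels Q1 and Q2. *)
Lemma comm_bic (T W : bop K K) : (forall X x x', A X x x' -> T ** X = X ** T) ->
 (forall Q q q', perp A Q q q' -> W ** Q = Q ** W) -> T ** W = W ** T.
Proof.
move=> hT hW; have sN : tstar N := @perp_star _ _ A.
have hT' X x x' : A X x x' -> T^# ** X = X ** T^#.
 by move=> /sA h; rewrite -[X]badjK -!badjM (hT _ _ _ h).
have mem Q1 q1 q1' Q2 q2 q2' : N Q1 q1 q1' -> N Q2 q2 q2' ->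
  N (Q1 ** T ** Q2) (Q1 (T q2)) (Q2^# (T^# q1')).
 move=> h1 h2 X x x' hX; have hXs := sA hX.
 have [a1 a2 a3 a4] := h1 _ _ _ hX; have [b1 b2 b3 b4] := h2 _ _ _ hX.
 have B0 := perp_sub sA hX; have B1 := perp_sub sA hXs.
 have c1 u : X (Q1 u) = Q1 (X u) by rewrite -[LHS]/((X ** Q1) u) (ts_comm ts B0 h1).
 have c2 u : X^# (Q1 u) = Q1 (X^# u) by rewrite -[LHS]/((X^# ** Q1) u) (ts_comm ts B1 h1).
 have c3 u : X (Q2^# u) = Q2^# (X u) by rewrite -[LHS]/((X ** Q2^#) u) (ts_comm ts B0 (sN _ _ _ h2)).
 have c4 u : X^# (Q2^# u) = Q2^# (X^# u) by rewrite -[LHS]/((X^# ** Q2^#) u) (ts_comm ts B1 (sN _ _ _ h2)).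
 have t1 u : X (T u) = T (X u) by rewrite -[LHS]/((X ** T) u) -(hT _ _ _ hX).
 have t2 u : X^# (T u) = T (X^# u) by rewrite -[LHS]/((X^# ** T) u) -(hT _ _ _ hXs).
 have t3 u : X (T^# u) = T^# (X u) by rewrite -[LHS]/((X ** T^#) u) -(hT' _ _ _ hX).
 have t4 u : X^# (T^# u) = T^# (X^# u) by rewrite -[LHS]/((X^# ** T^#) u) -(hT' _ _ _ hXs).
 rewrite !badjM bcA /= c1 c2 c3 c4 t1 t2 t3 t4 b1 b2 a3 a4; split=> //.
have z Q1 q1 q1' Q2 q2 q2' : N Q1 q1 q1' -> N Q2 q2 q2' -> Q1 ** ((T ** W - W ** T) ** Q2) = 0.
 move=> h1 h2; have := hW _ _ _ (mem _ _ _ _ _ _ h1 h2); have e1 := hW _ _ _ h1; have e2 := hW _ _ _ h2.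
 rewrite bcBl bcBr !bcA e1 -!bcA -e2 => ->; exact: subrr.
have z' Q2 q2 q2' : N Q2 q2 q2' -> (T ** W - W ** T) ** Q2 = 0.
 move=> h2; apply: bopP => u; rewrite bop0E; apply: (ts_ndN ts) => Q1 q1 q1' h1.
 by have := bop_at u (z _ _ _ _ _ _ h1 h2); rewrite bop0E.
suff : (T ** W - W ** T)^# = 0.
 by move=> /(congr1 (@badj _ _ _)); rewrite badjK badj0 => /subr0_eq.
apply: bopP => u; rewrite bop0E; apply: (ts_ndN ts) => Q q q' /sN h.
have := congr1 (@badj _ _ _) (z' _ _ _ h); rewrite badjM badj0 badjK => /(bop_at u).
by rewrite bop0E.
Qed.

End Commutants.

Section Ideal.
Context {R : realType} {H : rhilb R}.
Variables (M n : bop H H -> Prop) (e : nat -> H).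
Hypotheses (vM : vnalg M) (de : dns (range e)).
Record ideal : Prop := Ideal {
 id_M : forall a, n a -> M a;
 id_0 : n 0;
 id_lin : forall c a b, n a -> n b -> n (c *: a + b);
 id_l : forall a b, M a -> n b -> n (a ** b);
 id_nd : forall h, (forall b, n b -> b h = 0) -> h = 0 }.
Hypothesis nI : ideal.

Definition core (a : bop H H) := n a /\ n a^#.

Lemma core_sq b : n b -> core (b^# ** b).
Proof.
by move=> nb; have h := id_l nI (vn_adj vM (id_M nI nb)) nb; split=> //; rewrite badjM badjK.
Qed.

Lemma core_M a b : core a -> core b -> core (a ** b).
Proof.
by move=> [a1 a2] [b1 b2]; split; rewrite ?badjM; apply: (id_l nI) => //; exact: (id_M nI).
Qed.

Lemma core_mid a x b : core a -> M x -> core b -> core (a ** x ** b).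
Proof.
move=> [a1 a2] Mx [b1 b2]; split; rewrite ?badjM; apply: (id_l nI) => //.
 by apply: (vnM vM) => //; exact: (id_M nI).
 exact: (id_M nI).
by apply: (id_l nI) => //; exact: (vn_adj vM).
Qed.

(** For b in the ideal, b^# b is in the core, so P b k = 0; then every adjoint intertwiner sends k
    to a vector of H killed by the whole ideal. *)
Lemma core_nd (K : rhilb R) (P : bop H H -> bop K K) k : repn M P ->
 (forall a, core a -> P a k = 0) -> k = 0.
Proof.
move=> rP hk; apply: (intertw_total vM rP de) => T iT; apply: (id_nd nI) => b nb.
have Mb := id_M nI nb.
have Pb : P b k = 0.
 apply: ip_eq0; rewrite badjE -(rp_adj rP Mb).
 have := hk _ (core_sq nb); rewrite (rp_mul rP (vn_adj vM Mb) Mb) /= => ->.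
 by rewrite ip0r.
have := congr1 (@badj _ _ _) (iT _ (vn_adj vM Mb)); rewrite !badjM badjK (rp_adj rP Mb) badjK.
by move=> /(bop_at k) /= <-; rewrite Pb b0.
Qed.

(** The products a x c with a and c in the core are in the core for every x in M, and nondegeneracy
    of both representations cancels a and c. *)
Lemma core_ext (K L : rhilb R) (P : bop H H -> bop K K) (Q : bop H H -> bop L L) (T : bop K L) :
 repn M P -> repn M Q ->
 (forall a, core a -> T ** P a = Q a ** T) -> forall x, M x -> T ** P x = Q x ** T.
Proof.
move=> rP rQ hT x Mx; set D := T ** P x - Q x ** T.
have cM a : core a -> M a by case=> /(id_M nI).
have z a c : core a -> core c -> Q a ** (D ** P c) = 0.
 move=> ca cc; have := hT _ (core_mid ca Mx cc).
 rewrite (rp_mul rP (vnM vM (cM _ ca) Mx) (cM _ cc)) (rp_mul rP (cM _ ca) Mx).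
 rewrite (rp_mul rQ (vnM vM (cM _ ca) Mx) (cM _ cc)) (rp_mul rQ (cM _ ca) Mx).
 rewrite /D bcBl bcBr !bcA (hT _ ca) -!bcA (hT _ cc) => ->; exact: subrr.
have z' c : core c -> D ** P c = 0.
 move=> cc; apply: bopP => u; rewrite bop0E; apply: (core_nd rQ) => a ca.
 by have := bop_at u (z _ _ ca cc); rewrite bop0E.
suff : D^# = 0 by move=> /(congr1 (@badj _ _ _)); rewrite badjK badj0 => /subr0_eq.
apply: bopP => u; rewrite bop0E; apply: (core_nd rP) => c [c1 c2].
have := congr1 (@badj _ _ _) (z' c^# (conj c2 (eq_ind_r n c1 (badjK c)))); rewrite badjM badj0 (rp_adj rP (id_M nI c1)) badjK.
by move=> /(bop_at u); rewrite bop0E.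
Qed.

End Ideal.

Section StdForm.
Context {R : realType} {H : rhilb R}.
Variables (M : bop H H -> Prop) (e : nat -> H).
Hypotheses (vM : vnalg M) (de : dns (range e)).

(** The GNS data of a faithful normal semifinite weight, with [g = (1 + D)^-1]
  for the positive part [D] of the polar decomposition of [L a |-> L a^#]. *)
Record sform (K : rhilb R) (P : bop H H -> bop K K) (n : bop H H -> Prop) (L : bop H H -> K)
  (J g : bop K K) : Prop := Sform {
 sf_P : repn M P;
 sf_n : ideal M n;
 sf_lin : forall c a b, n a -> n b -> L (c *: a + b) = c *: L a + L b;
 sf_PL : forall a b, M a -> n b -> P a (L b) = L (a ** b);
 sf_dns : dns (L @` n);
 sf_inj : forall a, n a -> L a = 0 -> a = 0;
 sf_JJ : J^# ** J = bid /\ J ** J^# = bid;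
 sf_g : ble1 g /\ forall u, g u = 0 -> u = 0;
 sf_vA : forall a, core n a -> exists k, L a = g k /\ L a^# = J (k - g k);
 sf_dA : forall k (d : R), 0 < d -> exists a, [/\ core n a, nrm (g k - L a) < d & nrm (J (k - g k) - L a^#) < d] }.

Section One.
Context {K : rhilb R} {P : bop H H -> bop K K} {n : bop H H -> Prop} {L : bop H H -> K} {J g : bop K K}.
Hypothesis sf : sform P n L J g.
Let rP := sf_P sf.
Let nI := sf_n sf.
Let cM a : core n a -> M a. Proof. by case=> /(id_M nI). Qed.

(** The core is stable under adjoints, so its part of the graph of S is symmetric. Approximation by
    core elements carries the symmetry to every k, as [polar_of_involution] asks. *)
Lemma sf_polar : polar g J.
Proof.
have [J1 J2] := sf_JJ sf; have [g1 gi] := sf_g sf.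
have JJ u : J^# (J u) = u by rewrite -[LHS]/((J^# ** J) u) J1.
have nJ (f : bop K K) u : f^# ** f = bid -> nrm (f u) = nrm u.
 by move=> h; rewrite /nrm badjE -[f^# _]/((f^# ** f) u) h.
apply: polar_of_involution => // k.
pose l := J (k - g k) + J^# (g k); exists l.
have gb := ble1_bnd g1.
have ap d : 0 < d -> exists l', [/\ nrm (l - l') < 2 * d, nrm (g l' - J (k - g k)) < d & nrm (g k - J (l' - g l')) < d].
 move=> d0; have [a [ca h1 h2]] := sf_dA sf k d0.
 have [l' []] := sf_vA sf (conj ca.2 (eq_ind_r n ca.1 (badjK a))); rewrite badjK => e1 e2.
 exists l'; split; [|by rewrite -e1 nrmB|by rewrite -e2].
 have -> : l' = L a^# + J^# (L a) by rewrite e1 e2 JJ addrC subrK.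
 rewrite /l opprD addrACA -bB.
 by apply: le_lt_trans (nrmD _ _) _; rewrite (nJ J^#) ?badjK//; lra.
have z x : (forall d : R, 0 < d -> nrm x <= 6 * d) -> x = 0.
 by move=> hx; apply: (eps_eq0 (C := 6)) => d; exact: hx.
split; apply/subr0_eq/z => d d0; have [l' [h1 h2 h3]] := ap d d0.
 have -> : J (k - g k) - g l = - (g l' - J (k - g k)) - g (l - l') by rewrite !bB; vring.
 apply: le_trans (nrmD _ _) _; rewrite !nrmN.
 by have := gb.2 (l - l'); lra.
have -> : g k - J (l - g l) = (g k - J (l' - g l')) - J (l - l') + J (g (l - l')) by rewrite !bB; vring.
apply: le_trans (nrmD _ _) _; have := nrmD (g k - J (l' - g l')) (- J (l - l')); rewrite nrmN !(nJ J)//.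
by have := gb.2 (l - l'); lra.
Qed.

Definition sfA (X : bop K K) (x x' : K) := exists a, [/\ core n a, X = P a, x = L a & x' = L a^#].

Lemma sfA_star : tstar sfA.
Proof.
move=> X x x' [a [[a1 a2] -> -> ->]]; exists a^#; split=> //; rewrite ?badjK//.
 by split=> //; rewrite badjK.
by rewrite (rp_adj rP (id_M nI a1)).
Qed.

Lemma sf_tsys : tsys g J (perp (perp sfA)) (perp sfA).
Proof.
have pl := sf_polar; apply: tsys_build => //.
- split.
  exists 0; have L0 : L 0 = 0.
   by have := sf_lin sf (-1) (id_0 nI) (id_0 nI); rewrite !scaleN1r oppr0 addr0 addNr.
  by split; rewrite ?badj0 ?L0 ?(rp0 vM rP)//; split; rewrite ?badj0; exact: (id_0 nI).
 move=> c _ _ _ _ _ _ [a [ca -> -> ->]] [b [cb -> -> ->]]; exists (c *: a + b).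
 have [a1 a2] := ca; have [b1 b2] := cb.
 have h : core n (c *: a + b) by split; rewrite ?badjD ?badjZ; exact: (id_lin nI).
 split=> //; first by rewrite (rp_lin rP)//; exact: cM.
  by rewrite (sf_lin sf).
 by rewrite badjD badjZ (sf_lin sf).
- exact: sfA_star.
- move=> _ _ _ _ _ _ [a [ca -> _ ->]] [b [cb -> -> _]]; exists (a ** b).
 have [a1 a2] := ca; have [b1 b2] := cb; split; first exact: (core_M nI).
 + by rewrite (rp_mul rP)//; exact: cM.
 + by rewrite (sf_PL sf)//; exact: cM.
 + by rewrite -(rp_adj rP (cM cb)) (sf_PL sf)// ?badjM//; apply: (vn_adj vM); exact: cM.
- move=> k hk; apply: (core_nd vM de nI rP) => a ca.
 by apply: (hk _ (L a) (L a^#)); exists a.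
- by move=> _ _ _ [a [ca _ -> ->]]; exact: (sf_vA sf).
- move=> u d d0; have d2 : 0 < d / 2 by rewrite divr_gt0.
 have [a [ca h1 h2]] := sf_dA sf u d2; have [k [e1 e2]] := sf_vA sf ca.
 exists k; first by exists (P a); exists a; split.
 have -> : u - k = (g u - L a) + J (J (u - g u) - L a^#).
  by rewrite e1 e2 !bB !(JJE pl); vring.
 apply: le_lt_trans (nrmD _ _) _; have -> : nrm (J (J (u - g u) - L a^#)) = nrm (J (u - g u) - L a^#).
  by rewrite /nrm (bsaE _ _ (pl_J pl)) (JJE pl).
 by lra.
Qed.

Lemma sf_comm x z : M x -> M z -> P x ** (J ** P z ** J) = (J ** P z ** J) ** P x.
Proof.
move=> Mx Mz; have ts := sf_tsys.
have h1 Q q q' : perp sfA Q q q' -> P z ** Q = Q ** P z.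
 move=> hQ; apply/esym/(core_ext vM de nI rP rP) => // a ca.
 have hA : sfA (P a) (L a) (L a^#) by exists a.
 by rewrite (ts_comm ts (perp_sub sfA_star hA) hQ).
apply/esym/(core_ext vM de nI rP rP) => // a ca.
have hA : sfA (P a) (L a) (L a^#) by exists a.
exact: (tomita ts h1 (perp_sub sfA_star hA)).
Qed.

Hypothesis fM : forall p, M p -> (forall a, M a -> a ** p = p ** a) -> bsa p -> p ** p = p -> p = 0 \/ p = bid.

(** By [tomita], p commutes with all right elements, and then by [comm_bic] with the whole commutant
    of P(M). So it comes from a central projection q of M, namely the one onto the vectors of H that
    every intertwiner sends into the range of p; [fM] makes q trivial. *)
Lemma sf_proj p : bsa p -> p ** p = p -> (forall a, M a -> p ** P a = P a ** p) ->
 (forall a, M a -> p ** (J ** P a ** J) = (J ** P a ** J) ** p) -> p = 0 \/ p = bid.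
Proof.
move=> sp pp h1 h2; have ts := sf_tsys; have JJ := pl_JJ (ts_pol ts).
have h3 X x x' : sfA X x x' -> (J ** p ** J) ** X = X ** (J ** p ** J).
 move=> [a [ca -> _ _]]; have := congr1 (fun f => J ** f ** J) (h2 a (cM ca)).
 by rewrite !bcA JJ bc1l -!bcA JJ !bcA bc1r => ->.
have h4 X x x' : perp (perp sfA) X x x' -> (J ** p ** J) ** X = X ** (J ** p ** J).
 by move=> hX; apply: (comm_bic sfA_star ts h3) => Q q q' hQ; exact: (ts_comm ts hX hQ).
have h5 Q q q' : perp sfA Q q q' -> p ** Q = Q ** p.
 move=> hQ; have := tomita (tsys_swap ts) h4 hQ.
 suff -> : J ** (J ** p ** J) ** J = p by [].
 by rewrite !bcA JJ bc1l -bcA JJ bc1r.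
have h6 X : (forall a, M a -> X ** P a = P a ** X) -> X ** p = p ** X.
 by move=> hX; apply: (comm_bic sfA_star ts) h5 => _ _ _ [a [/cM ca -> _ _]]; exact: hX.
have iT S : intertw M P S -> forall a, M a -> S^# ** P a = a ** S^#.
 move=> hS a Ma; have := congr1 (@badj _ _ _) (hS _ (vn_adj vM Ma)).
 by rewrite !badjM badjK (rp_adj rP Ma) badjK.
have h7 S S' : intertw M P S -> intertw M P S' -> S ** S'^# ** p = p ** (S ** S'^#).
 by move=> hS hS'; apply: h6 => a Ma; rewrite bcA hS// -!bcA -iT.
pose E : set H := [set h | forall S, intertw M P S -> p (S h) = S h].
have sE : subsp E.
 by split=> [S _|c u v hu hv S hS]; rewrite ?b0// !bop_lin hu// hv.
have cE : sclosed E.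
 move=> x l hx cx S hS; apply: (conv_uniq (bop_conv p (bop_conv S cx))) => d /(bop_conv S cx) [N hN].
 by exists N => m /hN; rewrite hx.
have [q [sq qq Eq qE _]] := bproj_exists sE cE.
have inv1 a : M a -> invariant a E E.
 move=> Ma u hu S hS; rewrite -[S (a u)]/((S ** a) u) -hS//= -[p _]/((p ** P a) _) h1//=.
 by rewrite hu.
have inv2 c : (forall a, M a -> c ** a = a ** c) -> invariant c E E.
 move=> hc u hu S hS; apply: (hu (S ** c)) => a Ma.
 by rewrite bcA hS// -!bcA hc.
have q1 a : M a -> a ** q = q ** a.
 by move=> Ma; apply: (bproj_comm sq Eq qE); apply: inv1 => //; exact: (vn_adj vM).
have Mq : M q.
 apply: (vn_bic vM) => c hc; apply: (bproj_comm sq Eq qE); apply: inv2 => // a Ma.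
 by rewrite -[a]badjK -!badjM (hc _ (vn_adj vM Ma)).
have [q0|q0] := fM Mq q1 sq qq; [left|right]; apply: bopP => k.
 rewrite bop0E; apply: (intertw_total vM rP de) => S hS.
 have : E (S^# (p k)).
  by move=> S' hS'; rewrite -[S' _]/((S' ** S^# ** p) k) h7//= -[p (p _)]/((p ** p) _) pp.
 by move=> /qE; rewrite q0 bop0E.
apply/eqP; rewrite eq_sym -subr_eq0; apply/eqP/(intertw_total vM rP de) => S hS.
apply: ip_inj => h; rewrite ip0l -badjEr ipDl ipNl (bsaE _ _ sp).
have : E h by rewrite -[h]/((@bid R H) h) -q0.
by move=> /(_ S hS) ->; rewrite subrr.
Qed.

End One.
End StdForm.

(** * Schur's lemma for a real-linear commutant *)

Section Schur.
Context {R : realType} {K : rhilb R}.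
Variables (S : bop K K -> Prop) (I : bop K K).
Hypotheses (Ss : forall a, S a -> S a^#) (sI : I^# = - I) (II : I ** I = - bid) (SI : S I)
 (Ic : forall a, S a -> I ** a = a ** I).
Hypothesis pS : forall p, bsa p -> p ** p = p -> (forall a, S a -> p ** a = a ** p) -> p = 0 \/ p = bid.

(** The sign projection of T - c commutes with S and is therefore trivial, so T >= c or T <= c for
    every c. The scalar is the largest lower bound of T. *)
Lemma schur_sa T : bsa T -> (forall a, S a -> T ** a = a ** T) -> exists x : R, T = x *: bid.
Proof.
move=> sT hT; have [C hC] := bop_bnd T; have C0 := hC.1.
have [[k k0]|z] := pselect (exists k : K, ip k k != 0); last first.
 exists 0; apply: bopP => u; rewrite bopZE scale0r; apply: ip_eq0.
 by apply: contrapT => /eqP h; apply: z; exists (T u).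
have pk : 0 < ip k k by rewrite lt0r k0 ip_ge0.
have dich c : (forall u, c * ip u u <= ip (T u) u) \/ (forall u, ip (T u) u <= c * ip u u).
 pose D := C + `|c| + 1; have D0 : 0 < D by rewrite /D ltr_wpDl// addr_ge0.
 pose s := D^-1 *: (T - c *: bid).
 have ss : bsa s by rewrite /bsa /s badjZ badjB badjZ badj1 sT.
 have Di : 0 < D^-1 by rewrite invr_gt0.
 have s1 : bnd s 1.
  split=> // u; rewrite mul1r /s bopZE bopBE bopZE nrmZ (ger0_norm (ltW Di)) ler_pdivrMl//.
  apply: le_trans (nrmD _ _) _; rewrite nrmN nrmZ; apply: le_trans (lerD (hC.2 u) (lexx _)) _.
  by rewrite /D /= !mulrDl mul1r lerDl nrm_ge0.
 have [p [sp pp hp h1 h2]] := sign_proj ss s1.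
 have hs a : S a -> a ** s = s ** a.
  by move=> Sa; rewrite /s bcZl bcZr bcBl bcBr bcZl bcZr bc1l bc1r hT.
 have [_ x1 _] := bsqrt_spec (bsa_sq_ble1 ss s1); rewrite -/(babs s) in x1.
 have sE u : ip (s u) u = D^-1 * (ip (T u) u - c * ip u u).
  by rewrite /s bopZE bopBE bopZE /= ipZl ipDl ipNl ipZl.
 have [p0|p0] := pS sp pp (fun a Sa => esym (hp a (hs a Sa) (hs _ (Ss Sa)))).
  right=> u; have := congr1 (fun f : bop K K => ip (f u) u) h2; rewrite p0 subr0 !bc1r bopNE ipNl sE => h.
  by have := x1.1.2 u; rewrite -oppr_le0 -h pmulr_rle0// subr_le0.
 left=> u; have := congr1 (fun f : bop K K => ip (f u) u) h1; rewrite p0 !bc1r sE => h.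
 by have := x1.1.2 u; rewrite -h pmulr_rge0// subr_ge0.
pose E := [set c : R | forall u, c * ip u u <= ip (T u) u].
have hE : has_sup E.
 split.
  exists (- C) => u; have := CSabs (T u) u; have := hC.2 u; have := nrm_ge0 u.
  rewrite -nrm2 => n0 n1 /ler_normlP[h _]; apply: le_trans (_ : - (nrm (T u) * nrm u) <= _); last by lra.
  by rewrite mulNr lerN2 expr2 mulrA ler_wpM2r.
 exists C => c /(_ k) h; have := le_trans h (bnd_form k hC).
 by rewrite ler_pM2r.
exists (sup E); set x := sup E.
have hl u : x * ip u u <= ip (T u) u.
 apply: eps_le => d d0; have [u0|u0] := eqVneq (ip u u) 0.
  by rewrite u0 mulr0 (ip_eq0 u0) ip0r add0r ltW.
 have u1 : 0 < ip u u by rewrite lt0r u0 ip_ge0.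
 have [c Ec hc] := sup_adherent (ltac:(by rewrite divr_gt0) : 0 < d / ip u u) hE.
 have := Ec u; rewrite -/x in hc; have : (x - d / ip u u) * ip u u < c * ip u u by rewrite ltr_pM2r.
 by rewrite mulrBl divfK//; lra.
have hr u : ip (T u) u <= x * ip u u.
 apply: eps_le => d d0; have [u0|u0] := eqVneq (ip u u) 0.
  by rewrite u0 mulr0 (ip_eq0 u0) ip0r add0r ltW.
 have u1 : 0 < ip u u by rewrite lt0r u0 ip_ge0.
 have q0 : 0 < d / ip u u by rewrite divr_gt0.
 have [h|h] := dich (x + d / ip u u); last by have := h u; rewrite mulrDl divfK.
 have : x + d / ip u u <= x by apply: ub_le_sup => //; exact: hE.2.
 by lra.
have z : bnd (T - x *: bid) 0.
 apply: bsa_bnd => // [|u]; first by rewrite /bsa badjB badjZ badj1 sT.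
 rewrite mul0r bopBE bopZE ipDl ipNl ipZl /=.
 by have := hl u; have := hr u => a b; rewrite (_ : _ - _ = 0) ?normr0//; lra.
apply: bopP => u; apply/eqP; rewrite -subr_eq0 -bopBE; apply/eqP/nrm_eq0/eqP.
by rewrite eq_le nrm_ge0 andbT; have := z.2 u; rewrite mul0r.
Qed.

(** T + T^# and I (T - T^#) are self-adjoint, so the self-adjoint case covers both halves of T. *)
Lemma schur T : (forall a, S a -> T ** a = a ** T) -> exists x y : R, T = x *: bid + y *: I.
Proof.
move=> hT; have hT' a : S a -> T^# ** a = a ** T^#.
 by move=> /Ss h; rewrite -[a]badjK -!badjM hT.
have [x hx] : exists x : R, T + T^# = x *: bid.
 apply: schur_sa => [|a Sa]; first by rewrite /bsa badjD badjK addrC.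
 by rewrite bcDl bcDr hT// hT'.
have [y hy] : exists y : R, I ** (T - T^#) = y *: bid.
 apply: schur_sa => [|a Sa].
  by rewrite /bsa badjM sI badjB badjK bcNr bcBl (hT _ SI) (hT' _ SI) -bcBr -bcNr opprB.
 by rewrite -bcA bcBl hT// hT'// -bcBr bcA Ic// bcA.
have e1 : T - T^# = - (y *: I).
 have := congr1 (fun f => I ** f) hy; rewrite bcA II bcNl bc1l bcZr bc1r => <-.
 by rewrite opprK.
exists (2^-1 * x), (2^-1 * - y).
have -> : T = 2^-1 *: ((T + T^#) + (T - T^#)).
 by apply: bopP => u; rewrite bopZE !bopDE bopNE; apply: ip_inj => w; rewrite !ipE; lra.
by rewrite hx e1 scalerDr scalerN -scaleNr !scalerA mulrN mulNr.
Qed.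

End Schur.

Arguments sfA {R H K} P n L X x x'.

Section Aux.
Context {R : realType}.

Lemma dns_of_orth (U : rhilb R) (A : set U) : subsp A ->
 (forall u, (forall a, A a -> ip u a = 0) -> u = 0) -> dns A.
Proof.
move=> sA hA u; have [a ha ua] := projection u (scl_subsp sA) (@scl_closed _ _ A).
have : u - a = 0 by apply: hA => b hb; apply: ua; exact: sub_scl.
by move=> /subr0_eq ->.
Qed.

Lemma conv_pair (U V : rhilb R) (x : nat -> U) (y : nat -> V) u v : conv x u -> conv y v ->
 conv (fun n => ((x n, y n) : rprod U V)) (u, v).
Proof.
move=> hx hy; apply: (@conv_le _ _ _ _ 1 (fun n => nrm (x n - u) + nrm (y n - v))) => // [n|d d0].
 by rewrite mul1r; exact: nrm_prod_le.
have [n1 h1] := hx (d / 2) ltac:(by rewrite divr_gt0).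
have [n2 h2] := hy (d / 2) ltac:(by rewrite divr_gt0).
by exists (maxn n1 n2) => n; rewrite geq_max => /andP[/h1 + /h2]; lra.
Qed.

Lemma polar_near (K : rhilb R) (g J : bop K K) u k d : polar g J ->
 nrm (g u - g k) < d -> nrm (J (u - g u) - J (k - g k)) < d -> nrm (u - k) < 2 * d.
Proof.
move=> pl h1 h2; have -> : u - k = (g u - g k) + J (J (u - g u) - J (k - g k)).
 by rewrite !bB !(JJE pl); vring.
apply: le_lt_trans (nrmD _ _) _.
have -> : nrm (J (J (u - g u) - J (k - g k))) = nrm (J (u - g u) - J (k - g k)).
 by rewrite /nrm (bsaE _ _ (pl_J pl)) (JJE pl).
lra.
Qed.

Definition bblk (U V : rhilb R) (a : bop U U) (b : bop V U) (c : bop U V) (d : bop V V) :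
  bop (rprod U V) (rprod U V) :=
 pinl U V ** a ** pfst U V + pinl U V ** b ** psnd U V +
 (pinr U V ** c ** pfst U V + pinr U V ** d ** psnd U V).

Lemma bblkE (U V : rhilb R) a b c d (p : rprod U V) :
 bblk a b c d p = (a p.1 + b p.2, c p.1 + d p.2).
Proof.
by rewrite /bblk !bopDE /= !pinlE !pinrE; apply: prod_eq => /=; rewrite ?addr0 ?add0r.
Qed.

Lemma bblk_adj (U V : rhilb R) (a : bop U U) (b : bop V U) (c : bop U V) (d : bop V V) :
 (bblk a b c d)^# = bblk a^# c^# b^# d^#.
Proof.
apply: badj_uniq => p q; rewrite !bblkE !ip_prod /= !ipDl !ipDr !badjE; lra.
Qed.

End Aux.

Section Faithful.
Context {R : realType} {H : rhilb R} {M : bop H H -> Prop} {e : nat -> H}.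
Hypotheses (vM : vnalg M) (de : dns (range e)).
Context {K : rhilb R} {P : bop H H -> bop K K} {n : bop H H -> Prop} {L : bop H H -> K} {J g : bop K K}.
Hypothesis sf : sform M P n L J g.
Let rP := sf_P sf.
Let nI := sf_n sf.

Lemma sf_right a Q q q' : n a -> perp (sfA P n L) Q q q' -> P a q = Q (L a).
Proof.
move=> na hQ; have Ma := id_M nI na; apply: subr0_eq.
apply: (core_nd vM de nI rP) => c [c1 c2]; have Mc := id_M nI c1.
have cc : core n (c ** a).
 by split; rewrite ?badjM; apply: (id_l nI) => //; exact: (vn_adj vM).
have hA x : core n x -> sfA P n L (P x) (L x) (L x^#) by move=> cx; exists x.
rewrite bB -[P c (P a q)]/((P c ** P a) q) -(rp_mul rP Mc Ma).
have [-> _ _ _] := hQ _ _ _ (hA _ cc).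
rewrite -(sf_PL sf Mc na) -[Q (P c _)]/((Q ** P c) _).
have h : sfA P n L (P c) (L c) (L c^#) by apply: hA.
by rewrite -(ts_comm (sf_tsys vM de sf) (perp_sub (sfA_star sf) h) hQ) subrr.
Qed.

(** The common kernel of the intertwiners is invariant under M and its commutant, so its projection
    p lies in M, and P p = 0. As L is injective, p annihilates the ideal. *)
Lemma sf_faithful h : (forall T, intertw M P T -> T h = 0) -> h = 0.
Proof.
pose E : set H := [set h | forall T, intertw M P T -> T h = 0].
have sE : subsp E by split=> [T _|c u v hu hv T hT]; rewrite ?b0// bop_lin hu// hv// scaler0 addr0.
have cE : sclosed E.
 move=> x l hx cx T hT; apply: (conv_uniq (bop_conv T cx)) => d d0.
 by exists 0%N => m _; rewrite hx// subrr nrm0.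
have [p [sp pp Ep pE _]] := bproj_exists sE cE.
have inv1 a : M a -> invariant a E E.
 by move=> Ma u hu T hT; rewrite -[T (a u)]/((T ** a) u) -hT//= hu// b0.
have inv2 c : (forall a, M a -> c ** a = a ** c) -> invariant c E E.
 move=> hc u hu T hT; apply: (hu (T ** c)) => a Ma.
 by rewrite bcA hT// -!bcA hc.
have Mp : M p.
 apply: (vn_bic vM) => c hc; apply: (bproj_comm sp Ep pE); apply: inv2 => // a Ma.
 by rewrite -[a]badjK -!badjM (hc _ (vn_adj vM Ma)).
have Tp T : intertw M P T -> T ** p = 0.
 by move=> hT; apply: bopP => u; rewrite bop0E /=; exact: Ep.
have Pp : P p = 0.
 apply: bopP => k; rewrite bop0E; apply: (intertw_total vM rP de) => T hT.
 have := congr1 (@badj _ _ _) (Tp _ hT); rewrite -(hT _ Mp) badjM badj0 -(rp_adj rP Mp) sp.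
 by move=> /(bop_at k); rewrite bop0E.
have pb b : n b -> p ** b = 0.
 move=> nb; apply: (sf_inj sf); first exact: (id_l nI).
 by rewrite -(sf_PL sf)// Pp bop0E.
move=> /(pE h) <-; apply: (id_nd nI) => b nb; apply: ip_eq0.
have := congr1 (@badj _ _ _) (pb _ (core_sq vM nI nb).1); rewrite badj0 !badjM badjK sp.
by move=> /(bop_at h); rewrite bop0E badjE /= => ->; rewrite ip0r.
Qed.

End Faithful.

Section Closable.
Context {R : realType} {H : rhilb R} {M : bop H H -> Prop} {e : nat -> H}.
Hypotheses (vM : vnalg M) (de : dns (range e)).
Context {K1 : rhilb R} {P1 : bop H H -> bop K1 K1} {n1 : bop H H -> Prop} {L1 : bop H H -> K1} {J1 g1 : bop K1 K1}.
Context {K2 : rhilb R} {P2 : bop H H -> bop K2 K2} {n2 : bop H H -> Prop} {L2 : bop H H -> K2} {J2 g2 : bop K2 K2}.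
Hypotheses (sf1 : sform M P1 n1 L1 J1 g1) (sf2 : sform M P2 n2 L2 J2 g2).

(** Right elements and intertwiners to both GNS spaces turn a pairing with L2 a^# into one that is
    continuous in L1 a, and such pairings separate vectors. So the relative involution of two
    weights is closable. *)
Lemma cross_closable v : (forall d : R, 0 < d -> exists a, [/\ n1 a, n2 a^#, nrm (L1 a) < d & nrm (v - L2 a^#) < d]) ->
 v = 0.
Proof.
move=> hv; have ts1 := sf_tsys vM de sf1; have ts2 := sf_tsys vM de sf2.
have iT (K : rhilb R) (P : bop H H -> bop K K) (rP : repn M P) S : intertw M P S -> forall a, M a -> S^# ** P a = a ** S^#.
 move=> hS a Ma; have := congr1 (@badj _ _ _) (hS _ (vn_adj vM Ma)).
 by rewrite !badjM badjK (rp_adj rP Ma) badjK.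
apply: (ts_ndN ts2) => Q2 q2 q2' hQ2.
apply: (intertw_total vM (sf_P sf2) de) => T2 hT2.
apply: (sf_faithful vM de sf1) => T1 hT1.
apply: (dns_orth (ts_dvN ts1)) => q1 [Q1 [q1' hQ1]]; rewrite badjE.
pose xi := T2 (T1^# q1); have -> : ip (T2^# (Q2 v)) (T1^# q1) = ip xi (Q2 v) by rewrite ipC [RHS]badjE.
pose W := T2 ** T1^# ** Q1.
have [C1 b1] := bop_bnd W; have [C2 b2] := bop_bnd Q2.
apply/eqP; rewrite -normr_eq0 eq_le normr_ge0 andbT.
pose D := C1 * nrm q2 + nrm xi * C2 + 1.
have D0 : 0 < D by rewrite /D ltr_wpDl// addr_ge0// mulr_ge0 ?nrm_ge0 ?b1.1 ?b2.1.
apply: eps_le => d d0; rewrite add0r; have [a [na na' h1 h2]] := hv (d / D) ltac:(by rewrite divr_gt0).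
have Ma := id_M (sf_n sf1) na.
have e1 : ip (W (L1 a)) q2 = ip xi (Q2 (L2 a^#)).
 rewrite /W /= -(sf_right vM de sf1 na hQ1) -(sf_right vM de sf2 na' hQ2).
 rewrite -[T1^# (P1 a q1)]/((T1^# ** P1 a) q1) (iT _ _ (sf_P sf1) _ hT1)//=.
 by rewrite -[T2 (a _)]/((T2 ** a) _) -hT2//= (rp_adj (sf_P sf2) Ma) badjE.
have -> : ip xi (Q2 v) = ip xi (Q2 (v - L2 a^#)) + ip (W (L1 a)) q2 by rewrite e1 bB ipDr ipNr subrK.
apply: le_trans (ler_normD _ _) _.
have i1 : `|ip xi (Q2 (v - L2 a^#))| <= nrm xi * C2 * (d / D).
 apply: le_trans (CSabs _ _) _; rewrite -mulrA ler_wpM2l ?nrm_ge0//.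
 by apply: le_trans (b2.2 _) _; rewrite ler_wpM2l ?b2.1// ltW.
have i2 : `|ip (W (L1 a)) q2| <= C1 * nrm q2 * (d / D).
 apply: le_trans (CSabs _ _) _; rewrite mulrAC ler_wpM2r ?nrm_ge0//.
 by apply: le_trans (b1.2 _) _; rewrite ler_wpM2l ?b1.1// ltW.
have i3 : D * (d / D) = d by rewrite mulrCA mulfV ?mulr1// lt0r_neq0.
have i4 : 0 < d / D by rewrite divr_gt0.
by move: i3 i4 i1 i2; rewrite /D; move: (d / _) => q; rewrite !mulrDl; lra.
Qed.

Lemma cross_dns : dns [set x | exists a, [/\ n1 a, n2 a^# & x = L1 a]].
Proof.
have I1 := sf_n sf1; have I2 := sf_n sf2.
apply: dns_of_orth => [|u hu].
 split=> [|c _ _ [a [a1 a2 ->]] [b [b1 b2 ->]]].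
  exists 0; rewrite badj0; split; [exact: id_0 I1|exact: id_0 I2|].
  by have := sf_lin sf1 (-1) (id_0 I1) (id_0 I1); rewrite !scaleN1r oppr0 addr0 addNr.
 exists (c *: a + b); rewrite badjD badjZ (sf_lin sf1)//.
 by split=> //; [exact: (id_lin I1)|exact: (id_lin I2)].
apply: (core_nd vM de I2 (sf_P sf1)) => d [d1 d2]; have Md := id_M I2 d1.
apply: (dns_orth (sf_dns sf1)) => _ [b nb <-].
rewrite badjE -(rp_adj (sf_P sf1) Md) (sf_PL sf1)//; last exact: (vn_adj vM).
apply: hu; exists (d^# ** b); split=> //; first by apply: (id_l I1) => //; exact: (vn_adj vM).
by rewrite badjM badjK; apply: (id_l I2) => //; apply: (vn_adj vM); exact: (id_M I1).
Qed.

End Closable.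

(** * Uniqueness of the standard form by 2 x 2 matrices *)

Section Uniqueness.
Context {R : realType} {H : rhilb R} {M : bop H H -> Prop} {e : nat -> H}.
Hypotheses (vM : vnalg M) (de : dns (range e)).
Context {K1 : rhilb R} {P1 : bop H H -> bop K1 K1} {n1 : bop H H -> Prop} {L1 : bop H H -> K1} {J1 g1 : bop K1 K1}.
Context {K2 : rhilb R} {P2 : bop H H -> bop K2 K2} {n2 : bop H H -> Prop} {L2 : bop H H -> K2} {J2 g2 : bop K2 K2}.
Hypotheses (sf1 : sform M P1 n1 L1 J1 g1) (sf2 : sform M P2 n2 L2 J2 g2).
Let I1 := sf_n sf1.
Let I2 := sf_n sf2.
Let rP1 := sf_P sf1.
Let rP2 := sf_P sf2.

(** The GNS data of the weight [phi1 (a 1 1) + phi2 (a 2 2)] on the 2 x 2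
  matrices over [M] ([true] stands for the index [1]). The coordinates of its
  Hilbert space are ordered as [((11, 22), (21, 12))]. *)
Let mat := bool -> bool -> bop H H.
Let mulm (a b : mat) : mat := fun i j => a i true ** b true j + a i false ** b false j.
Let adjm (a : mat) : mat := fun i j => (a j i)^#.
Let Mm (a : mat) := forall i j, M (a i j).
Let nn (i : bool) := if i then n1 else n2.
Let C4 (a : mat) := forall i j, nn j (a i j) /\ nn i (a i j)^#.
Let K12 := rprod K1 K2.
Let D (x y : bop H H) : bop K12 K12 := bdiag (P1 x) (P2 y).
Let X4 (a : mat) : bop (rprod K12 K12) (rprod K12 K12) :=
 bblk (D (a true true) (a false false)) (D (a true false) (a false true))
    (D (a false true) (a true false)) (D (a false false) (a true true)).
Let L4 (a : mat) : rprod K12 K12 := ((L1 (a true true), L2 (a false false)), (L1 (a false true), L2 (a true false))).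

Let nnM i a : nn i a -> M a. Proof. by case: i; [exact: (id_M I1)|exact: (id_M I2)]. Qed.
Let nnl i a b : M a -> nn i b -> nn i (a ** b). Proof. by case: i; [exact: (id_l I1)|exact: (id_l I2)]. Qed.
Let nnlin i c a b : nn i a -> nn i b -> nn i (c *: a + b). Proof. by case: i; [exact: (id_lin I1)|exact: (id_lin I2)]. Qed.
Let nnD i a b : nn i a -> nn i b -> nn i (a + b). Proof. by move=> h h'; rewrite -[a]scale1r; exact: nnlin. Qed.
Let nn0 i : nn i 0. Proof. by case: i; [exact: (id_0 I1)|exact: (id_0 I2)]. Qed.
Let C4M a : C4 a -> Mm a. Proof. by move=> h i j; exact: nnM (h i j).1. Qed.
Let MmM a b : Mm a -> Mm b -> Mm (mulm a b).
Proof. by move=> ha hb i j; apply: (vnD vM); apply: (vnM vM). Qed.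
Let C4star a : C4 a -> C4 (adjm a).
Proof. by move=> h i j; split; rewrite /adjm ?badjK; case: (h j i). Qed.
Let C4mid a x b : C4 a -> Mm x -> C4 b -> C4 (mulm (mulm a x) b).
Proof.
move=> ha hx hb i j; have hax := MmM (C4M ha) hx; split.
 by apply: nnD; apply: nnl => //; exact: (hb _ _).1.
rewrite badjD !badjM; apply: nnD; apply: nnl; try exact: (vn_adj vM) (C4M hb _ _).
 by rewrite badjD !badjM; apply: nnD; apply: nnl (ha _ _).2; exact: (vn_adj vM).
by rewrite badjD !badjM; apply: nnD; apply: nnl (ha _ _).2; exact: (vn_adj vM).
Qed.
Let C4mul a b : C4 a -> C4 b -> C4 (mulm a b).
Proof.
move=> ha hb i j; split; first by apply: nnD; apply: nnl (hb _ _).1; exact: C4M.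
by rewrite badjD !badjM; apply: nnD; apply: nnl (ha _ _).2; apply: (vn_adj vM); exact: C4M.
Qed.
Let X4E a p : X4 a p = ((P1 (a true true) p.1.1 + P1 (a true false) p.2.1, P2 (a false false) p.1.2 + P2 (a false true) p.2.2),
 (P1 (a false true) p.1.1 + P1 (a false false) p.2.1, P2 (a true false) p.1.2 + P2 (a true true) p.2.2)).
Proof. by rewrite /X4 bblkE /D !bdiagE. Qed.
Let X4M a b : Mm a -> Mm b -> X4 (mulm a b) = X4 a ** X4 b.
Proof.
move=> ha hb; apply: bopP => p; rewrite /= !X4E /= /mulm !(rpD rP1) ?(rpD rP2); try exact: (vnM vM).
rewrite !(rp_mul rP1) ?(rp_mul rP2)// !bopDE !bD /=.
by congr ((_, _), (_, _)); vring.
Qed.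
Let X4star a : Mm a -> X4 (adjm a) = (X4 a)^#.
Proof. by move=> ha; rewrite /X4 bblk_adj /D !bdiag_adj /adjm !(rp_adj rP1)// !(rp_adj rP2). Qed.
Let X4L a b : Mm a -> C4 b -> X4 a (L4 b) = L4 (mulm a b).
Proof.
move=> ha hb; have h i j := (hb i j).1; rewrite X4E /= /mulm /L4.
have LD1 x y : n1 x -> n1 y -> L1 (x + y) = L1 x + L1 y.
 by move=> h1 h2; have := sf_lin sf1 1 h1 h2; rewrite !scale1r.
have LD2 x y : n2 x -> n2 y -> L2 (x + y) = L2 x + L2 y.
 by move=> h1 h2; have := sf_lin sf2 1 h1 h2; rewrite !scale1r.
have l1 x y : M x -> n1 y -> n1 (x ** y) := @nnl true x y.
have l2 x y : M x -> n2 y -> n2 (x ** y) := @nnl false x y.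
have := h true true; have := h true false; have := h false true; have := h false false; rewrite /nn => h1 h2 h3 h4.
by rewrite !LD1 ?LD2 ?(sf_PL sf1) ?(sf_PL sf2)//; try exact: l1; try exact: l2; congr ((_, _), (_, _)); rewrite addrC.
Qed.
Let diagm (x y : bop H H) : mat := fun i j => if i == j then (if i then x else y) else 0.
Let X4nd k : (forall a, C4 a -> X4 a k = 0) -> k = 0.
Proof.
have h0 x y : core n1 x -> core n2 y -> C4 (diagm x y).
 move=> [hx hx'] [hy hy'] i j; case: i; case: j; rewrite /diagm /= ?badj0.
  - by split.
  - by split; first [exact: (id_0 I1)|exact: (id_0 I2)].
  - by split; first [exact: (id_0 I1)|exact: (id_0 I2)].
  - by split.
have c1 : core n1 0 by split; rewrite ?badj0; exact: (id_0 I1).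
have c2 : core n2 0 by split; rewrite ?badj0; exact: (id_0 I2).
move=> hk; apply: prod_eq; apply: prod_eq => /=.
- apply: (core_nd vM de I1 rP1) => a ca; have := hk _ (h0 _ _ ca c2); rewrite X4E /diagm /= (rp0 vM rP1) bop0E addr0.
 by case.
- apply: (core_nd vM de I2 rP2) => a ca; have := hk _ (h0 _ _ c1 ca); rewrite X4E /diagm /= (rp0 vM rP2) bop0E addr0.
 by case.
- apply: (core_nd vM de I2 rP1) => a ca; have := hk _ (h0 _ _ c1 ca).
 rewrite X4E => /(congr1 (fun p : rprod K12 K12 => p.2.1)).
 by rewrite /diagm /= (rp0 vM rP1) bop0E add0r.
- apply: (core_nd vM de I1 rP2) => a ca; have := hk _ (h0 _ _ ca c2).
 rewrite X4E => /(congr1 (fun p : rprod K12 K12 => p.2.2)).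
 by rewrite /diagm /= (rp0 vM rP2) bop0E add0r.
Qed.
Let X4ext Q : (forall a, C4 a -> Q ** X4 a = X4 a ** Q) -> forall x, Mm x -> Q ** X4 x = X4 x ** Q.
Proof.
move=> hQ x hx; set E := Q ** X4 x - X4 x ** Q.
have z a c : C4 a -> C4 c -> X4 a ** (E ** X4 c) = 0.
 move=> ha hc; have Ma := C4M ha; have Mc := C4M hc.
 have := hQ _ (C4mid ha hx hc); rewrite (X4M (MmM Ma hx) Mc) (X4M Ma hx).
 rewrite /E bcBl bcBr !bcA (hQ _ ha) -!bcA (hQ _ hc) => ->; exact: subrr.
have z' c : C4 c -> E ** X4 c = 0.
 move=> hc; apply: bopP => u; rewrite bop0E; apply: X4nd => a ha.
 by have := bop_at u (z _ _ ha hc); rewrite bop0E.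
suff : E^# = 0 by move=> /(congr1 (@badj _ _ _)); rewrite badjK badj0 => /subr0_eq.
apply: bopP => u; rewrite bop0E; apply: X4nd => c hc.
have := congr1 (@badj _ _ _) (z' _ (C4star hc)); rewrite badjM badj0 (X4star (C4M hc)) badjK.
by move=> /(bop_at u); rewrite bop0E.
Qed.

(** The involution on off-diagonal entries: [a] is the entry 21 and b the entry 12, and the adjoint
    of a matrix exchanges the two positions. *)
Let S0 : set (rprod K12 K12) := [set p | exists a b, [/\ n1 a, n2 a^#, n2 b, n1 b^# &
 p = ((L1 a, L2 b), (L1 b^#, L2 a^#))]].
Let z1 : L1 0 = 0.
Proof. by have := sf_lin sf1 (-1) (id_0 I1) (id_0 I1); rewrite !scaleN1r oppr0 addr0 addNr. Qed.
Let z2 : L2 0 = 0.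
Proof. by have := sf_lin sf2 (-1) (id_0 I2) (id_0 I2); rewrite !scaleN1r oppr0 addr0 addNr. Qed.
Let sS0 : subsp S0.
Proof.
split.
 exists 0, 0; rewrite !badj0 z1 z2; split=> //; first [exact: (id_0 I1)|exact: (id_0 I2)].
move=> c _ _ [a [b [a1 a2 b1 b2 ->]]] [a' [b' [a1' a2' b1' b2' ->]]].
exists (c *: a + a'), (c *: b + b'); rewrite !badjD !badjZ !(sf_lin sf1)// !(sf_lin sf2)//.
by split=> //; first [exact: (id_lin I1)|exact: (id_lin I2)].
Qed.
Let S (u v : K12) := scl S0 (u, v).

(** The last clause makes J off-diagonal with respect to K1 and K2. It holds because changing the
    sign of the entry 12 maps the graph to itself up to the opposite sign on images. *)
Let pl12 : exists g J, [/\ polar g J, forall u v, S u v <-> exists k, u = g k /\ v = J (k - g k) &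
 J ** bdiag bid (- bid) = - (bdiag bid (- bid) ** J)].
Proof.
have hS := scl_subsp sS0.
have nsw (x y z w : K12) : nrm ((x, y) - (z, w) : rprod K12 K12) = nrm ((y, x) - (w, z) : rprod K12 K12).
 by rewrite /nrm !ip_prod /= addrC.
have sl : bsa (bdiag bid (- bid) : bop K12 K12) by rewrite /bsa bdiag_adj badjN !badj1.
have [] := @polar_of_graph _ K12 S.
- exact: hS.1.
- by move=> c u v u' v' h1 h2; exact: (hS.2 c _ _ h1 h2).
- move=> x y u v h cx cy; exact: (scl_closed h (conv_pair cx cy)).
- move=> u v h d /h [p [a [b [a1 a2 b1 b2 ->]]] hp]; exists ((L1 b^#, L2 a^#), (L1 a, L2 b)).
  by exists b^#, a^#; rewrite !badjK.
 by rewrite nsw.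
- move=> [u1 u2] d d0; have d2 : 0 < d / 2 by rewrite divr_gt0.
 have [_ [a [a1 a2 ->]] h1] := cross_dns vM de sf1 sf2 u1 d2.
 have [_ [b [b1 b2 ->]] h2] := cross_dns vM de sf2 sf1 u2 d2.
 exists (L1 a, L2 b); first by exists (L1 b^#, L2 a^#); apply: sub_scl; exists a, b.
 by apply: le_lt_trans (nrm_prod_le _) _; rewrite /=; lra.
- move=> [v1 v2] h.
 have hs d : 0 < d -> exists a b, [/\ n1 a /\ n2 a^#, n2 b /\ n1 b^#, nrm (L1 a) < d /\ nrm (L2 b) < d,
   nrm (v1 - L1 b^#) < d & nrm (v2 - L2 a^#) < d].
  move=> /h [p [a [b [a1 a2 b1 b2 ->]]] hp]; exists a, b.
  have := nrm_fst (0 - L1 a, 0 - L2 b); have := nrm_snd (0 - L1 a, 0 - L2 b).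
  have := nrm_fst (v1 - L1 b^#, v2 - L2 a^#); have := nrm_snd (v1 - L1 b^#, v2 - L2 a^#).
  have := nrm_fst ((0, (v1, v2)) - (L1 a, L2 b, (L1 b^#, L2 a^#)) : rprod K12 K12).
  have := nrm_snd ((0, (v1, v2)) - (L1 a, L2 b, (L1 b^#, L2 a^#)) : rprod K12 K12).
  rewrite /= !sub0r !nrmN => q1 q2 q3 q4 q5 q6.
  by split=> //; try split; lra.
 apply: prod_eq => /=.
  apply: (cross_closable vM de sf2 sf1) => d /hs [a [b [_ [h1 h2] [_ h3] h4 _]]].
  by exists b.
 apply: (cross_closable vM de sf1 sf2) => d /hs [a [b [[h1 h2] _ [h3 _] _ h4]]].
 by exists a.
move=> g [J [pl hJ aJ]]; exists g, J; split=> //; apply: aJ => // u v h d /h [p [a [b [a1 a2 b1 b2 ->]]] hp].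
exists ((L1 a, L2 (- b)), (L1 (- b^#), L2 a^#)).
 exists a, (- b); rewrite badjN; split=> //.
  by rewrite -[- b]addr0 -scaleN1r; apply: (id_lin I2) => //; exact: (id_0 I2).
 by rewrite -[- _]addr0 -scaleN1r; apply: (id_lin I1) => //; exact: (id_0 I1).
have e1 : L1 (- b^#) = - L1 b^#.
 by have := sf_lin sf1 (-1) b2 (id_0 I1); rewrite !scaleN1r !addr0 z1 addr0.
have e2 : L2 (- b) = - L2 b.
 by have := sf_lin sf2 (-1) b1 (id_0 I2); rewrite !scaleN1r !addr0 z2 addr0.
rewrite e1 e2; move: hp; congr (Num.sqrt _ < _).
by rewrite !ip_prod /= !bdiagE /= !bopNE /= !ipE; ring.
Qed.

(** The commutation theorem for the matrix unit [e21]. *)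
Theorem sf_unique : exists V : bop K1 K2, [/\ V^# ** V = bid, V ** V^# = bid,
 forall a, M a -> V ** P1 a = P2 a ** V & V ** J1 = J2 ** V].
Proof.
have [g' [J' [pl' hS aJ]]] := pl12.
have pl1 := sf_polar sf1; have pl2 := sf_polar sf2.
pose g4 := bdiag (bdiag g1 g2) g'; pose J4 := bdiag (bdiag J1 J2) J'.
have pl4 : polar g4 J4 by apply: bdiag_polar => //; exact: bdiag_polar.
pose A (X : bop (rprod K12 K12) (rprod K12 K12)) x x' := exists a, [/\ C4 a, X = X4 a, x = L4 a & x' = L4 (adjm a)].
have sA : tstar A.
 move=> _ _ _ [a [ca -> -> ->]]; exists (adjm a); split; [exact: C4star|by rewrite X4star//; exact: C4M|by []|].
 by congr L4; apply/funext => i; apply/funext => j; rewrite /adjm badjK.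
have S12 a : C4 a -> S (L4 a).2 (L4 (adjm a)).2.
 move=> ca; apply: sub_scl; exists (a false true), (a true false).
 by have := ca false true; have := ca true false; rewrite /nn => -[? ?] [? ?]; split.
have ts : tsys g4 J4 (perp (perp A)) (perp A).
 apply: tsys_build => //.
 - split.
   exists (fun _ _ => 0); have -> : adjm (fun _ _ => 0) = (fun _ _ => 0).
    by apply/funext => i; apply/funext => j; rewrite /adjm badj0.
   split; [by move=> i j; rewrite badj0; split; exact: nn0| |by rewrite /L4 z1 z2|by rewrite /L4 z1 z2].
   by apply: bopP => p; rewrite X4E /= (rp0 vM rP1) (rp0 vM rP2) !bop0E !addr0.
  move=> c _ _ _ _ _ _ [a [ca -> -> ->]] [b [cb -> -> ->]]; exists (fun i j => c *: a i j + b i j).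
  have LL (x y : mat) : C4 x -> C4 y -> L4 (fun i j => c *: x i j + y i j) = c *: L4 x + L4 y.
   move=> hx hy; rewrite /L4 !(sf_lin sf1) ?(sf_lin sf2)//; first [exact: (hx true true).1|exact: (hy true true).1|
    exact: (hx false false).1|exact: (hy false false).1|exact: (hx true false).1|exact: (hy true false).1|
    exact: (hx false true).1|exact: (hy false true).1].
  split.
  + by move=> i j; rewrite badjD badjZ; split; apply: nnlin; first [exact: (ca i j).1|exact: (cb i j).1|exact: (ca i j).2|exact: (cb i j).2].
  + apply: bopP => p; have Ma := C4M ca; have Mb := C4M cb.
   rewrite X4E bopDE bopZE !X4E !(rp_lin rP1)// !(rp_lin rP2)// !bopDE !bopZE.
   by congr ((_, _), (_, _)); vring.
  + by rewrite LL.
  + by rewrite -(LL _ _ (C4star ca) (C4star cb)); congr L4; apply/funext => i; apply/funext => j; rewrite /adjm badjD badjZ.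
 - move=> _ _ _ _ _ _ [a [ca -> _ ->]] [b [cb -> -> _]]; exists (mulm a b); split.
  + exact: C4mul.
  + by rewrite (X4M (C4M ca) (C4M cb)).
  + exact: (X4L (C4M ca) cb).
  + rewrite -(X4star (C4M cb)) (X4L (C4M (C4star cb)) (C4star ca)); congr L4.
   by apply/funext => i; apply/funext => j; rewrite /adjm /mulm badjD !badjM.
 - by move=> k hk; apply: X4nd => a ca; apply: (hk _ (L4 a) (L4 (adjm a))); exists a.
 - move=> _ _ _ [a [ca _ -> ->]].
  have [k1 [h1 h1']] := sf_vA sf1 (ca true true : core n1 _).
  have [k2 [h2 h2']] := sf_vA sf2 (ca false false : core n2 _).
  have [k' [h3 h3']] := (hS _ _).1 (S12 _ ca).
  exists (((k1, k2), k') : rprod K12 K12); rewrite /g4 /J4 !bdiagE /=.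
  by rewrite -h1' -h2' -h3' -h1 -h2 -h3.
 - move=> [[u1 u2] u'] d d0; have d8 : 0 < d / 8 by rewrite divr_gt0.
  have [a1 [c1 x1 y1]] := sf_dA sf1 u1 d8; have [k1 [h1 h1']] := sf_vA sf1 c1.
  have [a2 [c2 x2 y2]] := sf_dA sf2 u2 d8; have [k2 [h2 h2']] := sf_vA sf2 c2.
  have hu : S (g' u') (J' (u' - g' u')) by apply/hS; exists u'.
  have [_ [a [b [b1 b2 b3 b4 ->]]] hp] := hu _ d8.
  pose x : mat := fun i j => if i then (if j then a1 else b) else (if j then a else a2).
  have cx : C4 x.
   by case: c1 => c1 c1'; case: c2 => c2 c2'; case; case; rewrite /x /=; split.
  have [k' [h3 h3']] := (hS _ _).1 (S12 _ cx).
  have q1 := nrm_fst ((g' u', J' (u' - g' u')) - (L1 a, L2 b, (L1 b^#, L2 a^#)) : rprod K12 K12).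
  have q2 := nrm_snd ((g' u', J' (u' - g' u')) - (L1 a, L2 b, (L1 b^#, L2 a^#)) : rprod K12 K12).
  rewrite h1 in x1; rewrite h1' in y1; rewrite h2 in x2; rewrite h2' in y2.
  have p1 := polar_near pl1 x1 y1; have p2 := polar_near pl2 x2 y2.
  have p3 : nrm (u' - k') < 2 * (d / 8).
   apply: (polar_near pl'); rewrite -?h3' -?h3; first exact: (le_lt_trans q1 hp).
   exact: (le_lt_trans q2 hp).
  exists ((k1, k2), k').
   exists (X4 x), x; split=> //; rewrite /g4 /J4 !bdiagE /=.
    by rewrite -h1 -h2 -h3.
   by rewrite -h1' -h2' -h3'.
  apply: le_lt_trans (nrm_prod_le _) _; rewrite /=.
  have := nrm_prod_le ((u1, u2) - (k1, k2) : K12); rewrite /=; lra.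
pose e21 : mat := fun i j => if i then 0 else if j then bid else 0.
have M0 := vn0 vM; have M1 := vn1 vM.
have Me : Mm e21 by case; case.
have h0 Q q q' : perp A Q q q' -> X4 e21 ** Q = Q ** X4 e21.
 move=> hQ; apply/esym/X4ext => // a ca.
 have hA : A (X4 a) (L4 a) (L4 (adjm a)) by exists a.
 by rewrite (ts_comm ts (perp_sub sA hA) hQ).
(* By [tomita], W commutes with the action of all matrices. Read on the coordinate 11, diagonal
   matrices show that V0 J1 intertwines P1 and P2, and e21 itself shows V0 J1 = J2 V0. *)
pose W := J4 ** X4 e21 ** J4.
have hW x : Mm x -> W ** X4 x = X4 x ** W.
 move=> hx; apply: X4ext => // a ca.
 have hA : A (X4 a) (L4 a) (L4 (adjm a)) by exists a.
 exact: (tomita ts h0 (perp_sub sA hA)).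
pose V0 := psnd K1 K2 ** J' ** pinl K1 K2; pose V0' := pfst K1 K2 ** J' ** pinr K1 K2.
have JE p : J' p = (V0' p.2, V0 p.1).
 have h (q : K12) : J' (q.1, - q.2) = (- (J' q).1, (J' q).2).
  have := bop_at q aJ; rewrite bopNE /= !bdiagE /= !bopNE /= => ->.
  by apply: prod_eq; rewrite /= ?opprK.
 have z1' : (J' (p.1, 0)).1 = 0.
  have := h (p.1, 0); rewrite /= oppr0 => /(congr1 fst) /= hh.
  by apply: ip_eq0; move: (congr1 (fun v => ip v (J' (p.1, 0)).1) hh); rewrite ipNl; lra.
 have z2' : (J' (0, p.2)).2 = 0.
  have := h (0, - p.2); rewrite /= opprK => /(congr1 snd) /= hh.
  have : J' (0, - p.2) = - J' (0, p.2) by rewrite -bN; congr (J' _); apply: prod_eq; rewrite /= ?oppr0.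
  move=> hN; rewrite hN /= in hh.
  by apply: ip_eq0; move: (congr1 (fun v => ip v (J' (0, p.2)).2) hh); rewrite ipNl; lra.
 have -> : p = (p.1, 0) + (0, p.2) by apply: prod_eq; rewrite /= ?addr0 ?add0r.
 rewrite bD /V0 /V0' /= !pinlE !pinrE; apply: prod_eq; rewrite /= ?z1' ?z2' ?addr0 ?add0r //.
clearbody V0 V0'.
have sJ' := pl_J pl'; have JJ' u : J' (J' u) = u := JJE pl' u.
have V01 k : V0' (V0 k) = k by have := JJ' (k, 0); rewrite !JE /= => -[].
have V02 k : V0 (V0' k) = k by have := JJ' (0, k); rewrite !JE /= => -[].
have V0s : V0^# = V0'.
 apply: badj_uniq => u v; have := bsaE ((u, 0) : K12) ((0, v) : K12) sJ'.
 by rewrite !JE !ip_prod /= !b0 !ipE !add0r addr0.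
have JJ1 u : J1 (J1 u) = u := JJE pl1 u; have JJ2 u : J2 (J2 u) = u := JJE pl2 u.
have WE p : W p = ((0, J2 (V0 p.2.1)), (0, V0 (J1 p.1.1))).
 rewrite /W /= /J4 !bdiagE X4E /e21 /= !JE !(rp0 vM rP1) !(rp0 vM rP2) !bop0E (rp_1 rP1) (rp_1 rP2) /=.
 by rewrite !addr0 !b0 !add0r.
clearbody W.
exists (V0 ** J1); have s1 := pl_J pl1.
have VJ2 k : V0 (J1 k) = J2 (V0 k).
 have := bop_at (((k, 0), 0) : rprod K12 K12) (hW _ Me).
 rewrite -[(W ** _) _]/(W (X4 _ _)) -[(_ ** W) _]/(X4 _ (W _)) !WE !X4E /e21 /= !(rp0 vM rP1) !(rp0 vM rP2) !bop0E (rp_1 rP1) (rp_1 rP2) /=.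
 by rewrite ?addr0 ?add0r => -[].
split.
- by apply: bopP => u; rewrite badjM s1 V0s /= V01 JJ1.
- by apply: bopP => u; rewrite badjM s1 V0s /= JJ1 V02.
- move=> a Ma; apply: bopP => k.
 have Mx : Mm (diagm a a) by case; case.
 have := bop_at (((k, 0), 0) : rprod K12 K12) (hW _ Mx).
 rewrite -[(W ** _) _]/(W (X4 _ _)) -[(_ ** W) _]/(X4 _ (W _)) !WE !X4E /diagm /= !(rp0 vM rP1) !(rp0 vM rP2) !bop0E /=.
 by rewrite ?b0 ?addr0 ?add0r => -[].
- by apply: bopP => u; rewrite /= JJ1 VJ2 JJ2.
Qed.

End Uniqueness.

(** * Irreducible algebras and continuity of semigroups *)

Section Power.
Context {R : realType} (T : finType) (K : rhilb R).

Let V := {ffun T -> K}.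
Let pwip (u v : V) : R := \sum_j ip (u j) (v j).
Fact pwipC u v : pwip u v = pwip v u.
Proof. by apply: eq_bigr => j _; rewrite ipC. Qed.
Fact pwipDl u v w : pwip (u + v) w = pwip u w + pwip v w.
Proof. by rewrite /pwip -big_split; apply: eq_bigr => j _; rewrite ffunE ipDl. Qed.
Fact pwipZl c u v : pwip (c *: u) v = c * pwip u v.
Proof. by rewrite /pwip mulr_sumr; apply: eq_bigr => j _; rewrite ffunE ipZl. Qed.
Fact pwip_ge0 u : 0 <= pwip u u.
Proof. by apply: sumr_ge0 => j _; exact: ip_ge0. Qed.
Fact pwip_le (u : V) j : ip (u j) (u j) <= pwip u u.
Proof. by rewrite /pwip (bigD1 j)//= lerDl; apply: sumr_ge0 => i _; exact: ip_ge0. Qed.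
Fact pwip_eq0 u : pwip u u = 0 -> u = 0.
Proof.
move=> h; apply/ffunP => j; rewrite ffunE; apply: ip_eq0; apply/eqP; rewrite eq_le ip_ge0 andbT -h.
exact: pwip_le.
Qed.
Fact pwip_complete (x : nat -> V) :
 (forall e : R, 0 < e -> exists N : nat, forall m n, (N <= m)%N -> (N <= n)%N ->
   pwip (x m - x n) (x m - x n) < e) ->
 exists l, forall e : R, 0 < e -> exists N : nat, forall n, (N <= n)%N ->
   pwip (x n - l) (x n - l) < e.
Proof.
move=> hx; have /choice[l hl] : forall j, exists l : K, forall e : R, 0 < e -> exists N : nat, forall n, (N <= n)%N ->
   ip (x n j - l) (x n j - l) < e.
 move=> j; apply: ip_complete => e /hx [N hN]; exists N => m n hm hn.
 by apply: le_lt_trans (hN m n hm hn); have := pwip_le (x m - x n) j; rewrite !ffunE.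
exists [ffun j => l j] => e e0; have c0 : 0 < e / (#|T|%:R + 1) by rewrite divr_gt0// ltr_wpDl.
have /choice[N hN] := fun j => hl j _ c0; exists (\max_j N j)%N => n hn.
apply: le_lt_trans (_ : \sum_(j : T) e / (#|T|%:R + 1) < _).
 apply: ler_sum => j _; rewrite !ffunE; apply/ltW/hN; apply: leq_trans hn; exact: leq_bigmax.
rewrite sumr_const -[_ *+ _]mulr_natl; set k := (#|_|%:R : R); have k0 : 0 <= k by rewrite ler0n.
by rewrite mulrCA gtr_pMr// ltr_pdivrMr ?ltr_wpDl// mul1r ltrDl.
Qed.
Definition pw := RHilb pwipC pwipDl pwipZl pwip_ge0 pwip_eq0 pwip_complete.

Lemma ip_pw (u v : pw) : ip u v = \sum_j ip (u j) (v j). Proof. by []. Qed.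

Lemma nrm_pw (u : pw) j : nrm (u j) <= nrm u.
Proof. by apply: sq_le; rewrite ?nrm_ge0// !nrm2; exact: pwip_le. Qed.

Fact ppr_lin j (c : R) (u v : pw) : (c *: u + v) j = c *: u j + v j.
Proof. by rewrite !ffunE. Qed.
Fact ppr_bd j (u : pw) : nrm (u j) <= 1 * nrm u. Proof. by rewrite mul1r nrm_pw. Qed.
Definition ppr j : bop pw K := mkbop (@ppr_lin j) ler01 (ppr_bd j).

Lemma ppr_adj i j k : ppr i ((ppr j)^# k) = if i == j then k else 0.
Proof.
apply: ip_inj => w.
have -> : ip (ppr i ((ppr j)^# k)) w = ip k (ppr j ((ppr i)^# w)) by rewrite badjE -badjEr.
have -> : ip k (ppr j ((ppr i)^# w)) = ip ((ppr j)^# k) ((ppr i)^# w) by rewrite [RHS]badjE badjK.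
pose d (j : T) (k : K) : pw := [ffun i => if i == j then k else 0].
have dE j' k' : (ppr j')^# k' = d j' k'.
 apply: ip_inj => u; rewrite -badjEr [RHS]ip_pw (bigD1 j')//= ffunE eqxx big1 ?addr0// => i' /negPf h.
 by rewrite ffunE h ip0l.
rewrite !dE ip_pw (bigD1 i)//= !ffunE eqxx big1 ?addr0// => i' /negPf h.
by rewrite [d i w i']ffunE h ip0r.
Qed.

Lemma ppr_sum : \sum_j (ppr j)^# ** ppr j = bid.
Proof.
apply: bopP => u; rewrite bopsumE; apply: ip_inj => w; rewrite ip_suml ip_pw.
by apply: eq_bigr => j _; rewrite -badjEr [RHS]ipC ipC.
Qed.

Definition pdiag (a : bop K K) : bop pw pw := \sum_j (ppr j)^# ** a ** ppr j.

Lemma pprdiag j a u : ppr j (pdiag a u) = a (ppr j u).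
Proof.
rewrite /pdiag bopsumE bsum.
have E i : ppr j (((ppr i)^# ** a ** ppr i) u) = if j == i then a (ppr i u) else 0 by exact: ppr_adj.
rewrite (eq_bigr _ (fun i _ => E i)) (bigD1 j)//= eqxx big1 ?addr0// => i /negPf.
by rewrite eq_sym => ->.
Qed.

Lemma pdiagE a (u : pw) j : pdiag a u j = a (u j). Proof. exact: pprdiag. Qed.

Lemma pdiag_adj a : (pdiag a)^# = pdiag a^#.
Proof.
by apply: badj_uniq => u v; rewrite !ip_pw; apply: eq_bigr => j _; rewrite !pdiagE badjE.
Qed.

End Power.

Section RankOne.
Context {R : realType} {K : rhilb R}.
Variable I : bop K K.
Hypotheses (sI : I^# = - I) (II : I ** I = - bid).

Lemma IIE u : I (I u) = - u.
Proof. by rewrite -[LHS]/((I ** I) u) II bopNE. Qed.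
Lemma ipI u v : ip (I u) v = - ip u (I v).
Proof. by rewrite badjE sI bopNE ipNr. Qed.
Lemma ipII u v : ip (I u) (I v) = ip u v. Proof. by rewrite ipI IIE ipNr opprK. Qed.
Lemma ipI0 u : ip u (I u) = 0. Proof. by have := ipI u u; rewrite ipC; lra. Qed.
Lemma nrmI u : nrm (I u) = nrm u. Proof. by rewrite /nrm ipII. Qed.

Definition CB (x : bop K K) := x ** I = I ** x.

Lemma CBE x u : CB x -> x (I u) = I (x u).
Proof. by move=> h; rewrite -[LHS]/((x ** I) u) h. Qed.

Lemma vnCB : vnalg CB.
Proof.
split=> [a ha|a ha].
 by have := congr1 (@badj _ _ _) ha; rewrite /CB !badjM sI bcNl bcNr => /oppr_inj.
by apply/esym/ha => b; rewrite /CB => ->.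
Qed.

Fact rk_lin u v c (w w' : K) : ip (c *: w + w') v *: u + ip (c *: w + w') (I v) *: I u =
 c *: (ip w v *: u + ip w (I v) *: I u) + (ip w' v *: u + ip w' (I v) *: I u).
Proof. by vring. Qed.
Fact rk_bd u v (w : K) : nrm (ip w v *: u + ip w (I v) *: I u) <= (2 * nrm u * nrm v) * nrm w.
Proof.
apply: le_trans (nrmD _ _) _; rewrite !nrmZ nrmI.
have h1 := CSabs w v; have := CSabs w (I v); rewrite nrmI => h2.
have := ler_wpM2r (nrm_ge0 u) h1; have := ler_wpM2r (nrm_ge0 u) h2; lra.
Qed.
Fact rk_ge0 (u v : K) : 0 <= 2 * nrm u * nrm v.
Proof. by rewrite !mulr_ge0 ?nrm_ge0. Qed.
(** The complex rank one operator [w |-> <w, v> u]. *)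
Definition rk u v : bop K K := mkbop (rk_lin u v) (rk_ge0 u v) (rk_bd u v).

Lemma rkE u v w : rk u v w = ip w v *: u + ip w (I v) *: I u. Proof. by []. Qed.
Lemma bnd_rk u v : bnd (rk u v) (2 * nrm u * nrm v).
Proof. by split; [exact: rk_ge0|exact: rk_bd]. Qed.

Lemma rkCB u v : CB (rk u v).
Proof.
apply: bopP => w; rewrite /= bD !bZ IIE ipII ipI.
vring.
Qed.

Lemma rk_adj u v : (rk u v)^# = rk v u.
Proof.
apply: badj_uniq => w z; rewrite !rkE !ipE (ipC z u) (ipC z (I u)) ipI.
rewrite (ipC w (I v)) ipI (ipC w); ring.
Qed.

Lemma rk_l x u v : CB x -> x ** rk u v = rk (x u) v.
Proof. by move=> hx; apply: bopP => w; rewrite /= bD !bZ (CBE _ hx). Qed.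

(** Complex polarisation, with I in the role of i. *)
Lemma rk_polar u v : rk u v = 4^-1 *: ((rk (u + v) (u + v) - rk (u - v) (u - v)) +
 I ** (rk (u + I v) (u + I v) - rk (u - I v) (u - I v))).
Proof.
apply: bopP => w; rewrite bopZE bopDE bopBE -[(I ** _) w]/(I (_ w)) bopBE !rkE.
rewrite !(bD, bB, bZ, bN, IIE); apply: ip_inj => z; rewrite !ipE; lra.
Qed.

Lemma rk_proj v : ip v v = 1 -> rk v v ** rk v v = rk v v.
Proof.
move=> v1; rewrite rk_l; last exact: rkCB.
by congr rk; rewrite rkE v1 ipI0 scale0r addr0 scale1r.
Qed.

(** For v = T^# u the hypothesis on u gives rk v v v = |v|^2 v = 0. *)
Lemma rk_total (L : rhilb R) (P : bop K K -> bop L L) (e : nat -> K) u : dns (range e) -> repn CB P ->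
 (forall v, P (rk v v) u = 0) -> u = 0.
Proof.
move=> de rP hu; apply: (intertw_total vnCB rP de) => T hT; set v := T^# u.
have h : rk v v v = 0.
 have := congr1 (@badj _ _ _) (hT _ (rkCB v v)); rewrite !badjM -(rp_adj rP (rkCB v v)) rk_adj.
 by move=> /(bop_at u) /=; rewrite hu b0 => /esym.
have := congr1 (fun w => ip w v) h; rewrite rkE ipI0 scale0r addr0 ipZl ip0l => /eqP.
by rewrite mulf_eq0 orbb => /eqP /ip_eq0.
Qed.

End RankOne.

Section Cayley.
Context {R : realType} {K : rhilb R}.

(** [f = 2 a (1 + a^2)^-1], the bounded functional calculus used to keep
  approximants bounded. *)
Definition cayley (a m f : bop K K) :=
 [/\ bsa a, (a ** a + bid) ** m = bid, m ** (a ** a + bid) = bid & f = 2 *: (a ** m)].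

Lemma cayley_exists a : bsa a -> exists m f, cayley a m f.
Proof.
move=> sa; have [m [h1 h2 _ _]] := eps_inv a ltr01; rewrite scale1r sa in h1 h2.
by exists m, (2 *: (a ** m)).
Qed.

Lemma cayley_bnd a m f : cayley a m f -> bnd m 1 /\ bnd f 1.
Proof.
move=> [sa h1 h2 ->].
have uE u : u = a (a (m u)) + m u by have := bop_at u h1; rewrite /= bopDE.
have uu u : ip u u = ip (a (a (m u))) (a (a (m u))) + 2 * ip (a (m u)) (a (m u)) + ip (m u) (m u).
 rewrite [in LHS](uE u) !ipDl !ipDr (ipC (m u) (a (a (m u)))) (bsaE (a (m u)) (m u) sa); lra.
split; split=> // u; rewrite mul1r; apply: sq_le; rewrite ?nrm_ge0// !nrm2 (uu u); set w := m u.
 by have := ip_ge0 (a (a w)); have := ip_ge0 (a w); lra.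
rewrite bopZE !ipE -[(a ** m) u]/(a w).
by have := ip_ge0 (a (a w) - w); rewrite !ipE (ipC w (a (a w))) (bsaE (a w) w sa); lra.
Qed.

Lemma cayley_uniq a m f m' f' : cayley a m f -> cayley a m' f' -> f = f'.
Proof.
move=> [_ _ h2 ->] [_ h1' _ ->]; congr (2 *: (a ** _)).
by rewrite -[m]bc1r -h1' bcA h2 bc1l.
Qed.

(** The identity f - f' = 2 m (a - b) m' - 1/2 f (a - b) f', as in Kaplansky's density theorem: a -
    b is only evaluated at vectors that depend on b and w. *)
Lemma cayley_diff a m f b m' f' w : cayley a m f -> cayley b m' f' ->
 nrm (f w - f' w) <= 2 * nrm ((a - b) (m' w)) + nrm ((a - b) (f' w)).
Proof.
move=> ca cb; have [bm bf] := cayley_bnd ca; case: (ca) => [sa h1 h2 fE]; case: (cb) => [_ h1' h2' fE'].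
have wE : w = b (b (m' w)) + m' w by have := bop_at w h1'; rewrite /= bopDE.
have f'E : f' w = 2 *: b (m' w) by rewrite fE' bopZE.
have h2E u : m (a (a u)) + m u = u by have := bop_at u h2; rewrite /= bopDE bD.
have am u : a (m u) = m (a u).
 suff : a ** m = m ** a by move=> h; rewrite -[LHS]/((a ** m) u) h.
 by apply: (binv_comm h1 h2); rewrite bcDl bcDr bc1l bc1r bcA.
have e : f w - f' w = 2 *: m ((a - b) (m' w)) - 2^-1 *: f ((a - b) (f' w)).
 rewrite {1}wE fE !bopZE !bopBE f'E /= !(bD, bN, bZ) !am; set u := m' w.
 have := h2E (b u); move: (m (a (b (b u)))) (m (a u)) (m (b u)) (m (a (a (b u)))) => p q r s <-.
 by apply: ip_inj => z; rewrite !ipE; lra.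
rewrite e; apply: le_trans (nrmD _ _) _; rewrite nrmN !nrmZ !ger0_norm ?invr_ge0//.
have := bm.2 ((a - b) (m' w)); have := bf.2 ((a - b) (f' w)); have := nrm_ge0 ((a - b) (f' w)); rewrite !mul1r; lra.
Qed.

End Cayley.

(** 2 x / (1 + x^2) fixes 0 and 1, so a projection is its own transform. *)
Lemma cayley_proj (R : realType) (K : rhilb R) (k : bop K K) : bsa k -> k ** k = k -> cayley k (bid - 2^-1 *: k) k.
Proof.
move=> sk kk; have h u : k (k u) = k u by rewrite -[LHS]/((k ** k) u) kk.
by split=> //; apply: bopP => u; rewrite ?kk /= !(bopDE, bopNE, bopZE) /= !(bopDE, bopNE, bopZE, bD, bN, bZ) /= ?(bopDE, bopNE, bopZE) ?h;
 apply: ip_inj => w; rewrite !ipE; lra.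
Qed.

Lemma cayley_rep (R : realType) (H K : rhilb R) (M : bop H H -> Prop) (P : bop H H -> bop K K) a m f :
 vnalg M -> repn M P -> M a -> cayley a m f -> M f /\ cayley (P a) (P m) (P f).
Proof.
move=> vM rP Ma [sa h1 h2 ->].
have Mq : M (a ** a + bid) by apply: (vnD vM); [exact: (vnM vM)|exact: (vn1 vM)].
have Mm : M m := vn_inv vM h1 h2 Mq.
have Mam := vnM vM Ma Mm.
have Pq : P (a ** a + bid) = P a ** P a + bid.
 by rewrite (rpD rP (vnM vM Ma Ma) (vn1 vM)) (rp_mul rP)// (rp_1 rP).
split; first exact: (vnZ vM).
split.
- by rewrite /bsa -(rp_adj rP Ma) sa.
- by rewrite -Pq -(rp_mul rP)// h1 (rp_1 rP).
- by rewrite -Pq -(rp_mul rP)// h2 (rp_1 rP).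
- by rewrite (rpZ vM rP _ Mam) (rp_mul rP).
Qed.

(** * Density theorems for an irreducible algebra *)

Section Density.
Context {R : realType} {K : rhilb R}.
Variables (I : bop K K) (A : bop K K -> Prop) (e : nat -> K).
Hypotheses (sI : I^# = - I) (II : I ** I = - bid) (de : dns (range e)).
Record irred_alg : Prop := IrredAlg {
 ia_CB : forall a, A a -> CB I a;
 ia_1 : A bid;
 ia_I : A I;
 ia_lin : forall c a b, A a -> A b -> A (c *: a + b);
 ia_mul : forall a b, A a -> A b -> A (a ** b);
 ia_adj : forall a, A a -> A a^#;
 ia_irr : forall T, (forall a, A a -> T ** a = a ** T) -> exists x y : R, T = x *: bid + y *: I }.
Hypothesis iA : irred_alg.

Lemma ia_0 : A 0.
Proof. by have := ia_lin iA (-1) (ia_1 iA) (ia_1 iA); rewrite scaleN1r addNr. Qed.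

Lemma ia_D a b : A a -> A b -> A (a + b).
Proof. by move=> ha hb; rewrite -[a]scale1r; exact: (ia_lin iA). Qed.

(** The double commutant argument on a finite power of K: the projection onto the closure of A X
    commutes with the diagonal action of A, so irreducibility makes its matrix entries complex
    scalars, and it commutes with every complex-linear x. *)
Lemma density (T : finType) (xi eta : T -> K) :
 (forall a, A a -> \sum_j ip (a (xi j)) (eta j) = 0) ->
 forall x, CB I x -> \sum_j ip (x (xi j)) (eta j) = 0.
Proof.
move=> h x hx; pose X : pw T K := [ffun j => xi j]; pose Y : pw T K := [ffun j => eta j].
pose L : set (pw T K) := [set u | exists2 a, A a & u = pdiag T a X].
have E (a : bop K K) : \sum_j ip (a (xi j)) (eta j) = ip (pdiag T a X) Y.
 by rewrite ip_pw; apply: eq_bigr => j _; rewrite pdiagE !ffunE.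
have sL : subsp L.
 split.
  exists 0; first exact: ia_0.
  by apply/ffunP => j; rewrite pdiagE bop0E ffunE.
 move=> c _ _ [a Aa ->] [b Ab ->]; exists (c *: a + b); first exact: (ia_lin iA).
 by apply/ffunP => j; rewrite ppr_lin !pdiagE bopDE bopZE.
have [p [sp pp Lp pL _]] := bproj_exists (scl_subsp sL) (@scl_closed _ _ L).
have inv a : A a -> invariant (pdiag T a) (scl L) (scl L).
 move=> Aa u hu d d0; have [C hC] := bop_bnd (pdiag T a).
 have C1 : 0 < C + 1 by have := hC.1; lra.
 have [_ [b Ab ->] hd] := hu (d / (C + 1)) ltac:(by rewrite divr_gt0).
 exists (pdiag T (a ** b) X); first by exists (a ** b) => //; exact: (ia_mul iA).
 have -> : pdiag T (a ** b) X = pdiag T a (pdiag T b X).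
  by apply/ffunP => j; rewrite !pdiagE.
 rewrite -bB; apply: le_lt_trans (hC.2 _) _.
 apply: le_lt_trans (ler_wpM2r (nrm_ge0 _) (_ : C <= C + 1)) _; first by lra.
 by rewrite mulrC -ltr_pdivlMr.
have pa a : A a -> pdiag T a ** p = p ** pdiag T a.
 move=> Aa; apply: (bproj_comm sp Lp pL); first exact: inv.
 by rewrite pdiag_adj; apply: inv; exact: (ia_adj iA).
have dj a j : pdiag T a ** (ppr K j)^# = (ppr K j)^# ** a.
 have := congr1 (@badj _ _ _) (_ : ppr K j ** pdiag T a^# = a^# ** ppr K j); rewrite !badjM pdiag_adj badjK.
 by apply; apply: bopP => u /=; exact: pdiagE.
have dl a j : ppr K j ** pdiag T a = a ** ppr K j by apply: bopP => u /=; exact: pdiagE.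
have ent i j : ppr K i ** p ** (ppr K j)^# ** x = x ** (ppr K i ** p ** (ppr K j)^#).
 have [|s [t ->]] := ia_irr iA (T := ppr K i ** p ** (ppr K j)^#).
  by move=> a Aa; rewrite -bcA -dj bcA -(bcA _ p) -(pa _ Aa) !bcA dl.
 by rewrite bcDl bcDr !bcZl !bcZr bc1l bc1r -hx.
have px : pdiag T x ** p = p ** pdiag T x.
 have res (f f' : bop (pw T K) (pw T K)) : (forall i j, ppr K i ** f ** (ppr K j)^# = ppr K i ** f' ** (ppr K j)^#) -> f = f'.
  move=> hf; rewrite -[f]bc1r -[f']bc1r -(ppr_sum T K); apply: bopP => u /=; rewrite !bopsumE !bsum.
  apply: eq_bigr => j _; apply/ffunP => i.
  by have := bop_at (ppr K j u) (hf i j).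
 by apply: res => i j; rewrite !bcA dl -(bcA _ (pdiag T x)) dj bcA ent !bcA.
have LX : scl L X.
 by apply: sub_scl; exists bid; [exact: (ia_1 iA)|apply/ffunP => j; rewrite pdiagE].
have : scl L (pdiag T x X) by rewrite -(pL _ LX) -[pdiag T x _]/((pdiag T x ** p) X) px; exact: Lp.
move=> /scl_seq [z hz cz]; rewrite E; apply: (conv_ip_eq cz) => n.
by have [a Aa ->] := hz n; rewrite -E h.
Qed.

(** The best approximation is taken within the real space of self-adjoint elements. Doubling the
    list of vectors writes the pairing with a + a^# as one to which [density] applies. *)
Lemma sa_approx (T : finType) (xi : T -> K) k d : CB I k -> bsa k -> 0 < d ->
 exists a, [/\ A a, bsa a & forall j, nrm (k (xi j) - a (xi j)) < d].
Proof.
move=> hk sk d0; pose X : pw T K := [ffun j => xi j].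
pose L : set (pw T K) := [set u | exists a, [/\ A a, bsa a & u = pdiag T a X]].
have sL : subsp L.
 split.
  exists 0; split; [exact: ia_0|by rewrite /bsa badj0|].
  by apply/ffunP => j; rewrite pdiagE bop0E ffunE.
 move=> c _ _ [a [Aa sa ->]] [b [Ab sb ->]]; exists (c *: a + b); split.
 - exact: (ia_lin iA).
 - by rewrite /bsa badjD badjZ sa sb.
 - by apply/ffunP => j; rewrite ppr_lin !pdiagE bopDE bopZE.
have [q Lq hq] := projection (pdiag T k X) (scl_subsp sL) (@scl_closed _ _ L).
set D := pdiag T k X - q in hq.
pose x2 (s : T + T) := match s with inl j => xi j | inr j => D j end.
pose y2 (s : T + T) := match s with inl j => D j | inr j => xi j end.
have sum2 (a : bop K K) : \sum_s ip (a (x2 s)) (y2 s) = ip (pdiag T (a + a^#) X) D.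
 rewrite [RHS]ip_pw big_sumType /= -big_split; apply: eq_bigr => j _.
 have XE : X j = xi j by rewrite ffunE.
 by rewrite pdiagE XE bopDE ipDl /=; congr (_ + _); rewrite badjE ipC.
have z : \sum_s ip (k (x2 s)) (y2 s) = 0.
 apply: density hk => a Aa; rewrite sum2 ipC; apply: hq; apply: sub_scl; exists (a + a^#); split=> //.
  by apply: ia_D => //; exact: (ia_adj iA).
 by rewrite /bsa badjD badjK addrC.
have D0 : D = 0.
 apply: ip_eq0; have e1 := hq q Lq; rewrite sum2 sk in z.
 have e2 : ip (pdiag T k X) D = 0.
  move: z; have -> : pdiag T (k + k) X = 2 *: pdiag T k X.
   by apply/ffunP => j; rewrite ffunE !pdiagE bopDE scaler_nat.
  by rewrite ipZl; lra.
 by rewrite {1}/D ipDl ipNl e2 (ipC q) e1 subrr.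
have [_ [a [Aa sa ->]] hd] := Lq d d0; exists a; split=> // j.
apply: le_lt_trans hd; have := nrm_pw (q - pdiag T a X) j.
have -> : q = pdiag T k X by move/eqP: D0; rewrite subr_eq0 => /eqP.
by rewrite !ffunE !pdiagE !ffunE.
Qed.

(** The a n approach k = rk v v on v and on the first n vectors e j, possibly without any common
    bound. Their Cayley transforms are contractions and still converge to k, which is its own
    transform. *)
Lemma rk_approx v : ip v v = 1 -> exists a m f : nat -> bop K K,
 [/\ forall n, A (a n), forall n, cayley (a n) (m n) (f n) & scv f (rk sI II v v)].
Proof.
move=> v1; set k := rk sI II v v.
have hk : CB I k := rkCB sI II v v; have sk : bsa k := rk_adj sI II v v.
have kk : k ** k = k := rk_proj sI II v1.
have nv : nrm v = 1 by rewrite /nrm v1 sqrtr1.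
have /choice[a ha] : forall n, exists a, [/\ A a, bsa a, nrm ((a - k) v) < n.+1%:R^-1 &
  forall j, (j < n)%N -> nrm ((a - k) (e j)) < n.+1%:R^-1].
 move=> n; pose xi (s : option 'I_n) := if s is Some j then e j else v.
 have [a [Aa sa hd]] := sa_approx xi hk sk (ltac:(by rewrite invr_gt0) : 0 < n.+1%:R^-1 :> R).
 exists a; split=> //; first by have := hd None; rewrite bopBE nrmB.
 by move=> j jn; have := hd (Some (Ordinal jn)); rewrite bopBE nrmB.
have /choice[mf hmf] : forall n, exists mf : bop K K * bop K K, cayley (a n) mf.1 mf.2.
 by move=> n; case: (ha n) => _ /cayley_exists [m [f h]] _ _; exists (m, f).
exists a, (fun n => (mf n).1), (fun n => (mf n).2); split=> //.
 by move=> n; case: (ha n).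
have ck : cayley k (bid - 2^-1 *: k) k := cayley_proj sk kk.
have kE w : k w = ip w v *: v + ip w (I v) *: I v by [].
have hI n u : (a n - k) (I u) = I ((a n - k) u).
 by case: (ha n) => An _ _ _; rewrite !bopBE bB (CBE _ (ia_CB iA An)) (CBE _ hk).
clearbody k.
(* In [cayley_diff] the vector k w is a combination of v and I v, so convergence at v controls
   it. *)
have est n w : nrm ((mf n).2 w - k w) <= 2 * nrm ((a n - k) w) + 4 * nrm w * nrm ((a n - k) v).
 apply: le_trans (cayley_diff w (hmf n) ck) _; rewrite (bopBE bid) bopZE; set b := a n - k.
 have hb : nrm (b (k w)) <= 2 * nrm w * nrm (b v).
  rewrite kE bD !bZ; apply: le_trans (nrmD _ _) _; rewrite !nrmZ hI (nrmI sI II).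
  have := CSabs w v; have := CSabs w (I v); rewrite (nrmI sI II) nv mulr1 => h1 h2.
  by have := ler_wpM2r (nrm_ge0 (b v)) h1; have := ler_wpM2r (nrm_ge0 (b v)) h2; lra.
 have : nrm (b (w - 2^-1 *: k w)) <= nrm (b w) + 2^-1 * nrm (b (k w)).
  by rewrite bB bZ; apply: le_trans (nrmD _ _) _; rewrite nrmN nrmZ ger0_norm ?invr_ge0.
 lra.
have cv j : conv (fun n => (mf n).2 (e j)) (k (e j)).
 move=> d d0; pose C := 2 + 4 * nrm (e j); have C0 : 0 < C by have := nrm_ge0 (e j); rewrite /C; lra.
 have [N hN] := inv_small (ltac:(by rewrite divr_gt0) : 0 < d / C).
 exists (maxn N j.+1) => n; rewrite geq_max => /andP[/hN h1 jn].
 have [_ _ h2 h3] := ha n; have {}h3 := h3 j jn; apply: le_lt_trans (est n (e j)) _.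
 have h4 : C * n.+1%:R^-1 < d by rewrite mulrC -ltr_pdivlMr.
 move: h2 h3 h4; move: (n.+1%:R^-1) => q h2 h3; rewrite /C.
 have := ler_wpM2l (nrm_ge0 (e j)) (ltW h2); lra.
have [|_ [j _ <-]|l hl cl] := @scv_exists _ _ _ (fun n => (mf n).2) 1 (range e) _ de.
- by move=> n; have [] := cayley_bnd (hmf n).
- by exists (k (e j)); exact: cv.
suff -> : k = l by [].
by apply/esym/(bop_eq_dns de) => _ [j _ <-]; exact: (conv_uniq (cl (e j)) (cv j)).
Qed.

(** A need not be norm dense. P and Q are compared along the bounded sequences of [rk_approx], whose
    terms are algebraic expressions in elements of A; rank one operators then determine both. *)
Lemma rep_unique (L : rhilb R) (P Q : bop K K -> bop L L) : repn (CB I) P -> repn (CB I) Q ->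
 (forall a, A a -> P a = Q a) -> forall x, CB I x -> P x = Q x.
Proof.
move=> rP rQ hA; have vM := vnCB sI.
have h1 v : ip v v = 1 -> P (rk sI II v v) = Q (rk sI II v v).
 move=> v1; have [a [m [f [Aa cf sf]]]] := rk_approx v1.
 have cP n := cayley_rep vM rP (ia_CB iA (Aa n)) (cf n).
 have cQ n := cayley_rep vM rQ (ia_CB iA (Aa n)) (cf n).
 have e1 n : P (f n) = Q (f n).
  by apply: (cayley_uniq (cP n).2); rewrite (hA _ (Aa n)); exact: (cQ n).2.
 have Mf n : CB I (f n) := (cP n).1.
 have bP n : bnd (P (f n)) 1 := (cayley_bnd (cP n).2).2.
 have bQ n : bnd (Q (f n)) 1 := (cayley_bnd (cQ n).2).2.
 have sP := rp_scv vM rP de Mf (rkCB sI II v v) bP sf.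
 have sQ := rp_scv vM rQ de Mf (rkCB sI II v v) bQ sf.
 suff h : scv (fun n => P (f n)) (Q (rk sI II v v)) by exact: (scv_uniq sP h).
 by move=> u d d0; have [N hN] := sQ u d d0; exists N => n /hN; rewrite e1.
have h2 v : P (rk sI II v v) = Q (rk sI II v v).
 have [v0|v0] := eqVneq (ip v v) 0.
  have -> : rk sI II v v = 0.
   by apply: bopP => w; rewrite rkE (ip_eq0 v0) b0 !scaler0 addr0 bop0E.
  by rewrite (rp0 vM rP) (rp0 vM rQ).
 have n0 : nrm v != 0 by apply: contra v0 => /eqP /nrm_eq0 ->; rewrite ip0l.
 pose u := (nrm v)^-1 *: v.
 have u1 : ip u u = 1 by rewrite /u !ipE -nrm2 expr2; field.
 have -> : rk sI II v v = (nrm v ^+ 2) *: rk sI II u u.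
  apply: bopP => w; rewrite bopZE !rkE /u !bZ !ipZr !scalerA scalerDr !scalerA.
  by congr (_ *: _ + _ *: _); field.
 by rewrite (rpZ vM rP) ?(rpZ vM rQ) ?h1//; exact: rkCB.
have CI : CB I I by [].
have h3 u v : P (rk sI II u v) = Q (rk sI II u v).
 have c1 u v := rkCB sI II u v.
 have hB X Y : CB I X -> CB I Y -> P X = Q X -> P Y = Q Y -> P (X - Y) = Q (X - Y).
  by move=> hX hY eX eY; rewrite (rpB rP hX hY) (rpB rQ hX hY) eX eY.
 have hL X Y : CB I X -> CB I Y -> P X = Q X -> P Y = Q Y -> P (4^-1 *: (X + I ** Y)) = Q (4^-1 *: (X + I ** Y)).
  move=> hX hY eX eY; have hI := vnM vM CI hY; have hs := vnD vM hX hI.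
  rewrite (rpZ vM rP _ hs) (rpZ vM rQ _ hs) (rpD rP hX hI) (rpD rQ hX hI).
  by rewrite (rp_mul rP CI hY) (rp_mul rQ CI hY) eX eY (hA _ (ia_I iA)).
 by rewrite rk_polar; apply: hL; try apply: hB; try apply: (vnB vM).
move=> x hx; apply: subr0_eq; set D := P x - Q x.
suff : D^# = 0 by move=> /(congr1 (@badj _ _ _)); rewrite badjK badj0.
apply: bopP => u; rewrite bop0E; apply: (rk_total (sI := sI) (II := II) de rP) => v.
have c := rkCB sI II v v.
have : D ** P (rk sI II v v) = 0.
 by rewrite /D bcBl -(rp_mul rP)// h2 -(rp_mul rQ)// rk_l// h3 subrr.
move=> /(congr1 (@badj _ _ _)); rewrite badjM badj0 -(rp_adj rP c) rk_adj.
by move=> /(bop_at u); rewrite bop0E.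
Qed.

End Density.

(** The sets E where sequence i varies by at most 1/(k + 1) from index N on are closed, and every t
    lies in one of them for each i and k. Baire's theorem gives a positive t0 that is interior to
    every E containing it. *)
Lemma baire_cts (R : realType) (f : nat -> nat -> R -> R) (F : nat -> R -> R) :
 (forall i n, continuous (f i n)) ->
 (forall i t (d : R), 0 < d -> exists N : nat, forall n, (N <= n)%N -> `|f i n t - F i t| < d) ->
 exists2 t0 : R, 0 < t0 & forall i, F i @ t0 --> F i t0.
Proof.
move=> cf hf.
pose E (p : nat * nat * nat) : set R := \bigcap_(m in [set m | (p.2 <= m)%N]) \bigcap_(n in [set n | (p.2 <= n)%N])
 ((fun t => `|f p.1.1 m t - f p.1.1 n t|) @^-1` [set x | x <= p.1.2.+1%:R^-1]).
have cE p : closed (E p).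
 apply: closed_bigI => m _; apply: closed_bigI => n _; apply: closed_comp; last exact: closed_le.
 by move=> x _; apply: cvg_norm; apply: cvgB; exact: cf.
pose G j : set R := if unpickle j is Some p then ~` E p `|` (E p)^° else setT.
have hd : dense (\bigcap_j G j).
 apply: Baire => j; rewrite /G; case: (unpickle j) => [p|]; last first.
  by split; [exact: openT|move=> O [x Ox] _; exists x].
 split; first by apply: openU; [exact: closed_openC|exact: open_interior].
 move=> O O0 oO; have [h|/existsNP[x]] := pselect (O `<=` E p).
  by have [x Ox] := O0; exists x; split=> //; right; rewrite (open_subsetE _ oO) in h; exact: h.
 by move=> /not_implyP[Ox h]; exists x; split=> //; left.
have [t0 [/= t00 ht0]] := hd [set t | 0 < t] (ex_intro _ 1 ltr01) (@open_gt R 0).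
exists t0 => // i; apply/cvgrPdist_lt => d d0.
have [k hk] := inv_small (ltac:(by rewrite divr_gt0) : 0 < d / 3).
have {hk} := hk k (leqnn k) => hk.
have q0 : 0 < k.+1%:R^-1 :> R by rewrite invr_gt0.
have [N hN] := hf i t0 (k.+1%:R^-1 / 2) ltac:(by rewrite divr_gt0).
have Et0 : E (i, k, N) t0.
 move=> m /= hm n /= hn; have h1 := hN m hm; have h2 := hN n hn.
 have := ler_distD (F i t0) (f i m t0) (f i n t0); rewrite (distrC (F i t0)).
 by move: h1 h2; move: (k.+1%:R^-1) => q; lra.
have : G (pickle (i, k, N)) t0 by exact: ht0.
rewrite /G pickleK => -[//|hint].
have key t : E (i, k, N) t -> `|f i N t - F i t| <= k.+1%:R^-1.
 move=> hE; apply: eps_le => r r0; have [N' hN'] := hf i t r r0.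
 have := hE N (leqnn N) (maxn N N') (leq_maxl _ _); rewrite /= => h1.
 have := hN' (maxn N N') (leq_maxr _ _) => h2.
 have := ler_distD (f i (maxn N N') t) (f i N t) (F i t); move: h1 h2; move: (k.+1%:R^-1) => q; lra.
have c0 : \forall t \near t0, `|f i N t0 - f i N t| < k.+1%:R^-1.
 by move/cvgrPdist_lt : (cf i N t0) => /(_ _ q0).
near=> t.
have h1 := key _ Et0; have h2 : `|f i N t - F i t| <= k.+1%:R^-1 by apply: key; near: t; exact: hint.
have h3 : `|f i N t0 - f i N t| < k.+1%:R^-1 by near: t.
have := ler_distD (f i N t0) (F i t0) (F i t); have := ler_distD (f i N t) (f i N t0) (F i t).
rewrite (distrC (F i t0) (f i N t0)); move: h1 h2 h3 hk; move: (k.+1%:R^-1) => q; lra.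
Unshelve. all: by end_near. Qed.

Lemma rp_bnd (R : realType) (H K : rhilb R) (M : bop H H -> Prop) (P : bop H H -> bop K K) a C :
 vnalg M -> repn M P -> M a -> bnd a C -> bnd (P a) C.
Proof.
move=> vM rP Ma [C0 hC]; split=> // k.
have [z|z] := eqVneq C 0.
 have -> : a = 0.
  apply: bopP => u; rewrite bop0E; apply: nrm_eq0; apply/eqP; rewrite eq_le nrm_ge0 andbT.
  by have := hC u; rewrite z mul0r.
 by rewrite (rp0 vM rP) bop0E nrm0 mulr_ge0// nrm_ge0.
have Cp : 0 < C by rewrite lt0r z.
pose b := (C ^- 2) *: (a^# ** a).
have c2 : 0 < C ^- 2 by rewrite invr_gt0 exprn_gt0.
have Mb : M b by apply: (vnZ vM); apply: (vnM vM) => //; exact: (vn_adj vM).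
have b1 : ble1 b.
 split; first by apply: bposZ; [exact: ltW|exact: bpos_adjl].
 move=> u; rewrite /b bopZE ipZl /= -badjEr ler_pdivrMl ?exprn_gt0// -!nrm2 -exprMn.
 by rewrite lerXn2r ?nnegrE ?mulr_ge0 ?nrm_ge0// ltW.
have := rp_ge0 vM rP k (vnB vM (vn1 vM) Mb) (ble1_compl b1).
rewrite (rpB rP (vn1 vM) Mb) (rp_1 rP) bopBE ipDl ipNl /b (rpZ vM rP); last by apply: (vnM vM) => //; exact: (vn_adj vM).
rewrite (rp_mul rP) ?(rp_adj rP)//; last exact: (vn_adj vM).
rewrite bopZE ipZl /= -badjEr subr_ge0 ler_pdivrMl ?exprn_gt0// -!nrm2 -exprMn => h.
by apply: sq_le => //; rewrite mulr_ge0// nrm_ge0.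
Qed.

Section Continuity.
Context {R : realType} {K : rhilb R}.
Variables (I : bop K K) (A : bop K K -> Prop) (e : nat -> K) (al : R -> bop K K -> bop K K).
Hypotheses (sI : I^# = - I) (II : I ** I = - bid) (de : dns (range e)) (iA : irred_alg I A).
Hypothesis ha : forall t, 0 <= t -> repn (CB I) (al t).
Hypothesis hCB : forall t x, 0 <= t -> CB I x -> CB I (al t x).
Hypothesis hs : forall s t x, 0 <= s -> 0 <= t -> CB I x -> al s (al t x) = al (s + t) x.

Definition ctat (f : R -> K) t := forall d : R, 0 < d -> exists2 r : R, 0 < r &
 forall s, 0 <= s -> `|s - t| < r -> nrm (f s - f t) < d.

Hypothesis hA : forall a w t, A a -> 0 <= t -> ctat (fun t => al t a w) t.

Let vC := vnCB sI.
Let k2 u v := rk sI II u v.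
Let c2 u v : CB I (k2 u v) := rkCB sI II u v.

Lemma ctat_le (f g : R -> K) t (C : R) : 0 <= C -> ctat g t ->
 (forall s, 0 <= s -> nrm (f s - f t) <= C * nrm (g s - g t)) -> ctat f t.
Proof.
move=> C0 hg hfg d d0; have C1 : 0 < C + 1 by lra.
have [r r0 hr] := hg (d / (C + 1)) ltac:(by rewrite divr_gt0); exists r => // s s0 /hr => /(_ s0) h.
apply: le_lt_trans (hfg s s0) _; apply: le_lt_trans (_ : (C + 1) * nrm (g s - g t) < _).
 by rewrite ler_wpM2r ?nrm_ge0//; lra.
by rewrite mulrC -ltr_pdivlMr.
Qed.

Lemma ctatD (f g : R -> K) t : ctat f t -> ctat g t -> ctat (fun s => f s + g s) t.
Proof.
move=> hf hg d d0; have d2 : 0 < d / 2 by rewrite divr_gt0.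
have [r r0 hr] := hf _ d2; have [q q0 hq] := hg _ d2.
exists (Num.min r q); first by rewrite lt_min r0.
move=> s s0; rewrite lt_min => /andP[/(hr s s0) h1 /(hq s s0) h2].
rewrite opprD addrACA; apply: le_lt_trans (nrmD _ _) _; lra.
Qed.

Lemma ctatB (f g : R -> K) t : ctat f t -> ctat g t -> ctat (fun s => f s - g s) t.
Proof.
move=> hf hg; apply: ctatD => //; apply: (ctat_le ler01 hg) => s s0.
by rewrite mul1r -opprD nrmN.
Qed.

Lemma ctat_mul (F B : R -> bop K K) (C t : R) w : 0 <= t -> (forall s, 0 <= s -> bnd (F s) C) ->
 (forall u, ctat (fun s => F s u) t) -> ctat (fun s => B s w) t -> ctat (fun s => F s (B s w)) t.
Proof.
move=> t0 bA cA cB.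
have -> : (fun s => F s (B s w)) = (fun s => F s (B s w - B t w) + F s (B t w)).
 by apply/funext => s; rewrite bB subrK.
apply: ctatD; last exact: cA.
apply: (ctat_le (bA t t0).1 cB) => s s0; rewrite subrr b0 subr0; exact: (bA s s0).2.
Qed.

Let ctx x t := forall w, ctat (fun s => al s x w) t.

Let albnd x C t : 0 <= t -> CB I x -> bnd x C -> bnd (al t x) C.
Proof. by move=> t0 hx; apply: (rp_bnd vC (ha t0)). Qed.

Let ctx_ext (f : R -> K) (g : R -> K) t : 0 <= t -> (forall s, 0 <= s -> f s = g s) -> ctat f t -> ctat g t.
Proof. by move=> t0 h hf; apply: (ctat_le ler01 hf) => s s0; rewrite mul1r !h. Qed.

Let ctxM x y t : 0 <= t -> CB I x -> CB I y -> ctx x t -> ctx y t -> ctx (x ** y) t.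
Proof.
move=> t0 hx hy cx cy w; have [C bC] := bop_bnd x.
apply: (@ctx_ext (fun s => al s x (al s y w))) => // [s s0|]; first by rewrite (rp_mul (ha s0)).
exact: (ctat_mul (B := fun s => al s y) t0 (fun s s0 => albnd s0 hx bC) cx (cy w)).
Qed.

Let ctxlin c x y t : 0 <= t -> CB I x -> CB I y -> ctx x t -> ctx y t -> ctx (c *: x + y) t.
Proof.
move=> t0 hx hy cx cy w; apply: (@ctx_ext (fun s => c *: al s x w + al s y w)) => // [s s0|].
 by rewrite (rp_lin (ha s0))// bopDE bopZE.
apply: ctatD => //; apply: (ctat_le (normr_ge0 c) (cx w)) => s s0.
by rewrite -scalerBr nrmZ.
Qed.

Let ctx_cayley a m f t : 0 <= t -> A a -> cayley a m f -> ctx f t.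
Proof.
move=> t0 Aa cf w d d0.
have cy s (s0 : 0 <= s) := (cayley_rep vC (ha s0) (ia_CB iA Aa) cf).2.
have [r r0 hr] := hA (al t m w) Aa t0 (d := d / 4) ltac:(by rewrite divr_gt0).
have [q q0 hq] := hA (al t f w) Aa t0 (d := d / 4) ltac:(by rewrite divr_gt0).
exists (Num.min r q); first by rewrite lt_min r0.
move=> s s0; rewrite lt_min => /andP[/(hr s s0) h1 /(hq s s0) h2].
apply: le_lt_trans (cayley_diff w (cy s s0) (cy t t0)) _; rewrite !bopBE; lra.
Qed.

(** Arguments over all times are reduced to nonnegative ones by [`|s|]. *)
Let N (k : bop K K) u (s : R) := nrm (al `|s| k u).

(** The images of k are projections, so <al_s(k) u, u> = |al_s(k) u|^2. Weak continuity on the e i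
    extends to all u because these norms are 1-Lipschitz in u, and polarisation makes it strong. *)
Let proj_cts k (t0 : R) : 0 < t0 -> CB I k -> bsa k -> k ** k = k ->
 (forall i, (fun s => ip (al `|s| k (e i)) (e i)) @ t0 --> ip (al `|t0| k (e i)) (e i)) -> ctx k t0.
Proof.
move=> t00 hk sk kk hc.
have qN s u : ip (al `|s| k u) u = N k u s ^+ 2.
 have s0 := normr_ge0 s; rewrite /N nrm2 [RHS]badjE -(rp_adj (ha s0) hk) sk.
 by rewrite -[al _ k (al _ _ _)]/((al `|s| k ** al `|s| k) u) -(rp_mul (ha s0) hk hk) kk ipC.
have b1 : bnd k 1.
 split=> // u; rewrite mul1r; apply: sq_le; rewrite ?nrm_ge0// !nrm2.
 have e1 : ip (k u) (k u) = ip (k u) u by rewrite badjE sk -[k (k u)]/((k ** k) u) kk ipC.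
 by have := ip_ge0 (u - k u); rewrite !ipE (ipC u (k u)) e1; lra.
have Nc u : N k u @ t0 --> N k u t0.
 apply/cvgrPdist_lt => d d0; have d4 : 0 < d / 4 by rewrite divr_gt0.
 have [_ [i _ <-] hi] := de u d4.
 have near1 s : `|N k u s - N k (e i) s| < d / 4.
  apply: le_lt_trans hi; have := (albnd (normr_ge0 s) hk b1).2 (u - e i); rewrite mul1r bB => h.
  have h1 := nrmD (al `|s| k u - al `|s| k (e i)) (al `|s| k (e i)); rewrite subrK in h1.
  have h2 := nrmD (al `|s| k (e i) - al `|s| k u) (al `|s| k u); rewrite subrK nrmB in h2.
  by rewrite /N ler_norml; apply/andP; split; lra.
 have d16 : 0 < (d / 4) ^+ 2 by rewrite exprn_gt0.
 move/cvgrPdist_lt : (hc i) => /(_ _ d16); apply: filterS => s; rewrite !qN => h.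
 have h3 : `|N k (e i) t0 - N k (e i) s| < d / 4.
  rewrite -(ltr_pXn2r (n := 2)) ?nnegrE// ?(ltW d4)//; apply: le_lt_trans h.
  rewrite subr_sqr normrM expr2 ler_wpM2l//.
  have n1 := nrm_ge0 (al `|t0| k (e i)); have n2 := nrm_ge0 (al `|s| k (e i)).
  by rewrite (ger0_norm (addr_ge0 n1 n2)) ler_norml /N; apply/andP; split; lra.
 have := near1 s; have := near1 t0.
 have := ler_distD (N k (e i) t0) (N k u t0) (N k u s); have := ler_distD (N k (e i) s) (N k (e i) t0) (N k u s).
 by rewrite (distrC (N k (e i) s) (N k u s)); lra.
move=> u d d0; set w := al t0 k u; have at0 : `|t0| = t0 by rewrite ger0_norm// ltW.
(* The squared distance of al_s(k) u and w, with the mixed term polarised into norms N that are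
   continuous at t0. *)
pose Phi s := N k u s ^+ 2 + N k u t0 ^+ 2 - 2^-1 * (N k (u + w) s ^+ 2 - N k (u - w) s ^+ 2).
have PhiE s : 0 <= s -> nrm (al s k u - w) ^+ 2 = Phi s.
 move=> s0; have as0 : `|s| = s by rewrite ger0_norm.
 have sa (v v' : K) : ip (al s k v) v' = ip (al s k v') v by rewrite badjE -(rp_adj (ha s0) hk) sk ipC.
 rewrite /Phi {2}/N at0 -/w -!qN as0 !nrm2 !bD !bN !ipE (sa w u) (ipC w (al s k u)).
 by have := qN s u; rewrite as0 /N nrm2 as0 => ->; lra.
have P0 : Phi t0 = 0 by rewrite -PhiE ?ltW// /w subrr nrm0 expr0n.
have Pc : Phi @ t0 --> Phi t0.
 have sq v : (fun s => N k v s ^+ 2) @ t0 --> N k v t0 ^+ 2.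
  by under eq_fun do rewrite expr2; rewrite expr2; apply: cvgM; exact: Nc.
 by apply: cvgB; [apply: cvgD; [exact: sq|exact: cvg_cst]|apply: cvgM; [exact: cvg_cst|apply: cvgB; exact: sq]].
have d2 : 0 < d ^+ 2 by rewrite exprn_gt0.
move/cvgrPdist_lt : Pc => /(_ _ d2); rewrite P0 => /nbhs_ballP[r r0 hr]; exists r => // s s0 sr.
have := hr s; rewrite /ball /= distrC => /(_ sr); rewrite sub0r normrN -PhiE// => h.
rewrite -(ltr_pXn2r (n := 2)) ?nnegrE ?nrm_ge0// ?ltW//; apply: le_lt_trans h; exact: ler_norm.
Qed.

(** Each rk (e j) (e j) is a multiple of a projection that is a strong limit of Cayley transforms of
    elements of A, whose orbits are continuous. [baire_cts] treats the countably many diagonal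
    coefficients at once. *)
Let cts_point : exists2 t0 : R, 0 < t0 & forall j, ctx (k2 (e j) (e j)) t0.
Proof.
have /choice[D hD] : forall j, exists D : R * bop K K * (nat -> bop K K), [/\ CB I D.1.2, bsa D.1.2, D.1.2 ** D.1.2 = D.1.2,
  k2 (e j) (e j) = D.1.1 *: D.1.2 & (forall n, exists a m, A a /\ cayley a m (D.2 n)) /\ scv D.2 D.1.2].
 move=> j; have [v0|v0] := eqVneq (ip (e j) (e j)) 0.
  have z : CB I 0 := vn0 vC.
  exists (0, 0, fun=> 0); split=> //=; rewrite ?bc0l//.
  - by rewrite /bsa badj0.
  - by rewrite scaler0; apply: bopP => w; rewrite rkE (ip_eq0 v0) b0 !scaler0 addr0 bop0E.
  split=> [n|u]; last by rewrite bop0E; exact: conv_cst.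
  exists 0, bid; split; first exact: (ia_0 iA).
  by split; rewrite ?bc0l ?add0r ?bc1l ?scaler0// /bsa badj0.
 have n0 : nrm (e j) != 0 by apply: contra v0 => /eqP /nrm_eq0 ->; rewrite ip0l.
 pose u := (nrm (e j))^-1 *: e j.
 have u1 : ip u u = 1 by rewrite /u !ipE -nrm2 expr2; field.
 have [a [m [f [Aa cf sf]]]] := rk_approx sI II de iA u1.
 exists (nrm (e j) ^+ 2, k2 u u, f); split=> //=.
 - exact: rk_adj.
 - exact: rk_proj.
 - apply: bopP => w; rewrite bopZE !rkE /u !bZ !ipZr !scalerA scalerDr !scalerA.
  by congr (_ *: _ + _ *: _); field.
 - by split=> // n; exists (a n), (m n).
pose f i n (t : R) : R := if unpickle i is Some (j, m) then ip (al `|t| ((D j).2 n) (e m)) (e m) else 0.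
pose F i (t : R) : R := if unpickle i is Some (j, m) then ip (al `|t| (D j).1.2 (e m)) (e m) else 0.
have [i n t|i t d d0|t0 t00 h] := @baire_cts R f F.
- rewrite /f; case: (unpickle i) => [[j m]|]; last exact: cvg_cst.
 have [_ _ _ _ [hc _]] := hD j; have [a [b [Aa cf]]] := hc n.
 apply/cvgrPdist_lt => d d0; have n0 : 0 < nrm (e m) + 1 by rewrite ltr_wpDl// nrm_ge0.
 have [r r0 hr] := ctx_cayley (normr_ge0 t) Aa cf (e m) (d := d / (nrm (e m) + 1)) ltac:(by rewrite divr_gt0).
 apply/nbhs_ballP; exists r => // s /= ts.
 have := hr `|s| (normr_ge0 s) (le_lt_trans (ler_dist_dist _ _) (eq_ind_r (fun x => x < r) ts (distrC _ _))).
 rewrite -ipNl -ipDl ltr_pdivlMr// => h; apply: le_lt_trans (CSabs _ _) _; rewrite nrmB.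
 by apply: le_lt_trans h; rewrite ler_wpM2l ?nrm_ge0// lerDl.
- rewrite /f /F; case: (unpickle i) => [[j m]|]; last by exists 0%N => n _; rewrite subrr normr0.
 have [hk _ _ _ [hc sc]] := hD j; have s0 := normr_ge0 t.
 have cb n : CB I ((D j).2 n) /\ bnd (al `|t| ((D j).2 n)) 1.
  have [a [b [Aa cf]]] := hc n; have [Mf cf'] := cayley_rep vC (ha s0) (ia_CB iA Aa) cf.
  by split=> //; exact: (cayley_bnd cf').2.
 exact: conv_ip (rp_scv vC (ha s0) de (fun n => (cb n).1) hk (fun n => (cb n).2) sc (e m)) d0.
exists t0 => // j; have [hk sk kk kE _] := hD j; rewrite kE.
have hp : ctx (D j).1.2 t0.
 by apply: proj_cts => // i; have := h (pickle (j, i)); rewrite /F pickleK.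
have := ctxlin (D j).1.1 (ltW t00) hk (vn0 vC) hp; rewrite addr0; apply.
move=> w; apply: (@ctx_ext (fun=> 0)) => [|s s0|]; first exact: ltW.
 by rewrite (rp0 vC (ha s0)) bop0E.
by move=> d d0; exists 1 => // s _ _; rewrite subrr nrm0.
Qed.

Let ctx_closed x t : 0 <= t -> CB I x -> (forall d : R, 0 < d -> exists y, [/\ CB I y, ctx y t & bnd (x - y) d]) -> ctx x t.
Proof.
move=> t0 hx h w d d0; have n0 : 0 < 4 * (nrm w + 1) by have := nrm_ge0 w; lra.
have [y [hy cy bxy]] := h (d / (4 * (nrm w + 1))) ltac:(by rewrite divr_gt0).
have [r r0 hr] := cy w (d / 2) ltac:(by rewrite divr_gt0).
exists r => // s s0 /(hr s s0) h1.
have est u : 0 <= u -> nrm (al u x w - al u y w) <= d / 4.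
 move=> u0; rewrite -bopBE -(rpB (ha u0) hx hy).
 apply: le_trans ((albnd u0 (vnB vC hx hy) bxy).2 w) _.
 by rewrite mulrAC ler_pdivrMr//; have := mulr_ge0 (ltW d0) (nrm_ge0 w); lra.
have := est s s0; have := est t t0.
have := nrm_distD (al s x w) (al t x w) (al s y w); have := nrm_distD (al s y w) (al t x w) (al t y w).
by rewrite (nrmB (al t y w) (al t x w)); lra.
Qed.

Let ctx_rk t0 : 0 < t0 -> (forall j, ctx (k2 (e j) (e j)) t0) -> forall u v, ctx (k2 u v) t0.
Proof.
move=> t00 he; have t01 := ltW t00.
have h1 v : ctx (k2 v v) t0.
 apply: ctx_closed => // d d0; have n0 : 0 < 4 * (nrm v + 1) by have := nrm_ge0 v; lra.
 have [_ [j _ <-] hj] := de v (ltac:(by rewrite lt_min ltr01 divr_gt0) : 0 < Num.min 1 (d / (4 * (nrm v + 1)))).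
 move: hj; rewrite lt_min => /andP[j1 j2].
 exists (k2 (e j) (e j)); split=> //.
 have -> : k2 v v - k2 (e j) (e j) = k2 (v - e j) v + k2 (e j) (v - e j).
  by apply: bopP => w; rewrite bopBE bopDE !rkE !bB; vring.
 apply: bnd_le (bnd_add (bnd_rk sI II _ _) (bnd_rk sI II _ _)).
 have h := nrmD (e j - v) v; rewrite subrK (nrmB (e j)) in h.
 rewrite ltr_pdivlMr// in j2; have := nrm_ge0 v; have := nrm_ge0 (e j); have := nrm_ge0 (v - e j) => a b c.
 have := ler_wpM2r a h; have := ler_wpM2r a (ltW j1); lra.
have CI : CB I I by [].
have cI : ctx I t0 by move=> w; apply: hA => //; exact: (ia_I iA).
have B x y : CB I x -> CB I y -> ctx x t0 -> ctx y t0 -> ctx (x - y) t0.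
 by move=> hx hy cx cy; rewrite addrC -scaleN1r; exact: ctxlin.
move=> u v; rewrite /k2 rk_polar -[_ *: _]addr0; apply: ctxlin => //; first 1 last.
- exact: (vn0 vC).
- rewrite -[X in X + _]scale1r; apply: ctxlin => //.
 + exact: (vnB vC).
 + by apply: (vnM vC) => //; exact: (vnB vC).
 + exact: B.
 + by apply: ctxM => //; [exact: (vnB vC)|exact: B].
- by move=> w; apply: hA => //; exact: (ia_0 iA).
- by apply: (vnD vC); [exact: (vnB vC)|apply: (vnM vC) => //; exact: (vnB vC)].
Qed.

(** The vectors at which the orbit of x is continuous include the ranges of the al_t0 (rk v v),
    since x rk v v = rk (x v) v has a continuous orbit; these ranges are total. *)
Let ctx_all t0 x : 0 < t0 -> (forall u v, ctx (k2 u v) t0) -> CB I x -> ctx x t0.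
Proof.
move=> t00 hk hx; have t01 := ltW t00; have [C bC] := bop_bnd x.
pose D : set K := [set w | ctat (fun s => al s x w) t0].
have dD : dns D.
 apply: dns_of_orth => [|u hu].
  split=> [|c u v hu hv].
   by apply: (@ctx_ext (fun=> 0)) => // [s s0|d d0]; [rewrite b0|exists 1 => // s _ _; rewrite subrr nrm0].
  apply: (@ctx_ext (fun s => c *: al s x u + al s x v)) => // [s s0|]; first by rewrite bop_lin.
  by apply: ctatD => //; apply: (ctat_le (normr_ge0 c) hu) => s s0; rewrite -scalerBr nrmZ.
 apply: (rk_total (sI := sI) (II := II) de (ha t01)) => v; apply: ip_inj => w; rewrite ip0l badjE.
 rewrite -(rp_adj (ha t01) (c2 v v)) rk_adj; apply: hu.
 have c1 := hk (x v) v w.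
 apply: (@ctx_ext (fun s => al s (k2 (x v) v) w - al s x (al s (k2 v v) w - al t0 (k2 v v) w))) => // [s s0|].
  by rewrite /k2 -(rk_l sI II _ _ hx) (rp_mul (ha s0) hx (c2 v v)) /= -bB opprB addrC subrK.
 apply: ctatB => //.
 have c3 : ctat (fun s => al s (k2 v v) w - al t0 (k2 v v) w) t0.
  by apply: (ctat_le ler01 (hk v v w)) => s s0; rewrite mul1r subrr subr0.
 apply: (ctat_le bC.1 c3) => s s0; rewrite subrr b0 !subr0.
 exact: (albnd s0 hx bC).2.
move=> w d d0; have C1 : 0 < 4 * (C + 1) by have := bC.1; lra.
have [w' Dw' hw'] := dD w (d / (4 * (C + 1))) ltac:(by rewrite divr_gt0).
have [r r0 hr] := Dw' (d / 2) ltac:(by rewrite divr_gt0).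
exists r => // s s0 /(hr s s0) h1.
have est u : 0 <= u -> nrm (al u x w - al u x w') <= d / 4.
 move=> u0; rewrite -bB; apply: le_trans ((albnd u0 hx bC).2 _) _.
 have := ltW hw'; rewrite ler_pdivlMr// => h.
 by have := nrm_ge0 (w - w'); lra.
have := est s s0; have := est t0 t01.
have := nrm_distD (al s x w) (al t0 x w) (al s x w'); have := nrm_distD (al s x w') (al t0 x w) (al t0 x w').
by rewrite (nrmB (al t0 x w') (al t0 x w)); lra.
Qed.

(** By Baire's theorem the orbits of countably many rank one projections have a
  common point of continuity. *)
Theorem semigroup_continuous x w t : CB I x -> 0 <= t -> ctat (fun t => al t x w) t.
Proof.
move=> hx t_ge; have [t0 t00 he] := cts_point.
have t01 := ltW t00; have [C bC] := bop_bnd x.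
have c0 : ctx x t0 by apply: ctx_all => //; exact: ctx_rk.
(* For t >= t0, al_s near t is al_(t - t0) after al_q with q near t0, and the normal map al_(t - t0)
   preserves bounded strong convergence. *)
have [tt|tt] := leP t0 t.
 apply: contrapT => /existsNP[d /not_implyP[d0 /forall2NP hn]].
 have /choice[s hs'] : forall n : nat, exists s, [/\ 0 <= s, `|s - t| < Num.min t0 n.+1%:R^-1 & d <= nrm (al s x w - al t x w)].
  move=> n; have m0 : 0 < Num.min t0 n.+1%:R^-1 by rewrite lt_min t00 invr_gt0 ltr0n.
  have [//|/existsNP[s /not_implyP[s0 /not_implyP[h1 h2]]]] := hn (Num.min t0 n.+1%:R^-1).
  by exists s; split=> //; rewrite leNgt; exact/negP.
 have r0 : 0 <= t - t0 by lra.
 pose q n := s n - (t - t0).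
 have q0 n : 0 <= q n.
  by have [_ + _] := hs' n; rewrite lt_min => /andP[+ _]; rewrite ltr_norml /q => /andP[]; lra.
 have sv : scv (fun n => al (q n) x) (al t0 x).
  move=> u r rp; have [p p0 hp] := c0 u r rp; have [m hm] := inv_small p0.
  exists m => n /hm hn'; apply: hp => //.
  have [_ + _] := hs' n; rewrite lt_min => /andP[_ h]; apply: lt_trans hn'.
  by rewrite /q (_ : _ - _ = s n - t)//; lra.
 have Mq n : CB I (al (q n) x) by exact: hCB.
 have bq n : bnd (al (t - t0) (al (q n) x)) C by apply: albnd => //; exact: albnd.
 have := rp_scv vC (ha r0) de Mq (hCB t01 hx) bq sv w d0.
 move=> [m /(_ m (leqnn m))]; rewrite !hs// /q !subrK (_ : t - t0 + (s m - (t - t0)) = s m); last by lra.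
 by have [_ _ h] := hs' m; rewrite ltNge h.
have r0 : 0 <= t0 - t by lra.
(* For t < t0, a nonzero intertwiner T of al_(t0 - t) satisfies al_(u + t0 - t)(x) T = T al_u(x). By
   irreducibility T^# T is a positive scalar, so continuity at t0 is pulled back to t. *)
have [[T hT [z hz]]|hno] := pselect (exists2 T, intertw (CB I) (al (t0 - t)) T & exists z, T z != 0); last first.
 have K0 (k : K) : k = 0.
  apply: (intertw_total vC (ha r0) de) => T hT; apply: ip_inj => u; rewrite ip0l -badjEr.
  have [->|h] := eqVneq (T u) 0; first by rewrite ip0r.
  by exfalso; apply: hno; exists T => //; exists u.
 by move=> d d0; exists 1 => // s _ _; rewrite (K0 (_ - _)) nrm0.
have [a [b TT]] : exists a b : R, T^# ** T = a *: bid + b *: I.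
 apply: (ia_irr iA) => y /(ia_CB iA) hy; have := hT _ hy.
 have := congr1 (@badj _ _ _) (hT _ (vn_adj vC hy)); rewrite !badjM badjK (rp_adj (ha r0) hy) badjK => e1 e2.
 by rewrite -bcA -e2 bcA e1 bcA.
have nT u : nrm (T u) ^+ 2 = a * nrm u ^+ 2.
 rewrite !nrm2 badjE -[T^# (T u)]/((T^# ** T) u) TT bopDE !bopZE !ipE /=.
 by rewrite (ipI0 sI) mulr0 addr0.
have a0 : 0 < a.
 have h : 0 < nrm (T z) ^+ 2.
  by rewrite exprn_gt0// lt0r nrm_ge0 andbT; apply: contra hz => /eqP /nrm_eq0 ->.
 have := sqr_ge0 (nrm z); rewrite nT in h => h'.
 by rewrite ltNge; apply/negP => h2; move: h; rewrite ltNge mulr_le0_ge0.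
have sh : ctat (fun s => al (s + (t0 - t)) x (T w)) t.
 move=> d d0; have [r rp hr] := c0 (T w) d d0; exists r => // s s0 h.
 rewrite (_ : t + (t0 - t) = t0); last by lra.
 by apply: hr; [lra|rewrite (_ : _ - t0 = s - t)//; lra].
apply: (ctat_le (C := (Num.sqrt a)^-1) _ sh) => [|s s0]; first by rewrite invr_ge0 sqrtr_ge0.
have e1 u : 0 <= u -> al (u + (t0 - t)) x (T w) = T (al u x w).
 move=> u0; rewrite addrC -hs//.
 exact: (bop_at w (hT _ (hCB u0 hx))).
rewrite !e1// -bB ler_pdivlMl ?sqrtr_gt0//; apply: sq_le; first exact: nrm_ge0.
by rewrite nT exprMn sqr_sqrtr// ltW.
Qed.

End Continuity.

Local Open Scope complex_scope.

(** * Complex Hilbert spaces, weights and GNS representations *)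

Section Realify.
Context {R : realType}.

(** An alias of the carrier, so that the real scalar multiplication does not clash with the complex
    one. *)
Definition rl (H : hilbert R) : Type := hcarrier H.
HB.instance Definition _ (H : hilbert R) := GRing.Zmodule.on (rl H).

Section Scale.
Variable H : hilbert R.
Definition rscale (c : R) (v : rl H) : rl H := c%:C *: (v : H).
Fact rscaleA a b v : rscale a (rscale b v) = rscale (a * b) v.
Proof. by rewrite /rscale scalerA -rmorphM. Qed.
Fact rscale1 : left_id 1 rscale.
Proof. by move=> v; rewrite /rscale scale1r. Qed.
Fact rscaleDr : right_distributive rscale +%R.
Proof. by move=> c u v; rewrite /rscale scalerDr. Qed.
Fact rscaleDl v : {morph rscale^~ v : a b / a + b}.
Proof. by move=> a b; rewrite /rscale rmorphD scalerDl. Qed.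
HB.instance Definition _ := GRing.Zmodule_isLmodule.Build R (rl H) rscaleA rscale1 rscaleDr rscaleDl.
End Scale.

Section Hdot.
Context {H : hilbert R}.
Implicit Types u v w : H.
Lemma hdotC u v : hdot H v u = (hdot H u v)^*.
Proof. by rewrite [LHS]hermC expr0 mul1r. Qed.
Lemma hdotDl u v w : hdot H (u + v) w = hdot H u w + hdot H v w.
Proof. exact: linearDl. Qed.
Lemma hdotZl c u v : hdot H (c *: u) v = c * hdot H u v.
Proof. exact: linearZl_LR. Qed.
Lemma hdotZr c u v : hdot H u (c *: v) = c^* * hdot H u v.
Proof. by rewrite (hdotC _ u) hdotZl rmorphM; congr (_ * _); exact/esym/hdotC. Qed.
Lemma hdot_ge0 u : 0 <= hdot H u u.
Proof. by rewrite -hilbert_norm exprn_ge0. Qed.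
Lemma hdotRe u : hdot H u u = (complex.Re (hdot H u u))%:C.
Proof. by rewrite RRe_real// ger0_real// hdot_ge0. Qed.
End Hdot.

Definition rip (H : hilbert R) (u v : rl H) : R := complex.Re (hdot H u v).

Section Rip.
Variable H : hilbert R.
Fact ripC (u v : rl H) : rip u v = rip v u.
Proof. by rewrite /rip (hdotC v u); case: (hdot H v u). Qed.
Fact ripDl (u v w : rl H) : rip (u + v) w = rip u w + rip v w.
Proof. by rewrite /rip hdotDl raddfD. Qed.
Fact ripZl c (u v : rl H) : rip (c *: u) v = c * rip u v.
Proof. by rewrite /rip hdotZl; case: (hdot H u v) => a b /=; rewrite mul0r subr0. Qed.
Fact rip_ge0 (u : rl H) : 0 <= rip u u.
Proof. by rewrite -ler0c /rip -hdotRe hdot_ge0. Qed.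
Fact rip_norm (u : rl H) : `|u : H| = (Num.sqrt (rip u u))%:C.
Proof.
apply/eqP; rewrite -(eqrXn2 (n := 2))// ?ler0c ?sqrtr_ge0//.
by rewrite hilbert_norm -rmorphXn /= sqr_sqrtr ?rip_ge0// /rip -hdotRe.
Qed.
Fact rip_eq0 (u : rl H) : rip u u = 0 -> u = 0.
Proof. by move=> h; apply/eqP; rewrite -(@normr_eq0 _ H) rip_norm h sqrtr0. Qed.
Fact rip_complete (x : nat -> rl H) :
 (forall e : R, 0 < e -> exists N : nat, forall m n, (N <= m)%N -> (N <= n)%N ->
   rip (x m - x n) (x m - x n) < e) ->
 exists l, forall e : R, 0 < e -> exists N : nat, forall n, (N <= n)%N ->
   rip (x n - l) (x n - l) < e.
Proof.
move=> hx; pose y : nat -> H := x.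
have nlt (u : rl H) (e : R) : 0 < e -> (`|u : H| < e%:C) = (rip u u < e ^+ 2).
 move=> e0; rewrite rip_norm ltcR -[e in LHS]ger0_norm ?ltW// -sqrtr_sqr.
 by rewrite ltr_sqrt ?exprn_gt0.
have cy : cvgn y.
 apply/cauchy_cvgP/cauchy_exP => e e0; have eE : e = (complex.Re e)%:C by rewrite RRe_real// gtr0_real.
 have e1 : 0 < complex.Re e by rewrite -ltcR -eE.
 have [N hN] := hx _ (exprn_gt0 2 e1); exists (y N); exists N => // n /= Nn.
 by rewrite -ball_normE /= eE nlt// hN.
exists (limn y) => e e0; have s0 : 0 < Num.sqrt e by rewrite sqrtr_gt0.
have : \forall n \near \oo, `|limn y - y n| < (Num.sqrt e)%:C by apply: cvgr_dist_lt => //; rewrite ltcR.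
move=> [N _ hN]; exists N => n /hN /=.
by rewrite distrC nlt// sqr_sqrtr// ltW.
Qed.
Definition rH := RHilb ripC ripDl ripZl rip_ge0 rip_eq0 rip_complete.
End Rip.

Section Ops.
Context {H : hilbert R}.
Local Notation K := (rH H).
Implicit Types (u v w : K) (f g : bop K K).

Lemma normE u : `|u : H| = (nrm u)%:C.
Proof. exact: rip_norm. Qed.

Lemma nrm_ltC u (d : R) : (`|u : H| < d%:C) = (nrm u < d).
Proof. by rewrite normE ltcR. Qed.

Fact ii_lin (c : R) u v : 'i *: (c *: u + v : H) = c *: ('i *: (u : H) : K) + ('i *: (v : H) : K) :> K.
Proof.
rewrite -[c *: u + v]/(c%:C *: (u : H) + (v : H)) -[RHS]/(c%:C *: ('i *: (u : H)) + 'i *: (v : H)).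
by rewrite scalerDr !scalerA mulrC.
Qed.
Fact ii_bd u : nrm ('i *: (u : H) : K) <= 1 * nrm u.
Proof. by rewrite mul1r -lecR -!normE normrZ normc_def /= expr0n /= add0r expr1n sqrtr1 mul1r. Qed.
Definition ii : bop K K := mkbop ii_lin ler01 ii_bd.

Lemma hdotii u v : hdot H u v = ip u v +i* ip u (ii v).
Proof.
rewrite -[ip u v]/(complex.Re (hdot H u v)) -[ip u (ii v)]/(complex.Re (hdot H (u : H) ('i *: (v : H)))) hdotZr.
by case: (hdot H u v) => a b /=; rewrite mul0r mulN1r sub0r opprK.
Qed.

Lemma sii : ii^# = - ii.
Proof.
apply: badj_uniq => u v; rewrite bopNE ipNr -[ip (ii u) v]/(complex.Re (hdot H ('i *: (u : H)) (v : H))) hdotZl.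
rewrite -[ip u (ii v)]/(complex.Re (hdot H (u : H) ('i *: (v : H)))) hdotZr.
by case: (hdot H u v) => a b /=; rewrite !mul0r mulN1r mul1r !sub0r opprK.
Qed.

Lemma iiii : ii ** ii = - bid.
Proof.
apply: bopP => u; rewrite bopNE /= scalerA -expr2 sqr_i scaleN1r //.
Qed.

Lemma cscale (c : R[i]) u : c *: (u : H) = complex.Re c *: u + complex.Im c *: ii u.
Proof.
rewrite -[RHS]/((complex.Re c)%:C *: (u : H) + (complex.Im c)%:C *: ('i *: (u : H))).
by rewrite scalerA -scalerDl [_ * 'i]mulrC -complexE.
Qed.

Lemma bop_bounded f : CB ii f -> bounded_ops H f.
Proof.
move=> cf; split.
 move=> c u v; rewrite (cscale c (u : K)) -addrA bD !bD bZ bZ (CBE _ cf) addrA; congr (_ + _).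
 by rewrite (cscale c (f u)).
have [C hC] := bop_bnd f; move=> u; apply/cvgrPdist_lt => e e0.
have eE : e = (complex.Re e)%:C by rewrite RRe_real// gtr0_real.
have e1 : 0 < complex.Re e by rewrite -ltcR -eE.
have C1 : 0 < C + 1 by have := hC.1; lra.
have q0 : 0 < (complex.Re e / (C + 1))%:C by rewrite ltcR divr_gt0.
near=> v.
have : `|(u : H) - v| < (complex.Re e / (C + 1))%:C by near: v; apply: cvgr_dist_lt => //; exact: cvg_id.
rewrite (nrm_ltC ((u : K) - v)) ltr_pdivlMr// => h.
rewrite eE (nrm_ltC (f u - f v)) -bB; apply: le_lt_trans (hC.2 _) _.
by apply: le_lt_trans h; rewrite mulrC ler_wpM2l ?nrm_ge0//; lra.
Unshelve. all: by end_near. Qed.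

Lemma bounded_bop (T : H -> H) : bounded_ops H T -> exists2 f, CB ii f & T = f.
Proof.
move=> [lT cT]; have lr (c : R) u v : T (c *: u + v) = c *: (T u : K) + T v by exact: lT.
have T0 : T 0 = 0 by have := lT (-1) 0 0; rewrite scaler0 addr0 scaleN1r addNr.
have Z (c : R) u : T (c *: u) = c *: (T u : K) by have := lr c u 0; rewrite !addr0 T0 addr0.
have [r r0 hr] : exists2 r : R, 0 < r & forall u, nrm u < r -> nrm (T u : K) < 1.
 have := cT 0; move/cvgrPdist_lt => /(_ 1 ltr01); rewrite T0 => /nbhs_normP[e /= e0 he].
 have eE : e = (complex.Re e)%:C by rewrite RRe_real// gtr0_real.
 exists (complex.Re e); first by rewrite -ltcR -eE.
 move=> u hu; have := he (u : H); rewrite /= !sub0r !normrN => /(_ _) h.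
 by rewrite -nrm_ltC; apply: h; rewrite eE nrm_ltC.
have bd u : nrm (T u : K) <= 2 / r * nrm u.
 have [->|u0] := eqVneq u 0; first by rewrite T0 !nrm0 mulr0.
 have n0 : 0 < nrm u by rewrite lt0r nrm_ge0 andbT; apply: contra u0 => /eqP /nrm_eq0 ->.
 have q0 : 0 < r / (2 * nrm u) by rewrite divr_gt0// mulr_gt0.
 have := hr ((r / (2 * nrm u)) *: u); rewrite Z !nrmZ (ger0_norm (ltW q0)).
 have -> : r / (2 * nrm u) * nrm u = r / 2 by field; exact: lt0r_neq0.
 move=> /(_ ltac:(lra)); rewrite mulrAC ltr_pdivrMr ?mulr_gt0// mul1r => h.
 by rewrite mulrAC ler_pdivlMr// mulrC ltW.
exists (@mkbop R K K T _ lr (ltac:(by rewrite divr_ge0// ltW) : 0 <= 2 / r) bd) => //.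
apply: bopP => u /=; have := lT 'i u 0; rewrite !addr0 T0 addr0 //.
Qed.

Lemma adjE f : CB ii f -> adj (f : H -> H) = f^#.
Proof.
move=> cf; have cf' := vn_adj (vnCB sii) cf.
have h1 : forall u v : H, hdot H (f u) v = hdot H u (f^# v).
 by move=> u v; rewrite !hdotii -!(CBE _ cf') !badjE.
apply: xget_subset1 => // S S' hS hS'; apply/funext => v; apply: (@ip_inj _ K) => u.
by rewrite ipC [RHS]ipC /= /rip -hS -hS'.
Qed.

Lemma compB f g : (f : H -> H) \o (g : H -> H) = f ** g. Proof. by []. Qed.

Lemma linB (c : R[i]) f g : c *: (f : H -> H) + (g : H -> H) =
 (complex.Re c *: f + complex.Im c *: (ii ** f) + g : bop K K).
Proof. by apply/funext => u; rewrite !bopDE !bopZE /= -cscale. Qed.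

Lemma linBR (c : R) f g : c%:C *: (f : H -> H) + (g : H -> H) = (c *: f + g : bop K K).
Proof. by apply/funext => u; rewrite bopDE bopZE. Qed.

(** The value is [0] when [T] is not a bounded operator. *)
Definition tob (T : H -> H) : bop K K := xget (0 : bop K K) [set f | (f : H -> H) = T].

Lemma bfun_inj f g : (f : H -> H) = g -> f = g.
Proof. by move=> h; apply: bopP => u; rewrite h. Qed.

Lemma tobE (T : H -> H) : bounded_ops H T -> tob T = T :> (H -> H).
Proof. by move=> /bounded_bop [f _ ->]; exact: (@xgetPex _ 0 [set g : bop K K | (g : H -> H) = f] (ex_intro _ f erefl)). Qed.

Lemma tobCB (T : H -> H) : bounded_ops H T -> CB ii (tob T).
Proof. by move=> hT; have [f cf e] := bounded_bop hT; rewrite (bfun_inj (etrans (tobE hT) e)). Qed.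

Lemma tobK f : tob f = f.
Proof. by apply: bfun_inj; exact: (@xgetPex _ 0 [set g : bop K K | (g : H -> H) = f] (ex_intro _ f erefl)). Qed.

Lemma dns_dense (D : set H) : dense D -> dns (D : set K).
Proof.
move=> dD u e e0; have [||v [/= h Dv]] := dD (ball (u : H) e%:C).
- by exists (u : H); apply: ballxx; rewrite ltcR.
- by apply: ball_open; rewrite ltcR.
by exists v => //; rewrite -nrm_ltC; move: h; rewrite -ball_normE.
Qed.

Lemma sep_seq : exists e : nat -> K, dns (range e).
Proof.
have [D /countable_injP[f fi] dD] := @hilbert_separable R H.
pose e n : K := xget (0 : K) [set d | D d /\ f d = n].
exists e => u d d0; have [a Da ha] := dns_dense dD u d0; exists a => //.
exists (f a) => //; 
have [] := @xgetPex _ (0 : K) [set d : H | D d /\ f d = f a] (ex_intro _ a (conj Da erefl)).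
by rewrite -/(e (f a)) => De fe; apply: fi; rewrite ?inE.
Qed.

Definition Mb (M : set (H -> H)) f := M f.

Lemma vN_bop (M : set (H -> H)) T : von_neumann_algebra M -> M T -> exists2 f, CB ii f & T = f.
Proof. by move=> [h _ _] /h /bounded_bop. Qed.

Lemma Mb_CB (M : set (H -> H)) f : von_neumann_algebra M -> Mb M f -> CB ii f.
Proof. by move=> [hM _ _] /hM /bounded_bop [g cg /bfun_inj ->]. Qed.

Lemma Mb_ii (M : set (H -> H)) : von_neumann_algebra M -> Mb M ii.
Proof.
move=> [hM _ <-]; split; first exact: bop_bounded.
by move=> x [/bounded_bop [f cf ->] _]; rewrite !compB cf.
Qed.

Lemma vnMb (M : set (H -> H)) : von_neumann_algebra M -> vnalg (Mb M).
Proof.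
move=> vM; split=> [f hf|a ha].
 by rewrite /Mb -(adjE (Mb_CB vM hf)); case: vM => _ + _; exact.
have ca : CB ii a.
 by apply/esym/ha => b hb; rewrite (Mb_CB vM hb).
rewrite /Mb; case: vM (vM) => hM hadj <- vM; split; first exact: bop_bounded.
move=> x [/bounded_bop [f cf ->] hf]; rewrite !compB; apply: (congr1 (@bfun R K K)); apply/esym/ha => b hb.
by apply: bopP => u; exact: (congr1 (fun F : H -> H => F u) (hf b hb)).
Qed.

End Ops.

Lemma Ceps (e : R[i]) : 0 < e -> exists2 d : R, 0 < d & e = d%:C.
Proof.
move=> e0; have eE : e = (complex.Re e)%:C by rewrite RRe_real// gtr0_real.
by exists (complex.Re e) => //; rewrite -ltcR -eE.
Qed.

Lemma within_eps (V : normedModType R[i]) (F : R -> V) : {within `[0, +oo[, continuous F} <->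
 forall t, 0 <= t -> forall d : R, 0 < d -> exists2 r : R, 0 < r &
  forall s, 0 <= s -> `|s - t| < r -> `|F t - F s| < d%:C.
Proof.
have itv t : `[0, +oo[%classic t = (0 <= t) :> Prop by rewrite /= in_itv /= andbT.
split=> [/subspace_continuousP h t t0 d d0|h].
 have := h t ltac:(by rewrite itv); move/cvgrPdist_lt => /(_ d%:C); rewrite ltcR => /(_ d0).
 rewrite /within /= => /nbhs_ballP [r /= r0 hr]; exists r => // s s0 st.
 by apply: hr; [rewrite /ball /= distrC|rewrite /= in_itv /= s0].
apply/subspace_continuousP => t; rewrite itv => t0; apply/cvgrPdist_lt => e /Ceps [d d0 ->].
have [r r0 hr] := h t t0 d d0; apply/nbhs_ballP; exists r => // s; rewrite /ball /= distrC => st.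
by rewrite in_itv /= andbT => s0; exact: hr.
Qed.

Lemma strong_ctat (H : hilbert R) (F : R -> bop (rH H) (rH H)) :
 strongly_continuous (fun t => F t : H -> H) <-> forall u t, 0 <= t -> ctat (fun s => F s u) t.
Proof.
split=> [h u t t0 d d0|h u].
 have [r r0 hr] := (within_eps _).1 (h u) t t0 d d0; exists r => // s s0 st.
 by rewrite nrmB -nrm_ltC; exact: hr.
apply/within_eps => t t0 d d0; have [r r0 hr] := h u t t0 d d0; exists r => // s s0 st.
by rewrite (nrm_ltC (F t u - F s u)) nrmB; exact: hr.
Qed.

(** * Functionals of the predual on bounded families *)

Section Predual.
Context {H : hilbert R}.
Local Notation K := (rH H).
Implicit Types (f g : bop K K) (M : set (H -> H)).

Lemma hdot_CS (u v : K) : `|hdot H u v| <= (nrm u * nrm v)%:C.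
Proof.
have [->|z] := eqVneq (hdot H u v) 0; first by rewrite normr0 ler0c mulr_ge0 ?nrm_ge0.
pose c := (hdot H u v)^* / `|hdot H u v|.
have n0 : `|hdot H u v| != 0 by rewrite normr_eq0.
have e1 : `|hdot H u v| = hdot H (c *: (u : H)) v.
 by rewrite hdotZl /c mulrAC [_^* * _]mulrC -sqr_normc expr2 mulfK.
have e2 : `|hdot H u v| = (complex.Re (hdot H (c *: (u : H)) v))%:C by rewrite -e1 RRe_real// normr_real.
rewrite e2 lecR; apply: le_trans (CS (c *: (u : H) : K) v) _; rewrite ler_wpM2r ?nrm_ge0//.
rewrite -lecR -!normE normrZ /c normf_div normr_id [`|_^*|](_ : _ = `|hdot H u v|).
 by rewrite divff// mul1r.
by rewrite !normc_def; case: (hdot H u v) => x y /=; rewrite sqrrN.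
Qed.

(** The tails of the sums of |xi n|^2 and |eta n|^2 bound the remainder uniformly on a ball, so
    continuity of rho along bounded families only involves finitely many vectors. *)
Lemma predual_finite M rho (C d : R) : predual M rho -> 0 <= C -> 0 < d -> exists (m : nat) (xi eta : nat -> K),
 forall f, Mb M f -> bnd f C -> `|rho f - \sum_(n < m) hdot H (f (xi n)) (eta n)| <= d%:C.
Proof.
move=> [xi [eta [cx ce hr]]] C0 d0.
have tail (z : nat -> H) (e : R) : cvgn (series (fun n => `|z n| ^+ 2 : R[i]^o)) -> 0 < e ->
  exists m, forall p, (m <= p)%N -> \sum_(m <= n < p) ip (z n : K) (z n : K) <= e.
 move=> cz e0; have e2 : 0 < (e / 2)%:C by rewrite ltcR divr_gt0.
 have [m _ hm] : \forall n \near \oo, `|limn (series (fun n => `|z n| ^+ 2 : R[i]^o)) - series (fun n => `|z n| ^+ 2 : R[i]^o) n| < (e / 2)%:C.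
  exact: cvgr_dist_lt.
 exists m => p mp; have h1 := hm m (leqnn m); have h2 := hm p mp.
 set S := series _ in h1 h2; set l := limn _ in h1 h2.
 have E : S p - S m = (\sum_(m <= n < p) ip (z n : K) (z n : K))%:C.
  rewrite /S sub_series_geq//= rmorph_sum; apply: eq_bigr => n _.
  by rewrite hilbert_norm hdotRe.
 have : `|S p - S m| < e%:C.
  have -> : e%:C = (e / 2)%:C + (e / 2)%:C by rewrite -rmorphD /=; congr (_%:C); lra.
  apply: le_lt_trans (ler_distD l _ _) _; rewrite (distrC (S p)); exact: ltrD.
 rewrite E ger0_norm ?ltcR; first exact: ltW.
 by rewrite ler0c sumr_ge0// => n _; exact: ip_ge0.
have q0 : 0 < d / (C + 1) by rewrite divr_gt0//; lra.
have [m1 h1] := tail _ _ cx q0; have [m2 h2] := tail _ _ ce q0.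
exists (maxn m1 m2), xi, eta => f Mf bf; set m := maxn m1 m2.
have sub (z : nat -> H) m' (e : R) : (m' <= m)%N -> (forall p, (m' <= p)%N -> \sum_(m' <= n < p) ip (z n : K) (z n : K) <= e) ->
  forall p, (m <= p)%N -> \sum_(m <= n < p) ip (z n : K) (z n : K) <= e.
 move=> mm hz p mp; apply: le_trans (hz p (leq_trans mm mp)); rewrite [leRHS](big_cat_nat mm)//= lerDr.
 by apply: sumr_ge0 => n _; exact: (rip_ge0 (z n : rl H)).
have k1 := sub _ _ _ (leq_maxl _ _) h1; have k2 := sub _ _ _ (leq_maxr _ _) h2.
set T := series (fun n => hdot H ((f : H -> H) (xi n)) (eta n) : R[i]^o) in hr.
have hT : series (fun n => hdot H ((f : H -> H) (xi n)) (eta n) : R[i]^o) @ \oo --> rho f := hr _ Mf.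
set T' := series _ in hT.
have -> : \sum_(n < m) hdot H (f (xi n)) (eta n) = T' m by rewrite /T' /series /= big_mkord.
have part p : (m <= p)%N -> `|T' p - T' m| <= d%:C.
 move=> mp; rewrite /T' sub_series_geq//=; apply: le_trans (ler_norm_sum _ _ _) _.
 apply: le_trans (_ : \sum_(m <= n < p) (C * (2^-1 * (ip (xi n : K) (xi n : K) + ip (eta n : K) (eta n : K))))%:C <= _).
  apply: ler_sum => n _; apply: le_trans (hdot_CS _ _) _; rewrite lecR.
  apply: le_trans (_ : C * nrm (xi n : K) * nrm (eta n : K) <= _); first by rewrite ler_wpM2r ?nrm_ge0// bf.2.
  rewrite -mulrA ler_wpM2l// -!nrm2; have := sqr_ge0 (nrm (xi n : K) - nrm (eta n : K)); rewrite !expr2; lra.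
 rewrite -rmorph_sum lecR -mulr_sumr -mulr_sumr big_split /=.
 have := k1 p mp; have := k2 p mp; set a := \sum_(_ <= _ < _) _; set b := \sum_(_ <= _ < _) _ => ha hb.
 have h : C * (2^-1 * (b + a)) <= C * (d / (C + 1)) by apply: ler_wpM2l => //; lra.
 apply: le_trans h _; rewrite mulrCA ger_pMr// ler_pdivrMr ?mul1r; lra.
apply/ler_addgt0Pr => e /Ceps [r r0 ->].
have [p _ hp] : \forall n \near \oo, `|rho f - T' n| < r%:C by apply: cvgr_dist_lt => //; rewrite ltcR.
apply: le_trans (ler_distD (T' (maxn p m)) _ _) _; rewrite addrC; apply: lerD; first exact: part (leq_maxr _ _).
exact/ltW/hp/leq_maxl.
Qed.

Lemma predual_vec M (k l : H) : predual M (fun x => hdot H (x k) l).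
Proof.
pose z (k : H) (n : nat) := if n is 0 then k else 0.
have single (a : nat -> R[i]^o) : (forall n, a n.+1 = 0) -> series a @ \oo --> a 0%N.
 move=> h; apply: cvg_near_cst; exists 1%N => // -[//|n] _.
 by rewrite /series /= big_nat_recl//= big1 ?addr0.
exists (z k), (z l); split.
- by apply/cvg_ex; exists (`|k| ^+ 2 : R[i]^o); apply: single => n; rewrite normr0 expr0n.
- by apply/cvg_ex; exists (`|l| ^+ 2 : R[i]^o); apply: single => n; rewrite normr0 expr0n.
- by move=> x _; apply: single => n; rewrite /= linear0r.
Qed.

Lemma predual_close M rho (C d : R) : predual M rho -> 0 <= C -> 0 < d -> exists (m : nat) (xi : nat -> K) (e : R),
 0 < e /\ forall f g, Mb M f -> Mb M g -> bnd f C -> bnd g C ->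
  (forall j, (j < m)%N -> nrm (f (xi j) - g (xi j)) < e) -> `|rho f - rho g| < d%:C.
Proof.
move=> hr C0 d0; have d4 : 0 < d / 4 by rewrite divr_gt0.
have [m [xi [eta h]]] := predual_finite hr C0 d4.
pose S := \sum_(n < m) nrm (eta n); have S0 : 0 <= S by apply: sumr_ge0 => n _; exact: nrm_ge0.
have e0 : 0 < d / 4 / (S + 1) by rewrite divr_gt0// ltr_wpDl.
exists m, xi, (d / 4 / (S + 1)); split=> // f g Mf Mg bf bg hfg.
have h1 := h f Mf bf; have h2 := h g Mg bg.
set A := \sum_(n < m) _ in h1; set B := \sum_(n < m) _ in h2.
have h3 : `|A - B| <= (d / 4)%:C.
 rewrite /A /B -sumrB; apply: le_trans (ler_norm_sum _ _ _) _.
 apply: le_trans (_ : \sum_(n < m) (d / 4 / (S + 1) * nrm (eta n))%:C <= _).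
  apply: ler_sum => n _; rewrite -linearBl; apply: le_trans (hdot_CS (f (xi n) - g (xi n)) _) _.
  by rewrite lecR ler_wpM2r ?nrm_ge0// ltW// hfg.
 rewrite -rmorph_sum lecR -mulr_sumr -/S; move: (d / 4) d4 => q q0.
 by rewrite mulrAC ler_pdivrMr ?ltr_wpDl// ler_pM2l// lerDl.
apply: le_lt_trans (_ : `|rho f - A| + `|A - B| + `|B - rho g| < _).
 apply: le_trans (ler_distD B _ _) _; rewrite lerD2r; exact: ler_distD.
rewrite (distrC B); apply: le_lt_trans (lerD (lerD h1 h3) h2) _.
by rewrite -!rmorphD ltcR; lra.
Qed.

Lemma predual_ctat M rho (C t : R) (F : R -> bop K K) : predual M rho -> (forall s, 0 <= s -> Mb M (F s)) -> 0 <= t ->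
 (forall s, 0 <= s -> bnd (F s) C) -> (forall u, ctat (fun s => F s u) t) ->
 forall d : R, 0 < d -> exists2 r : R, 0 < r & forall s, 0 <= s -> `|s - t| < r -> `|rho (F t) - rho (F s)| < d%:C.
Proof.
move=> hr hM t0 hb hc d d0; have [m [xi [e [e0 h]]]] := predual_close hr (hb t t0).1 d0.
have [r r0 hr'] : exists2 r : R, 0 < r & forall j, (j < m)%N -> forall s, 0 <= s -> `|s - t| < r -> nrm (F s (xi j) - F t (xi j)) < e.
 elim: m {h} => [|m [r r0 IH]]; first by exists 1.
 have [q q0 hq] := hc (xi m) e e0; exists (Num.min r q); first by rewrite lt_min r0.
 move=> j; rewrite ltnS leq_eqVlt => /predU1P[->|jm] s s0; rewrite lt_min => /andP[h1 h2]; [exact: hq|exact: IH].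
by exists r => // s s0 st; rewrite distrC; apply: h; auto.
Qed.

Lemma predual_scv M rho (C : R) (x : nat -> bop K K) (l : bop K K) : predual M rho -> (forall n, Mb M (x n)) -> Mb M l ->
 (forall n, bnd (x n) C) -> bnd l C -> scv x l ->
 forall d : R, 0 < d -> exists n, `|rho (x n) - rho l| < d%:C.
Proof.
move=> hr hM Ml hb bl hc d d0; have [m [xi [e [e0 h]]]] := predual_close hr bl.1 d0.
have /choice[N hN] := fun j => hc (xi j) e e0.
exists (\max_(j < m) N j)%N; apply: h => // j jm; apply: hN.
exact: (leq_bigmax (Ordinal jm)).
Qed.

Lemma star_hom_lin M N (th : (H -> H) -> (H -> H)) (c : R) f g : star_hom M N th -> Mb M f -> Mb M g ->
 th (c *: f + g : bop K K) = c%:C *: th f + th g.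
Proof. by move=> [_ h _ _] Mf Mg; rewrite -linBR h. Qed.

Definition lift (th : (H -> H) -> (H -> H)) (f : bop K K) : bop K K := tob (th f).

End Predual.

Lemma vN_bounded (H : hilbert R) : von_neumann_algebra (bounded_ops H).
Proof.
split=> // [x /bounded_bop [f cf ->]|].
 by rewrite adjE//; apply: bop_bounded; exact: (vn_adj (vnCB sii)).
by apply/seteqP; split=> [x []//|x hx]; split=> // y [_ hy]; rewrite hy.
Qed.

Lemma Mb_bounded (H : hilbert R) : Mb (bounded_ops H) = CB ii.
Proof.
apply/funext => f; apply/propext; split; last exact: bop_bounded.
exact: (Mb_CB (vN_bounded H)).
Qed.

End Realify.

Lemma op_parallelogram (R : realType) (U : rhilb R) (a b : bop U U) :
 2 *: (a^# ** a) + 2 *: (b^# ** b) - (a + b)^# ** (a + b) = (a - b)^# ** (a - b).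
Proof. by rewrite badjD badjB; oring. Qed.

Section Positive.
Context {R : realType} {H : hilbert R}.
Implicit Types f g : bop (rH H) (rH H).

(** Positivity of a complex number includes that its imaginary part vanishes, so the complex form
    yields <f u, i u> = 0 and with it self-adjointness, which a nonnegative real form alone would
    not. *)
Lemma posE f : CB ii f -> positive_op (f : H -> H) <-> bpos f.
Proof.
move=> cf; have cf' := vn_adj (vnCB sii) cf; split=> [h|[sf h] u].
 have hu u : ip (f u) (ii u) = 0 /\ 0 <= ip (f u) u.
  by have := h u; rewrite hdotii lecE /= => /andP[/eqP -> ?].
 split; last by move=> u; case: (hu u).
 pose g := ii ** f; have gE u : ip (g u) u = 0.
  by have [e _] := hu u; rewrite -[g u]/(ii (f u)) (ipI sii) e oppr0.
 have z : bnd (g + g^#) 0.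
  apply: bsa_bnd => // [|u]; first by rewrite /bsa badjD badjK addrC.
  by rewrite bopDE ipDl -badjEr (ipC u) gE addr0 normr0 mul0r.
 have e0 : g + g^# = 0.
  apply: bopP => u; rewrite bop0E; apply: nrm_eq0; apply/eqP; rewrite eq_le nrm_ge0 andbT.
  by have := z.2 u; rewrite mul0r.
 have := congr1 (fun x => ii ** x) e0; rewrite bc0r bcDr /g badjM sii bcNr cf' bcNr !bcA iiii.
 by rewrite !bcNl !bc1l opprK addrC => /subr0_eq.
have e0 : ip (f u) (ii u) = 0.
 have := bsaE (u : rH H) (ii u) sf; rewrite (CBE _ cf) => e.
 by have := ipI sii (u : rH H) (f u); rewrite ipC e; lra.
by rewrite hdotii e0 lecE /= eqxx; exact: h.
Qed.

Lemma op_leE f g : CB ii f -> CB ii g -> op_le (f : H -> H) g <-> bpos (g - f).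
Proof.
move=> cf cg; rewrite -(posE (vnB (vnCB sii) cg cf)).
suff -> : op_le (f : H -> H) g = positive_op ((g - f : bop (rH H) (rH H)) : H -> H) by [].
by rewrite /op_le; congr positive_op; apply/funext => u; rewrite bopBE.
Qed.

End Positive.

(** * From a weight to a standard form *)

Section Weight.
Context {R : realType} {H : hilbert R} {M : set (H -> H)} {phi : (H -> H) -> \bar R}.
Hypotheses (vM : von_neumann_algebra M) (fw : fns_weight M phi).
Local Notation B := (bop (rH H) (rH H)).
Implicit Types (a b f g : B).
Let vMb := vnMb vM.
Let cM f (Mf : Mb M f) : CB ii f := Mb_CB vM Mf.
Let W : weight M phi. Proof. by case: fw. Qed.

Lemma coneE f : Mb M f -> bpos f -> positive_cone M f.
Proof. by move=> Mf pf; split=> //; apply/posE => //; exact: cM. Qed.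

Lemma wD f g : Mb M f -> bpos f -> Mb M g -> bpos g -> phi (f + g : B) = (phi f + phi g)%E.
Proof.
move=> Mf pf Mg pg; have [_ h _] := W; rewrite -h; try exact: coneE.
by congr phi; apply/funext => u; rewrite bopDE.
Qed.

Lemma wZ c f : 0 <= c -> Mb M f -> bpos f -> phi (c *: f : B) = (c%:E * phi f)%E.
Proof.
move=> c0 Mf pf; have [_ _ h] := W; rewrite -h//; last exact: coneE.
by congr phi; apply/funext => u; rewrite bopZE.
Qed.

Lemma w_ge0 f : Mb M f -> bpos f -> (0 <= phi f)%E.
Proof. by move=> Mf pf; have [h _ _] := W; apply: h; exact: coneE. Qed.

Lemma w_le f g : Mb M f -> bpos f -> Mb M g -> bpos (g - f) -> (phi f <= phi g)%E.
Proof.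
move=> Mf pf Mg pg; have Md := vnB vMb Mg Mf.
by rewrite -[g](subrK f) (wD Md pg Mf pf) leeDr// w_ge0.
Qed.

Definition wn f := weight_ideal M phi f.

Lemma wnE f : wn f <-> Mb M f /\ (phi (f^# ** f : B) < +oo)%E.
Proof. by rewrite /wn /weight_ideal /=; split=> -[Mf]; rewrite adjE//; exact: cM. Qed.

Lemma wn_le f g : Mb M f -> bpos (g^# ** g - f^# ** f) -> wn g -> wn f.
Proof.
move=> Mf h /wnE [Mg hg]; apply/wnE; split=> //; apply: le_lt_trans hg.
by apply: w_le => //; try exact: bpos_adjl; apply: (vnM vMb) => //; exact: (vn_adj vMb).
Qed.

(** Sums are controlled by the parallelogram law for operators, left multiples by a^# a <= C^2 for a
    bound C of [a], and nondegeneracy is semifiniteness. *)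
Lemma wn_ideal : ideal (Mb M) wn.
Proof.
have Ms f : Mb M f -> Mb M (f^# ** f) by move=> Mf; apply: (vnM vMb) => //; exact: (vn_adj vMb).
have wnZ c f : wn f -> wn (c *: f).
 move=> /wnE [Mf hf]; apply/wnE; split; first exact: (vnZ vMb).
 rewrite badjZ bcZl bcZr scalerA -expr2 wZ ?sqr_ge0//; last 2 first.
  exact: Ms.
  exact: bpos_adjl.
 by rewrite lte_mul_pinfty// ?lee_fin ?sqr_ge0//.
split.
- by move=> a /wnE [].
- apply/wnE; split; first exact: (vn0 vMb).
 have -> : (0 : B)^# ** (0 : B) = 0 *: bid by rewrite bc0r scale0r.
 by rewrite wZ//; [rewrite mul0e ltry|exact: (vn1 vMb)|exact: bpos1].
- move=> c a b na nb; have /wnE [Ma ha] := wnZ c _ na; have /wnE [Mbb hb] := nb.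
 set a' := c *: a in Ma ha *.
 apply/wnE; split; first exact: (vnD vMb).
 have p1 := bposZ (ltW (ltr0Sn R 1)) (bpos_adjl a'); have p2 := bposZ (ltW (ltr0Sn R 1)) (bpos_adjl b).
 have m1 := vnZ vMb 2 (Ms _ Ma); have m2 := vnZ vMb 2 (Ms _ Mbb).
 apply: (@le_lt_trans _ _ (phi (2 *: (a'^# ** a') + 2 *: (b^# ** b) : B))).
  apply: w_le; [by apply: Ms; exact: (vnD vMb)|exact: bpos_adjl|exact: (vnD vMb)|].
  by rewrite op_parallelogram; exact: bpos_adjl.
 rewrite wD// !wZ//; try exact: Ms; try exact: bpos_adjl.
 by rewrite lte_add_pinfty// lte_mul_pinfty// lee_fin.
- move=> a b Ma nb; have [_ Mb'] : True /\ Mb M b by case/wnE: nb.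
 have [C bC] := bop_bnd a; apply: (wn_le (vnM vMb Ma Mb') _ (wnZ C _ nb)).
 have -> : (C *: b)^# ** (C *: b) - (a ** b)^# ** (a ** b) = b^# ** (C ^+ 2 *: bid - a^# ** a) ** b.
  rewrite badjZ bcZl bcZr scalerA badjM bcBr bcBl bcZr bcZl bc1r !bcA expr2 //.
 apply: bpos_conj; split=> [|u]; first by rewrite /bsa badjB badjZ badj1 badjM badjK.
 rewrite bopBE bopZE ipDl ipNl ipZl -[(a^# ** a) u]/(a^# (a u)) -[bid u]/u -badjEr subr_ge0 -!nrm2 -exprMn.
 by rewrite lerXn2r ?nnegrE ?nrm_ge0 ?mulr_ge0 ?bC.1 ?nrm_ge0//; exact: bC.2.
- move=> h hb; have [_ _ _ sfw] := fw.
 apply: (eps_eq0 (C := 1)) => e e0; rewrite mul1r.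
 have id1 : M idfun := vn1 vMb.
 have nb : nbhs (idfun : {ptws H -> H}) [set T : {ptws H -> H} | `|(h : H) - T h| < e%:C].
  have : (fun T : {ptws H -> H} => T h) @ (nbhs (idfun : {ptws H -> H})) --> (h : H).
   exact: (@proj_continuous H (fun=> H) h idfun).
  by move/cvgrPdist_lt; apply; rewrite ltcR.
 have [T [nT]] := sfw _ id1 _ nb.
 have [f cf TE] := vN_bop vM nT.1; rewrite TE /= in nT *.
 by rewrite hb// subr0 nrm_ltC => /ltW.
Qed.

(** l is the supremum of the x n, so normality gives phi (x n) -> phi l; additivity and finiteness
    of phi l allow the subtraction. *)
Lemma w_sup (x : nat -> B) l : (forall n, Mb M (x n)) -> (forall n, bpos (x n)) ->
 (forall n, bpos (x n.+1 - x n)) -> Mb M l -> scv x l -> (forall n, bpos (l - x n)) -> (phi l < +oo)%E ->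
 forall d : R, 0 < d -> exists n, (phi (l - x n : B)%R < d%:E)%E.
Proof.
move=> Mx px inc Ml cx lx hl d d0; have [_ _ nw _] := fw.
have mono n k : bpos (x (n + k)%N - x n).
 elim: k => [|k IH]; first by rewrite addn0 subrr; exact: bpos0.
 by have := bposD (inc (n + k)%N) IH; rewrite addrA subrK addnS.
have pl : bpos l by rewrite -[l](subrK (x 0%N)); apply: bposD.
have cx' n := cM (Mx n); have cl := cM Ml.
pose D : set (H -> H) := fun T : H -> H => exists n, T = x n.
have sup : op_sup M D l.
 split; [exact: coneE|by move=> _ [n ->]; apply/op_leE|].
 move=> z [Mz pz] hz; have [f cf zE] := vN_bop vM Mz; rewrite zE in pz hz *.
 apply/op_leE => //; have pf := (posE cf).1 pz.
 split=> [|u]; first by rewrite /bsa badjB pf.1 pl.1.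
 rewrite bopBE ipDl ipNl subr_ge0; apply: (conv_ip_le (cx u)) => n.
 have := (op_leE (cx' n) cf).1 (hz _ (ex_intro _ n erefl)) => h.
 by have := h.2 u; rewrite bopBE ipDl ipNl subr_ge0.
have phiE : phi l = ereal_sup (phi @` D).
 apply: nw => //; first by move=> _ [n ->]; exact: coneE.
 split; first by exists (x 0%N), 0%N.
 move=> _ _ [n ->] [m ->]; exists (x (maxn n m)); split; [by exists (maxn n m)| |]; apply/op_leE => //.
  by rewrite -(subnKC (leq_maxl n m)).
 by rewrite -(subnKC (leq_maxr n m)).
have l0 := w_ge0 Ml pl.
have [_ [_ [n ->] <-] hn] := @ub_ereal_sup_adherent R (phi @` D) d d0 ltac:(by rewrite -phiE ge0_fin_numE).
exists n; rewrite -phiE in hn; have Md := vnB vMb Ml (Mx n).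
have := wD Md (lx n) (Mx n) (px n); rewrite subrK => e.
have a0 := w_ge0 Md (lx n); have b0' := w_ge0 (Mx n) (px n).
move: hn hl; rewrite e; move: a0 b0'; case: (phi (x n)) => [r| |]; case: (phi (l - x n : B)) => [q| |] //=.
rewrite -!EFinD !lte_fin; lra.
Qed.

Section Rep.
Context {K : hilbert R} (pi : (H -> H) -> (K -> K)) (Lam : (H -> H) -> K) (J : K -> K).
Hypotheses (hG : gns_representation M phi pi Lam) (hJ : modular_conjugation M phi Lam J).

Definition gP (f : B) : bop (rH K) (rH K) := tob (pi f).
Definition gL (f : B) : rH K := Lam f.

Let sh : star_hom M (bounded_ops K) pi. Proof. by case: hG. Qed.

Lemma gPE f : Mb M f -> gP f = pi f :> (K -> K).
Proof. by move=> Mf; case: sh => h _ _ _; exact: tobE (h _ Mf). Qed.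

Lemma gPCB f : Mb M f -> CB ii (gP f).
Proof. by move=> Mf; case: sh => h _ _ _; exact: tobCB (h _ Mf). Qed.

Lemma gP_lin c a b : Mb M a -> Mb M b -> gP (c *: a + b) = c *: gP a + gP b.
Proof.
move=> Ma Mb'; apply: bfun_inj; rewrite -linBR !gPE//; last exact: (vn_lin vMb).
by case: sh => _ h _ _; rewrite -h// linBR.
Qed.

Lemma gP_mul a b : Mb M a -> Mb M b -> gP (a ** b) = gP a ** gP b.
Proof.
move=> Ma Mb'; apply: bfun_inj; rewrite -compB !gPE//; last exact: (vnM vMb).
by case: sh => _ _ h _; exact: h.
Qed.

Lemma gP_adj a : Mb M a -> gP a^# = (gP a)^#.
Proof.
move=> Ma; apply: bfun_inj; rewrite -adjE; last exact: gPCB.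
rewrite !gPE//; last exact: (vn_adj vMb).
by case: sh => _ _ _ h; rewrite -h// adjE//; exact: cM.
Qed.

Lemma gL_lin c a b : wn a -> wn b -> gL (c *: a + b) = c *: gL a + gL b.
Proof. by move=> na nb; rewrite /gL -linBR; case: hG => _ h _ _ _; exact: h. Qed.

Lemma gPL a b : Mb M a -> wn b -> gP a (gL b) = gL (a ** b).
Proof. by move=> Ma nb; rewrite gPE// /gL -compB; case: hG => _ _ _ _ h; exact: h. Qed.

Lemma gL_nrm a : wn a -> ip (gL a) (gL a) = fine (phi (a^# ** a : B)).
Proof.
move=> na; have [Ma _] := wnE a; have := Ma na => -[Ma' _].
case: hG => _ _ h _ _; have := h _ na; rewrite adjE; last exact: cM.
by move=> /(congr1 (@complex.Re R)).
Qed.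

Lemma gL_dns : dns (gL @` wn).
Proof.
case: hG => _ _ _ h _; move=> u e e0; have [_ [T nT <-] hT] := dns_dense h u e0.
have [f cf TE] := vN_bop vM nT.1.
by exists (gL f); [exists f => //; rewrite /wn -TE|rewrite /gL -TE].
Qed.

Lemma gP1 : gP bid = bid.
Proof.
apply: (bop_eq_dns gL_dns) => _ [a na <-]; have Ma := id_M wn_ideal na.
by rewrite gPL ?bc1l//; exact: (vn1 vMb).
Qed.

(** For normality, k is approximated by some L y, and the squared norm of P (sqrt (l - x n)) (L y)
    is phi (y^# (l - x n) y), which [w_sup] makes small. *)
Lemma gP_rep : repn (Mb M) gP.
Proof.
have B0 a b : Mb M a -> Mb M b -> gP (a - b) = gP a - gP b.
 by move=> Ma Mb'; rewrite addrC -scaleN1r gP_lin// scaleN1r addrC.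
have sq a k : Mb M a -> ble1 a -> ip (gP a k) k = nrm (gP (bsqrt a) k) ^+ 2.
 move=> Ma a1; have [_ s1 ss] := bsqrt_spec a1; have Ms := vn_sqrt vMb a1 Ma.
 by rewrite nrm2 [RHS]badjE -(gP_adj Ms) s1.1.1 -[gP _ (gP _ _)]/((gP (bsqrt a) ** gP (bsqrt a)) k) -gP_mul// ss ipC.
have pos a k : Mb M a -> ble1 a -> nrm (gP (bsqrt a) k) <= nrm k.
 move=> Ma a1; apply: sq_le; first exact: nrm_ge0.
 rewrite -sq// nrm2; have := sqr_ge0 (nrm (gP (bsqrt (bid - a)) k)).
 have M1 := vn1 vMb; rewrite -sq ?B0 ?gP1//; [|exact: (vnB vMb)|exact: ble1_compl].
 by rewrite bopBE ipDl ipNl subr_ge0.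
split; [exact: gP_lin|exact: gP_mul|exact: gP_adj|exact: gP1|].
move=> k x l Mx x1 inc cx hk; have Ml := vn_scv vMb Mx cx.
have [l' [cl' pl bl hlx]] := monotone_scv (fun n => (x1 n).1) (fun n => ble1_bnd (x1 n)) inc.
have {l' cl' pl bl hlx} [l1 hlx] : ble1 l /\ forall n, bpos (l - x n).
 by rewrite (scv_uniq cx cl'); split=> //; exact: bnd_ble1.
have d1 n : ble1 (l - x n).
 split=> // u; rewrite bopBE ipDl ipNl; have := (x1 n).1.2 u; have := l1.2 u; lra.
have e n : ip (gP l k) k = nrm (gP (bsqrt (l - x n)) k) ^+ 2.
 by rewrite -sq//; [rewrite B0// bopBE ipDl ipNl hk subr0|exact: (vnB vMb)].
suff h : forall d : R, 0 < d -> exists n, nrm (gP (bsqrt (l - x n)) k) <= d.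
 apply/eqP; rewrite eq_le (e 0%N) sqr_ge0 andbT; apply: eps_le => d d0; rewrite add0r.
 have [n hn] := h (Num.sqrt d) ltac:(by rewrite sqrtr_gt0).
 rewrite -(e 0%N) (e n) -(sqr_sqrtr (ltW d0)) lerXn2r ?nnegrE ?sqrtr_ge0//; exact: nrm_ge0.
move=> d d0; have d2 : 0 < d / 2 by rewrite divr_gt0.
have [_ [y ny <-] hy] := gL_dns k d2; have My := id_M wn_ideal ny.
have My' := vn_adj vMb My; pose c a := y^# ** a ** y.
have cB a b : c (a - b) = c a - c b by rewrite /c bcBr bcBl.
have Mc a : Mb M a -> Mb M (c a) by move=> Ma; apply: (vnM vMb) => //; exact: (vnM vMb).
have pc a : bpos a -> bpos (c a) by move=> pa; exact: bpos_conj.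
have cc u : c u = y^# ** u ** y by [].
have fin : (phi (c l : B) < +oo)%E.
 have /wnE [_] := ny; apply: le_lt_trans; apply: w_le; [exact: Mc|exact: pc l1.1|exact: (vnM vMb)|].
 have -> : y^# ** y - c l = c (bid - l) by rewrite cB {2}/c bc1r.
 by apply: pc; have [] := ble1_compl l1.
have h1 n : bpos (c (x n.+1) - c (x n)) by rewrite -cB; exact: pc.
have h2 : scv (fun n => c (x n)) (c l) by move=> u; apply: bop_conv; exact: cx.
have h3 n : bpos (c l - c (x n)) by rewrite -cB; exact: pc.
have [n hn] := w_sup (fun n => Mc _ (Mx n)) (fun n => pc _ (x1 n).1) h1 (Mc _ Ml) h2 h3 fin (exprn_gt0 2 d2).
exists n; have Md := vnB vMb Ml (Mx n); have Ms := vn_sqrt vMb (d1 n) Md.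
have [_ s1 ss] := bsqrt_spec (d1 n); set s := bsqrt _ in s1 ss Ms *.
have ns : nrm (gP s (gL y)) <= d / 2.
 apply: sq_le; first exact: ltW.
 have nsy : wn (s ** y) := id_l wn_ideal Ms ny.
 rewrite gPL// nrm2 gL_nrm// badjM s1.1.1 -bcA (bcA s) ss bcA -/(c _) cB.
 have p0 : (0 <= phi (c l - c (x n) : B)%R)%E.
  by apply: w_ge0; [apply: (vnB vMb); exact: Mc|rewrite -cB; exact: pc].
 by move: hn p0; case: (phi _) => [r| |] //=; rewrite lte_fin => hr _; exact: ltW.
have := nrmD (gP s (k - gL y)) (gP s (gL y)); rewrite -bD subrK => h.
by have := pos _ (k - gL y) Md (d1 n); rewrite -/s; lra.
Qed.

Let Jl (c : R) (u v : rH K) : J (c *: u + v) = c *: (J u : rH K) + J v.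
Proof.
case: hJ => -[h _ _] _; have := h c%:C u v.
by rewrite (_ : Num.conj c%:C = c%:C)//; rewrite -[LHS]/(conjc _) conjc_real.
Qed.
Let Jb (u : rH K) : nrm (J u : rH K) <= 1 * nrm u.
Proof. by rewrite mul1r -lecR -!normE; case: hJ => -[_ h _] _; rewrite h. Qed.
Definition wJ : bop (rH K) (rH K) := @mkbop R (rH K) (rH K) J _ Jl ler01 Jb.

(** g is the inverse of 1 + sqrtDelta, obtained from the graph by [resolvent_of_graph]; the two
    approximation clauses are the two inclusions in the closure formula for S. *)
Lemma gns_sform : exists g : bop (rH K) (rH K), sform (Mb M) gP wn gL wJ g.
Proof.
have rP := gP_rep; have nI := wn_ideal.
have nJ u : nrm (wJ u) = nrm u.
 by apply: (@complexI R); rewrite -!normE; case: hJ => -[_ h _] _; rewrite h.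
have JJ : wJ^# ** wJ = bid.
 have pol (a : bop (rH K) (rH K)) : bsa a -> (forall u, ip (a u) u = 0) -> a = 0.
  move=> sa ha; have z : bnd a 0 by apply: bsa_bnd => // u; rewrite ha normr0 mul0r.
  apply: bopP => u; rewrite bop0E; apply: nrm_eq0; apply/eqP; rewrite eq_le nrm_ge0 andbT.
  by have := z.2 u; rewrite mul0r.
 apply/subr0_eq/pol; first by rewrite /bsa badjB badjM badjK badj1.
 move=> u; rewrite bopBE ipDl ipNl -[(wJ^# ** wJ) u]/(wJ^# (wJ u)) -badjEr -nrm2 nJ nrm2.
 exact: subrr.
have JJ' : wJ ** wJ^# = bid.
 apply: bopP => v; have [u <-] : exists u, wJ u = v by case: hJ => -[_ _ h] _; exact: h.
 by rewrite -[LHS]/(wJ ((wJ^# ** wJ) u)) JJ.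
have [aJ [A pA SE]] := hJ; have [dA eA posA] := pA.
have AE p : A p <-> forall q, A q -> hdot K q.2 p.1 = hdot K q.1 p.2 by rewrite {1}eA.
have Ai q : A q -> A ('i *: q.1, 'i *: q.2).
 by move=> /AE h; apply/AE => q' hq'; rewrite /= !hdotZr (h _ hq').
pose D (u v : rH K) := A (u, v).
have dD : dns [set u | exists v, D u v].
 by move=> u e e0; have [_ [[x y] hxy <-] h] := dns_dense dA u e0; exists x => //; exists y.
(* The graph is stable under i, so the real parts of the adjoint relation for (x, y) and (i x, i y)
   give the complex one. *)
have sD u v : D u v <-> forall x y, D x y -> ip y u = ip x v.
 split=> [/AE h x y /h /= e|h]; first exact: (congr1 (@complex.Re R) e).
 apply/AE => -[x y] hxy /=; rewrite hdotC [RHS]hdotC !hdotii; congr (conjc (_ +i* _)).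
  by rewrite ipC (h _ _ hxy) ipC.
 by have := h _ _ (Ai _ hxy); rewrite -/(ii x) -/(ii y) ipC [RHS]ipC.
have pD u v : D u v -> 0 <= ip v u.
 by move=> /posA /=; rewrite lecE => /andP[_].
have [g [g1 gi gE]] := resolvent_of_graph dD sD pD.
exists g; split => //.
- exact: gL_lin.
- exact: gPL.
- exact: gL_dns.
- move=> a na L0; have Ma := id_M nI na; have /wnE [_ fin] := na.
 have p0 := w_ge0 (vnM vMb (vn_adj vMb Ma) Ma) (bpos_adjl a).
 have := gL_nrm na; rewrite L0 ip0l => e0.
 have z : (a^# ** a : B) = (0 : B) :> (H -> H).
  have [_ fth _ _] := fw; have -> : ((0 : B) : H -> H) = 0 by apply/funext => u; rewrite bop0E.
  apply: fth; first by apply: coneE; [exact: (vnM vMb (vn_adj vMb Ma) Ma)|exact: bpos_adjl].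
  by move: fin p0 e0; case: (phi _) => [r| |] //= _ _ <-.
 apply: bopP => u; rewrite bop0E; apply: ip_eq0; rewrite badjE -[a^# (a u)]/((a^# ** a) u).
 by rewrite (bfun_inj z) bop0E ip0r.
- move=> a [na na']; have Ma := id_M nI na.
 have : A `<=` setT by [].
 have : closure [set (Lam x, Lam (adj x)) | x in [set x | weight_ideal M phi x /\ weight_ideal M phi (adj x)]] (Lam a, Lam (adj a)).
  by apply: subset_closure; exists (a : H -> H) => //; split=> //; rewrite adjE//; exact: cM.
 rewrite SE => -[[u v] huv [e1 e2]] _.
 have [k [uE vE]] := (gE u v).1 huv; exists k; rewrite -vE -uE /gL -e1; split=> //.
 by rewrite -(adjE (cM Ma)) -e2.
- move=> k d d0; have Dk : D (g k) (k - g k) by apply/gE; exists k.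
 have : [set (p.1, J p.2) | p in A] (g k, J (k - g k)) by exists (g k, k - g k).
 rewrite -SE => /(_ [set q | ball (g k : K) d%:C q.1 /\ ball (J (k - g k)) d%:C q.2]) [].
  exists (ball (g k : K) d%:C, ball (J (k - g k)) d%:C); last by move=> [x y] [].
  by split; apply: nbhsx_ballx; rewrite ltcR.
 move=> _ [[x [nx nx'] <-] /= []]; have [f cf xE] := vN_bop vM nx.1.
 rewrite xE in nx nx' *; rewrite adjE// in nx' *; rewrite -!ball_normE /=.
 move=> h1 h2; exists f; split=> //.
  by rewrite -nrm_ltC.
 by rewrite -(nrm_ltC (wJ (k - g k) - gL f^#)).
Qed.

End Rep.
End Weight.

Lemma star_hom_comp (R : realType) (H K L : hilbert R) (M : set (H -> H)) (N : set (K -> K)) (O : set (L -> L)) f g :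
 star_hom M N f -> star_hom N O g -> star_hom M O (g \o f).
Proof.
move=> [f1 f2 f3 f4] [g1 g2 g3 g4]; split=> /= [x Mx|c x y Mx My|x y Mx My|x Mx].
- exact/g1/f1.
- by rewrite f2// g2//; exact: f1.
- by rewrite f3// g3//; exact: f1.
- by rewrite f4// g4//; exact: f1.
Qed.

Section Lift.
Context {R : realType} {H : hilbert R} {M : set (H -> H)} {th : (H -> H) -> (H -> H)}.
Hypotheses (vM : von_neumann_algebra M) (sh : star_hom M M th).
Local Notation B := (bop (rH H) (rH H)).
Let vMb := vnMb vM.

Lemma lift_fun (f : B) : Mb M f -> lift th f = th f :> (H -> H).
Proof. by move=> Mf; apply: tobE; case: vM => + _ _; apply; case: sh => + _ _ _; exact. Qed.

Lemma lift_M (f : B) : Mb M f -> Mb M (lift th f).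
Proof. by move=> Mf; rewrite /Mb lift_fun//; case: sh => + _ _ _; exact. Qed.

Lemma lift_lin c (f g : B) : Mb M f -> Mb M g -> lift th (c *: f + g) = c *: lift th f + lift th g.
Proof.
move=> Mf Mg; apply: bfun_inj; rewrite -linBR !lift_fun//; last exact: (vn_lin vMb).
exact: star_hom_lin sh Mf Mg.
Qed.

Lemma lift_mul (f g : B) : Mb M f -> Mb M g -> lift th (f ** g) = lift th f ** lift th g.
Proof.
move=> Mf Mg; apply: bfun_inj; rewrite -compB !lift_fun//; last exact: (vnM vMb).
by case: sh => _ _ h _; exact: h.
Qed.

Lemma lift_adj (f : B) : Mb M f -> lift th f^# = (lift th f)^#.
Proof.
move=> Mf; apply: bfun_inj; rewrite -adjE; last exact: (Mb_CB vM (lift_M Mf)).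
rewrite !lift_fun//; last exact: (vn_adj vMb).
by rewrite -(adjE (Mb_CB vM Mf)); case: sh => _ _ _ h; exact: h.
Qed.

End Lift.

Lemma normal_rep (R : realType) (H : hilbert R) (M : set (H -> H)) th : von_neumann_algebra M ->
 normal_endomorphism M th -> th idfun = idfun -> repn (Mb M) (lift th).
Proof.
move=> vM [sh hn] th1; have vMb := vnMb vM.
split; [exact: (lift_lin vM sh)|exact: (lift_mul vM sh)|exact: (lift_adj vM sh)| |].
- by rewrite /lift -[X in tob X]/(th idfun) th1; exact: (tobK bid).
- move=> k x l Mx x1 _ cx hk; have Ml := vn_scv vMb Mx cx.
 have bl : bnd l 1.
  split=> // u; apply: (conv_nrm_le (cx u)) => n; exact: (ble1_bnd (x1 n)).2.
 have pr := hn _ (predual_vec M k k).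
 apply/eqP; rewrite -normr_eq0 eq_le normr_ge0 andbT; apply: eps_le => d d0; rewrite add0r.
 have [n hn'] := predual_scv pr Mx Ml (fun n => ble1_bnd (x1 n)) bl cx d0.
 move: hn'; rewrite /= -!(lift_fun vM sh)// !hdotii hk => /ltW; rewrite normc_def lecR /=; apply: le_trans.
 by rewrite sub0r sqrrN -[leLHS]sqrtr_sqr ler_sqrt ?lerDl ?sqr_ge0// addr_ge0 ?sqr_ge0.
Qed.

Definition cj (R : realType) (K L : hilbert R) (A : bop (rH K) (rH L)) (T : K -> K) : L -> L :=
 fun u => A (T (A^# u)).

Section Conjugation.
Context {R : realType} {K L : hilbert R}.
Variable A : bop (rH K) (rH L).
Hypotheses (Al : A^# ** A = bid) (Ar : A ** A^# = bid) (Ai : A ** ii = ii ** A).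

Lemma unitary_ii : A^# ** ii = ii ** A^#.
Proof. by rewrite -[LHS]bc1r -Ar -bcA (bcA ii) -Ai !bcA Al bc1l. Qed.

Lemma unitary_nrm u : nrm (A^# u) = nrm u.
Proof. by rewrite /nrm badjE badjK -[A (A^# u)]/((A ** A^#) u) Ar. Qed.

Lemma cj_hom : star_hom (bounded_ops K) (bounded_ops L) (cj A).
Proof.
have cA f : CB ii f -> CB ii (A ** f ** A^#).
 by move=> cf; rewrite /CB -bcA unitary_ii bcA -(bcA A) cf !bcA Ai.
split=> [_ /bounded_bop [f cf ->]|c x y _ _|x y _ _|_ /bounded_bop [f cf ->]].
- exact: (bop_bounded (cA _ cf)).
- apply/funext => u; rewrite /cj -[RHS]/(c *: (A (x (A^# u)) : L) + A (y (A^# u))).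
 rewrite -[(_ + _) (A^# u)]/(c *: (x (A^# u) : K) + y (A^# u)) !cscale bD bD !bZ.
 by rewrite -[A (ii _)]/((A ** ii) _) Ai.
- by apply/funext => u; rewrite /cj /= -[A^# (A _)]/((A^# ** A) _) Al.
- rewrite adjE//; apply: etrans (esym (adjE (cA _ cf))); rewrite !badjM badjK bcA //.
Qed.

Lemma cj_predual rho : predual (bounded_ops L) rho -> predual (bounded_ops K) (fun T => rho (cj A T)).
Proof.
move=> [xi [eta [h1 h2 h3]]]; exists (fun n => A^# (xi n)), (fun n => A^# (eta n)).
have nE (z : nat -> L) : (fun n => `|(A^# (z n) : K)| ^+ 2 : R[i]^o) = (fun n => `|z n| ^+ 2 : R[i]^o).
 by apply/funext => n; rewrite normE unitary_nrm -normE.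
split; [by rewrite nE|by rewrite nE|move=> T bT].
have -> : (fun n => hdot K (T (A^# (xi n))) (A^# (eta n)) : R[i]^o) = (fun n => hdot L (cj A T (xi n)) (eta n) : R[i]^o).
 by apply/funext => n; rewrite !hdotii -[ii (A^# _)]/((ii ** A^#) _) -unitary_ii -!badjE.
by apply: h3; case: cj_hom => + _ _ _; exact.
Qed.

Lemma cjK T : cj A^# (cj A T) = T.
Proof.
have E u : A^# (A u) = u by rewrite -[LHS]/((A^# ** A) u) Al.
by apply/funext => u; rewrite /cj badjK !E.
Qed.

End Conjugation.

Lemma cj_iso (R : realType) (K L : hilbert R) (A : bop (rH K) (rH L)) :
 A^# ** A = bid -> A ** A^# = bid -> A ** ii = ii ** A -> star_iso (bounded_ops K) (bounded_ops L) (cj A).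
Proof.
move=> Al Ar Ai; have h := cj_hom Al Ar Ai; split=> //; split.
- by move=> T; case: h => + _ _ _; exact.
- by move=> S T _ _ /(congr1 (cj A^#)); rewrite !cjK.
- move=> T bT; exists (cj A^# T); last by apply: etrans (cjK (A := A^#) _ T); rewrite badjK.
 have [] := cj_hom (A := A^#) ltac:(by rewrite badjK) ltac:(by rewrite badjK) (unitary_ii Al Ar Ai).
 by move=> + _ _ _; exact.
Qed.

Lemma normal_cj (R : realType) (K L : hilbert R) (A C : bop (rH K) (rH L)) th :
 A^# ** A = bid -> A ** A^# = bid -> A ** ii = ii ** A -> C^# ** C = bid -> C ** C^# = bid -> C ** ii = ii ** C ->
 normal_endomorphism (bounded_ops K) th ->
 normal_endomorphism (bounded_ops L) (fun y => cj A (th (cj C^# y))).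
Proof.
move=> Al Ar Ai Cl Cr Ci [sh hn].
have Cl' : C^#^# ** C^# = bid by rewrite badjK.
have Cr' : C^# ** C^#^# = bid by rewrite badjK.
have Ci' := unitary_ii Cl Cr Ci; split.
 exact: (star_hom_comp (star_hom_comp (cj_hom Cl' Cr' Ci') sh) (cj_hom Al Ar Ai)).
by move=> rho h; exact: (cj_predual Cl' Cr' Ci' (hn _ (cj_predual Al Ar Ai h))).
Qed.

(** * Modular extensions *)

Section Standard.
Context {R : realType} {H : hilbert R} {M : set (H -> H)}.
Hypothesis vM : von_neumann_algebra M.
Local Notation B := (bop (rH H) (rH H)).
Let vMb := vnMb vM.

Section OneWeight.
Context {phi : (H -> H) -> \bar R} (G : gns M phi).
Local Notation K := (rH (gns_space G)).

Definition sP : B -> bop K K := gP (gns_pi G).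
Definition sJ : bop K K := wJ (gns_JP _ _ G).
(** The product of x in M and J z J in its commutant: a modular extension is prescribed exactly on
    these. *)
Definition gX (x z : B) : bop K K := sP x ** (sJ ** sP z ** sJ).

Hypothesis fw : fns_weight M phi.
Let hG := gnsP _ _ G.

Lemma sP_rep : repn (Mb M) sP. Proof. exact: (gP_rep vM fw hG). Qed.

Lemma sJ_inv : sJ ** sJ = bid /\ sJ^# = sJ.
Proof. by have [g /sf_polar pl] := gns_sform vM fw hG (gns_JP _ _ G); split; [exact: pl_JJ pl|exact: pl_J pl]. Qed.

Lemma sJ_ii : sJ ** ii = - (ii ** sJ).
Proof.
apply: bopP => u; have [[h _ _] _] := gns_JP _ _ G.
have := h 'i (u : gns_space G) 0; rewrite -[gns_J G 0]/(sJ 0) b0 !addr0 => e.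
rewrite -[LHS]/(gns_J G ('i *: (u : gns_space G))) e bopNE -[(ii ** sJ) u]/('i *: (gns_J G u : gns_space G)).
rewrite [X in X *: _](_ : _ = - 'i) ?scaleNr//; apply/eqP; rewrite eq_complex /= oppr0 !eqxx //.
Qed.

Lemma sP_ii : sP ii = ii.
Proof.
have Mi := Mb_ii vM; have M0 : Mb M (0 : B) := vn0 vMb; have M1 : Mb M (bid : B) := vn1 vMb.
apply: bfun_inj; rewrite (gPE hG Mi).
have -> : (ii : H -> H) = 'i *: ((bid : B) : H -> H) + ((0 : B) : H -> H).
 by apply/funext => u; rewrite -[RHS]/('i *: (u : H) + (0 : B) u) bop0E addr0.
have [[_ h _ _] _ _ _ _] := hG; rewrite h// -(gPE hG M1) -(gPE hG M0) (gP1 vM fw hG).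
have -> : gP (gns_pi G) (0 : B) = 0 by exact: (rp0 vMb sP_rep).
by apply/funext => u; rewrite -[LHS]/('i *: (u : gns_space G) + (0 : bop K K) u) bop0E addr0.
Qed.

Lemma gX_comm x z : Mb M x -> Mb M z -> sP x ** (sJ ** sP z ** sJ) = sJ ** sP z ** sJ ** sP x.
Proof.
move=> Mx Mz; have [g sf] := gns_sform vM fw hG (gns_JP _ _ G); have [e de] := @sep_seq _ H.
exact: (sf_comm vMb de sf).
Qed.

Lemma gXr_CB z : Mb M z -> CB ii (sJ ** sP z ** sJ).
Proof.
move=> Mz; rewrite /CB -bcA sJ_ii bcNr !bcA -(bcA sJ (sP z)) (gPCB hG Mz) bcA sJ_ii.
by rewrite !bcNl opprK.
Qed.

Lemma gX_CB x z : Mb M x -> Mb M z -> CB ii (gX x z).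
Proof. by move=> Mx Mz; apply: (vnM (vnCB sii)); [exact: (gPCB hG Mx)|exact: gXr_CB]. Qed.

Lemma gX_mul x z x' z' : Mb M x -> Mb M z -> Mb M x' -> Mb M z' ->
 gX x z ** gX x' z' = gX (x ** x') (z ** z').
Proof.
move=> Mx Mz Mx' Mz'; have [JJ _] := sJ_inv; rewrite /gX !(rp_mul sP_rep)//.
rewrite -bcA [(sJ ** sP z ** sJ) ** _]bcA -gX_comm// -!bcA; congr (_ ** (_ ** (_ ** (_ ** _)))).
by rewrite (bcA sJ sJ) JJ bc1l.
Qed.

Lemma gX_adj x z : Mb M x -> Mb M z -> (gX x z)^# = gX x^# z^#.
Proof.
move=> Mx Mz; have [_ Js] := sJ_inv; have rP := sP_rep; rewrite /gX (rp_adj rP Mx) (rp_adj rP Mz) -(rp_adj rP Mx) -(rp_adj rP Mz).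
rewrite gX_comm ?(vn_adj vMb Mx) ?(vn_adj vMb Mz)//; try exact: (vn_adj vMb).
by rewrite !badjM Js (rp_adj rP Mx) (rp_adj rP Mz) !bcA.
Qed.

Lemma gX1 : gX bid bid = bid.
Proof. by rewrite /gX !(rp_1 sP_rep) bc1r bc1l; case: sJ_inv. Qed.

Lemma gX_l x : gX x bid = sP x.
Proof. by rewrite /gX (rp_1 sP_rep) bc1r; case: sJ_inv => -> _; rewrite bc1r. Qed.

Lemma gX_ii : gX ii bid = ii. Proof. by rewrite gX_l sP_ii. Qed.

Lemma gX_fun x z : Mb M x -> Mb M z ->
 gX x z = gns_pi G x \o (gns_J G \o gns_pi G z \o gns_J G) :> (gns_space G -> gns_space G).
Proof. by move=> Mx Mz; rewrite -(gPE hG Mx) -(gPE hG Mz). Qed.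

Lemma mextE th th' : star_hom M M th -> modular_extension G th th' <->
 normal_endomorphism (bounded_ops (gns_space G)) th' /\
 forall x z : B, Mb M x -> Mb M z -> th' (gX x z) = gX (lift th x) (lift th z).
Proof.
move=> sh; have [JJ _] := sJ_inv; have gJJ u : gns_J G (gns_J G u) = u.
 exact: (congr1 (fun f : bop K K => f u) JJ).
have bM (T : H -> H) : M T -> exists2 f : B, Mb M f & T = f.
 by move=> MT; have [f _ e] := vN_bop vM MT; exists f => //; rewrite /Mb -e.
have tE x z (Mx : Mb M x) (Mz : Mb M z) := gX_fun (lift_M vM sh Mx) (lift_M vM sh Mz).
split=> -[hn h]; split=> //.
- move=> x z Mx Mz; rewrite gX_fun// tE// !(lift_fun vM sh)//; apply: h => //; last first.
  by apply/funext => u; rewrite /= !gJJ.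
 rewrite -(gPE hG Mz); split; first exact: (bop_bounded (gXr_CB Mz)).
 move=> _ [T /bM [f Mf ->] <-]; rewrite -(gPE hG Mf).
 exact: (congr1 (fun f : bop K K => f : gns_space G -> gns_space G) (esym (gX_comm Mf Mz))).
move=> _ y' _ /bM [x Mx ->] _ /bM [z Mz ->] e.
have -> : y' = gns_J G \o gns_pi G z \o gns_J G by rewrite e; apply/funext => u; rewrite /= !gJJ.
by rewrite -gX_fun// h// tE// !(lift_fun vM sh).
Qed.

End OneWeight.

Lemma std_iso (phi psi : (H -> H) -> \bar R) (G1 : gns M phi) (G2 : gns M psi) : fns_weight M phi -> fns_weight M psi ->
 exists V : bop (rH (gns_space G1)) (rH (gns_space G2)), [/\ V^# ** V = bid, V ** V^# = bid, V ** ii = ii ** V &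
  forall x z, Mb M x -> Mb M z -> V ** gX G1 x z = gX G2 x z ** V].
Proof.
move=> fw1 fw2; have [e de] := @sep_seq _ H.
have [g1 sf1] := gns_sform vM fw1 (gnsP _ _ G1) (gns_JP _ _ G1); have [g2 sf2] := gns_sform vM fw2 (gnsP _ _ G2) (gns_JP _ _ G2).
have [V [V1 V2 VP VJ]] := sf_unique vMb de sf1 sf2; exists V; split=> //.
 by rewrite -(sP_ii G1 fw1) VP; [rewrite -/(sP G2 ii) (sP_ii G2 fw2)|exact: Mb_ii].
by move=> x z Mx Mz; rewrite /gX bcA VP// -!bcA; congr (_ ** _); rewrite bcA VJ -bcA (bcA V) VP// -bcA VJ !bcA.
Qed.

(** A perturbation by U and a change of weight are treated together: gX U U implements Ad U on both
    factors of [gX], and V carries one [gX] to the other. It is applied with U = 1 and with V =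
    1. *)
Lemma mext_twist (phi psi : (H -> H) -> \bar R) (G1 : gns M phi) (G2 : gns M psi) th th2 th' (U : B)
  (V : bop (rH (gns_space G1)) (rH (gns_space G2))) : fns_weight M phi -> fns_weight M psi ->
 star_hom M M th -> star_hom M M th2 -> Mb M U -> U^# ** U = bid -> U ** U^# = bid ->
 (forall x, Mb M x -> lift th2 x = U ** lift th x ** U^#) ->
 V^# ** V = bid -> V ** V^# = bid -> V ** ii = ii ** V ->
 (forall x z, Mb M x -> Mb M z -> V ** gX G1 x z = gX G2 x z ** V) ->
 modular_extension G1 th th' -> modular_extension G2 th2 (fun y => cj (V ** gX G1 U U) (th' (cj V^# y))).
Proof.
move=> fw1 fw2 s1 s2 MU U1 U2 hU V1 V2 Vi VX /(mextE fw1 _ s1) [hn h]; apply/(mextE fw2 _ s2).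
have MU' := vn_adj vMb MU; set W := gX G1 U U.
have W1 : W^# ** W = bid by rewrite /W gX_adj// gX_mul// U1 gX1.
have W2 : W ** W^# = bid by rewrite /W gX_adj// gX_mul// U2 gX1.
split.
 apply: normal_cj => //; first by rewrite badjM bcA -(bcA W^#) V1 bc1r.
  by rewrite badjM bcA -(bcA V) W2 bc1r.
 by rewrite -bcA (gX_CB G1 MU MU) !bcA Vi.
move=> x z Mx Mz.
have -> : cj V^# (gX G2 x z) = gX G1 x z.
 rewrite -[LHS]/(fun u => (V^# ** gX G2 x z ** V^#^#) u); apply/funext => u.
 by rewrite badjK -bcA -VX// bcA V1 bc1l.
rewrite h// !hU//; have Mtx := lift_M vM s1 Mx; have Mtz := lift_M vM s1 Mz.
apply/funext => u; rewrite -[LHS]/((V ** W ** gX G1 (lift th x) (lift th z) ** (V ** W)^#) u).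
suff -> : V ** W ** gX G1 (lift th x) (lift th z) ** (V ** W)^# = gX G2 (U ** lift th x ** U^#) (U ** lift th z ** U^#) by [].
have MUx y : Mb M y -> Mb M (U ** y) by move=> My; exact: (vnM vMb).
have e : W ** gX G1 (lift th x) (lift th z) ** W^# = gX G1 (U ** lift th x ** U^#) (U ** lift th z ** U^#).
 by rewrite gX_adj// !gX_mul//; exact: MUx.
have -> : V ** W ** gX G1 (lift th x) (lift th z) ** (V ** W)^# =
  V ** (W ** gX G1 (lift th x) (lift th z) ** W^#) ** V^# by rewrite badjM !bcA.
by rewrite e VX; [rewrite -bcA V2 bc1r|apply: (vnM vMb) => //; exact: MUx..].
Qed.

Lemma vN_lin c x y : M x -> M y -> M (c *: x + y).
Proof.
move=> Mx My; have [f _ xE] := vN_bop vM Mx.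
have [g _ yE] := vN_bop vM My; rewrite xE yE in Mx My *; rewrite linB.
have Mi : Mb M (ii ** f) by apply: (vnM vMb) => //; exact: Mb_ii.
exact: (vnD vMb (vnD vMb (vnZ vMb _ Mx) (vnZ vMb _ Mi)) My).
Qed.

Lemma vN_comp x y : M x -> M y -> M (x \o y).
Proof.
move=> Mx My; have [f _ xE] := vN_bop vM Mx.
by have [g _ yE] := vN_bop vM My; rewrite xE yE in Mx My *; exact: (vnM vMb Mx My).
Qed.

Lemma star_iso_inv ga : star_iso M M ga ->
 exists de, [/\ star_iso M M de, forall x, M x -> ga (de x) = x & forall x, M x -> de (ga x) = x].
Proof.
move=> [[g1 g2 g3 g4] [_ gi gs]].
pose de T : H -> H := xget T [set x | M x /\ ga x = T].
have spec T : M T -> M (de T) /\ ga (de T) = T.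
 by move=> /gs [x Mx e]; exact: (@xgetPex _ T [set x | M x /\ ga x = T] (ex_intro _ x (conj Mx e))).
have inj x y : M x -> M y -> ga x = ga y -> x = y by move=> Mx My; apply: gi; rewrite inE.
have dg x : M x -> de (ga x) = x.
 by move=> Mx; have [h1 h2] := spec _ (g1 _ Mx); apply: inj.
exists de; split=> //; last by move=> x /spec[].
split; last first.
 split; [by move=> x /spec[]| |].
  by move=> x y /set_mem /spec[_ {2}<-] /set_mem /spec[_ {2}<-] ->.
 by move=> x Mx; exists (ga x); [exact: g1|exact: dg].
split=> [x /spec[]//|c x y Mx My|x y Mx My|x Mx].
- have [a1 a2] := spec x Mx; have [b1 b2] := spec y My.
 by rewrite -{1}a2 -{1}b2 -g2// dg//; exact: vN_lin.
- have [a1 a2] := spec x Mx; have [b1 b2] := spec y My.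
 by rewrite -{1}a2 -{1}b2 -g3// dg//; exact: vN_comp.
- have [a1 a2] := spec x Mx; rewrite -{1}a2 -g4// dg//.
 by case: vM => _ + _; exact.
Qed.

Lemma vN_sqrt (f : B) : Mb M f -> bpos f -> exists2 s : B, Mb M s & f = s^# ** s.
Proof.
move=> Mf pf; have [C bC] := bop_bnd f; have C1 : 0 < C + 1 by have := bC.1; lra.
have b1 : ble1 ((C + 1)^-1 *: f).
 apply: bnd_ble1; first by apply: bposZ; rewrite ?invr_ge0 ?ltW.
 split=> // u; rewrite bopZE nrmZ ger0_norm ?invr_ge0 ?(ltW C1)// mul1r ler_pdivrMl//.
 by apply: le_trans (bC.2 u) _; rewrite ler_wpM2r ?nrm_ge0//; lra.
have [_ [[s1 _] _] ss] := bsqrt_spec b1; set s := bsqrt _ in s1 ss.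
exists (Num.sqrt (C + 1) *: s); first by apply: (vnZ vMb); apply: (vn_sqrt vMb) => //; exact: (vnZ vMb).
rewrite badjZ s1 bcZl bcZr ss scalerA -expr2 sqr_sqrtr ?(ltW C1)// scalerA mulfV ?scale1r//.
exact: lt0r_neq0.
Qed.

Lemma hom_pos h (f : B) : star_hom M M h -> Mb M f -> bpos f -> bpos (lift h f).
Proof.
move=> sh Mf pf; have [s Ms ->] := vN_sqrt Mf pf.
by rewrite (lift_mul vM sh (vn_adj vMb Ms) Ms) (lift_adj vM sh Ms); exact: bpos_adjl.
Qed.

Lemma hom_cone h x : star_hom M M h -> positive_cone M x -> positive_cone M (h x).
Proof.
move=> sh [Mx]; have [f cf xE] := vN_bop vM Mx; rewrite xE in Mx * => /(posE cf) pf.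
by rewrite -(lift_fun vM sh Mx); apply: (coneE vM); [exact: (lift_M vM sh)|exact: hom_pos].
Qed.

Lemma hom_le h x y : star_hom M M h -> M x -> M y -> op_le x y -> op_le (h x) (h y).
Proof.
move=> sh Mx My l; have E (a b : H -> H) : a - b = -1 *: b + a by rewrite scaleN1r addrC.
have Md : M (y - x) by rewrite E; exact: vN_lin.
have [_] := hom_cone sh (conj Md l : positive_cone M (y - x)).
by rewrite /op_le !E; case: sh => _ -> // _ _.
Qed.

Lemma hom0 h : star_hom M M h -> h 0 = 0.
Proof.
move=> [_ hl _ _]; have M0 : M (0 : H -> H).
 by have -> : (0 : H -> H) = (0 : B); [apply/funext => u; rewrite bop0E|exact: (vn0 vMb)].
by have := hl (-1) 0 0 M0 M0; rewrite scaler0 addr0 scaleN1r addNr.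
Qed.

(** The ideal also acts nondegenerately on finite powers of H, so one b nearly fixes finitely many
    vectors. *)
Lemma ideal_approx n (T : finType) (h : T -> rH H) (d : R) : ideal (Mb M) n -> 0 < d ->
 exists2 b, n b & forall j, nrm (h j - b (h j)) < d.
Proof.
move=> nI d0; pose v : pw T (rH H) := [ffun j => h j].
pose S : set (pw T (rH H)) := fun u => exists2 b, n b & u = pdiag T b v.
have vE j : v j = h j by rewrite /v ffunE.
have pl (c : R) (b e : B) : pdiag T (c *: b + e) = c *: pdiag T b + pdiag T e.
 by apply: bopP => u; apply/ffunP => j; rewrite pdiagE bopDE bopZE bopDE bopZE ppr_lin !pdiagE.
have p0 : pdiag T (0 : B) = 0.
 by have := pl (-1) 0 0; rewrite scaler0 addr0 scaleN1r addNr.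
have sS : subsp S.
 split; first by exists 0; rewrite ?p0 ?bop0E//; exact: (id_0 nI).
 move=> c _ _ [a na ->] [b nb ->]; exists (c *: a + b); first exact: (id_lin nI).
 by rewrite pl bopDE bopZE.
have inv c u : Mb M c -> scl S u -> scl S (pdiag T c u).
 move=> Mc /scl_seq [x hx cx] e e0; have [N hN] := bop_conv (pdiag T c) cx e0.
 have [b nb xb] := hx N; exists (pdiag T c (x N)); last by rewrite nrmB; exact: hN.
 exists (c ** b); first exact: (id_l nI).
 by rewrite xb; apply/ffunP => j; rewrite !pdiagE.
have [a ca ho] := projection v (scl_subsp sS) (@scl_closed _ _ S).
have w0 : v - a = 0.
 apply/ffunP => j; rewrite [RHS]ffunE; apply: (id_nd nI) => b nb; have Mbb := id_M nI nb.
 suff z : pdiag T b (v - a) = 0 by have := congr1 (fun u : pw T (rH H) => u j) z; rewrite pdiagE [RHS]ffunE.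
 have h1 : scl S (pdiag T b (v - a)).
  rewrite bB addrC -scaleN1r; apply: (scl_subsp sS).2; first exact: inv.
  by move=> e e0; exists (pdiag T b v); [exists b|rewrite subrr nrm0].
 by apply: ip_eq0; rewrite badjEr pdiag_adj ipC; apply: ho; apply: inv => //; exact: (vn_adj vMb).
have av : a = v by move: w0 => /subr0_eq.
have [_ [b nb ->] hb] := ca d d0; exists b => // j; apply: le_lt_trans hb; rewrite av -vE -(@pdiagE _ T).
suff <- : (v - pdiag T b v) j = v j - pdiag T b v j by exact: nrm_pw.
by rewrite addrC -scaleN1r ppr_lin scaleN1r addrC.
Qed.

(** The strong topology enters through the filter of finite boxes around [x]. *)
Lemma ideal_dense n : ideal (Mb M) n -> M `<=` closure ([set T : H -> H | exists2 b : B, n b & T = b] : set {ptws H -> H}).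
Proof.
move=> nI x Mx; have [f cf xE] := vN_bop vM Mx; rewrite xE in Mx * => {x xE}.
pose F : set_system {ptws H -> H} := fun S => exists (s : seq H) (d : R), 0 < d /\
 forall b : B, n b -> (forall h, h \in s -> nrm (f h - b h) < d) -> S (b : H -> H).
have FF : Filter F.
 split.
 - by exists [::], 1.
 - move=> P Q [s [d [d0 h]]] [s' [d' [d0' h']]]; exists (s ++ s'), (Num.min d d'); split; first by rewrite lt_min d0.
  move=> b nb hb; split; [apply: h => // k ks|apply: h' => // k ks].
   by have := hb k ltac:(by rewrite mem_cat ks); rewrite lt_min => /andP[].
  by have := hb k ltac:(by rewrite mem_cat ks orbT); rewrite lt_min => /andP[].
 - by move=> P Q PQ [s [d [d0 h]]]; exists s, d; split=> // b nb hb; exact/PQ/h.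
have cv : {ptws, F --> (f : H -> H)}.
 apply/pointwise_cvgP => t; apply/cvgrPdist_lt => e /Ceps [d d0 ->]; exists [:: t], d; split=> // b nb hb.
 by rewrite (nrm_ltC (f t - b t)); apply: hb; rewrite mem_seq1.
move=> S /cv [s [d [d0 hS]]].
have [C bC] := bop_bnd f; have C1 : 0 < C + 1 by have := bC.1; lra.
have [b nb hb] := @ideal_approx n 'I_(size s) (fun j => nth 0 s j : rH H) _ nI (divr_gt0 d0 C1).
exists ((f ** b : B) : H -> H); split; first by exists (f ** b) => //; exact: (id_l nI).
apply: hS => [|h hs]; first exact: (id_l nI).
have := hb (Ordinal (n := size s) (m := index h s) ltac:(by rewrite index_mem)); rewrite /= nth_index// ltr_pdivlMr// => hq.
suff : nrm (f ((h : rH H) - b h)) < d by rewrite bB.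
apply: le_lt_trans (bC.2 _) _; apply: le_lt_trans hq; rewrite mulrC ler_wpM2l ?nrm_ge0//; lra.
Qed.

(** An automorphism and its inverse both preserve order, hence limits of increasing sequences:
    normality is automatic. *)
Lemma iso_rep ga : star_iso M M ga -> repn (Mb M) (lift ga).
Proof.
move=> ig; have [sg _] := ig.
have [de [[sd _] gd dg]] := star_iso_inv ig.
have ld f : Mb M f -> lift de (lift ga f) = f.
 by move=> Mf; apply: bfun_inj; rewrite (lift_fun vM sd (lift_M vM sg Mf)) (lift_fun vM sg Mf) dg.
have gl f : Mb M f -> lift ga (lift de f) = f.
 by move=> Mf; apply: bfun_inj; rewrite (lift_fun vM sg (lift_M vM sd Mf)) (lift_fun vM sd Mf) gd.
have M1 : Mb M (bid : B) := vn1 vMb.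
have g1 : lift ga bid = bid.
 have e f : Mb M f -> lift ga bid ** f = f.
  by move=> Mf; rewrite -{1}(gl f Mf) -(lift_mul vM sg M1 (lift_M vM sd Mf)) bc1l gl.
 by rewrite -[LHS]bc1r; exact: e.
have lB h f g : star_hom M M h -> Mb M f -> Mb M g -> lift h (f - g) = lift h f - lift h g.
 by move=> sh Mf Mg; rewrite addrC -scaleN1r (lift_lin vM sh)// scaleN1r addrC.
split; [exact: (lift_lin vM sg)|exact: (lift_mul vM sg)|exact: (lift_adj vM sg)|exact: g1|].
move=> k x l Mx x1 inc cx hk; have Ml := vn_scv vMb Mx cx.
have pl n : bpos (l - x n).
 have [l' [cl' _ _ hl]] := monotone_scv (fun n => (x1 n).1) (fun n => ble1_bnd (x1 n)) inc.
 by rewrite (scv_uniq cx cl').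
have Mg n := lift_M vM sg (Mx n).
have b1 n : bnd (lift ga (x n)) 1.
 apply: ble1_bnd; split; first exact: (hom_pos sg (Mx n) (x1 n).1).
 have := hom_pos sg (vnB vMb M1 (Mx n)) (ble1_compl (x1 n)).1; rewrite lB// g1 => -[_ h] u.
 by have := h u; rewrite bopBE ipDl ipNl subr_ge0.
have inc' n : bpos (lift ga (x n.+1) - lift ga (x n)).
 by rewrite -lB//; apply: hom_pos => //; exact: (vnB vMb).
have [l' [cl' pl' _ hl']] := monotone_scv (fun n => hom_pos sg (Mx n) (x1 n).1) b1 inc'.
have Ml' := vn_scv vMb Mg cl'.
have [l0 [cl0 pl0 _ _]] := monotone_scv (fun n => (x1 n).1) (fun n => ble1_bnd (x1 n)) inc.
have {}pl0 : bpos l by rewrite (scv_uniq cx cl0).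
have Md := lift_M vM sd Ml'.
have le2 : bpos (lift de l' - l).
 split=> [|u]; first by rewrite /bsa badjB -(lift_adj vM sd Ml') pl'.1 pl0.1.
 rewrite bopBE ipDl ipNl subr_ge0; apply: (conv_ip_le (cx u)) => n.
 have [_ h] := hom_pos sd (vnB vMb Ml' (Mg n)) (hl' n).
 by have := h u; rewrite lB// ld// bopBE ipDl ipNl subr_ge0.
have [_ h] := hom_pos sg (vnB vMb Md Ml) le2; have := h k; rewrite lB// gl// bopBE ipDl ipNl.
rewrite (conv_ip_eq (cl' k) hk) sub0r oppr_ge0 => h1.
by apply/eqP; rewrite eq_le h1 (hom_pos sg Ml pl0).2.
Qed.

Section Transport.
Variables (ga : (H -> H) -> (H -> H)) (phi : (H -> H) -> \bar R).
Hypotheses (ig : star_iso M M ga).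
Let sg : star_hom M M ga. Proof. by case: ig. Qed.

Lemma iso_ideal x : M x -> weight_ideal M (phi \o ga) x <-> weight_ideal M phi (ga x).
Proof.
move=> Mx; have [g1 g2 g3 g4] := sg; have Ma : M (adj x) by case: vM => _ + _; exact.
by split=> -[_ h]; (split; [auto|move: h; rewrite /= g3// g4]).
Qed.

(** The algebraic and order axioms are transported directly. For semifiniteness, the ideal of phi o
    ga is nondegenerate since the inverse of ga is a normal representation, and [ideal_dense] turns
    this into strong density. *)
Lemma iso_fns : fns_weight M phi -> fns_weight M (phi \o ga).
Proof.
have [de [id' gd dg]] := star_iso_inv ig; have sd : star_hom M M de by case: id'.
move=> fw; have [[w1 w2 w3] wf wno wsf] := fw; have [g1 g2 g3 g4] := sg.
have cM x : positive_cone M x -> M x by case.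
split.
- split=> [x cx|x y cx cy|c x c0 cx] /=; first exact: w1 (hom_cone sg cx).
  rewrite -w2; try exact: hom_cone; congr phi.
  by have := g2 1 x y (cM _ cx) (cM _ cy); rewrite !scale1r.
 rewrite -w3//; last exact: hom_cone.
 have M0 : M (0 : H -> H) by have := vN_lin (-1) (cM _ cx) (cM _ cx); rewrite scaleN1r addNr.
 by congr phi; have := g2 c%:C x 0 (cM _ cx) M0; rewrite (hom0 sg) !addr0.
- by move=> x cx /= h; rewrite -(dg x (cM _ cx)) (wf _ (hom_cone sg cx) h) (hom0 sd).
- move=> D x Dc [[x0 Dx0] dD] [xc xu xl] /=; rewrite (_ : _ @` D = phi @` (ga @` D)); last by rewrite image_comp.
 have DM y : D y -> M y by move=> /Dc [].
 apply: wno.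
 + by move=> _ [y Dy <-]; apply: hom_cone => //; exact: Dc.
 + split; first by exists (ga x0), x0.
  move=> _ _ [a Da <-] [b Db <-]; have [z [Dz az bz]] := dD a b Da Db.
  by exists (ga z); split; [exists z|apply: (hom_le sg); auto..].
 + split; first exact: hom_cone.
   by move=> _ [y Dy <-]; apply: (hom_le sg); auto.
  move=> z cz hz; rewrite -(gd z (cM _ cz)); have cd := hom_cone sd cz.
  apply: (hom_le sg); auto; apply: xl => // y Dy; rewrite -(dg y (DM _ Dy)).
  by apply: (hom_le sd); auto; apply: hz; exists y.
have nI := wn_ideal vM fw; have Msq f : Mb M f -> ga (f^# ** f : B) = (lift ga f)^# ** lift ga f.
 move=> Mf; have Ml := vnM vMb (vn_adj vMb Mf) Mf; rewrite -(lift_fun vM sg Ml).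
 by rewrite (lift_mul vM sg (vn_adj vMb Mf) Mf) (lift_adj vM sg Mf).
have wE (f : B) : weight_ideal M (phi \o ga) f <-> Mb M f /\ @wn _ _ M phi (lift ga f).
 split=> [[Mf]|[Mf /(wnE vM) [_ h]]].
  rewrite /= (adjE (Mb_CB vM Mf)) compB Msq// => h; split=> //; apply/(wnE vM); split=> //.
  exact: (lift_M vM sg).
 by split=> //; rewrite /= (adjE (Mb_CB vM Mf)) compB Msq.
pose n (f : B) := weight_ideal M (phi \o ga) f.
have nJ : ideal (Mb M) n.
 split.
 - by move=> a /wE [].
 - have M0 : Mb M (0 : B) := vn0 vMb; apply/wE; split=> //.
  rewrite (_ : lift ga 0 = 0); first exact: (id_0 nI).
  by have := lift_lin vM sg (-1) M0 M0; rewrite scaler0 addr0 scaleN1r addNr.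
 - move=> c a b /wE [Ma na] /wE [Mb' nb]; apply/wE; split; first exact: (vn_lin vMb).
  by rewrite (lift_lin vM sg)//; exact: (id_lin nI).
 - move=> a b Ma /wE [Mb' nb]; apply/wE; split; first exact: (vnM vMb).
  by rewrite (lift_mul vM sg)//; apply: (id_l nI) => //; exact: (lift_M vM sg).
 - move=> h hn; have [e e_d] := @sep_seq _ H.
  have rd := iso_rep id'.
  apply: (core_nd vMb e_d nI rd) => a [na _]; have Ma := id_M nI na; apply: hn; apply/wE; split.
   exact: (lift_M vM sd).
  rewrite (_ : lift ga (lift de a) = a)//; apply: bfun_inj.
  by rewrite (lift_fun vM sg (lift_M vM sd Ma)) (lift_fun vM sd Ma) gd.
move=> x Mx; have := ideal_dense nJ Mx; apply: closure_subset => _ [b nb ->] //.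
Qed.

Lemma iso_image : weight_ideal M (phi \o ga) `<=` M /\ ga @` M = M /\
 ga @` weight_ideal M (phi \o ga) = weight_ideal M phi.
Proof.
have [_ [_ _ gs]] := ig; have [g1 _ _ _] := sg; split; first by move=> x [].
split; apply/seteqP; split=> y.
- by move=> [x Mx <-]; exact: g1.
- by move=> /gs [x Mx <-]; exists x.
- by move=> [x nx <-]; apply/iso_ideal => //; case: nx.
- by move=> [/gs [x Mx <-] h]; exists x => //; apply/iso_ideal => //; split=> //; exact: g1.
Qed.

Variable G : gns M phi.

Lemma iso_gns_rep : gns_representation M (phi \o ga) (gns_pi G \o ga) (gns_Lambda G \o ga).
Proof.
have [h1 h2 h3 h4 h5] := gnsP _ _ G; have [g1 g2 g3 g4] := sg; have [sub [_ im]] := iso_image.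
have nI x : weight_ideal M (phi \o ga) x -> weight_ideal M phi (ga x) by move=> nx; apply/iso_ideal => //; exact: sub.
have Ma x : M x -> M (adj x) by case: vM => _ + _; exact.
split=> /=; first exact: star_hom_comp sg h1.
- by move=> c x y nx ny; rewrite g2 ?h2//; auto.
- by move=> x nx; have Mx := sub _ nx; rewrite (h3 _ (nI _ nx)) (g3 _ _ (Ma _ Mx) Mx) (g4 _ Mx).
- by rewrite -image_comp im.
- by move=> x y Mx ny; rewrite (h5 _ _ (g1 _ Mx) (nI _ ny)) (g3 _ _ Mx (sub _ ny)).
Qed.

Lemma iso_gns_J : modular_conjugation M (phi \o ga) (gns_Lambda G \o ga) (gns_J G).
Proof.
have [aJ [A pA SE]] := gns_JP _ _ G; split=> //; exists A => //; rewrite -SE; congr closure.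
have [g1 g2 g3 g4] := sg; have [_ [imM im]] := iso_image.
have Ma x : M x -> M (adj x) by case: vM => _ + _; exact.
apply/seteqP; split=> _ [x [nx nx'] <-].
 have Mx : M x by case: nx.
 exists (ga x); last by rewrite /= g4.
 by split; [apply/iso_ideal|rewrite -g4//; apply/iso_ideal; auto].
have [y ny yE] : (ga @` weight_ideal M (phi \o ga)) x by rewrite im.
have My : M y by case: ny.
exists y; last by rewrite /= g4// yE.
by split=> //; apply/iso_ideal; [exact: Ma|rewrite g4// yE].
Qed.

(** The GNS data of phi o ga live on the same space with the same J, so conjugation leaves a modular
    extension unchanged as a map. *)
Definition iso_gns : gns M (phi \o ga) := @Gns _ _ _ _ _ _ _ _ iso_gns_rep iso_gns_J.

Lemma iso_ext th th2 th' : (forall x, M x -> M (th2 x)) -> (forall x, M x -> ga (th2 x) = th (ga x)) ->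
 modular_extension G th th' -> modular_extension iso_gns th2 th'.
Proof.
move=> h2 hc [hn h]; split=> // x y' z Mx cy Mz /= e; have [_ [imM _]] := iso_image.
have [g1 _ _ _] := sg; rewrite !hc//; apply: h; auto.
by move: cy; rewrite /= -image_comp imM.
Qed.

End Transport.
End Standard.

Lemma ctat_bop (R : realType) (K L : rhilb R) (T : bop K L) (f : R -> K) t : ctat f t -> ctat (fun s => T (f s)) t.
Proof.
move=> cf d d0; have [C bC] := bop_bnd T; have C1 : 0 < C + 1 by have := bC.1; lra.
have [r r0 hr] := cf _ (divr_gt0 d0 C1); exists r => // s s0 st; have := hr s s0 st; rewrite ltr_pdivlMr// => h.
by rewrite -bB; apply: le_lt_trans (bC.2 _) _; apply: le_lt_trans h; rewrite mulrC ler_wpM2l ?nrm_ge0//; lra.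
Qed.

Lemma ctat_rep (R : realType) (H K : rhilb R) (M : bop H H -> Prop) (P : bop H H -> bop K K) (e : nat -> H)
  (F : R -> bop H H) (C t : R) k : vnalg M -> repn M P -> dns (range e) -> 0 <= t ->
 (forall s, 0 <= s -> M (F s)) -> (forall s, 0 <= s -> bnd (F s) C) ->
 (forall u, ctat (fun s => F s u) t) -> ctat (fun s => P (F s) k) t.
Proof.
move=> vM rP de t0 MF bF cF d d0; apply: contrapT => hn.
have /choice[s hs] (n : nat) : exists s, [/\ 0 <= s, `|s - t| < n.+1%:R^-1 & d <= nrm (P (F s) k - P (F t) k)].
 apply: contrapT => h; apply: hn; exists n.+1%:R^-1; first by rewrite invr_gt0.
 by move=> s s0 st; rewrite ltNge; apply/negP => ge; apply: h; exists s.
have sF : scv (fun n => F (s n)) (F t).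
 move=> u q q0; have [r r0 hr] := cF u q q0; have [N hN] := inv_small r0.
 by exists N => n Nn; have [s0 st _] := hs n; apply: hr => //; exact: lt_trans st (hN n Nn).
have s0 n : 0 <= s n by case: (hs n).
have [N hN] := rp_scv vM rP de (fun n => MF _ (s0 n)) (MF _ t0) (fun n => rp_bnd vM rP (MF _ (s0 n)) (bF _ (s0 n))) sF k d0.
by have := hN N (leqnn N); have [_ _] := hs N; rewrite leNgt => /negP.
Qed.

Section Extension.
Context {R : realType} {H : hilbert R} {M : set (H -> H)}.
Hypothesis fM : is_factor M.
Local Notation B := (bop (rH H) (rH H)).
Let vM : von_neumann_algebra M. Proof. by case: fM. Qed.
Let vMb := vnMb vM.

(** Weak continuity also holds for x^# x, so the norms |sg_s(x) u| are continuous, and weak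
    convergence with convergence of norms is strong. *)
Lemma E0_ctat sg (x : B) u t : E0_semigroup M sg -> Mb M x -> 0 <= t -> ctat (fun s => lift (sg s) x u) t.
Proof.
move=> [h1 _ _ h4] Mx t0.
have sh s : 0 <= s -> star_hom M M (sg s) by move=> /h1 [[]].
have w (y : B) k l (d : R) : Mb M y -> 0 < d -> exists2 r : R, 0 < r & forall s, 0 <= s -> `|s - t| < r ->
  `|ip (lift (sg s) y k) l - ip (lift (sg t) y k) l| < d.
 move=> My d0; have [r r0 hr] := (within_eps _).1 (h4 _ _ (predual_vec M k l) My) t t0 d d0.
 exists r => // s s0 st; have := hr s s0 st; rewrite -!(lift_fun vM (sh _ _) My)// => h.
 rewrite distrC -ltcR; apply: le_lt_trans h; apply: le_trans (normc_ge_Re _).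
 by rewrite raddfB.
move=> d d0; set y := fun s => lift (sg s) x.
have d4 : 0 < d ^+ 2 / 4 by rewrite divr_gt0 ?exprn_gt0.
have Mxx : Mb M (x^# ** x) := vnM vMb (vn_adj vMb Mx) Mx.
have [r r0 hr] := w _ u u _ Mxx d4; have [q q0 hq] := w _ u (y t u) _ Mx d4.
exists (Num.min r q); first by rewrite lt_min r0.
move=> s s0; rewrite lt_min => /andP[/(hr s s0) k1 /(hq s s0) k2].
have sq p : 0 <= p -> ip (lift (sg p) (x^# ** x) u) u = ip (y p u) (y p u).
 by move=> p0; rewrite (lift_mul vM (sh p p0) (vn_adj vMb Mx) Mx) (lift_adj vM (sh p p0) Mx); exact/esym/badjEr.
rewrite !sq// in k1; move: k1 k2; rewrite -!/(y _) !ltr_norml => /andP[_ k1] /andP[k2 _].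
suff : nrm (y s u - y t u) ^+ 2 < d ^+ 2 by rewrite ltr_pXn2r// ?nnegrE ?nrm_ge0 ?(ltW d0).
rewrite nrm2 ipDl !ipDr !ipNl !ipNr (ipC (y t u) (y s u)); move: (exprn_gt0 2 d0) => d2; lra.
Qed.

Section OneWeight.
Context {phi : (H -> H) -> \bar R} {G : gns M phi}.
Hypothesis fw : fns_weight M phi.
Local Notation K := (rH (gns_space G)).
Let M1 : Mb M (bid : B) := vn1 vMb.

Lemma gX_ctat (F1 F2 : R -> B) (C t : R) w : 0 <= t -> (forall s, 0 <= s -> Mb M (F1 s) /\ Mb M (F2 s)) ->
 (forall s, 0 <= s -> bnd (F1 s) C /\ bnd (F2 s) C) ->
 (forall u, ctat (fun s => F1 s u) t) -> (forall u, ctat (fun s => F2 s u) t) -> ctat (fun s => gX G (F1 s) (F2 s) w) t.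
Proof.
move=> t0 MF bF c1 c2; have rP := sP_rep vM G fw; have [e de] := @sep_seq _ H.
apply: (@ctat_mul _ _ (fun s => sP G (F1 s)) (fun s => sJ G ** sP G (F2 s) ** sJ G) C) => //.
- by move=> s s0; apply: (rp_bnd vMb rP); [case: (MF s s0)|case: (bF s s0)].
- by move=> u; apply: (ctat_rep u vMb rP de t0 (C := C)) => // s s0; [case: (MF s s0)|case: (bF s s0)].
apply: (@ctat_bop _ _ _ (sJ G) (fun s => sP G (F2 s) (sJ G w))).
by apply: (ctat_rep _ vMb rP de t0 (C := C)) => // s s0; [case: (MF s s0)|case: (bF s s0)].
Qed.

(** The span of [M J M J], which is irreducible as [M] is a factor. *)
Inductive gA : bop K K -> Prop :=
| gA0 : gA 0
| gAX c x z a : Mb M x -> Mb M z -> gA a -> gA (c *: gX G x z + a).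

Lemma gA_X x z : Mb M x -> Mb M z -> gA (gX G x z).
Proof. by move=> Mx Mz; rewrite -[gX _ _ _]addr0 -[gX _ _ _]scale1r; apply: gAX => //; exact: gA0. Qed.

Lemma gA_lin c a b : gA a -> gA b -> gA (c *: a + b).
Proof.
move=> ha hb; elim: ha => [|k x z a' Mx Mz _ IH]; first by rewrite scaler0 add0r.
by rewrite scalerDr scalerA -addrA; exact: gAX.
Qed.

Lemma gA_CB a : gA a -> CB ii a.
Proof.
elim=> [|c x z a' Mx Mz _ IH]; first exact: (vn0 (vnCB sii)).
by apply: (vn_lin (vnCB sii)) => //; exact: gX_CB.
Qed.

Lemma gA_irred : irred_alg ii gA.
Proof.
have Mi := Mb_ii vM; have Aii : gA ii by rewrite -(gX_ii vM G fw); exact: gA_X.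
have Aadj a : gA a -> gA a^#.
 elim=> [|c x z a' Mx Mz _ IH]; first by rewrite badj0; exact: gA0.
 by rewrite badjD badjZ (gX_adj vM G fw Mx Mz); apply: gAX => //; exact: (vn_adj vMb).
split; [exact: gA_CB|by rewrite -(gX1 vM G fw); exact: gA_X|exact: Aii|exact: gA_lin| |exact: Aadj|].
- move=> a b ha hb; elim: ha => [|c x z a' Mx Mz _ IH]; first by rewrite bc0l; exact: gA0.
 rewrite bcDl bcZl; apply: gA_lin => //.
 elim: hb {IH} => [|c' x' z' b' Mx' Mz' _ IH]; first by rewrite bc0r; exact: gA0.
 by rewrite bcDr bcZr (gX_mul vM G fw Mx Mz Mx' Mz'); apply: gAX => //; exact: (vnM vMb).
apply: (schur Aadj sii iiii Aii) => [a /gA_CB//|p sp pp hp].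
have [g sf] := gns_sform vM fw (gnsP _ _ G) (gns_JP _ _ G); have [e de] := @sep_seq _ H.
apply: (sf_proj vMb de sf) => // [q Mq qc _ qq|a Ma|a Ma].
- have : (M `&` commutant M) q.
  split=> //; split; first exact: (bop_bounded (Mb_CB vM Mq)).
  move=> x Mx; have [f _ xE] := vN_bop vM Mx; rewrite xE in Mx *.
  by rewrite !compB (qc _ Mx).
 case: fM => _ -> [c qE]; have cE u : q u = c *: (u : H) by rewrite qE.
 (* If the scalar c is not 0 or 1, then q q = q forces H to be the zero space, where q = 0. *)
 have [/eqP|c0] := eqVneq (c * c - c) 0.
  rewrite -{3}[c]mulr1 -mulrBr mulf_eq0 subr_eq0 => /orP[]/eqP c0; [left|right]; apply: bopP => u.
   by rewrite cE c0 scale0r bop0E.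
  by rewrite cE c0 scale1r.
 left; apply: bopP => u; rewrite bop0E; have := congr1 (fun f : B => f u) qq.
 rewrite -[LHS]/(q (q u)) !cE scalerA => e0; have : (c * c - c) *: (u : H) = 0 by rewrite scalerBl [X in X - _]e0 subrr.
 by move/eqP; rewrite scaler_eq0 (negPf c0) /= => /eqP ->; rewrite scaler0.
- by have := hp _ (gA_X Ma M1); rewrite (gX_l vM G fw).
- by have := hp _ (gA_X M1 Ma); rewrite /gX (rp_1 (sP_rep vM G fw)) bc1l.
Qed.

Lemma ext_unique (P Q : bop K K -> bop K K) : repn (CB ii) P -> repn (CB ii) Q ->
 (forall x z, Mb M x -> Mb M z -> P (gX G x z) = Q (gX G x z)) -> forall T, CB ii T -> P T = Q T.
Proof.
move=> rP rQ h; have [e de] := @sep_seq _ (gns_space G).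
apply: (rep_unique sii iiii de gA_irred rP rQ) => a; elim=> [|c x z a' Mx Mz ha IH].
 by rewrite (rp0 (vnCB sii) rP) (rp0 (vnCB sii) rQ).
by rewrite (rp_lin rP) ?(rp_lin rQ) ?h ?IH//; try exact: gX_CB; exact: gA_CB.
Qed.

(** The semigroup law and the value at 0 hold on the [gX] and extend by [ext_unique]. On [gA] the
    orbits are continuous because those in M are; [semigroup_continuous] reaches all bounded
    operators. *)
Lemma E0_of_ext sg sg' : E0_semigroup M sg -> E0_modular_extension G sg sg' ->
 E0_semigroup (bounded_ops (gns_space G)) sg'.
Proof.
move=> E hx; have [h1 h2 h3 _] := E.
have sh t (t0 : 0 <= t) : star_hom M M (sg t) by case: (h1 t t0) => -[].
have nx t (t0 : 0 <= t) : normal_endomorphism (bounded_ops (gns_space G)) (sg' t) by case: (hx t t0).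
have X t (t0 : 0 <= t) := ((mextE vM fw (sg' t) (sh t t0)).1 (hx t t0)).2.
have rs t (t0 : 0 <= t) : repn (Mb M) (lift (sg t)) by have [n0 i0] := h1 t t0; exact: normal_rep.
have vK := vN_bounded (gns_space G).
have cbE f : CB ii f -> Mb (bounded_ops (gns_space G)) f by rewrite Mb_bounded.
have id1 t (t0 : 0 <= t) : sg' t idfun = idfun.
 have := X t t0 _ _ M1 M1; rewrite (rp_1 (rs t t0)) (gX1 vM G fw) //.
have nrep th : normal_endomorphism (bounded_ops (gns_space G)) th -> th idfun = idfun -> repn (CB ii) (lift th).
 by move=> n1 i1; have := normal_rep vK n1 i1; rewrite Mb_bounded.
have rx t (t0 : 0 <= t) := nrep _ (nx t t0) (id1 t t0).
have lf t (t0 : 0 <= t) f (cf : CB ii f) : lift (sg' t) f = sg' t f :> (gns_space G -> gns_space G).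
 by apply: (lift_fun vK); [case: (nx t t0)|exact: cbE].
have lX t (t0 : 0 <= t) x z : Mb M x -> Mb M z -> lift (sg' t) (gX G x z) = gX G (lift (sg t) x) (lift (sg t) z).
 by move=> Mx Mz; rewrite /lift X// tobK.
have law s t x (s0 : 0 <= s) (t0 : 0 <= t) : CB ii x -> lift (sg' s) (lift (sg' t) x) = lift (sg' (s + t)) x.
 pose cp T := sg' s (sg' t T); have st0 := addr_ge0 s0 t0.
 have cpE f : CB ii f -> lift cp f = lift (sg' s) (lift (sg' t) f).
  by move=> cf; rewrite -[RHS]/(tob (sg' s (lift (sg' t) f))) lf.
 move=> cx; rewrite -cpE//; apply: (ext_unique (P := lift cp)) => //.
 - apply: nrep; last by rewrite /cp !id1.
  have [a1 a2] := nx s s0; have [b1 b2] := nx t t0; split; first exact: star_hom_comp b1 a1.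
  by move=> rho hr; exact: b2 (a2 _ hr).
 - exact: rx.
 - move=> y z My Mz; rewrite cpE ?lX//; try exact: gX_CB; try exact: (lift_M vM (sh t t0)).
  have L f : Mb M f -> lift (sg s) (lift (sg t) f) = lift (sg (s + t)) f.
   by move=> Mf; rewrite -[LHS]/(tob (sg s (lift (sg t) f))) (lift_fun vM (sh t t0) Mf) h3.
  by rewrite !L.
have rid : repn (CB ii) (@id (bop K K)).
 split=> // k x l _ _ _ cx hk; exact: (conv_ip_eq (cx k) hk).
have ct x w t : CB ii x -> 0 <= t -> ctat (fun s => lift (sg' s) x w) t.
 have [e de] := @sep_seq _ (gns_space G).
 apply: (semigroup_continuous (al := fun t => lift (sg' t)) sii iiii de gA_irred) => //.
  move=> s f s0 cf; rewrite -Mb_bounded; apply: (lift_M vK); [by case: (nx s s0)|exact: cbE].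
 move=> a {}w {}t ha t0; elim: ha => [|c x' z' a' Mx Mz ha IH].
  apply: (@ctat_le _ _ _ (fun=> 0) t 0) => // [d d0|s s0]; first by exists 1 => // *; rewrite subrr nrm0.
  by rewrite !(rp0 (vnCB sii) (rx _ _))// subrr nrm0 mul0r.
 have ext (f g : R -> K) : (forall s, 0 <= s -> f s = g s) -> ctat f t -> ctat g t.
  by move=> fg cf d d0; have [r r0 hr] := cf d d0; exists r => // s s0; rewrite -!fg//; exact: hr.
 apply: (ext (fun s => c *: gX G (lift (sg s) x') (lift (sg s) z') w + lift (sg' s) a' w)).
  by move=> s s0; rewrite (rp_lin (rx s s0)) ?lX ?bopDE ?bopZE//; [exact: gX_CB|exact: gA_CB].
 apply: ctatD => //; apply: (@ctat_le _ _ _ (fun s => gX G (lift (sg s) x') (lift (sg s) z') w) t `|c|) => // [|s s0].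
  have [C1 b1] := bop_bnd x'; have [C2 b2] := bop_bnd z'.
  have mx (f : B) C C' : C <= C' -> bnd f C -> bnd f C'.
   by move=> CC [p q]; split=> [|u]; [exact: le_trans CC|apply: le_trans (q u) _; rewrite ler_wpM2r ?nrm_ge0].
  have le1 : C1 <= Num.max C1 C2 by rewrite le_max lexx.
  have le2 : C2 <= Num.max C1 C2 by rewrite le_max lexx orbT.
  apply: (gX_ctat (C := Num.max C1 C2)) => // [s s0|s s0|u|u].
  - by split; exact: (lift_M vM (sh s s0)).
  - by split; apply: (rp_bnd vMb (rs s s0)) => //; [exact: mx b1|exact: mx b2].
  - exact: E0_ctat.
  - exact: E0_ctat.
 by rewrite -scalerBr nrmZ.
split=> [t t0|x bx|s t x s0 t0 bx|rho x hr bx]; first by split; [exact: nx|exact: id1].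
- have [f cf ->] := bounded_bop bx; rewrite -lf//; suff -> : lift (sg' 0) f = f by [].
 apply: (ext_unique (P := lift (sg' 0)) (Q := id)) => // [|y z My Mz]; first exact: rx.
 have L g : Mb M g -> lift (sg 0) g = g by move=> Mg; rewrite /lift h2// tobK.
 by rewrite lX// !L.
- have [f cf ->] := bounded_bop bx; have st0 := addr_ge0 s0 t0.
 have c1 : CB ii (lift (sg' t) f) by rewrite -Mb_bounded; apply: (lift_M vK); [case: (nx t t0)|exact: cbE].
 have := congr1 (fun f : bop K K => f : gns_space G -> gns_space G) (law s t f s0 t0 cf).
 by rewrite (lf s s0 _ c1) (lf t t0 _ cf) (lf _ st0 _ cf).
have [f cf xE] := bounded_bop bx; rewrite xE; have [C bC] := bop_bnd f.
apply/within_eps => t t0 d d0.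
have [s s0|s s0|u|r r0 hr'] := predual_ctat (C := C) (F := fun s => lift (sg' s) f) hr _ t0 _ _ d0.
- by apply: (lift_M vK); [case: (nx s s0)|exact: cbE].
- exact: (rp_bnd (vnCB sii) (rx s s0)).
- exact: ct.
by exists r => // s s0 st; have := hr' s s0 st; rewrite !lf.
Qed.

End OneWeight.
End Extension.

(** * Cocycles and types *)

Section Cocycle.
Context {R : realType} {H : hilbert R} {M : set (H -> H)} {a b : R -> (H -> H) -> (H -> H)} {U : R -> H -> H}.
Hypotheses (vM : von_neumann_algebra M) (Ea : E0_semigroup M a) (cU : cocycle M a U).
Hypothesis bE : forall t x, 0 <= t -> M x -> b t x = U t \o a t x \o adj (U t).
Local Notation B := (bop (rH H) (rH H)).
Let vMb := vnMb vM.

Lemma E0_hom t : 0 <= t -> star_hom M M (a t).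
Proof. by case: Ea => h _ _ _ /h [[]]. Qed.

Lemma coc_bop t : 0 <= t -> exists u : B, [/\ Mb M u, U t = u, u^# ** u = bid, u ** u^# = bid & adj (U t) = u^#].
Proof.
move=> t0; have [h _ _] := cU; have [MU [bU e1 e2]] := h t t0.
have [u cu uE] := bounded_bop bU; rewrite uE in MU e1 e2 *; have aE := adjE cu; exists u; split=> //.
 by apply: bfun_inj; rewrite -compB -aE.
by apply: bfun_inj; rewrite -compB -aE.
Qed.

Lemma coc_ctat t w : 0 <= t -> ctat (fun s => U s w : rH H) t.
Proof.
move=> t0 d d0; have [_ h _] := cU; have [r r0 hr] := (within_eps _).1 (h w) t t0 d d0.
by exists r => // s s0 st; rewrite nrmB -nrm_ltC; exact: hr.
Qed.

(** The cocycle law at 0 reads U 0 = U 0 U 0, and U 0 is invertible. *)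
Lemma coc_0 : U 0 = idfun.
Proof.
have [_ _ h] := cU; have [u [Mu uE u1 u2 _]] := coc_bop (lexx 0).
have [_ h0 _ _] := Ea; have := h 0 0 (lexx 0) (lexx 0); rewrite addr0 h0; last by rewrite uE.
rewrite uE => e0; have e := bfun_inj (e0 : (u : H -> H) = (u ** u : B)).
have : u^# ** u = u^# ** u ** u by rewrite -bcA -e.
by rewrite u1 bc1l => <-.
Qed.

(** The adjoints undo the perturbation, so each invariance statement below needs only one
    implication. *)
Lemma coc_sym : cocycle M b (fun t => adj (U t)) /\
 forall t x, 0 <= t -> M x -> a t x = adj (U t) \o b t x \o adj (adj (U t)).
Proof.
have [_ _ h] := cU; split; last first.
 move=> t x t0 Mx; have [u [Mu uE u1 u2 uA]] := coc_bop t0; rewrite bE// uA uE (adjE (Mb_CB vM (vn_adj vMb Mu))) badjK.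
 have Max : M (a t x) by case: (E0_hom t0) => + _ _ _; exact.
 apply/funext => w; have e v : u^# (u v) = v by rewrite -[LHS]/((u^# ** u) v) u1.
 by rewrite /= !e.
split.
- move=> t t0; have [u [Mu uE u1 u2 uA]] := coc_bop t0; have Mu' := vn_adj vMb Mu; rewrite uA.
 have cu := Mb_CB vM Mu'; split=> //; split; first exact: bop_bounded.
  by rewrite adjE// badjK compB u2.
 by rewrite adjE// badjK compB u1.
- move=> w; apply/within_eps => t t0 d d0; have [u [Mu uE u1 u2 uA]] := coc_bop t0.
 have [r r0 hr] := coc_ctat (u^# w) t0 d0; exists r => // s s0 st; have := hr s s0 st.
 have [v [Mv vE v1 v2 vA]] := coc_bop s0; rewrite uA vA vE uE (nrm_ltC (u^# w - v^# w)).
 have uu : u (u^# w) = w by rewrite -[LHS]/((u ** u^#) w) u2.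
 rewrite uu => hlt; suff -> : nrm (u^# w - v^# w) = nrm (v (u^# w) - w) by [].
 have vi k : nrm (v k) = nrm k by rewrite /nrm badjEr -[v^# (v k)]/((v^# ** v) k) v1.
 by rewrite -vi bB -[v (v^# w)]/((v ** v^#) w) v2.
- move=> s t s0 t0; have [us [Mus usE us1 us2 usA]] := coc_bop s0.
 have [u [Mu uE u1 u2 uA]] := coc_bop t0; have Mus' := vn_adj vMb Mus.
 rewrite h// bE//; last by rewrite usA.
 have sh := E0_hom t0; rewrite usA uA usE uE -!(lift_fun vM sh)//.
 rewrite compB adjE; last by apply: (Mb_CB vM); apply: (vnM vMb) => //; exact: (lift_M vM sh).
 rewrite badjM -(lift_adj vM sh Mus); apply/funext => w.
 have e v : u^# (u v) = v by rewrite -[LHS]/((u^# ** u) v) u1.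
 by rewrite [RHS]/= e.
Qed.

End Cocycle.

Section Types.
Context {R : realType} {K : hilbert R} {a b : R -> (K -> K) -> (K -> K)} {U : R -> K -> K}.
Hypotheses (Ea : E0_semigroup (bounded_ops K) a) (cU : cocycle (bounded_ops K) a U).
Hypothesis bE : forall t x, 0 <= t -> bounded_ops K x -> b t x = U t \o a t x \o adj (U t).
Let vK := vN_bounded K.

Lemma bounded_comp (S T : K -> K) : bounded_ops K S -> bounded_ops K T -> bounded_ops K (S \o T).
Proof. exact: (vN_comp vK). Qed.

Let bU t (t0 : 0 <= t) : bounded_ops K (U t). Proof. by case: cU => h _ _; case: (h t t0). Qed.

Let bUa t (t0 : 0 <= t) x : bounded_ops K x -> b t x \o U t = U t \o a t x.
Proof.
move=> bx; rewrite bE//; have [u [Mu uE u1 u2 uA]] := coc_bop cU t0; rewrite uA uE.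
by apply/funext => w; rewrite /= -[u^# (u w)]/((u^# ** u) w) u1.
Qed.

Lemma coc_unit T : semigroup_unit a T -> semigroup_unit b (fun t => U t \o T t).
Proof.
move=> [h1 h2 h3 h4 h5]; have [_ _ hc] := cU; split.
- by move=> t t0; apply: bounded_comp; auto.
- move=> w; apply/within_eps => t t0 d d0.
 have /choice[f fP] (s : R) : exists g : bop (rH K) (rH K), 0 <= s -> [/\ CB ii g, U s = g & g^# ** g = bid].
  have [s0|s0] := boolP (0 <= s); last by exists bid.
  by have [u [Mu uE u1 _ _]] := coc_bop cU s0; exists u => _; split=> //; exact: (Mb_CB vK Mu).
 have c2 : ctat (fun s => T s w : rH K) t.
  move=> q q0; have [r r0 hr] := (within_eps _).1 (h2 w) t t0 q q0; exists r => // s s0 st.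
  by rewrite nrmB -nrm_ltC; exact: hr.
 have b1 s : 0 <= s -> bnd (f s) 1.
  move=> s0; have [_ _ e] := fP s s0; split=> // k; rewrite mul1r /nrm badjEr -[(f s)^# _]/(((f s)^# ** f s) k) e //.
 have c1 k : ctat (fun s => f s k) t.
  have := coc_ctat cU k t0; move=> c q q0; have [r r0 hr] := c q q0; exists r => // s s0 st.
  by have := hr s s0 st; have [_ -> _] := fP s s0; have [_ -> _] := fP t t0.
 have [|r r0 hr] := ctat_mul (B := fun s => tob (T s)) (w := w) t0 b1 c1 _ d0; last first.
  exists r => // s s0 st; have := hr s s0 st; have [_ e1 _] := fP s s0; have [_ e2 _] := fP t t0.
  by rewrite /= e1 e2 (nrm_ltC (f t (T t w) - f s (T s w))) nrmB !tobE; auto.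
 by move=> q q0; have [r r0 hr] := c2 q q0; exists r => // s s0 st; rewrite !tobE; auto.
- by rewrite h3 (coc_0 Ea cU).
(* The law is used as U (t + s) = U s o a_s(U t): the unit relation moves a_s(U t) past T s, which
   leaves U s T s U t T t. *)
- move=> s t s0 t0; rewrite [s + t]addrC hc// [t + s]addrC h4//; apply/funext => w /=; congr (U s _).
 by have := congr1 (fun F : K -> K => F (T t w)) (h5 s (U t) s0 (bU t0)).
- move=> t x t0 bx; have := h5 t x t0 bx => e; rewrite compA (bUa t0 bx).
 by rewrite -compA e.
Qed.

Lemma coc_intertw t T : 0 <= t -> intertwiners a t T -> intertwiners b t (U t \o T).
Proof.
move=> t0 [bT h]; split; first exact: bounded_comp (bU t0) bT.
by move=> x bx; rewrite compA (bUa t0 bx) -compA h.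
Qed.

(** The factor U t distributes over a product of units: U_t T_1 ... T_n = (U_s1 T_1) ... (U_sn T_n)
    when t is the sum of the s_i, by the computation for a single unit and induction. *)
Lemma coc_prod t P : unit_products a t P -> 0 <= t /\ unit_products b t (U t \o P).
Proof.
move=> [n [T [s [hT s0 <- ->]]]]; split; first exact: sumr_ge0.
exists n, (fun i t => U t \o T i t), s; split=> // [i|]; first exact: coc_unit.
elim: n T s hT s0 => [|n IH] T s hT s0; first by rewrite !big_ord0 (coc_0 Ea cU).
rewrite !big_ord_recl /= -(IH (fun i => T (fintype.lift ord0 i)) (fun i => s (fintype.lift ord0 i)))//; have [_ _ hc] := cU; have [_ _ _ _ h5] := hT ord0.
set t' := \sum_(i < n) _; set Q := \big[_/_]_(i < n) _; have t'0 : 0 <= t' by exact: sumr_ge0.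
rewrite [_ + t']addrC hc//; apply/funext => w /=; congr (U _ _).
by have := congr1 (fun F : K -> K => F (Q w)) (h5 (s ord0) (U t') (s0 ord0) (bU t'0)).
Qed.

Lemma coc_closure t T : 0 <= t -> norm_closure (linear_span (unit_products a t)) T ->
 norm_closure (linear_span (unit_products b t)) (U t \o T).
Proof.
move=> t0 [bT h]; split; first exact: bounded_comp (bU t0) bT.
move=> e e0; have [_ [n [c [S [hS ->]]]] hST] := h e e0.
have [u [Mu uE u1 u2 uA]] := coc_bop cU t0; have cu := Mb_CB vK Mu.
have lin (k : R[i]) (v w : K) : u (k *: v + w) = k *: (u v : K) + u w by case: (bop_bounded cu) => + _; exact.
have Us : U t \o (\sum_(i < n) c i *: S i) = \sum_(i < n) c i *: (U t \o S i).
 rewrite uE; elim: n c S {hS hST} => [|n IH] c S.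
  by rewrite !big_ord0; apply/funext => w; exact: (b0 u).
 rewrite !big_ord_recl -IH; apply/funext => w /=; exact: lin.
exists (U t \o (\sum_(i < n) c i *: S i)).
 by exists n, c, (fun i => U t \o S i); split=> // i; exact: (coc_prod (hS i)).2.
move=> w; apply: le_trans (hST w); rewrite uE /=.
set x := T w; set y := (\sum_(i < n) _) w.
rewrite (normE (u x - u y)) (normE ((x : rH K) - y)) -bB lecR /nrm badjEr -[u^# (u _)]/((u^# ** u) _) u1 //.
Qed.

End Types.

(** Only perturbation by a cocycle on one space is required: a conjugacy of M changes the weight,
    not the modular extension. *)
Definition coc_inv (R : realType) (P : forall K : hilbert R, (R -> (K -> K) -> (K -> K)) -> Prop) :=
 forall (K : hilbert R) a b U, E0_semigroup (bounded_ops K) a -> E0_semigroup (bounded_ops K) b ->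
  cocycle (bounded_ops K) a U ->
  (forall t x, 0 <= t -> bounded_ops K x -> b t x = U t \o a t x \o adj (U t)) -> P K a -> P K b.

Section Invariance.
Context {R : realType}.

Lemma inv_units : coc_inv (@has_units R).
Proof. by move=> K a b U Ea Eb cU bE [T hT]; exists (fun t => U t \o T t); exact: (coc_unit Ea cU bE). Qed.

Lemma inv_I : coc_inv (@type_I R).
Proof.
move=> K a b U Ea Eb cU bE [hu h]; split; first exact: (inv_units Ea Eb cU bE).
have vK := vN_bounded K; have [cV aE] := coc_sym vK Ea cU bE.
move=> t t0; have t0' := ltW t0; have [u [Mu uE u1 u2 uA]] := coc_bop cU t0'.
have e (T : K -> K) : U t \o (adj (U t) \o T) = T.
 by rewrite uA uE; apply/funext => w; rewrite /= -[u (u^# _)]/((u ** u^#) _) u2.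
apply/seteqP; split=> T hT; rewrite -(e T).
 by apply: (coc_closure Ea cU bE t0'); rewrite -h//; exact: (coc_intertw cV aE t0').
by apply: (coc_intertw cU bE t0'); rewrite h//; exact: (coc_closure Eb cV aE t0').
Qed.

Lemma inv_not (P : forall K : hilbert R, (R -> (K -> K) -> (K -> K)) -> Prop) : coc_inv P -> coc_inv (fun K a => ~ P K a).
Proof.
move=> iP K a b U Ea Eb cU bE nP Pb; apply: nP.
by have [cV aE] := coc_sym (vN_bounded K) Ea cU bE; exact: iP Eb Ea cV aE Pb.
Qed.

Lemma inv_II : coc_inv (@type_II R).
Proof.
move=> K a b U Ea Eb cU bE [h1 h2]; split; first exact: (inv_units Ea Eb cU bE).
exact: (inv_not inv_I Ea Eb cU bE).
Qed.

End Invariance.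

Section Main.
Context {R : realType} {H : hilbert R} {M : set (H -> H)}.
Hypothesis fM : is_factor M.
Local Notation B := (bop (rH H) (rH H)).
Let vM : von_neumann_algebra M. Proof. by case: fM. Qed.
Let vMb := vnMb vM.
Implicit Types (P : forall K : hilbert R, (R -> (K -> K) -> (K -> K)) -> Prop).

Lemma ext_transfer phi psi (G1 : gns M phi) (G2 : gns M psi) th th' V : fns_weight M phi -> fns_weight M psi ->
 star_hom M M th -> V^# ** V = bid -> V ** V^# = bid -> V ** ii = ii ** V ->
 (forall x z, Mb M x -> Mb M z -> V ** gX G1 x z = gX G2 x z ** V) ->
 modular_extension G1 th th' -> modular_extension G2 th (fun y => cj V (th' (cj V^# y))).
Proof.
move=> fw1 fw2 sh V1 V2 Vi VX ext; have b1 : (bid : B)^# ** bid = bid by rewrite badj1 bc1l.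
have b2 : (bid : B) ** bid^# = bid by rewrite badj1 bc1l.
have hU x : Mb M x -> lift th x = bid ** lift th x ** bid^# by rewrite badj1 bc1l bc1r.
have := mext_twist vM fw1 fw2 sh sh (vn1 vMb) b1 b2 hU V1 V2 Vi VX ext.
by rewrite (gX1 vM G1 fw1) bc1r.
Qed.

Lemma ext_on a phi (G : gns M phi) : E0_semigroup M a -> fns_weight M phi -> E0_modularly_extendable M a ->
 exists a', E0_modular_extension G a a'.
Proof.
move=> Ea fw me; suff /choice[a' h] (t : R) : exists th', 0 <= t -> modular_extension G (a t) th' by exists a' => t; exact: h.
have [t0|t0] := boolP (0 <= t); last by exists id.
have [psi [G1 [fw1 [th' h]]]] := me t t0; have [V [V1 V2 Vi VX]] := std_iso vM G1 G fw1 fw.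
by eexists => _; exact: (ext_transfer fw1 fw (E0_hom Ea t0) V1 V2 Vi VX h).
Qed.

(** The cocycle law of W is that of U in both factors of [gX], since a'_t (gX u u) = gX (a_t u) (a_t
    u). Strong continuity of W is that of U, carried through a normal representation on the unit
    ball. *)
Lemma ext_coc a b U phi (G : gns M phi) a' : E0_semigroup M a -> E0_semigroup M b -> cocycle M a U ->
 (forall t x, 0 <= t -> M x -> b t x = U t \o a t x \o adj (U t)) -> fns_weight M phi ->
 E0_modular_extension G a a' ->
 exists b' W, [/\ E0_modular_extension G b b', cocycle (bounded_ops (gns_space G)) a' W &
  forall t x, b' t x = W t \o a' t x \o adj (W t)].
Proof.
move=> Ea Eb cU bE fw ha'; pose u t := tob (U t).
have uP t : 0 <= t -> [/\ Mb M (u t), U t = u t, (u t)^# ** u t = bid & u t ** (u t)^# = bid].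
 by move=> t0; have [v [Mv vE v1 v2 _]] := coc_bop cU t0; rewrite /u vE tobK.
pose w t := gX G (u t) (u t); pose W t : gns_space G -> gns_space G := w t.
have wP t : 0 <= t -> [/\ CB ii (w t), (w t)^# ** w t = bid & w t ** (w t)^# = bid].
 move=> t0; have [Mu _ u1 u2] := uP t t0; have Mu' := vn_adj vMb Mu.
 by rewrite /w (gX_adj vM G fw)// !(gX_mul vM G fw)// u1 u2 (gX1 vM G fw); split=> //; exact: gX_CB.
exists (fun t x => W t \o a' t x \o adj (W t)), W; split; [move=> t t0| |by []].
- have [Mu uE u1 u2] := uP t t0; have [cw _ _] := wP t t0.
 have hU x : Mb M x -> lift (b t) x = u t ** lift (a t) x ** (u t)^#.
  move=> Mx; apply: bfun_inj; rewrite (lift_fun vM (E0_hom Eb t0) Mx) bE// uE (adjE (Mb_CB vM Mu)).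
  by rewrite -(lift_fun vM (E0_hom Ea t0) Mx).
 pose i1 : bop (rH (gns_space G)) (rH (gns_space G)) := bid.
 have b1 : i1^# ** i1 = bid by rewrite badj1 bc1l.
 have b2 : i1 ** i1^# = bid by rewrite badj1 bc1l.
 have Vi : i1 ** ii = ii ** i1 by rewrite bc1l bc1r.
 have VX x z : Mb M x -> Mb M z -> i1 ** gX G x z = gX G x z ** i1 by rewrite bc1l bc1r.
 have := mext_twist vM fw fw (E0_hom Ea t0) (E0_hom Eb t0) Mu u1 u2 hU b1 b2 Vi VX (ha' t t0).
 rewrite bc1l -/(w t) badj1; congr (modular_extension G (b t)).
 apply/funext => y; rewrite /W (adjE cw) (_ : cj i1 y = y)//.
 by apply/funext => k; rewrite /cj badj1.
split.
- move=> t t0; have [cw w1 w2] := wP t t0; split; first exact: bop_bounded.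
 by split; [exact: bop_bounded|rewrite /W adjE// compB w1|rewrite /W adjE// compB w2].
- have cu v t : 0 <= t -> ctat (fun s => u s v) t.
  move=> t0 d d0; have [r r0 hr] := coc_ctat cU v t0 d0; exists r => // s s0 st.
  by have := hr s s0 st; have [_ -> _ _] := uP s s0; have [_ -> _ _] := uP t t0.
 apply/strong_ctat => k t t0; apply: (gX_ctat fM fw (C := 1)) => // [s s0|s s0|v|v]; try exact: cu.
  by have [] := uP s s0.
 have [_ _ u1 _] := uP s s0.
 by split; split=> // v; rewrite mul1r /nrm badjEr -[(u s)^# _]/(((u s)^# ** u s) v) u1.
- move=> s t s0 t0; have st0 := addr_ge0 s0 t0; have [Mu uE _ _] := uP t t0; have [Ms sE _ _] := uP s s0.
 have [_ _ hc] := cU; have [_ stE _ _] := uP _ st0; have sh := E0_hom Ea t0.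
 have e : u (s + t) = u t ** lift (a t) (u s).
  by apply: bfun_inj; rewrite -stE hc// uE sE -(lift_fun vM sh Ms).
 have [_ hX] := (mextE vM fw _ sh).1 (ha' t t0).
 rewrite /W /w e -(gX_mul vM G fw Mu Mu) ?hX//; exact: (lift_M vM sh).
Qed.

Lemma has_coc a b U P : coc_inv P -> E0_semigroup M a -> E0_semigroup M b -> cocycle M a U ->
 (forall t x, 0 <= t -> M x -> b t x = U t \o a t x \o adj (U t)) ->
 modular_extension_has M a P -> modular_extension_has M b P.
Proof.
move=> iP Ea Eb cU bE [phi [G [a' [fw ha' Pa]]]].
have [b' [W [hb' cW b'E]]] := ext_coc Ea Eb cU bE fw ha'; exists phi, G, b'; split; [exact: fw|exact: hb'|].
have Ea' := E0_of_ext fM fw Ea ha'; have Eb' := E0_of_ext fM fw Eb hb'.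
exact: (iP _ a' b' W Ea' Eb' cW (fun t x _ _ => b'E t x) Pa).
Qed.

Lemma has_conj a b ga P : star_iso M M ga -> E0_semigroup M b ->
 (forall t x, 0 <= t -> M x -> ga (b t x) = a t (ga x)) ->
 modular_extension_has M a P -> modular_extension_has M b P.
Proof.
move=> ig Eb h [phi [G [a' [fw ha' Pa]]]]; exists (phi \o ga), (iso_gns vM ig G), a'; split; [exact: (iso_fns vM ig fw)| |exact: Pa].
move=> t t0; apply: (iso_ext vM ig (th := a t)) => [x Mx|x Mx|]; [|exact: h|exact: ha'].
by case: (E0_hom Eb t0) => + _ _ _; exact.
Qed.

Lemma has_iff a b P : coc_inv P -> E0_semigroup M a -> E0_semigroup M b -> cocycle_conjugate M b M a ->
 modular_extension_has M a P <-> modular_extension_has M b P.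
Proof.
move=> iP Ea Eb [c [Ec [ga [ig hg]] [U [cU cE]]]]; split=> h.
 exact: (has_conj ig Eb hg (has_coc iP Ea Ec cU cE h)).
have [cV aE] := coc_sym vM Ea cU cE; apply: (has_coc iP Ec Ea cV aE).
have [de [id' gd dg]] := star_iso_inv vM ig; apply: (has_conj id' Ec _ h) => t x t0 Mx.
have [[d1 _ _ _] _] := id'; rewrite -{1}(gd x Mx) -hg; auto; rewrite dg//.
by case: (E0_hom Eb t0) => + _ _ _; apply; exact: d1.
Qed.

(** Extendability becomes the case P = True of the invariance argument. The definition allows a
    different weight at each time, and [ext_on] moves all extensions to the weight found at time
    0. *)
Lemma me_has a : E0_semigroup M a -> E0_modularly_extendable M a <-> modular_extension_has M a (fun _ _ => True).
Proof.
move=> Ea; split=> [me|[phi [G [a' [fw ha' _]]]] t t0]; last by exists phi, G; split; [exact: fw|exists (a' t); exact: ha'].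
have [phi [G [fw _]]] := me 0 (lexx 0); have [a' ha'] := ext_on G Ea fw me.
by exists phi, G, a'; split; [exact: fw|exact: ha'|].
Qed.

End Main.

Theorem proposition4p7 (R : realType) (H : hilbert R) (M : set (H -> H))
  (alpha beta : R -> (H -> H) -> (H -> H)) :
 is_factor M ->
 E0_semigroup M alpha ->
 E0_semigroup M beta ->
 cocycle_conjugate M beta M alpha ->
 (E0_modularly_extendable M alpha ->
   E0_modularly_extendable M beta /\
   forall (phi psi : (H -> H) -> \bar R) (G : gns M phi) (G' : gns M psi),
    fns_weight M phi -> fns_weight M psi ->
    exists alpha' beta',
     [/\ E0_modular_extension G alpha alpha',
       E0_modular_extension G' beta beta' &
       cocycle_conjugate (bounded_ops (gns_space G')) beta'
                (bounded_ops (gns_space G)) alpha']) /\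
 (forall tau : E0_type, has_type M alpha tau <-> has_type M beta tau).
Proof.
move=> fM Ea Eb cc; have vM : von_neumann_algebra M by case: fM.
have meE : E0_modularly_extendable M alpha <-> E0_modularly_extendable M beta.
 rewrite (me_has fM Ea) (me_has fM Eb); exact: (has_iff fM _ Ea Eb cc).
split; last first.
 case=> /=; [exact: (has_iff fM inv_I Ea Eb cc)|exact: (has_iff fM inv_II Ea Eb cc)| |].
  exact: (has_iff fM (inv_not inv_units) Ea Eb cc).
 by rewrite meE.
move=> me; split; first exact/meE.
move=> phi psi G G' fw fw'; have [c [Ec [ga [ig hg]] [U [cU cE]]]] := cc.
have [a' ha'] := ext_on fM G Ea fw me.
have [c' [W [hc' cW c'E]]] := ext_coc fM Ea Ec cU cE fw ha'.
have fwg := iso_fns vM ig fw; pose Gg := iso_gns vM ig G.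
(* c' is the extension of the perturbed semigroup for phi and at the same time that of [beta] for
   phi o ga; V carries it to the given weight psi. *)
have [V [V1 V2 Vi VX]] := std_iso vM Gg G' fwg fw'.
have hb t : 0 <= t -> modular_extension Gg (beta t) (c' t).
 move=> t0; apply: (iso_ext vM ig (th := c t)) => [x Mx|x Mx|]; [|exact: hg|exact: hc'].
 by case: (E0_hom Eb t0) => + _ _ _; exact.
exists a', (fun t y => cj V (c' t (cj V^# y))); split; [exact: ha'|move=> t t0|].
 exact: (ext_transfer fM fwg fw' (E0_hom Eb t0) V1 V2 Vi VX (hb t t0)).
exists c'; split; first exact: (E0_of_ext fM fw Ec hc').
- exists (cj V^#); split; last by move=> t x _ _; rewrite cjK.
 by apply: cj_iso; rewrite ?badjK//; exact: (unitary_ii V1 V2 Vi).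
- by exists W; split; [exact: cW|move=> t x _ _; exact: c'E].
Qed.
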